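(* Let $f_0$ be a rational map of degree $d\ge 2$ with parabolic points, and let $(f_n)_{n\ge1}$ be a generic perturbation of $f_0$. If $J(f_n)\to J(f_0)$ in the Hausdorff topology, then $f_n\to f_0$ horocyclically.
   Context: $J(f)$ is the Julia set; the Hausdorff topology is that on non-empty compact subsets of the Riemann sphere $\widehat{\mathbb C}$. A sequence of rational maps $f_n\to f_0$ algebraically if $\deg f_n=\deg f_0$ and the coefficients of $f_n$ (as a ratio of polynomials) can be chosen to converge to those of $f_0$. A periodic point is parabolic if its multiplier is a root of unity. Let $\zeta$ be a parabolic periodic point of $f_0$, and let $l\ge1$ be the minimal integer with $f_0^l(\zeta)=\zeta$ and $(f_0^l)'(\zeta)=1$. The multiplicity of $\zeta$ is the order $\nu+1\ge2$ of the zero of $f_0^l(z)-z$ at $\zeta$. If $f_n\to f_0$ algebraically, then for large $n$ the map $f_n^l$ has exactly $\nu+1$ fixed points (with multiplicity) near $\zeta$, i.e. in a fixed small neighbourhood of $\zeta$ containing no other fixed point of $f_0^l$; one says $\zeta$ splits into these points. Generic perturbation: a sequence $(f_n)$ with $f_n\to f_0$ algebraically is a generic perturbation of $f_0$ at $\zeta$ if $\zeta$ splits into non-parabolic periodic points of $f_n$ (there are no parabolic points of $f_n$ among them); it is a generic perturbation of $f_0$ if this holds at every parabolic point of $f_0$. Horocyclic convergence: for $\lambda_n\in\mathbb C^*$ with $\lambda_n\to1$, one says $\lambda_n\to1$ horocyclically if $|\mathrm{Re}(1/(1-\lambda_n))|\to+\infty$ (equivalently, writing $\lambda_n=e^{L_n+i\theta_n}$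 with $L_n,\theta_n\to0$ real, $\theta_n^2/L_n\to0$). One says $f_n\to f_0$ horocyclically at $\zeta$ if $f_n\to f_0$ algebraically and, for the fixed points $\zeta_n$ of $f_n^l$ converging to $\zeta$ (i.e. for every sequence of fixed points $\zeta_n$ of $f_n^l$ with $\zeta_n\to\zeta$), the multipliers $(f_n^l)'(\zeta_n)$ converge to $1$ horocyclically. One says $f_n\to f_0$ horocyclically if this holds at every parabolic point $\zeta$ of $f_0$. *)

(* Defs.v *)
From HB Require Import structures.
From mathcomp Require Import all_boot all_order all_algebra ring lra complex.
From mathcomp Require Import all_classical all_reals all_analysis.

Set Implicit Arguments.
Unset Strict Implicit.
Unset Printing Implicit Defensive.

Import Order.TTheory GRing.Theory Num.Theory.
Import numFieldNormedType.Exports.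

Local Open Scope classical_set_scope.
Local Open Scope ring_scope.

(* [R[i]] itself carries no topology in the library; naming it as a
   [numClosedFieldType] gives it the one induced by the modulus, and makes
   [derive1] the complex derivative. *)
Definition C (R : realType) : numClosedFieldType := R[i].

(* [None] is the point at infinity. *)
Definition sphere (R : realType) : Type := option (C R).

Section chordal_metric.
Variable R : realType.
Implicit Types (x y z : sphere R) (u v w : C R * C R).

Definition hcoord z : C R * C R := if z is Some a then (a, 1) else (1, 0).

Definition cmod (a : C R) : R := ComplexField.Normc.normc a.

Definition hnorm u : R := Num.sqrt (cmod u.1 ^+ 2 + cmod u.2 ^+ 2).

Definition wedge u v : C R := u.1 * v.2 - u.2 * v.1.

(* Written in homogeneous coordinates: for finite points this is
   2|a - b| / (sqrt(1 + |a|^2) sqrt(1 + |b|^2)), and 2 / sqrt(1 + |a|^2)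
   when one of them is infinity. *)
Definition chordal x y : R :=
  2 * cmod (wedge (hcoord x) (hcoord y)) /
    (hnorm (hcoord x) * hnorm (hcoord y)).

Let hdot u v : C R := u.1 * conjc v.1 + u.2 * conjc v.2.

Let cmodE (a : C R) : cmod a ^+ 2 = complex.Re a ^+ 2 + complex.Im a ^+ 2.
Proof.
by rewrite /cmod; case: a => a b /=; rewrite sqr_sqrtr // addr_ge0 ?sqr_ge0.
Qed.

Let cmod_ge0 (a : C R) : 0 <= cmod a.
Proof. by rewrite /cmod; case: a => a b /=; rewrite sqrtr_ge0. Qed.

Let hnormE u : hnorm u ^+ 2 = cmod u.1 ^+ 2 + cmod u.2 ^+ 2.
Proof. by rewrite sqr_sqrtr // addr_ge0 ?sqr_ge0. Qed.

Let cmodC (a b : R) : cmod (Complex a b) ^+ 2 = a ^+ 2 + b ^+ 2.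
Proof. by rewrite cmodE. Qed.

Let hdot_le u v : cmod (hdot u v) <= hnorm u * hnorm v.
Proof.
have h0 w : 0 <= hnorm w by rewrite sqrtr_ge0.
rewrite -ler_sqr ?nnegrE ?mulr_ge0 // exprMn !hnormE -subr_ge0.
have -> : (cmod u.1 ^+ 2 + cmod u.2 ^+ 2) * (cmod v.1 ^+ 2 + cmod v.2 ^+ 2)
    - cmod (hdot u v) ^+ 2 = cmod (wedge u v) ^+ 2.
  case: u => -[a b] [c d]; case: v => -[a' b'] [c' d'].
  by rewrite !cmodE /hdot /wedge /=; ring.
exact: sqr_ge0.
Qed.

Let wedge_hdot u v w :
  cmod (wedge v w) * hnorm u ^+ 2 <=
  cmod (wedge v u) * cmod (hdot w u) + cmod (wedge u w) * cmod (hdot v u).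
Proof.
have -> : cmod (wedge v w) * hnorm u ^+ 2 =
    cmod (wedge v u * hdot w u + wedge u w * hdot v u).
  have -> : wedge v u * hdot w u + wedge u w * hdot v u =
      wedge v w * ((hnorm u ^+ 2)%:C)%C.
    rewrite hnormE !cmodE.
    case: u => -[a b] [c d]; case: v => -[a' b'] [c' d'].
    case: w => -[a2 b2] [c2 d2]; rewrite /hdot /wedge.
    by apply/eqP; rewrite eq_complex /=; apply/andP; split; apply/eqP; ring.
  rewrite /cmod ComplexField.Normc.normcM; congr (_ * _).
  by rewrite /= expr0n addr0 sqrtr_sqr ger0_norm ?sqr_ge0.
by rewrite /cmod -!ComplexField.Normc.normcM le_normcD.
Qed.

Let hnorm_gt0 x : 0 < hnorm (hcoord x).
Proof.
rewrite /hnorm; case: x => [a|] /=; rewrite sqrtr_gt0 /cmod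
  ?ComplexField.Normc.normc1 ?ComplexField.Normc.normc0.
  by rewrite expr1n ltr_pwDr // sqr_ge0.
by rewrite expr1n expr0n addr0.
Qed.

Fact chordalxx x : chordal x x = 0.
Proof.
rewrite /chordal /wedge mulrC [X in X - _]mulrC subrr.
by rewrite /cmod ComplexField.Normc.normc0 mulr0 mulr0.
Qed.

Fact chordal_sym x y : chordal x y = chordal y x.
Proof.
rewrite /chordal [hnorm _ * _]mulrC; congr (_ * _ / _).
rewrite /wedge -opprB /cmod normcN; congr ComplexField.Normc.normc.
by rewrite mulrC [X in _ - X]mulrC.
Qed.

Fact chordal_positivity x y : chordal x y = 0 -> x = y.
Proof.
move=> /eqP; rewrite /chordal !mulf_eq0 invr_eq0 mulf_eq0 pnatr_eq0 /=.
rewrite !(gt_eqF (hnorm_gt0 _)) !orbF => /eqP/ComplexField.Normc.eq0_normc.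
rewrite /wedge; case: x y => [a|] [b|] //=.
- by rewrite mulr1 mul1r => /eqP; rewrite subr_eq0 => /eqP ->.
- by rewrite mulr0 mulr1 sub0r => /eqP; rewrite oppr_eq0 oner_eq0.
- by rewrite mulr1 mul0r subr0 => /eqP; rewrite oner_eq0.
Qed.

Fact chordal_triangle y x z : chordal x z <= chordal x y + chordal y z.
Proof.
rewrite /chordal; set u := hcoord y; set v := hcoord x; set w := hcoord z.
have u0 : 0 < hnorm u by exact: hnorm_gt0.
have v0 : 0 < hnorm v by exact: hnorm_gt0.
have w0 : 0 < hnorm w by exact: hnorm_gt0.
have key : cmod (wedge v w) * hnorm u <=
    cmod (wedge v u) * hnorm w + cmod (wedge u w) * hnorm v.
  rewrite -(ler_pM2r u0) -mulrA -expr2 (le_trans (wedge_hdot _ _ _)) //.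
  by rewrite mulrDl lerD // -mulrA ler_wpM2l ?cmod_ge0 ?hdot_le.
rewrite -subr_ge0.
have -> : 2 * cmod (wedge v u) / (hnorm v * hnorm u) +
    2 * cmod (wedge u w) / (hnorm u * hnorm w) -
    2 * cmod (wedge v w) / (hnorm v * hnorm w) =
    2 * (cmod (wedge v u) * hnorm w + cmod (wedge u w) * hnorm v -
      cmod (wedge v w) * hnorm u) / (hnorm u * hnorm v * hnorm w).
  by field; rewrite !gt_eqF.
by rewrite divr_ge0 ?mulr_ge0 ?subr_ge0 // ltW.
Qed.

HB.instance Definition _ := Choice.on (sphere R).
HB.instance Definition _ := Pointed.on (sphere R).
HB.instance Definition _ := @isMetric.Build R (sphere R) chordal
  chordalxx chordal_positivity chordal_sym chordal_triangle.

End chordal_metric.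

Definition hausdorff_cvg (R : realType) (T : metricType R)
    (A : nat -> set T) (B : set T) : Prop :=
  forall e : R, 0 < e -> \forall n \near \oo,
    (forall x, A n x -> exists2 y, B y & mdist x y < e) /\
    (forall y, B y -> exists2 x, A n x & mdist x y < e).

Section rational_maps.
Variable R : realType.

Record ratmap := Ratmap {
  rnum : {poly C R};
  rden : {poly C R};
  _ : coprimep rnum rden }.

Implicit Types (f : ratmap) (zeta : sphere R) (g : sphere R -> sphere R).

Definition rdeg f : nat := (maxn (size (rnum f)) (size (rden f))).-1.

(* At infinity the value is the ratio of the coefficients of degree [rdeg f]. *)
Definition reval f (z : sphere R) : sphere R :=
  let: (a, b) := if z is Some w then ((rnum f).[w], (rden f).[w])
                 else ((rnum f)`_(rdeg f), (rden f)`_(rdeg f)) in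
  if b == 0 then None else Some (a / b).

Definition riter f (n : nat) : sphere R -> sphere R := iter n (reval f).

Definition normal_on (U : set (sphere R)) (F : set (sphere R -> sphere R)) :=
  forall h : nat -> (sphere R -> sphere R), (forall n, F (h n)) ->
  exists s : nat -> nat, {homo s : m n / (m < n)%N} /\
  exists g, forall K, K `<=` U -> compact K -> {uniform K, (h \o s) @ \oo --> g}.

Definition fatou f : set (sphere R) :=
  [set z | exists U, [/\ open U, U z & normal_on U (range (riter f))]].

Definition julia f : set (sphere R) := ~` fatou f.

(* A pair of coprime polynomials representing a rational map is unique up to a
   common non-zero factor, so the choice of coefficients is a choice of [c]. *)
Definition alg_cvg (f : nat -> ratmap) (f0 : ratmap) : Prop :=
  (forall n, rdeg (f n) = rdeg f0) /\
  exists c : nat -> C R, (forall n, c n != 0) /\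
    forall i : nat,
      (c n * (rnum (f n))`_i @[n --> \oo] --> (rnum f0)`_i) /\
      (c n * (rden (f n))`_i @[n --> \oo] --> (rden f0)`_i).

Definition sphere_inv (z : sphere R) : sphere R :=
  if z is Some a then if a == 0 then None else Some a^-1 else Some 0.

(* Meant for [g] holomorphic near its fixed point [zeta]; the default value 0
   of [odflt] is then not used near [zeta]. At infinity, the chart is 1/z. *)
Definition multiplier g zeta : C R :=
  if zeta is Some a then derive1 (fun z : C R => odflt 0 (g (Some z))) a
  else derive1 (fun z : C R => odflt 0 (sphere_inv (g (sphere_inv (Some z))))) 0.

Definition minimal_period f zeta (p : nat) : Prop :=
  [/\ (0 < p)%N, riter f p zeta = zeta &
      forall m, (0 < m < p)%N -> riter f m zeta <> zeta].

Definition parabolic f zeta : Prop :=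
  exists2 p, minimal_period f zeta p &
    exists2 k, (0 < k)%N & multiplier (riter f p) zeta ^+ k = 1.

Definition multiplier_one_period f zeta (l : nat) : Prop :=
  [/\ (0 < l)%N, riter f l zeta = zeta, multiplier (riter f l) zeta = 1 &
      forall m, (0 < m)%N -> riter f m zeta = zeta ->
        multiplier (riter f m) zeta = 1 -> (l <= m)%N].

(* The points into which [zeta] splits are, for [n] large, the fixed points of
   the [l]-th iterate of [f n] in the isolating neighbourhood [U]. *)
Definition generic_at (f : nat -> ratmap) (f0 : ratmap) zeta : Prop :=
  alg_cvg f f0 /\
  forall l, multiplier_one_period f0 zeta l ->
  exists U : set (sphere R),
    [/\ nbhs zeta U,
        (forall z, U z -> riter f0 l z = z -> z = zeta) &
        \forall n \near \oo, forall z, U z -> riter (f n) l z = z ->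
          ~ parabolic (f n) z].

Definition generic_perturbation (f : nat -> ratmap) (f0 : ratmap) : Prop :=
  alg_cvg f f0 /\ forall zeta, parabolic f0 zeta -> generic_at f f0 zeta.

(* The term [lam n = 1], where 1 / (1 - lam n) should be infinite, contributes
   the value 0; hence the second limit forces [lam n] to differ from 1 for [n]
   large, while the first one forces it to be non-zero. *)
Definition horocyclic_cvg1 (lam : nat -> C R) : Prop :=
  (lam n @[n --> \oo] --> (1 : C R)) /\
  (`|complex.Re (1 - lam n)^-1 : R| @[n --> \oo] --> +oo).

Definition horocyclic_at (f : nat -> ratmap) (f0 : ratmap) zeta : Prop :=
  alg_cvg f f0 /\
  forall l, multiplier_one_period f0 zeta l ->
  forall z : nat -> sphere R, (forall n, riter (f n) l (z n) = z n) ->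
    z n @[n --> \oo] --> zeta ->
    horocyclic_cvg1 (fun n => multiplier (riter (f n) l) (z n)).

Definition horocyclic_cvg (f : nat -> ratmap) (f0 : ratmap) : Prop :=
  alg_cvg f f0 /\ forall zeta, parabolic f0 zeta -> horocyclic_at f f0 zeta.

End rational_maps.

(* Main.v *)
(* Suppose that [f_n] does not converge horocyclically at [zeta]: along a subsequence there are fixed points
   [zeta_n -> zeta] of [F_n = f_n^l] with multipliers [lambda_n -> 1], [lambda_n != 1] and
   [|Re (1 / (1 - lambda_n))|] bounded. In the coordinate [U = -1 / (nu a z^nu)] the limit [F_0 = f_0^l] is
   close to the translation by 1, so the region where [Re U + |Im U|] is comparable to [|U|] is an
   attracting petal, contained in the Fatou set of [f_0]; its analogue for the inverse branch is a repelling
   petal, and [zeta] is in the Julia set.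
   Hausdorff convergence keeps compact parts of the petal away from [julia f_n], which contains points near
   [zeta], near a preimage [y] of [zeta] and near a preimage of [y]. By Landau's theorem, applied to the
   cross ratios of [F_n^k z] with these three points, the steps of the [F_n]-orbits of the petal stay small,
   so these orbits enter every small neighbourhood of [zeta]; by the same theorem they accumulate only at
   fixed points. Boundedness of the real part means that [F_n] rotates around [zeta_n] many times before its
   modulus changes appreciably; comparing an orbit with its translate by one turn shows that no orbit of a
   petal accumulates at [zeta_n], neither for [F_n] nor for its inverse. On the other hand, on a ray from
   [zeta_n] to the petals that avoids the other fixed points, the first point at which stability of both
   families of iterates fails provides such an orbit, by Harnack's inequality. *)
Require Import Defs.
From mathcomp Require Import all_boot all_order all_algebra ring lra zify complex.
From mathcomp Require Import all_classical all_reals all_analysis.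
Set Implicit Arguments. Unset Strict Implicit. Unset Printing Implicit Defensive.
Import Order.TTheory GRing.Theory Num.Theory.
Import numFieldNormedType.Exports.
Local Open Scope classical_set_scope.
Local Open Scope ring_scope.
Import Defs.

(* [lra] slows down with the number of hypotheses: the most recent comparisons usually suffice. *)
Ltac revert_comparisons k := lazymatch k with
  | O => idtac
  | S ?j => match goal with
    | H : is_true (Order.le _ _) |- _ => revert H; revert_comparisons j
    | H : is_true (Order.lt _ _) |- _ => revert H; revert_comparisons j
    | H : is_true (_ && _) |- _ => revert H; revert_comparisons j
    | H : @eq (Real.sort _) _ _ |- _ => revert H; revert_comparisons j
    | _ => idtac
    end
  end.
Ltac keep_comparisons k :=
  revert_comparisons k; repeat match goal with H : ?P |- _ => match type of P with Prop => clear H end end; intros.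

Ltac lra_all := lra.
Ltac lra_recent := first [keep_comparisons 5%N; lra | keep_comparisons 12%N; lra | lra].
Tactic Notation "lra" := lra_recent.


(** Landau's theorem needs omitted values, which the iterates of a local inverse do not have, since
    they do not extend to rational maps. The attraction of the repelling petals under the inverse is
    therefore deduced from that of the attracting petals under [F_n]: a backward orbit leaving a
    small disc crosses the attracting petal, whence forward iteration would bring it closer to 0
    than its earlier points were. At the first unstable point [y] of the ray there are two cases. If
    the orbit of [y] reaches the circle of radius [r], it accumulates at a fixed point other than
    [zeta_n]; Harnack's inequality, chained along the ray from [zeta_n], which all iterates fix,
    forbids this. If only neighbouring orbits exit, later and later, the other map carries a limit
    of exit points towards [y], so that [y] is a fixed point on the ray. Landau's theorem and
    Harnack's inequality both come from Ahlfors' lemma, for metrics on the plane without 0 and 1 and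
    on the punctured disc; a four-point second difference stands for the Laplacian, and no
    integration occurs. *)

(** * Moduli, real and imaginary parts *)

Section M0. Variable R : realType.
Implicit Types (z w h : C R).
Lemma cmod_ge0 z : 0 <= cmod z.
Proof. by rewrite /cmod; case: z => a b /=; rewrite sqrtr_ge0. Qed.
Lemma cmod0 : cmod (0 : C R) = 0. Proof. exact: ComplexField.Normc.normc0. Qed.
Lemma cmod1 : cmod (1 : C R) = 1. Proof. exact: ComplexField.Normc.normc1. Qed.
Lemma cmodM z w : cmod (z * w) = cmod z * cmod w.
Proof. exact: ComplexField.Normc.normcM. Qed.
Lemma cmodV z : cmod z^-1 = (cmod z)^-1.
Proof. exact: ComplexField.Normc.normcV. Qed.
Lemma cmodN z : cmod (- z) = cmod z.
Proof. exact: normcN. Qed.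
Lemma cmodD z w : cmod (z + w) <= cmod z + cmod w.
Proof. exact: le_normcD. Qed.
Lemma cmod_eq0 z : cmod z = 0 -> z = 0.
Proof. exact: ComplexField.Normc.eq0_normc. Qed.
Lemma cmodBC z w : cmod (z - w) = cmod (w - z).
Proof. by rewrite -cmodN opprB. Qed.
Lemma cmodf z w : cmod (z / w) = cmod z / cmod w.
Proof. by rewrite cmodM cmodV. Qed.
Lemma cmodX z n : cmod (z ^+ n) = cmod z ^+ n.
Proof. by elim: n => [|n IH]; rewrite ?expr0 ?cmod1 // !exprS cmodM IH. Qed.
Lemma cmod_gt0 z : (0 < cmod z) = (z != 0).
Proof.
rewrite lt_neqAle cmod_ge0 andbT eq_sym.
case: (eqVneq z 0) => [->|h]; first by rewrite cmod0 eqxx.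
by apply/eqP => /cmod_eq0 /eqP; apply/negP.
Qed.
Lemma cmodB z w : cmod (z - w) <= cmod z + cmod w.
Proof. by rewrite -(cmodN w) cmodD. Qed.
Lemma cmodBtri u z w : cmod (z - w) <= cmod (z - u) + cmod (u - w).
Proof. have -> : z - w = (z - u) + (u - w) by ring. exact: cmodD. Qed.
Lemma lerB_cmod z w : cmod z - cmod w <= cmod (z - w).
Proof. by rewrite lerBlDr -{1}(subrK w z) cmodD. Qed.
Lemma lerD_cmod z w : cmod z - cmod w <= cmod (z + w).
Proof. by rewrite -(opprK w) (le_trans _ (lerB_cmod _ _)) // cmodN. Qed.
Lemma cmodE z : cmod z ^+ 2 = complex.Re z ^+ 2 + complex.Im z ^+ 2.
Proof. by rewrite /cmod; case: z => a b /=; rewrite sqr_sqrtr // addr_ge0 ?sqr_ge0. Qed.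
Lemma normE z : `|z| = ((cmod z)%:C)%C :> C R. Proof. by []. Qed.
Lemma cmodR (x : R) : cmod ((x%:C)%C : C R) = `|x|.
Proof. by rewrite /cmod /= expr0n addr0 sqrtr_sqr. Qed.
Lemma cmodn n : cmod (n%:R : C R) = n%:R.
Proof.
have -> : (n%:R : C R) = ((n%:R : R)%:C)%C by rewrite rmorph_nat.
by rewrite cmodR normr_nat.
Qed.
Lemma Re_cmod z : `|complex.Re z| <= cmod z.
Proof.
rewrite -ler_sqr ?nnegrE ?cmod_ge0 // real_normK ?num_real // cmodE.
by rewrite lerDl sqr_ge0.
Qed.
Lemma Im_cmod z : `|complex.Im z| <= cmod z.
Proof.
rewrite -ler_sqr ?nnegrE ?cmod_ge0 // real_normK ?num_real // cmodE.
by rewrite lerDr sqr_ge0.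
Qed.
Lemma cmod_ReIm z : cmod z <= `|complex.Re z| + `|complex.Im z|.
Proof.
rewrite -ler_sqr ?nnegrE ?cmod_ge0 ?addr_ge0 // cmodE.
have := normr_ge0 (complex.Re z); have := normr_ge0 (complex.Im z).
rewrite -[complex.Re z ^+ 2]real_normK ?num_real // -[complex.Im z ^+ 2]real_normK ?num_real //; nra.
Qed.
Lemma cReD z w : complex.Re (z + w) = complex.Re z + complex.Re w.
Proof. by case: z w => ? ? [? ?]. Qed.
Lemma cReN z : complex.Re (- z) = - complex.Re z.
Proof. by case: z. Qed.
Lemma cReB z w : complex.Re (z - w) = complex.Re z - complex.Re w.
Proof. by rewrite cReD cReN. Qed.
Lemma cImD z w : complex.Im (z + w) = complex.Im z + complex.Im w.
Proof. by case: z w => ? ? [? ?]. Qed.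
Lemma cImN z : complex.Im (- z) = - complex.Im z.
Proof. by case: z. Qed.
Lemma cImB z w : complex.Im (z - w) = complex.Im z - complex.Im w.
Proof. by rewrite cImD cImN. Qed.
Lemma cReM z w : complex.Re (z * w) = complex.Re z * complex.Re w - complex.Im z * complex.Im w.
Proof. by case: z w => ? ? [? ?]. Qed.
Lemma cImM z w : complex.Im (z * w) = complex.Re z * complex.Im w + complex.Im z * complex.Re w.
Proof. by case: z w => ? ? [? ?]. Qed.
Lemma cReMr z (x : R) : complex.Re (z * (x%:C)%C) = complex.Re z * x.
Proof. by rewrite cReM /= mulr0 subr0. Qed.
End M0.

(** * Complex derivatives *)

Section CDER. Variable R : realType.
Implicit Types (z w h d : C R) (f g : C R -> C R).

(** A first-order estimate without division: the increment [h = 0] is allowed, so compositions and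
    mean values need no punctured neighbourhoods. *)
Definition cder f z d := forall e : R, 0 < e -> exists2 del : R, 0 < del &
  forall h, cmod h < del -> cmod (f (z + h) - f z - d * h) <= e * cmod h.

Lemma cder_ext f g z d (r : R) : 0 < r ->
  (forall w, cmod (w - z) < r -> f w = g w) -> cder f z d -> cder g z d.
Proof.
move=> r0 fg df e e0; have [del del0 H] := df e e0.
exists (Num.min del r); first by rewrite lt_min del0.
move=> h; rewrite lt_min => /andP[h1 h2].
rewrite -!fg ?H // ?subrr ?cmod0 //.
by rewrite addrC addKr.
Qed.

Lemma cder_lip f z d : cder f z d -> exists2 del : R, 0 < del &
  forall h, cmod h < del -> cmod (f (z + h) - f z) <= (cmod d + 1) * cmod h.
Proof.
move=> df; have [del del0 H] := df 1 ltr01; exists del => // h hd.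
have -> : f (z + h) - f z = (f (z + h) - f z - d * h) + d * h by ring.
by rewrite (le_trans (cmodD _ _)) // mulrDl addrC cmodM lerD // H.
Qed.

Lemma cder_cont f z d (e : R) : cder f z d -> 0 < e -> exists2 del : R, 0 < del &
  forall w, cmod (w - z) < del -> cmod (f w - f z) < e.
Proof.
move=> /cder_lip [del del0 H] e0.
have c0 : 0 < cmod d + 1 by rewrite ltr_wpDl ?cmod_ge0.
exists (Num.min del (e / (cmod d + 1))).
  by rewrite lt_min del0 divr_gt0.
move=> w; rewrite lt_min => /andP[h1 h2].
have := H _ h1; rewrite [z + _]addrC subrK => /le_lt_trans; apply.
by rewrite mulrC -ltr_pdivlMr.
Qed.

Lemma cder_cst (c : C R) z : cder (fun=> c) z 0.
Proof.
move=> e e0; exists 1 => // h _.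
by rewrite subrr mul0r subrr cmod0 mulr_ge0 ?cmod_ge0 // ltW.
Qed.

Lemma cder_id z : cder id z 1.
Proof.
move=> e e0; exists 1 => // h _.
have -> : z + h - z - 1 * h = 0 by ring.
by rewrite cmod0 mulr_ge0 ?cmod_ge0 // ltW.
Qed.

Lemma cderD f g z d1 d2 : cder f z d1 -> cder g z d2 ->
  cder (fun w => f w + g w) z (d1 + d2).
Proof.
move=> df dg e e0.
have e20 : 0 < e / 2 by lra.
have [a a0 Ha] := df _ e20; have [b b0 Hb] := dg _ e20.
exists (Num.min a b); first by rewrite lt_min a0.
move=> h; rewrite lt_min => /andP[h1 h2].
have -> : f (z + h) + g (z + h) - (f z + g z) - (d1 + d2) * h =
  (f (z + h) - f z - d1 * h) + (g (z + h) - g z - d2 * h) by ring.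
rewrite (le_trans (cmodD _ _)) //.
have -> : e * cmod h = e / 2 * cmod h + e / 2 * cmod h by lra.
by rewrite lerD ?Ha ?Hb.
Qed.

Lemma cder_comp f g z d1 d2 : cder g z d2 -> cder f (g z) d1 ->
  cder (fun w => f (g w)) z (d1 * d2).
Proof.
move=> dg df e e0.
have [a a0 Ha] := cder_lip dg.
set K := cmod d2 + 1; have K0 : 0 < K by rewrite /K ltr_wpDl ?cmod_ge0.
have e1 : 0 < e / 2 / K by rewrite !divr_gt0.
have [b b0 Hb] := df _ e1.
set L := cmod d1 + 1; have L0 : 0 < L by rewrite /L ltr_wpDl ?cmod_ge0.
have e2 : 0 < e / 2 / L by rewrite !divr_gt0.
have [c c0 Hc] := dg _ e2.
exists (Num.min (Num.min a c) (b / K)); first by rewrite !lt_min a0 c0 divr_gt0.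
move=> h; rewrite !lt_min => /andP[/andP[h1 h3] h2].
set k := g (z + h) - g z.
have kE : g (z + h) = g z + k by rewrite /k; ring.
have kh : cmod k <= K * cmod h by exact: Ha.
have kb : cmod k < b.
  by rewrite (le_lt_trans kh) // mulrC -ltr_pdivlMr.
have -> : f (g (z + h)) - f (g z) - d1 * d2 * h =
  (f (g z + k) - f (g z) - d1 * k) + d1 * (g (z + h) - g z - d2 * h).
  by rewrite -kE /k; ring.
rewrite (le_trans (cmodD _ _)) // cmodM.
have A := Hb _ kb; have B := Hc _ h3.
have A' : e / 2 / K * cmod k <= e / 2 * cmod h.
  apply: le_trans (_ : e / 2 / K * (K * cmod h) <= _); first by rewrite ler_wpM2l // ltW.
  by rewrite mulrA divfK // gt_eqF.
have B' : cmod d1 * cmod (g (z + h) - g z - d2 * h) <= e / 2 * cmod h.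
  apply: le_trans (_ : L * (e / 2 / L * cmod h) <= _).
    by rewrite ler_pM ?cmod_ge0 // /L; lra.
  by rewrite mulrA mulrCA divff ?mulr1 // gt_eqF.
by have := lerD (le_trans A A') B'; lra.
Qed.

Lemma cderM f g z d1 d2 : cder f z d1 -> cder g z d2 ->
  cder (fun w => f w * g w) z (d1 * g z + f z * d2).
Proof.
move=> df dg e e0.
set A := cmod (g z) + 1; have A0 : 0 < A by rewrite /A ltr_wpDl ?cmod_ge0.
set B := cmod (f z) + 1; have B0 : 0 < B by rewrite /B ltr_wpDl ?cmod_ge0.
set L := cmod d1 + 1; have L0 : 0 < L by rewrite /L ltr_wpDl ?cmod_ge0.
set M := cmod d2 + 1; have M0 : 0 < M by rewrite /M ltr_wpDl ?cmod_ge0.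
have e30 : 0 < e / 3 by lra.
have [a a0 Ha] := df _ (divr_gt0 e30 A0); have [b b0 Hb] := dg _ (divr_gt0 e30 B0).
have [c c0 Hc] := cder_lip df; have [k k0 Hk] := cder_lip dg.
exists (Num.min (Num.min (Num.min a b) (Num.min c k)) (e / 3 / (L * M))).
  by rewrite !lt_min a0 b0 c0 k0 divr_gt0 // mulr_gt0.
move=> h; rewrite !lt_min => /andP[/andP[/andP[h1 h2] /andP[h3 h4]] h5].
have -> : f (z + h) * g (z + h) - f z * g z - (d1 * g z + f z * d2) * h =
  (f (z + h) - f z - d1 * h) * g z + f z * (g (z + h) - g z - d2 * h)
  + (f (z + h) - f z) * (g (z + h) - g z) by ring.
rewrite (le_trans (cmodD _ _)) // (le_trans (lerD (cmodD _ _) (lexx _))) // !cmodM.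
have H0 := cmod_ge0 h.
have X1 : cmod (f (z + h) - f z - d1 * h) * cmod (g z) <= e / 3 * cmod h.
  apply: le_trans (_ : (e / 3 / A * cmod h) * A <= _).
    by rewrite ler_pM ?cmod_ge0 ?Ha // /A; lra.
  by rewrite mulrAC divfK // gt_eqF.
have X2 : cmod (f z) * cmod (g (z + h) - g z - d2 * h) <= e / 3 * cmod h.
  apply: le_trans (_ : B * (e / 3 / B * cmod h) <= _).
    by rewrite ler_pM ?cmod_ge0 ?Hb // /B; lra.
  by rewrite mulrC mulrAC divfK // gt_eqF.
have X3 : cmod (f (z + h) - f z) * cmod (g (z + h) - g z) <= e / 3 * cmod h.
  apply: le_trans (_ : (L * cmod h) * (M * cmod h) <= _).
    by rewrite ler_pM ?cmod_ge0 ?Hc ?Hk.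
  move: h5; rewrite ltr_pdivlMr ?mulr_gt0 // => h5; nra.
lra.
Qed.

Lemma cderV z : z != 0 -> cder (fun w => w^-1) z (- (z ^+ 2)^-1).
Proof.
move=> z0 e e0; have c0 : 0 < cmod z by rewrite cmod_gt0.
exists (Num.min (cmod z / 2) (e * cmod z ^+ 3 / 2)).
  by rewrite lt_min !divr_gt0 ?mulr_gt0 ?exprn_gt0.
move=> h; rewrite lt_min => /andP[h1 h2].
have X : cmod z / 2 < cmod (z + h).
  by have := lerD_cmod z h; lra.
have zh : z + h != 0 by rewrite -cmod_gt0; lra.
have -> : (z + h)^-1 - z^-1 - - (z ^+ 2)^-1 * h = h ^+ 2 / (z ^+ 2 * (z + h)).
  by field; rewrite zh z0.
rewrite cmodf cmodX [cmod (_ * (z + h))]cmodM cmodX.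
have p0 : 0 < cmod z ^+ 2 * cmod (z + h) by rewrite mulr_gt0 ?exprn_gt0 //; lra.
rewrite ler_pdivrMr // expr2 -mulrA [leRHS]mulrCA ler_wpM2l ?cmod_ge0 //.
apply: le_trans (ltW h2) _; rewrite -mulrA ler_pM2l //.
have := exprn_gt0 2 c0; rewrite exprS; move: (cmod z ^+ 2) => q; nra.
Qed.

Lemma cder_uniq f z d1 d2 : cder f z d1 -> cder f z d2 -> d1 = d2.
Proof.
move=> H1 H2; apply/eqP; rewrite -subr_eq0; apply/negPn/negP => n0.
have c0 : 0 < cmod (d1 - d2) by rewrite cmod_gt0.
have e0 : 0 < cmod (d1 - d2) / 4 by rewrite divr_gt0.
have [a a0 Ha] := H1 _ e0; have [b b0 Hb] := H2 _ e0.
set t := Num.min a b / 2; have t0 : 0 < t by rewrite divr_gt0 // lt_min a0.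
have ct : cmod ((t%:C)%C : C R) = t by rewrite cmodR gtr0_norm.
have ta : t < a /\ t < b.
  have : t < Num.min a b by rewrite /t in t0 *; lra.
  by rewrite lt_min => /andP.
have := Ha (t%:C)%C; have := Hb (t%:C)%C; rewrite ct => /(_ ta.2) B /(_ ta.1) A.
have := cmodB (f (z + (t%:C)%C) - f z - d2 * (t%:C)%C) (f (z + (t%:C)%C) - f z - d1 * (t%:C)%C).
have -> : f (z + (t%:C)%C) - f z - d2 * (t%:C)%C - (f (z + (t%:C)%C) - f z - d1 * (t%:C)%C) = (d1 - d2) * (t%:C)%C by ring.
rewrite cmodM ct; nra.
Qed.

Lemma cder_eq f z d1 d2 : d1 = d2 -> cder f z d1 -> cder f z d2.
Proof. by move=> ->. Qed.

Lemma cderN f z d : cder f z d -> cder (fun w => - f w) z (- d).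
Proof.
move=> H e e0; have [a a0 Ha] := H e e0; exists a => // h hh.
have -> : - f (z + h) - - f z - - d * h = - (f (z + h) - f z - d * h) by ring.
by rewrite cmodN Ha.
Qed.

Lemma cderB f g z d1 d2 : cder f z d1 -> cder g z d2 ->
  cder (fun w => f w - g w) z (d1 - d2).
Proof. by move=> /cderD H /cderN /H. Qed.

Lemma cder_inv f z d : cder f z d -> f z != 0 ->
  cder (fun w => (f w)^-1) z (- d / f z ^+ 2).
Proof.
move=> df f0; apply: cder_eq (cder_comp df (cderV f0)).
by rewrite mulNr mulrC mulNr.
Qed.

Lemma cderMc (c : C R) f z d : cder f z d -> cder (fun w => c * f w) z (c * d).
Proof.
by move=> df; apply: cder_eq (cderM (cder_cst c z) df); rewrite mul0r add0r.
Qed.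
End CDER.

(** * Mean value inequalities, real and complex *)

Section REAL. Variable R : realType.
Implicit Types (f g : R -> R) (t d : R).

Definition rder f t d := forall e : R, 0 < e -> exists2 del : R, 0 < del &
  forall h, `|h| < del -> `|f (t + h) - f t - d * h| <= e * `|h|.

Lemma rder_is_derive f t d : rder f t d -> is_derive t 1 f d.
Proof.
move=> H.
have C : h^-1 *: (f (h *: 1 + t) - f t) @[h --> 0^'] --> d.
  apply/cvgrPdist_le => e e0; have [del del0 Hd] := H e e0.
  near=> h.
  have h0 : h != 0 by near: h; exact: nbhs_dnbhs_neq.
  have hd : `|h| < del by near: h; apply: dnbhs0_lt.
  have n0 : 0 < `|h| by rewrite normr_gt0.
  have := Hd _ hd; rewrite -(ler_pM2r (x := `|h|^-1)) ?invr_gt0 // mulfK ?gt_eqF //.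
  rewrite -normfV -normrM distrC; congr (_ <= _); congr `|_|.
  have -> : h *: (1 : R^o) = h by rewrite /GRing.scale /= mulr1.
  by rewrite /GRing.scale /= [h + t]addrC; field.
apply: DeriveDef; first by apply/cvg_ex; exists d.
exact: cvg_lim.
Unshelve. all: by end_near. Qed.

Lemma is_derive_rder f t d : is_derive t 1 f d -> rder f t d.
Proof.
move=> [Dv Dd] e e0.
have C : h^-1 *: (f (h *: 1 + t) - f t) @[h --> 0^'] --> d.
  by move: Dv; rewrite /derivable => /cvg_ex[l Hl]; rewrite -Dd /derive (cvg_lim _ Hl).
move/cvgrPdist_le: C => /(_ e e0).
rewrite near_withinE => /nbhs_ballP[del /= del0 Hd].
exists del => // h hd.
have [->|h0] := eqVneq h 0; first by rewrite addr0 subrr mulr0 subrr normr0 mulr0.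
have := Hd h; rewrite /ball /= sub0r normrN => /(_ hd h0).
have n0 : 0 < `|h| by rewrite normr_gt0.
rewrite -(ler_pM2r n0) -normrM distrC; congr (_ <= _); congr `|_|.
have -> : h *: (1 : R^o) = h by rewrite /GRing.scale /= mulr1.
by rewrite /GRing.scale /= [h + t]addrC; field.
Qed.

Lemma mean_value_le f (f1 : R -> R) (B : R) (b : R) : 0 <= b ->
  (forall t, 0 <= t <= b -> is_derive t 1 f (f1 t)) ->
  (forall t, 0 <= t <= b -> f1 t <= B) -> f b - f 0 <= B * b.
Proof.
move=> b0 fd fB.
have [c cb ->] : exists2 c : R, c \in `[0, b] & f b - f 0 = f1 c * (b - 0).
  apply: MVT_segment => // [x|].
    by rewrite in_itv /= => /andP[x1 x2]; apply: fd; rewrite !ltW.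
  apply: continuous_in_subspaceT => x; rewrite inE /= in_itv /= => xb.
  have [D _] := fd _ xb; apply: differentiable_continuous; exact/derivable1_diffP.
rewrite subr0; apply: ler_wpM2r => //; apply: fB; by move: cb; rewrite in_itv.
Qed.
End REAL.

Section MVI. Variable R : realType.
Implicit Types (z w h d : C R) (f : C R -> C R).

Lemma cder_line f z h t d : cder f (z + (t%:C)%C * h) d ->
  forall u : C R, is_derive t 1 (fun t : R => complex.Re (u * f (z + (t%:C)%C * h)))
     (complex.Re (u * (d * h))).
Proof.
move=> df u; apply: rder_is_derive => e e0.
set K := (cmod u + 1) * (cmod h + 1).
have K0 : 0 < K by rewrite mulr_gt0 // ltr_wpDl ?cmod_ge0.
have [del del0 H] := df _ (divr_gt0 e0 K0).
exists (del / (cmod h + 1)); first by rewrite divr_gt0 // ltr_wpDl ?cmod_ge0.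
move=> s sd.
have sh : cmod ((s%:C)%C * h) < del.
  rewrite cmodM cmodR; move: sd; rewrite ltr_pdivlMr ?ltr_wpDl ?cmod_ge0 //.
  have := normr_ge0 s; have := cmod_ge0 h; nra.
have := H _ sh.
have -> : z + (t%:C)%C * h + (s%:C)%C * h = z + ((t + s)%:C)%C * h.
  by rewrite rmorphD /=; ring.
set a := f _; set b := f _ => X.
have -> : complex.Re (u * a) - complex.Re (u * b) - complex.Re (u * (d * h)) * s =
  complex.Re (u * (a - b - d * ((s%:C)%C * h))).
  have -> : u * (a - b - d * ((s%:C)%C * h)) = u * a - u * b - (u * (d * h)) * (s%:C)%C by ring.
  by rewrite !cReB cReMr.
apply: le_trans (Re_cmod _) _; rewrite cmodM.
apply: le_trans (_ : cmod u * (e / K * (`|s| * cmod h)) <= _).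
  by rewrite ler_wpM2l ?cmod_ge0 // (le_trans X) // cmodM cmodR.
have -> : cmod u * (e / K * (`|s| * cmod h)) = e / K * (cmod u * cmod h) * `|s| by ring.
rewrite ler_wpM2r ?normr_ge0 // -mulrA ger_pMr // mulrC ler_pdivrMr // mul1r /K.
have := cmod_ge0 u; have := cmod_ge0 h; nra.
Qed.

(** The real mean value theorem is applied to [Re (u * f)] along the segment, where [u] is the
    conjugate of the total increment [D], so that [Re (u * D) = |D|^2]. *)
Lemma mvi f (f1 : C R -> C R) z h (B : R) :
  (forall t : R, 0 <= t <= 1 -> cder f (z + (t%:C)%C * h) (f1 (z + (t%:C)%C * h))) ->
  (forall t : R, 0 <= t <= 1 -> cmod (f1 (z + (t%:C)%C * h)) <= B) ->
  cmod (f (z + h) - f z) <= B * cmod h.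
Proof.
move=> df bf; set D := f (z + h) - f z.
have [->|D0] := eqVneq D 0.
  rewrite cmod0 mulr_ge0 ?cmod_ge0 // (le_trans (cmod_ge0 (f1 (z + (0%:C)%C * h)))) //.
  by rewrite bf // lexx ler01.
set u : C R := conjc D.
have uD : complex.Re (u * D) = cmod D ^+ 2.
  by rewrite cmodE /u; case: (D) => a b /=; ring.
have cu : cmod u = cmod D.
  by apply/eqP; rewrite -(eqrXn2 (n:=2)) ?cmod_ge0 // !cmodE /u; case: (D) => a b /=; rewrite sqrrN.
have := @mean_value_le R (fun t => complex.Re (u * f (z + (t%:C)%C * h)))
  (fun t => complex.Re (u * (f1 (z + (t%:C)%C * h) * h))) (cmod D * (B * cmod h)) 1 ler01.
have E1 : z + (1%:C)%C * h = z + h by rewrite rmorph1 mul1r.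
have E0 : z + (0%:C)%C * h = z by rewrite rmorph0 mul0r addr0.
rewrite E1 E0 -cReB -mulrBr uD mulr1 => X.
have D0' : 0 < cmod D by rewrite cmod_gt0.
rewrite -(ler_pM2l D0') -expr2; apply: X => t tb; first by apply: cder_line; exact: df.
apply: le_trans (ler_norm _) _; apply: le_trans (Re_cmod _) _.
by rewrite cmodM cu ler_wpM2l ?cmod_ge0 // cmodM ler_wpM2r ?cmod_ge0 // bf.
Qed.
End MVI.

(** * Compactness in the plane *)

Section BW. Variable R : realType.
Implicit Types (u : nat -> C R) (l z c : C R).

Definition cvgC u l := forall e : R, 0 < e -> exists n0, forall n, (n0 <= n)%N -> cmod (u n - l) < e.

Lemma incr_geid (s : nat -> nat) : (forall m n, (m < n)%N -> (s m < s n)%N) ->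
  forall n, (n <= s n)%N.
Proof. by move=> H; elim=> // n IH; apply: leq_ltn_trans IH _; exact: H. Qed.

Lemma bw_real (x : nat -> R) (B : R) : (forall n, `|x n| <= B) ->
  exists s : nat -> nat, (forall m n, (m < n)%N -> (s m < s n)%N) /\
    exists a, forall e : R, 0 < e -> exists n0, forall n, (n0 <= n)%N -> `|x (s n) - a| < e.
Proof.
move=> xB; have bx : bounded_fun x.
  exists B; split; first exact: num_real.
  by move=> M BM n _; apply: le_trans (xB n) (ltW BM).
have [s si cs] := bolzano_weierstrass bx.
exists s; split.
  move=> m n mn; rewrite ltnNge; apply/negP => h.
  have := si n m; rewrite /Order.le /= h => /esym.
  by rewrite leqNgt mn.
have /cvg_ex[a Ha] := cs; exists a => e e0.
move/cvgrPdist_lt: Ha => /(_ e e0)[n0 _ Hn]; exists n0 => n nn.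
by rewrite distrC; apply: Hn.
Qed.

Lemma bwC u (B : R) : (forall n, cmod (u n) <= B) ->
  exists s : nat -> nat, (forall m n, (m < n)%N -> (s m < s n)%N) /\ exists l, cvgC (u \o s) l.
Proof.
move=> uB.
have [n|s [si [a Ha]]] := @bw_real (fun n => complex.Re (u n)) B.
  exact: le_trans (Re_cmod _) (uB n).
have [n|s' [si' [b Hb]]] := @bw_real (fun n => complex.Im (u (s n))) B.
  exact: le_trans (Im_cmod _) (uB _).
exists (s \o s'); split; first by move=> m n mn /=; apply/si/si'.
exists (Complex a b) => e e0; have e2 : 0 < e / 2 by lra.
have [n1 H1] := Ha _ e2; have [n2 H2] := Hb _ e2.
exists (maxn n1 n2) => n; rewrite geq_max => /andP[nn1 nn2].
apply: le_lt_trans (cmod_ReIm _) _; rewrite cReB cImB /=.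
have := H1 (s' n) (leq_trans nn1 (incr_geid si' n)); have := H2 n nn2; lra.
Qed.

Lemma inv_nat_small (e : R) : 0 < e -> exists n0, forall n, (n0 <= n)%N -> n.+1%:R^-1 < e.
Proof.
move=> e0; exists (Num.truncn e^-1).+1 => n nn.
rewrite invf_plt ?posrE ?ltr0n //.
apply: lt_le_trans (truncnS_gt _) _; rewrite ler_nat; exact: leq_trans nn (leqnSn _).
Qed.

Lemma cmod_le_lim u l c (r : R) : cvgC u l -> (forall n, cmod (u n - c) <= r) -> cmod (l - c) <= r.
Proof.
move=> ul ub; rewrite leNgt; apply/negP => h.
have e0 : 0 < cmod (l - c) - r by rewrite subr_gt0.
have [n0 /(_ n0 (leqnn _)) H] := ul _ e0; have := ub n0.
have := cmodBtri (u n0) l c; rewrite (cmodBC l (u _)); lra.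
Qed.

Lemma max_disc (V : C R -> R) c (r : R) : 0 <= r ->
  (forall z, cmod (z - c) <= r -> forall e : R, 0 < e -> exists2 del : R, 0 < del &
     forall w, cmod (w - z) < del -> cmod (w - c) <= r -> `|V w - V z| < e) ->
  exists2 z, cmod (z - c) <= r & forall w, cmod (w - c) <= r -> V w <= V z.
Proof.
move=> r0 Vc.
(* Points with property [P n] for every [n] give one limit point whose value is approached by values
   with property [P n], for [n] as large as desired. It serves twice: with [P n x] meaning [n < x],
   for the boundedness of [V], and with [sup E - 1 / (n + 1) < x], for the attainment of the
   supremum. *)
have key (P : nat -> R -> Prop) : (forall n, exists2 z, cmod (z - c) <= r & P n (V z)) ->
    exists2 l, cmod (l - c) <= r & forall e : R, 0 < e -> forall n0, exists n x, [/\ (n0 <= n)%N, `|x - V l| < e & P n x].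
  move=> H; pose u n := projT1 (cid2 (H n)).
  have u1 n : cmod (u n - c) <= r by rewrite /u; case: cid2.
  have u2 n : P n (V (u n)) by rewrite /u; case: cid2.
  have uB n : cmod (u n) <= r + cmod c.
    by have := lerB_cmod (u n) c; have := u1 n; lra.
  have [s [si [l ul]]] := bwC uB; exists l.
    by apply: cmod_le_lim ul _ => n /=.
  move=> e e0 n0.
  have lr : cmod (l - c) <= r by apply: cmod_le_lim ul _ => n /=.
  have [del del0 Hd] := Vc l lr e e0; have [n1 Hn] := ul _ del0.
  exists (s (maxn n0 n1)), (V (u (s (maxn n0 n1)))); split => //.
    apply: leq_trans (leq_maxl n0 n1) (incr_geid si _).
  by apply: Hd => //; apply: Hn; exact: leq_maxr.
set E := [set V z | z in [set z | cmod (z - c) <= r]].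
have E0 : E !=set0 by exists (V c), c => //=; rewrite subrr cmod0.
have hsE : has_sup E.
  split=> //; apply/not_existsP => nub.
  have [n|l lr H] := key (fun n x => n%:R < x).
    have := nub n%:R; rewrite /ubound /= => /existsNP[x].
    by rewrite not_implyE => -[[z zr <-] /negP]; rewrite -ltNge => h; exists z.
  have [n [x [nn x1 x2]]] := H 1 ltr01 (Num.truncn (`|V l| + 1)).+1.
  have : `|V l| + 1 < n%:R.
    apply: lt_le_trans (truncnS_gt _) _; by rewrite ler_nat.
  have := ler_norm (x - V l); have := ler_norm (V l); lra.
have [n|l lr H] := key (fun n x => sup E - n.+1%:R^-1 < x).
  have n0 : 0 < n.+1%:R^-1 :> R by rewrite invr_gt0 ltr0n.
  have [x [z zr <-] h] := sup_adherent n0 hsE.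
  by exists z.
exists l => // w wr.
have : V w <= sup E by apply: ub_le_sup; [exact: hsE.2|exists w].
move=> /le_trans; apply; apply/ler_addgt0Pr => e e0.
have e2 : 0 < e / 2 by lra.
have [n0 Hn0] := inv_nat_small e2.
have [n [x [nn x1 x2]]] := H _ e2 n0.
have x3 : sup E - e / 2 < x by apply: lt_trans _ x2; rewrite ltrD2l ltrN2 Hn0.
have := ler_norm (x - V l); move: x1 x3; move: (V l) (sup E) (e : R) => p q r'; lra.
Qed.
End BW.

(** * Second-order expansions and the logarithm of a modulus *)

Section TAYLOR. Variable R : realType.

Lemma taylor2 (psi psi1 : R -> R) (x0 d r : R) : 0 < r ->
  (forall x, `|x - x0| < r -> is_derive x 1 psi (psi1 x)) ->
  is_derive x0 1 psi1 d ->
  forall e : R, 0 < e -> exists2 del : R, 0 < del & forall h, `|h| < del ->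
    `|psi (x0 + h) - psi x0 - psi1 x0 * h - d / 2 * h ^+ 2| <= e * h ^+ 2.
Proof.
move=> r0 D1 D2 e e0.
have [del del0 Hd] := is_derive_rder D2 e0.
exists (Num.min del r); first by rewrite lt_min del0.
move=> h; rewrite lt_min => /andP[hd hr].
have th (t : R) : 0 <= t <= 1 -> `|t * h| <= `|h|.
  by move=> /andP[t0 t1]; rewrite normrM (ger0_norm t0) ler_piMl.
(* [mean_value_le] bounds from above only, so the remainder along the segment is treated with both
   signs [s = 1] and [s = -1]. *)
pose k (s t : R) := s * (psi (x0 + t * h) - psi1 x0 * h * t - d / 2 * h ^+ 2 * t ^+ 2).
pose k1 (s t : R) := s * (psi1 (x0 + t * h) * h - psi1 x0 * h - d * h ^+ 2 * t).
have Dk (s t : R) : 0 <= t <= 1 -> is_derive t 1 (k s) (k1 s t).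
  move=> tb; have X : is_derive (x0 + t * h) 1 psi (psi1 (x0 + t * h)).
    by apply: D1; rewrite addrC addKr (le_lt_trans (th _ tb)).
  have Y : is_derive t 1 (fun t : R => x0 + t * h) h.
    by apply: is_derive_eq; rewrite /GRing.scale /=; ring.
  have Z := @is_derive1_comp R psi (fun t : R => x0 + t * h) t _ _ X Y.
  rewrite /k /k1; apply: is_derive_eq.
  by rewrite /GRing.scale /=; field.
have Bk (s t : R) : `|s| = 1 -> 0 <= t <= 1 -> k1 s t <= e * h ^+ 2.
  move=> s1 tb; apply: le_trans (ler_norm _) _; rewrite normrM s1 mul1r.
  have -> : psi1 (x0 + t * h) * h - psi1 x0 * h - d * h ^+ 2 * t =
    h * (psi1 (x0 + t * h) - psi1 x0 - d * (t * h)) by ring.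
  have -> : h ^+ 2 = `|h| * `|h| by rewrite -expr2 real_normK ?num_real.
  rewrite normrM [leRHS]mulrCA ler_wpM2l //.
  apply: le_trans (Hd _ (le_lt_trans (th _ tb) hd)) _.
  by rewrite ler_wpM2l ?th // ltW.
have A := mean_value_le ler01 (Dk 1) (fun t => Bk 1 t (normr1 _)).
have B := mean_value_le ler01 (Dk (-1)) (fun t => Bk (-1) t (normrN1 _)).
by move: A B; rewrite /k !mul0r !mul1r !mulr1 !addr0 expr1n expr0n /= !mulr0 ler_norml; lra.
Qed.

Lemma peano2 (f f1 : C R -> C R) (z d : C R) (r : R) : 0 < r ->
  (forall w, cmod (w - z) < r -> cder f w (f1 w)) -> cder f1 z d ->
  forall e : R, 0 < e -> exists2 del : R, 0 < del & forall h, cmod h < del ->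
    cmod (f (z + h) - f z - f1 z * h - d / 2 * h ^+ 2) <= e * cmod h ^+ 2.
Proof.
move=> r0 D1 D2 e e0.
have [del del0 Hd] := D2 _ e0.
exists (Num.min del r); first by rewrite lt_min del0.
move=> h; rewrite lt_min => /andP[hd hr].
pose g w := f w - (f1 z * (w - z) + d / 2 * ((w - z) * (w - z))).
have th (t : R) : 0 <= t <= 1 -> cmod ((t%:C)%C * h) <= cmod h.
  by move=> /andP[t0 t1]; rewrite cmodM cmodR (ger0_norm t0) ler_piMl ?cmod_ge0.
have := @mvi _ g (fun w => f1 w - f1 z - d * (w - z)) z h (e * cmod h).
have -> : g (z + h) - g z = f (z + h) - f z - f1 z * h - d / 2 * h ^+ 2.
  by rewrite /g; field.
have -> : e * cmod h ^+ 2 = e * cmod h * cmod h by ring.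
apply=> t tb.
  have X : cder (fun w => w - z) (z + (t%:C)%C * h) 1.
    by apply: cder_eq (cderB (cder_id _) (cder_cst z _)); rewrite subr0.
  rewrite /g; apply: cder_eq (cderB (D1 _ _) (cderD (cderMc (f1 z) X) (cderMc (d / 2) (cderM X X)))).
    by field.
  by rewrite addrC addKr (le_lt_trans (th _ tb)).
have := Hd _ (le_lt_trans (th _ tb) hd); rewrite [z + _ - z]addrC addKr => /le_trans; apply.
by rewrite ler_wpM2l ?th // ltW.
Qed.

(* [v] agrees with a harmonic function of gradient determined by [b] up to
   second order; the second-order term drops out of the four-point sum. *)
Definition harm2 (v : C R -> R) (z b : C R) := exists k : C R,
  forall e : R, 0 < e -> exists2 del : R, 0 < del & forall h, cmod h < del ->
  `|v (z + h) - v z - 2 * complex.Re (b * h) - complex.Re (k * h ^+ 2)| <= e * cmod h ^+ 2.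

Lemma taylor_ln1 (e : R) : 0 < e -> exists2 del : R, 0 < del & forall h : R, `|h| < del ->
  `|ln (1 + h) - h + h ^+ 2 / 2| <= e * h ^+ 2.
Proof.
move=> e0.
have [|x x1||del del0 H] := @taylor2 (@ln R) (fun x => x^-1) 1 (-1) (1/2) _ _ _ e e0.
- lra.
- apply: is_derive1_ln; move: x1; rewrite ltr_norml; lra.
- apply: rder_is_derive => a a0; exists (Num.min (1 / 2) (a / 2)).
    by rewrite lt_min; lra.
  move=> h; rewrite lt_min => /andP[h1 h2].
  have h3 : 1 / 2 < 1 + h by move: h1; rewrite ltr_norml; lra.
  have h4 : 1 + h != 0 by rewrite gt_eqF //; lra.
  have -> : (1 + h)^-1 - 1^-1 - -1 * h = h ^+ 2 / (1 + h) by field; rewrite h4.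
  rewrite normrM normfV normrX (@gtr0_norm _ (1 + h)); last by lra.
  rewrite ler_pdivrMr; last by lra.
  have h0 := normr_ge0 h.
  have A1 : 0 <= `|h| * (a / 2 - `|h|) by rewrite mulr_ge0 //; lra.
  have A2 : 0 <= a * `|h| * (1 + h - 1 / 2) by rewrite !mulr_ge0 //; lra.
  by move: A1 A2; lra.
exists del => // h hd; have := H h hd; rewrite ln1 invr1.
by have -> : ln (1 + h) - 0 - 1 * h - -1 / 2 * h ^+ 2 = ln (1 + h) - h + h ^+ 2 / 2 by field.
Qed.

(** With [f (z + h) = f z * (1 + w)] one has [|1 + w|^2 = 1 + T] for [T = 2 Re w + |w|^2], and
    [T - T^2 / 2 = 2 Re w - Re (w^2)] up to third order. Inserting [w = b h + g h^2] gives the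
    quadratic part [Re ((2 g - b^2) h^2)]. *)
Lemma harm2_ln (f : C R -> C R) (z c1 c2 : C R) : f z != 0 ->
  (forall e : R, 0 < e -> exists2 del : R, 0 < del & forall h, cmod h < del ->
    cmod (f (z + h) - f z - c1 * h - c2 * h ^+ 2) <= e * cmod h ^+ 2) ->
  harm2 (fun w => ln (cmod (f w) ^+ 2)) z (c1 / f z).
Proof.
move=> f0 Hf; set b := c1 / f z; set g := c2 / f z.
have cf : 0 < cmod (f z) by rewrite cmod_gt0.
exists (2 * g - b ^+ 2) => e e0.
set K := cmod b + cmod g + 1.
have K1 : 1 <= K by have := cmod_ge0 b; have := cmod_ge0 g; rewrite /K; lra.
set e1 := Num.min 1 (e / 100).
have e10 : 0 < e1 by rewrite lt_min ltr01; lra.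
have [e11 e1e] : e1 <= 1 /\ e1 <= e / 100 by apply/andP; rewrite -le_min.
have [d1 d10 H1] := Hf _ (mulr_gt0 e10 cf).
have K20 : 0 < 100 * K ^+ 2 by have := exprn_gt0 2 (lt_le_trans ltr01 K1); lra.
have [d2 d20 H2] := taylor_ln1 (divr_gt0 e0 K20).
set e3 := Num.min (d2 / (8 * K)) (Num.min (1 / (8 * K)) (e / (100 * K ^+ 3))).
have K30 : 0 < 100 * K ^+ 3 by have := exprn_gt0 3 (lt_le_trans ltr01 K1); lra.
have e30 : 0 < e3 by rewrite !lt_min !divr_gt0 //; lra.
exists (Num.min d1 e3); first by rewrite lt_min d10.
move=> h; rewrite !lt_min => /andP[hd1 /and3P[hd2 hd3 hd4]].
have h0 := cmod_ge0 h; set t := cmod h in h0 hd1 hd2 hd3 hd4 *.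
have Kt : K * t < 1 / 8.
  by move: hd3; rewrite ltr_pdivlMr; lra.
have t1 : t <= 1 by nra.
set w := (f (z + h) - f z) / f z.
set rho := w - b * h - g * h ^+ 2.
have Er : cmod rho <= e1 * t ^+ 2.
  have -> : rho = (f (z + h) - f z - c1 * h - c2 * h ^+ 2) / f z.
    by rewrite /rho /w /b /g; field.
  rewrite cmodf ler_pdivrMr //; have := H1 _ hd1.
  by rewrite -/t => /le_trans; apply; rewrite mulrAC.
have wb : cmod (w - b * h) <= K * t ^+ 2.
  have -> : w - b * h = rho + g * h ^+ 2 by rewrite /rho; ring.
  apply: le_trans (cmodD _ _) _; rewrite cmodM cmodX -/t /K.
  have := sqr_ge0 t; have := cmod_ge0 b; nra.
have bh : cmod (b * h) <= K * t by rewrite cmodM -/t /K; have := cmod_ge0 g; have := cmod_ge0 b; nra.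
have wK : cmod w <= 2 * K * t.
  have -> : w = (w - b * h) + b * h by ring.
  apply: le_trans (cmodD _ _) _; nra.
have w2 : cmod (w ^+ 2 - b ^+ 2 * h ^+ 2) <= 3 * K ^+ 2 * t ^+ 3.
  have -> : w ^+ 2 - b ^+ 2 * h ^+ 2 = (w - b * h) * (w + b * h) by ring.
  rewrite cmodM; have -> : 3 * K ^+ 2 * t ^+ 3 = (K * t ^+ 2) * (3 * K * t) by ring.
  apply: ler_pM; rewrite ?cmod_ge0 //; apply: le_trans (cmodD _ _) _; lra.
set T := 2 * complex.Re w + cmod w ^+ 2.
have fE : cmod (f (z + h)) ^+ 2 = cmod (f z) ^+ 2 * (1 + T).
  have -> : f (z + h) = f z * (1 + w) by rewrite /w; field.
  rewrite cmodM exprMn; congr (_ * _); rewrite /T !cmodE; case: (w) => x y /=.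
  by ring.
have ReW := Re_cmod w.
have Tb : `|T| <= 5 * K * t.
  have W0 := cmod_ge0 w; rewrite /T; move: ReW; rewrite !ler_norml; nra.
have T1 : 0 < 1 + T by move: Tb; rewrite ler_norml; nra.
have Td : `|T| < d2.
  by move: hd2; rewrite ltr_pdivlMr; nra.
have L := H2 _ Td.
have T2 : T ^+ 2 <= 25 * K ^+ 2 * t ^+ 2.
  have -> : 25 * K ^+ 2 * t ^+ 2 = (5 * K * t) ^+ 2 by ring.
  by rewrite -real_normK ?num_real // ler_sqr ?nnegrE //; nra.
have L2 : e / (100 * K ^+ 2) * T ^+ 2 <= e / 4 * t ^+ 2.
  apply: le_trans (_ : e / (100 * K ^+ 2) * (25 * K ^+ 2 * t ^+ 2) <= _).
    by rewrite ler_wpM2l // ltW // divr_gt0.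
  by rewrite le_eqVlt; apply/orP; left; apply/eqP; field; rewrite gt_eqF //; lra.
rewrite fE lnM ?posrE ?exprn_gt0 // -/b.
have T3 : `|T - T ^+ 2 / 2 - 2 * complex.Re w + complex.Re (w ^+ 2)| <= 20 * (K ^+ 3 * t ^+ 3).
  have -> : T - T ^+ 2 / 2 - 2 * complex.Re w + complex.Re (w ^+ 2) =
     - cmod w ^+ 2 * (2 * complex.Re w + cmod w ^+ 2 / 2).
    have -> : complex.Re (w ^+ 2) = 2 * complex.Re w ^+ 2 - cmod w ^+ 2.
      by rewrite cmodE; case: (w) => x y /=; ring.
    by rewrite /T; field.
  rewrite mulNr normrN normrM ger0_norm ?sqr_ge0 //.
  have W0 := cmod_ge0 w.
  have A1 : cmod w ^+ 2 <= (2 * K * t) ^+ 2 by rewrite ler_sqr ?nnegrE //; nra.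
  have A2 : `|2 * complex.Re w + cmod w ^+ 2 / 2| <= 5 * (K * t).
    by move: ReW; rewrite !ler_norml; nra.
  apply: le_trans (ler_pM (sqr_ge0 _) (normr_ge0 _) A1 A2) _.
  have : 0 <= K ^+ 3 * t ^+ 3 by rewrite mulr_ge0 ?exprn_ge0 //; lra.
  have -> : (2 * K * t) ^+ 2 * (5 * (K * t)) = 20 * (K ^+ 3 * t ^+ 3) by ring.
  lra.
have T4 : K ^+ 3 * t ^+ 3 <= e / 100 * t ^+ 2.
  have : K ^+ 3 * t <= e / 100.
    have K3 : 0 < K ^+ 3 by rewrite exprn_gt0 //; lra.
    move: hd4; rewrite ltr_pdivlMr //; lra.
  move=> A; have -> : K ^+ 3 * t ^+ 3 = (K ^+ 3 * t) * t ^+ 2 by ring.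
  by rewrite ler_wpM2r ?sqr_ge0.
have lnq : ln (cmod (f z) ^+ 2) + ln (1 + T) - ln (cmod (f z) ^+ 2) - 2 * complex.Re (b * h)
   - complex.Re ((2 * g - b ^+ 2) * h ^+ 2) =
   (ln (1 + T) - T + T ^+ 2 / 2) + (T - T ^+ 2 / 2 - 2 * complex.Re w + complex.Re (w ^+ 2))
   + 2 * complex.Re rho - complex.Re (w ^+ 2 - b ^+ 2 * h ^+ 2).
  have -> : complex.Re ((2 * g - b ^+ 2) * h ^+ 2) =
     2 * complex.Re (g * h ^+ 2) - complex.Re (b ^+ 2 * h ^+ 2).
    have -> : (2 * g - b ^+ 2) * h ^+ 2 = g * h ^+ 2 + g * h ^+ 2 - b ^+ 2 * h ^+ 2 by ring.
    by rewrite cReB cReD; ring.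
  by rewrite /rho !cReB; ring.
rewrite lnq; move: (le_trans (Re_cmod _) Er) (le_trans (Re_cmod _) w2) (le_trans L L2) T3.
have -> : 3 * K ^+ 2 * t ^+ 3 = 3 * (K ^+ 2 * t ^+ 3) by ring.
have A1 : K ^+ 2 * t ^+ 3 <= K ^+ 3 * t ^+ 3.
  by rewrite ler_wpM2r ?exprn_ge0 // [leRHS]exprS ler_peMl ?exprn_ge0 //; lra.
have A2 : e1 * t ^+ 2 <= e / 100 * t ^+ 2 by rewrite ler_wpM2r ?sqr_ge0.
have A3 : 0 <= e * t ^+ 2 by rewrite mulr_ge0 ?sqr_ge0 // ltW.
rewrite !ler_norml; lra.
Qed.
End TAYLOR.

(** * Ahlfors' lemma *)

Section AHLFORS. Variable R : realType.
Implicit Types (v V : C R -> R) (z b c h : C R) (s e : R).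

(** For smooth [v], [sum4 v z s / s^2] tends to the Laplacian of [v] at [z] as [s] tends to 0;
    inequalities for small [s] replace inequalities between second derivatives. *)
Definition sum4 v z s := (v (z + (s%:C)%C) - v z) + (v (z - (s%:C)%C) - v z) +
  (v (z + (s *i)%C) - v z) + (v (z - (s *i)%C) - v z).

Lemma cmod4 s : 0 <= s -> [/\ cmod ((s%:C)%C : C R) = s, cmod (- (s%:C)%C : C R) = s,
  cmod ((s *i)%C : C R) = s & cmod (- (s *i)%C : C R) = s].
Proof.
move=> s0; rewrite !cmodN cmodR ger0_norm //.
by rewrite /cmod /= expr0n add0r sqrtr_sqr ger0_norm.
Qed.

(** The Laplacian of [psi o v] is [psi'' (v) |grad v|^2] for harmonic [v], and
    [|grad v|^2 = 4 |b|^2] because the linear part of [v] is [2 Re (b h)]. *)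
Lemma sum4_psi v z b (psi psi1 : R -> R) (d r : R) : harm2 v z b -> 0 < r ->
  (forall x, `|x - v z| < r -> is_derive x 1 psi (psi1 x)) ->
  is_derive (v z) 1 psi1 d ->
  forall e : R, 0 < e -> exists2 del : R, 0 < del & forall s, 0 < s < del ->
   `|sum4 (psi \o v) z s - 4 * d * cmod b ^+ 2 * s ^+ 2| <= e * s ^+ 2.
Proof.
move=> [k Hv] r0 D1 D2 e e0.
set K := 2 * cmod b + cmod k + 1.
have b0 := cmod_ge0 b; have k0 := cmod_ge0 k.
have K1 : 1 <= K by rewrite /K; lra.
set P : R := `|psi1 (v z)| + `|d| + 1.
have p0 := normr_ge0 (psi1 (v z)); have q0 := normr_ge0 d.
have P1 : 1 <= P by rewrite /P; lra.
set e1 := Num.min 1 (e / (40 * P)).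
have e10 : 0 < e1 by rewrite lt_min ltr01 divr_gt0 //; lra.
have [e11 e1e] : e1 <= 1 /\ e1 * P <= e / 40.
  have [A B] : e1 <= 1 /\ e1 <= e / (40 * P) by apply/andP; rewrite -le_min.
  by split=> //; move: B; rewrite ler_pdivlMr; lra.
have [d1 d10 H1] := Hv _ e10.
have K20 : 0 < 100 * K ^+ 2 by have := exprn_gt0 2 (lt_le_trans ltr01 K1); lra.
have [d2 d20 H2] := taylor2 r0 D1 D2 (divr_gt0 e0 K20).
exists (Num.min (Num.min 1 d1) (Num.min (d2 / (2 * K)) (e / (100 * P * K ^+ 2)))).
  have A : 0 < d2 / (2 * K) by apply: divr_gt0 => //; lra.
  have B : 0 < e / (100 * P * K ^+ 2) by apply: divr_gt0 => //; rewrite mulr_gt0 ?exprn_gt0 //; lra.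
  by rewrite !lt_min ltr01 d10 A B.
move=> s; rewrite !lt_min => /andP[s0 /andP[/andP[s1 sd1] /andP[sd2 sd3]]].
have Ks : K * s < d2 by move: sd2; rewrite ltr_pdivlMr; nra.
have PKs : P * K ^+ 2 * s <= e / 100.
  have : 0 < P * K ^+ 2 by rewrite mulr_gt0 ?exprn_gt0 //; lra.
  move=> PK0; move: sd3; rewrite -mulrA ltr_pdivlMr; last by rewrite mulr_gt0.
  lra.
have key h : cmod h = s -> `|psi (v (z + h)) - psi (v z) - psi1 (v z) * (2 * complex.Re (b * h) + complex.Re (k * h ^+ 2)) - 2 * d * complex.Re (b * h) ^+ 2| <= e / 4 * s ^+ 2.
  move=> hs; set D := v (z + h) - v z; set l := 2 * complex.Re (b * h).
  set q := complex.Re (k * h ^+ 2).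
  have s20 := sqr_ge0 s.
  have X : `|D - l - q| <= e1 * s ^+ 2 by rewrite -hs H1 // hs.
  have lb : `|l| <= 2 * cmod b * s.
    rewrite /l normrM (ger0_norm (_ : 0 <= 2)) // -mulrA ler_pM2l // -hs -cmodM.
    exact: Re_cmod.
  have qb : `|q| <= cmod k * s ^+ 2 by rewrite -hs -cmodX -cmodM Re_cmod.
  have Dl : `|D - l| <= K * s ^+ 2.
    by move: X qb; rewrite /K !ler_norml; nra.
  have ss : s ^+ 2 <= s by rewrite expr2; nra.
  have Db : `|D| <= K * s.
    move: Dl lb X qb; rewrite /K !ler_norml; nra.
  have L := H2 D (le_lt_trans Db Ks).
  have vD : v z + D = v (z + h) by rewrite /D; ring.
  rewrite vD in L.
  have D2b : D ^+ 2 <= K ^+ 2 * s ^+ 2.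
    by rewrite -real_normK ?num_real // -exprMn ler_sqr ?nnegrE //; nra.
  have L2 : e / (100 * K ^+ 2) * D ^+ 2 <= e / 100 * s ^+ 2.
    apply: le_trans (_ : e / (100 * K ^+ 2) * (K ^+ 2 * s ^+ 2) <= _).
      by rewrite ler_wpM2l // ltW // divr_gt0.
    by rewrite le_eqVlt; apply/orP; left; apply/eqP; field; rewrite gt_eqF //; lra.
  have Dl2 : `|D ^+ 2 - l ^+ 2| <= 2 * (K ^+ 2 * s ^+ 3).
    have -> : D ^+ 2 - l ^+ 2 = (D - l) * (D + l) by ring.
    have -> : 2 * (K ^+ 2 * s ^+ 3) = (K * s ^+ 2) * (2 * K * s) by ring.
    rewrite normrM ler_pM //.
    by move: Db lb; rewrite /K !ler_norml; nra.
  have E : psi (v (z + h)) - psi (v z) - psi1 (v z) * (l + q) - 2 * d * complex.Re (b * h) ^+ 2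
   = (psi (v (z + h)) - psi (v z) - psi1 (v z) * D - d / 2 * D ^+ 2) + psi1 (v z) * (D - l - q)
     + d / 2 * (D ^+ 2 - l ^+ 2) by rewrite /l; field.
  rewrite E.
  have A1 : `|psi1 (v z) * (D - l - q)| <= e / 40 * s ^+ 2.
    rewrite normrM; apply: le_trans (_ : P * (e1 * s ^+ 2) <= _).
      by rewrite ler_pM //; rewrite /P; lra.
    by rewrite mulrA [P * _]mulrC ler_wpM2r.
  have A2 : `|d / 2 * (D ^+ 2 - l ^+ 2)| <= e / 100 * s ^+ 2.
    rewrite normrM; apply: le_trans (_ : (P / 2) * (2 * (K ^+ 2 * s ^+ 3)) <= _).
      by rewrite ler_pM // normrM (ger0_norm (_ : 0 <= 2^-1)) // /P; lra.
    have -> : P / 2 * (2 * (K ^+ 2 * s ^+ 3)) = (P * K ^+ 2 * s) * s ^+ 2 by field.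
    by rewrite ler_wpM2r.
  have A3 : 0 <= e * s ^+ 2 by rewrite mulr_ge0 // ltW.
  move: A1 A2 (le_trans L L2); rewrite !ler_norml; lra.
have [c1 c2 c3 c4] := cmod4 (ltW s0).
have := key _ c1; have := key _ c2; have := key _ c3; have := key _ c4.
have b2 : cmod b ^+ 2 = complex.Re b ^+ 2 + complex.Im b ^+ 2 by exact: cmodE.
rewrite /sum4 /= b2; case: (b) (k) => b1 b' [k1 k'] /=.
rewrite !ler_norml; move: (psi (v _)) (psi (v _)) (psi (v _)) (psi (v _)) (psi1 _) (psi (v z)) => a1 a2 a3 a4 a5 a6.
move=> /andP[X1 X2] /andP[X3 X4] /andP[X5 X6] /andP[X7 X8].
apply/andP; split; lra.
Qed.

End AHLFORS.

Section AHLFORS2. Variable R : realType.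
Implicit Types (v V : C R -> R) (z b c h : C R) (s e : R).

Lemma sum4_harm v z b : harm2 v z b ->
  forall e : R, 0 < e -> exists2 del : R, 0 < del & forall s, 0 < s < del ->
   `|sum4 v z s| <= e * s ^+ 2.
Proof.
move=> H e e0.
have [del del0 Hd] := @sum4_psi R v z b id (fun=> 1) 0 1 H ltr01 (fun x _ => is_derive_id x 1) (is_derive_cst _ _ _) e e0.
by exists del => // s /Hd; rewrite mulr0 !mul0r subr0.
Qed.

Lemma ln1_lower : exists2 del : R, 0 < del & forall x : R, `|x| < del -> x - x ^+ 2 <= ln (1 + x).
Proof.
have [del del0 H] := @taylor_ln1 R (1 / 2) ltac:(lra); exists del => // x /H.
rewrite ler_norml; lra.
Qed.

(** At an interior maximum of [V X^2], with [X = rho^2 - |z - c|^2], the second difference of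
    [ln V + 2 ln X] is at most 0. As that of [ln V] is about [kap V s^2] or more, [kap V] is bounded
    by the contribution of [X], and the bound on [V X^2] passes from the maximum to [c]. The sharp
    constant would be 8; 16 comes from the crude estimate [x - x^2 <= ln (1 + x)]. *)
Lemma ahlfors V c (rho kap : R) : 0 < rho -> 0 < kap ->
  (forall z, 0 <= V z) ->
  (forall z, cmod (z - c) <= rho -> forall e, 0 < e -> exists2 del : R, 0 < del &
     forall w, cmod (w - z) < del -> `|V w - V z| < e) ->
  (forall z, cmod (z - c) < rho -> 0 < V z -> forall e, 0 < e -> exists2 del : R, 0 < del &
     forall s, 0 < s < del -> (kap * V z - e) * s ^+ 2 <= sum4 (fun w => ln (V w)) z s) ->
  V c * rho ^+ 2 <= 16 / kap.
Proof.
move=> r0 k0 V0 Vc Vl.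
pose X z : R := rho ^+ 2 - cmod (z - c) ^+ 2.
pose Phi z := V z * X z ^+ 2.
have Xc : X c = rho ^+ 2 by rewrite /X subrr cmod0 expr0n subr0.
have Xle z : X z <= rho ^+ 2 by rewrite /X gerBl sqr_ge0.
have [Vc0|Vcp] := leP (V c) 0.
  apply: le_trans (_ : 0 <= _); first by rewrite mulr_le0_ge0 ?sqr_ge0.
  by rewrite divr_ge0 // ltW.
have [z0 z0r zmax] : exists2 z, cmod (z - c) <= rho & forall w, cmod (w - c) <= rho -> Phi w <= Phi z.
  apply: max_disc; first exact: ltW.
  move=> z zr e e0; rewrite /Phi.
  set A := V z + 1; set B := (rho ^+ 2) ^+ 2.
  have A0 : 0 < A by rewrite /A ltr_wpDl.
  have B0 : 0 < B by rewrite /B !exprn_gt0.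
  have [del del0 Hd] := Vc z zr _ (divr_gt0 e0 (mulr_gt0 (ltr0n R 2) B0)).
  have e1 : 0 < e / (8 * A * rho ^+ 3) by rewrite divr_gt0 // !mulr_gt0 ?exprn_gt0.
  exists (Num.min del (e / (8 * A * rho ^+ 3))); first by rewrite lt_min del0.
  move=> w; rewrite lt_min => /andP[w1 w2] wr.
  have bX u : cmod (u - c) <= rho -> 0 <= X u.
    by move=> ur; rewrite subr_ge0 ler_sqr ?nnegrE ?cmod_ge0 // ltW.
  have -> : V w * X w ^+ 2 - V z * X z ^+ 2 = (V w - V z) * X w ^+ 2 + V z * (X w ^+ 2 - X z ^+ 2) by ring.
  apply: le_lt_trans (ler_normD _ _) _; rewrite (normrM (V w - V z)) (normrM (V z)).
  have XB : `|X w ^+ 2| <= B.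
    by rewrite ger0_norm ?sqr_ge0 // /B ler_sqr ?nnegrE ?bX ?sqr_ge0 // Xle.
  have h1 : `|V w - V z| * `|X w ^+ 2| <= e / 2.
    apply: le_trans (ler_pM (normr_ge0 _) (normr_ge0 _) (ltW (Hd _ w1)) XB) _.
    by rewrite le_eqVlt; apply/orP; left; apply/eqP; field; rewrite gt_eqF.
  have h2 : `|X w ^+ 2 - X z ^+ 2| <= 4 * rho ^+ 3 * cmod (w - z).
    have -> : X w ^+ 2 - X z ^+ 2 = (cmod (z - c) - cmod (w - c)) * ((cmod (z - c) + cmod (w - c)) * (X w + X z)).
      by rewrite /X; ring.
    have q1 : `|cmod (z - c) - cmod (w - c)| <= cmod (w - z).
      have := lerB_cmod (z - c) (w - c); have := lerB_cmod (w - c) (z - c).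
      have -> : z - c - (w - c) = z - w by ring.
      have -> : w - c - (z - c) = w - z by ring.
      by rewrite (cmodBC z w) ler_norml; lra.
    have q2 : `|(cmod (z - c) + cmod (w - c)) * (X w + X z)| <= (2 * rho) * (2 * rho ^+ 2).
      rewrite ger0_norm; last by rewrite mulr_ge0 // addr_ge0 ?cmod_ge0 ?bX.
      have Xw := Xle w; have Xz := Xle z; have Xw0 := bX w wr; have Xz0 := bX z zr.
      have g0 u : 0 <= cmod (u - c) by exact: cmod_ge0.
      apply: ler_pM.
      - by rewrite addr_ge0.
      - by rewrite addr_ge0.
      - by have := lerD zr wr; rewrite mulr_natl mulr2n.
      - by have := lerD Xw Xz; rewrite mulr_natl mulr2n.
    rewrite normrM; apply: le_trans (ler_pM (normr_ge0 _) (normr_ge0 _) q1 q2) _.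
    by rewrite le_eqVlt; apply/orP; left; apply/eqP; ring.
  have h3 : `|V z| * `|X w ^+ 2 - X z ^+ 2| < e / 2.
    rewrite (ger0_norm (V0 z)).
    apply: le_lt_trans (_ : A * (4 * rho ^+ 3 * cmod (w - z)) < _).
      by rewrite ler_pM // /A lerDl.
    move: w2; rewrite ltr_pdivlMr ?mulr_gt0 ?exprn_gt0 //.
    by move: (rho ^+ 3) => q; lra.
  lra.
have Pc : Phi c <= Phi z0 by apply: zmax; rewrite subrr cmod0 ltW.
have Pc0 : 0 < Phi c by rewrite /Phi Xc mulr_gt0 ?exprn_gt0.
have Pz0 := lt_le_trans Pc0 Pc.
have X0 : 0 <= X z0 by rewrite subr_ge0 ler_sqr ?nnegrE ?cmod_ge0 // ltW.
have Xp : 0 < X z0.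
  rewrite lt_neqAle X0 andbT eq_sym; apply/eqP => h.
  by move: Pz0; rewrite /Phi h expr0n mulr0 ltxx.
have Vp : 0 < V z0 by move: Pz0; rewrite /Phi pmulr_lgt0 // exprn_gt0.
have z0r' : cmod (z0 - c) < rho.
  rewrite -ltr_sqr ?nnegrE ?cmod_ge0 ?ltW //.
  by rewrite -subr_gt0.
have key : kap * V z0 <= 16 * rho ^+ 2 / X z0 ^+ 2.
  apply/ler_addgt0Pr => e'; set e : R := e' => e0; have e2 : 0 < e / 2 by lra.
  have [d1 d10 H1] := Vl _ z0r' Vp _ e2.
  have [d2 d20 H2] := Vc _ z0r _ Vp.
  have [d3 d30 H3] := ln1_lower.
  set x := X z0 in X0 Xp *; set q := cmod (z0 - c) in z0r z0r' *.
  have q0 : 0 <= q by exact: cmod_ge0.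
  have xq : x = rho ^+ 2 - q ^+ 2 by [].
  set m : R := Num.min (Num.min (Num.min 1 (rho - q)) (Num.min d1 d2)) (Num.min (d3 * x / (2 * rho + 2)) (e * x ^+ 2 / 16)).
  have m0 : 0 < m.
    have A1 : 0 < d3 * x / (2 * rho + 2) by rewrite divr_gt0 ?mulr_gt0 //; lra.
    have A2 : 0 < e * x ^+ 2 / 16 by rewrite divr_gt0 ?mulr_gt0 ?exprn_gt0.
    by rewrite !lt_min ltr01 subr_gt0 z0r' d10 d20 A1 A2.
  set s : R := m / 2; have s0 : 0 < s by rewrite divr_gt0.
  have : s < m by rewrite /s; lra.
  rewrite !lt_min => /andP[/andP[/andP[s1 sq] /andP[sd1 sd2]] /andP[sd3 sd4]].
  pose d h : R := X (z0 + h) - x.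
  have dE h : d h = - (2 * complex.Re (conjc (z0 - c) * h)) - cmod h ^+ 2.
    rewrite /d /x /X !cmodE; case: (z0) (c) h => a1 a2 [b1 b2] [h1 h2] /=; ring.
  have step h : cmod h = s -> ln (V (z0 + h)) - ln (V z0) <= 2 * (- (d h / x) + (d h / x) ^+ 2).
    move=> hs.
    have hr : cmod (z0 + h - c) <= rho.
      have -> : z0 + h - c = (z0 - c) + h by ring.
      by apply: le_trans (cmodD _ _) _; rewrite hs -/q; lra.
    have Vh : 0 < V (z0 + h).
      have : `|V (z0 + h) - V z0| < V z0 by apply: H2; rewrite addrC addKr hs.
      rewrite ltr_norml; lra.
    have db : `|d h / x| < d3.
      rewrite normrM normfV (gtr0_norm Xp) ltr_pdivrMr // dE.
      have : `|complex.Re (conjc (z0 - c) * h)| <= q * s.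
        apply: le_trans (Re_cmod _) _; rewrite cmodM hs; suff -> : cmod (conjc (z0 - c)) = q by [].
        by apply/eqP; rewrite -(eqrXn2 (n:=2)) ?cmod_ge0 // /q !cmodE; case: (z0 - c) => a b /=; rewrite sqrrN.
      rewrite hs; move: sd3; rewrite ltr_pdivlMr; last by lra.
      have A1 : q * s <= rho * s by rewrite ler_wpM2r // ltW.
      have A2 : s ^+ 2 <= s by rewrite expr2; nra.
      have A3 := sqr_ge0 s; rewrite ler_norml ltr_norml; lra.
    have L := H3 _ db.
    have Xh : X (z0 + h) = x * (1 + d h / x) by rewrite /d; field; rewrite gt_eqF.
    have Xh0 : 0 < X (z0 + h).
      rewrite lt_neqAle eq_sym subr_ge0 ler_sqr ?nnegrE ?cmod_ge0 ?(ltW r0) // hr andbT.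
      rewrite subr_eq0 eqrXn2 ?cmod_ge0 ?(ltW r0) //; apply/eqP => rE.
      have : rho <= q + s.
        rewrite rE; have -> : z0 + h - c = (z0 - c) + h by ring.
        by apply: le_trans (cmodD _ _) _; rewrite hs.
      lra.
    have D0 : 0 < 1 + d h / x by move: Xh0; rewrite Xh pmulr_rgt0.
    have := zmax _ hr; rewrite /Phi -/x Xh.
    rewrite -ler_ln ?posrE ?mulr_gt0 ?exprn_gt0 ?mulr_gt0 //.
    rewrite !lnM ?posrE ?mulr_gt0 ?exprn_gt0 ?mulr_gt0 //.
    lra.
  have [c1 c2 c3 c4] := cmod4 (ltW s0).
  have S := H1 s; rewrite s0 sd1 in S; have {}S := S isT.
  have E1 : d ((s%:C)%C) + d (- (s%:C)%C) + d ((s *i)%C) + d (- (s *i)%C) = - (4 * s ^+ 2).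
    rewrite !dE !c1 !c2 !c3 !c4; case: (z0 - c) => a b /=; ring.
  have E2 : d ((s%:C)%C) ^+ 2 + d (- (s%:C)%C) ^+ 2 + d ((s *i)%C) ^+ 2 + d (- (s *i)%C) ^+ 2 = 8 * q ^+ 2 * s ^+ 2 + 4 * s ^+ 4.
    rewrite !dE !c1 !c2 !c3 !c4 /q cmodE; case: (z0 - c) => a b /=; ring.
  have E3 : (kap * V z0 - e / 2) * s ^+ 2 <= 2 * (4 / x + (8 * q ^+ 2 + 4 * s ^+ 2) / x ^+ 2) * s ^+ 2.
    have -> : 2 * (4 / x + (8 * q ^+ 2 + 4 * s ^+ 2) / x ^+ 2) * s ^+ 2 =
      2 * (- (- (4 * s ^+ 2)) / x + (8 * q ^+ 2 * s ^+ 2 + 4 * s ^+ 4) / x ^+ 2).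
      by field; rewrite gt_eqF.
    rewrite -E1 -E2; apply: le_trans S _; rewrite /sum4.
    have Q h : (d h / x) ^+ 2 = d h ^+ 2 / x ^+ 2 by rewrite expr_div_n.
    move: (step _ c1) (step _ c2) (step _ c3) (step _ c4); rewrite !Q.
    have Q' (a1 a2 a3 a4 : R) : - (a1 + a2 + a3 + a4) / x = - (a1 / x) - a2 / x - a3 / x - a4 / x.
      by field; rewrite gt_eqF.
    rewrite Q' !mulrDl; lra.
  have {}E3 : kap * V z0 - e / 2 <= 2 * (4 / x + (8 * q ^+ 2 + 4 * s ^+ 2) / x ^+ 2).
    by rewrite ler_pM2r ?exprn_gt0 // in E3.
  have s2 : 8 * s ^+ 2 / x ^+ 2 <= e / 2.
    rewrite ler_pdivrMr ?exprn_gt0 //; apply: le_trans (_ : 8 * s <= _).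
      by rewrite ler_wpM2l // expr2; nra.
    by move: sd4; move: (x ^+ 2) => q2; lra.
  have E4 : 2 * (4 / x + (8 * q ^+ 2 + 4 * s ^+ 2) / x ^+ 2) =
    16 * rho ^+ 2 / x ^+ 2 - 8 / x + 8 * s ^+ 2 / x ^+ 2.
    by rewrite (_ : rho ^+ 2 = x + q ^+ 2); [field; rewrite gt_eqF|rewrite xq; ring].
  have : 0 < 8 / x by rewrite divr_gt0.
  move: E3 s2; rewrite E4; move: (8 / x) (16 * rho ^+ 2 / x ^+ 2) (8 * s ^+ 2 / x ^+ 2) (kap * V z0) (e : R).
  by clear; move=> a1 a2 a3 a4 a5; lra.
move: key; rewrite ler_pdivlMr ?exprn_gt0 // => key.
have r20 : 0 < rho ^+ 2 by rewrite exprn_gt0.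
rewrite ler_pdivlMr // -(ler_pM2r r20).
apply: le_trans (_ : kap * Phi c <= _).
  by rewrite /Phi Xc le_eqVlt; apply/orP; left; apply/eqP; ring.
apply: le_trans (_ : kap * Phi z0 <= _); first by rewrite ler_pM2l.
by rewrite /Phi mulrA.
Qed.
End AHLFORS2.

(** * Ahlfors' lemma for pulled-back metrics *)

Section METRIC. Variable R : realType.
Implicit Types (v V sg : C R -> R) (z b c h w : C R) (s e : R) (f : C R -> C R).

Definition contR v z := forall e : R, 0 < e -> exists2 del : R, 0 < del &
  forall w, cmod (w - z) < del -> `|v w - v z| < e.

Lemma contR_ln1 (psi : R -> R) (x d : R) : is_derive x 1 psi d ->
  forall e : R, 0 < e -> exists2 del : R, 0 < del & forall y, `|y - x| < del -> `|psi y - psi x| < e.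
Proof.
move=> D e e0; have [del del0 H] := is_derive_rder D ltr01.
have c0 : 0 < `|d| + 2 by rewrite ltr_wpDl.
exists (Num.min del (e / (`|d| + 2))); first by rewrite lt_min del0 divr_gt0.
move=> y; rewrite lt_min => /andP[y1 y2].
have := H _ y1; rewrite [x + _]addrC subrK => A.
move: y2; rewrite ltr_pdivlMr // => y2.
have -> : psi y - psi x = (psi y - psi x - d * (y - x)) + d * (y - x) by ring.
apply: le_lt_trans (ler_normD _ _) _; rewrite normrM.
have := normr_ge0 (y - x); nra.
Qed.

Lemma contR_comp (psi : R -> R) v z (d : R) : is_derive (v z) 1 psi d -> contR v z ->
  contR (fun w => psi (v w)) z.
Proof.
move=> D H e e0; have [del del0 H1] := contR_ln1 D e0.
have [del' del'0 H2] := H _ del0; exists del' => // w /H2; exact: H1.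
Qed.

Lemma contRD v1 v2 z : contR v1 z -> contR v2 z -> contR (fun w => v1 w + v2 w) z.
Proof.
move=> H1 H2 e e0; have e2 : 0 < e / 2 by lra.
have [a a0 Ha] := H1 _ e2; have [b b0 Hb] := H2 _ e2.
exists (Num.min a b); first by rewrite lt_min a0.
move=> w; rewrite lt_min => /andP[/Ha h1 /Hb h2].
have -> : v1 w + v2 w - (v1 z + v2 z) = (v1 w - v1 z) + (v2 w - v2 z) by ring.
apply: le_lt_trans (ler_normD _ _) _; lra.
Qed.

Lemma contRM v1 v2 z : contR v1 z -> contR v2 z -> contR (fun w => v1 w * v2 w) z.
Proof.
move=> H1 H2 e e0.
set A := `|v1 z| + 1; set B := `|v2 z| + 1.
have A0 : 0 < A by rewrite /A ltr_wpDl.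
have B0 : 0 < B by rewrite /B ltr_wpDl.
have [a a0 Ha] := H1 _ (divr_gt0 e0 (mulr_gt0 (ltr0n R 2) B0)).
have [b b0 Hb] := H2 _ (divr_gt0 e0 (mulr_gt0 (ltr0n R 2) A0)).
have [b' b'0 Hb'] := H2 _ ltr01.
exists (Num.min a (Num.min b b')); first by rewrite !lt_min a0 b0.
move=> w; rewrite !lt_min => /and3P[/Ha h1 /Hb h2 /Hb' h3].
have -> : v1 w * v2 w - v1 z * v2 z = (v1 w - v1 z) * v2 w + v1 z * (v2 w - v2 z) by ring.
apply: le_lt_trans (ler_normD _ _) _; rewrite !normrM.
have h4 : `|v2 w| <= B.
  by have := ler_normD (v2 w - v2 z) (v2 z); rewrite subrK /B; lra.
have h5 : `|v1 w - v1 z| * `|v2 w| <= e / 2.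
  apply: le_trans (ler_pM (normr_ge0 _) (normr_ge0 _) (ltW h1) h4) _.
  by rewrite le_eqVlt; apply/orP; left; apply/eqP; field; rewrite gt_eqF.
have h6 : `|v1 z| * `|v2 w - v2 z| < e / 2.
  apply: le_lt_trans (_ : A * `|v2 w - v2 z| < _); first by rewrite ler_wpM2r // /A; lra.
  by move: h2; rewrite ltr_pdivlMr ?mulr_gt0 //; lra.
lra.
Qed.

Lemma contR_cmod2 f z (d : C R) : cder f z d -> contR (fun w => cmod (f w) ^+ 2) z.
Proof.
move=> D; have H : contR (fun w => cmod (f w)) z.
  move=> e e0; have [del del0 Hd] := cder_cont D e0; exists del => // w /Hd.
  apply: le_lt_trans; have := lerB_cmod (f w) (f z); have := lerB_cmod (f z) (f w).
  by rewrite (cmodBC (f z)) ler_norml; lra.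
exact: (contRM H H).
Qed.

(** Where [f1] does not vanish, [ln |f1|^2] is harmonic and does not affect the second difference of
    [ln V = ln |f1|^2 + sg]. [ahlfors] asks for continuity on a closed disc, so it is applied with
    radius [r / 2], and 16 becomes 64. *)
Lemma ahl_metric (f1 f2 f3 : C R -> C R) sg c (r kap : R) : 0 < r -> 0 < kap ->
  (forall z, cmod (z - c) < r -> cder f1 z (f2 z) /\ cder f2 z (f3 z)) ->
  (forall z, cmod (z - c) < r -> contR sg z) ->
  (forall z, cmod (z - c) < r -> forall e : R, 0 < e -> exists2 del : R, 0 < del &
     forall s : R, 0 < s < del ->
       (kap * (cmod (f1 z) ^+ 2 * expR (sg z)) - e) * s ^+ 2 <= sum4 sg z s) ->
  cmod (f1 c) ^+ 2 * expR (sg c) * r ^+ 2 <= 64 / kap.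
Proof.
move=> r0 k0 Hf Hs Hl.
pose V z := cmod (f1 z) ^+ 2 * expR (sg z).
have r20 : 0 < r / 2 by lra.
suff : V c * (r / 2) ^+ 2 <= 16 / kap.
  by rewrite /V expr_div_n; move: (_ * expR _) => a; move: (kap^-1) => b; lra.
have Vc z : cmod (z - c) < r -> contR V z.
  move=> zr; have [D _] := Hf z zr; apply: contRM (contR_cmod2 D) _.
  exact: contR_comp (is_derive_expR _) (Hs z zr).
apply: ahlfors => // [z|z zr|z zr Vz e e0].
- by rewrite mulr_ge0 ?sqr_ge0 ?expR_ge0.
- by apply: Vc; lra.
have zr' : cmod (z - c) < r by lra.
have [D1 D2] := Hf z zr'.
have f1z : f1 z != 0.
  by apply/eqP => h; move: Vz; rewrite /V h cmod0 expr0n mul0r ltxx.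
have e2 : 0 < e / 2 by lra.
have [d1 d10 H1] := Hl z zr' _ e2.
have Hh : harm2 (fun w => ln (cmod (f1 w) ^+ 2)) z (f2 z / f1 z).
  apply: (@harm2_ln R f1 z (f2 z) (f3 z / 2)) => //.
  apply: (@peano2 R f1 f2 z (f3 z) (r - cmod (z - c))) => //; first by lra.
  move=> w wz; have [] // := Hf w _.
  by have := cmodBtri z w c; lra.
have [d2 d20 H2] := sum4_harm Hh e2.
have cf : 0 < cmod (f1 z) by rewrite cmod_gt0.
have [d3 d30 H3] := cder_cont D1 cf.
exists (Num.min d1 (Num.min d2 d3)); first by rewrite !lt_min d10 d20.
move=> s; rewrite !lt_min => /andP[s0 /and3P[s1 s2 s3]].
have A := H1 s; rewrite s0 s1 in A; have {}A := A isT.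
have B := H2 s; rewrite s0 s2 in B; have {}B := B isT.
have [c1 c2 c3 c4] := cmod4 (ltW s0).
have E h : cmod h = s -> ln (V (z + h)) = ln (cmod (f1 (z + h)) ^+ 2) + sg (z + h).
  move=> hs; rewrite /V lnM ?posrE ?expR_gt0 ?expRK //.
  have X : cmod (z + h - z) < d3 by rewrite addrC addKr hs.
  apply: exprn_gt0; have := H3 _ X.
  have := lerB_cmod (f1 z) (f1 (z + h)); rewrite (cmodBC (f1 z)); lra.
have Ez : ln (V z) = ln (cmod (f1 z) ^+ 2) + sg z.
  by rewrite /V lnM ?posrE ?expR_gt0 ?expRK // exprn_gt0.
have -> : sum4 (fun w => ln (V w)) z s = sum4 (fun w => ln (cmod (f1 w) ^+ 2)) z s + sum4 sg z s.
  by rewrite /sum4 !E // Ez; ring.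
move: A B; rewrite -/(V z) ler_norml; move: (sum4 _ _ _) (sum4 _ _ _) => x y.
by move: (V z) (s ^+ 2) => v q; lra.
Qed.
End METRIC.

(** * Landau's theorem for functions omitting 0 and 1 *)

Section LANDAU. Variable R : realType.
Implicit Types (z c h w : C R) (s e : R) (f : C R -> C R).

(** Three derivatives, because [ahl_metric] expands the logarithm of the modulus of the first one to
    second order. *)
Definition hol c (r : R) f := exists f1 f2 f3 : C R -> C R, forall z, cmod (z - c) < r ->
  [/\ cder f z (f1 z), cder f1 z (f2 z) & cder f2 z (f3 z)].

Lemma is_derive_expR6 (x : R) : is_derive x 1 (fun x : R => 1 + expR (x / 6)) (expR (x / 6) / 6).
Proof.
have Y : is_derive x 1 (fun x : R => x / 6) (1 / 6).
  by apply: is_derive_eq; rewrite /GRing.scale /=; field.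
have Z := @is_derive1_comp R expR (fun x : R => x / 6) x _ _ (is_derive_expR _) Y.
by apply: is_derive_eq; rewrite /GRing.scale /=; field.
Qed.

(** [exp (rob (ln |w|^2))] is [(1 + |w|^(1/3)) / |w|^(5/3)]. The product of this for [w] and for
    [w - 1] is the squared density of Robinson's metric on the plane without 0 and 1, whose
    curvature is bounded above by a negative constant. *)
Definition rob (x : R) := ln (1 + expR (x / 6)) - 5 / 6 * x.
Definition rob1 (x : R) := 1 / 6 - 1 / 6 * (1 + expR (x / 6))^-1 - 5 / 6.

Lemma rob_der (x : R) : is_derive x 1 rob (rob1 x).
Proof.
have e0 := expR_gt0 (x / 6).
have e1 : 0 < 1 + expR (x / 6) by lra.
have Z := @is_derive1_comp R (@ln R) (fun x : R => 1 + expR (x / 6)) x _ _ (is_derive1_ln e1) (is_derive_expR6 x).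
rewrite /rob /rob1; apply: is_derive_eq; rewrite /GRing.scale /=; field.
by rewrite gt_eqF.
Qed.

Lemma rob1_der (x : R) : is_derive x 1 rob1 (1 / 36 * (expR (x / 6) / (1 + expR (x / 6)) ^+ 2)).
Proof.
have e0 := expR_gt0 (x / 6).
have e1 : 1 + expR (x / 6) != 0 by rewrite gt_eqF //; lra.
have Z := @is_deriveV R (fun x : R => 1 + expR (x / 6)) x _ 1 e1 (is_derive_expR6 x).
rewrite /rob1; apply: is_derive_eq; rewrite /GRing.scale /=; field.
exact: e1.
Qed.

Lemma harm2_hol f (f1 f2 f3 : C R -> C R) c (r : R) : 
  (forall z, cmod (z - c) < r -> [/\ cder f z (f1 z), cder f1 z (f2 z) & cder f2 z (f3 z)]) ->
  forall z, cmod (z - c) < r -> f z != 0 -> harm2 (fun w => ln (cmod (f w) ^+ 2)) z (f1 z / f z).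
Proof.
move=> Hf z zr fz; have [_ D2 _] := Hf z zr.
apply: (@harm2_ln R f z (f1 z) (f2 z / 2)) => //.
apply: (@peano2 R f f1 z (f2 z) (r - cmod (z - c))) => //; first by lra.
move=> w wz; have [] // := Hf w _.
by have := cmodBtri z w c; lra.
Qed.

Lemma cont_lncmod f z (d : C R) : cder f z d -> f z != 0 -> contR (fun w => ln (cmod (f w) ^+ 2)) z.
Proof.
move=> D fz; apply: contR_comp (contR_cmod2 D).
by apply: is_derive1_ln; rewrite exprn_gt0 // cmod_gt0.
Qed.

(** The curvature bound, with [p = |w|^(1/3)] and [q = |w - 1|^(1/3)]; the last hypothesis is the
    triangle inequality for 0, [w], 1. If [q <= p] then [p >= 3/4], so [1 + p <= 7/3 p], and the
    [q]-term alone suffices because [(7/3)^4 < 30 <= 40 p]. *)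
Lemma rob_ineq (p q : R) : 0 < p -> 0 < q -> 1 <= p ^+ 3 + q ^+ 3 ->
  ((1 + p) / p ^+ 5) * ((1 + q) / q ^+ 5) <=
  40 * (p / (1 + p) ^+ 2 / p ^+ 6 + q / (1 + q) ^+ 2 / q ^+ 6).
Proof.
wlog pq : p q / q <= p.
  move=> H p0 q0 h; have [/H|/ltW/H] := leP q p; first exact.
  by move=> /(_ q0 p0); rewrite [q ^+ 3 + _]addrC mulrC [p / _ / _ + _]addrC; apply.
move=> p0 q0 h.
have p34 : 3 / 4 <= p.
  rewrite leNgt; apply/negP => p34.
  have A : p ^+ 3 < (3 / 4) ^+ 3 by rewrite ltrXn2r // ?ltW.
  have B : q ^+ 3 <= p ^+ 3 by rewrite lerXn2r // ?nnegrE ltW.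
  have : (3 / 4 : R) ^+ 3 < 1 / 2 by rewrite !exprS expr0; lra.
  lra.
have P1 : 0 < 1 + p by lra.
have Q1 : 0 < 1 + q by lra.
apply: le_trans (_ : 40 * (q / (1 + q) ^+ 2 / q ^+ 6) <= _); last first.
  have : 0 < p / (1 + p) ^+ 2 / p ^+ 6 by rewrite !divr_gt0 ?exprn_gt0.
  lra.
have -> : 40 * (q / (1 + q) ^+ 2 / q ^+ 6) = (40 * p ^+ 5 / (1 + q) ^+ 2) / (p ^+ 5 * q ^+ 5).
  by field; rewrite !gt_eqF.
have -> : (1 + p) / p ^+ 5 * ((1 + q) / q ^+ 5) = (1 + p) * (1 + q) / (p ^+ 5 * q ^+ 5).
  by field; rewrite !gt_eqF.
rewrite ler_pM2r ?invr_gt0 ?mulr_gt0 ?exprn_gt0 // ler_pdivlMr ?exprn_gt0 //.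
apply: le_trans (_ : (1 + p) ^+ 4 <= _).
  have -> : (1 + p) * (1 + q) * (1 + q) ^+ 2 = (1 + p) * (1 + q) ^+ 3 by ring.
  by rewrite [leRHS]exprS ler_pM2l //; apply: lerXn2r; rewrite ?nnegrE; lra.
apply: le_trans (_ : (7 / 3 * p) ^+ 4 <= _).
  by apply: lerXn2r; rewrite ?nnegrE; lra.
rewrite exprMn [p ^+ 5]exprS mulrA.
have p40 : 0 < p ^+ 4 by rewrite exprn_gt0.
rewrite ler_pM2r //.
have -> : (7 / 3 : R) ^+ 4 = 2401 / 81 by field.
lra.
Qed.

Lemma landau_center f c (r : R) (D : C R) (M : R) : 0 < r -> hol c r f ->
  (forall z, cmod (z - c) < r -> f z != 0 /\ f z != 1) -> cder f c D -> cmod (f c) <= M ->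
  cmod D * r <= 160 * (2 + M) ^+ 2.
Proof.
move=> r0 [f1 [f2 [f3 Hf]]] om DD fM.
pose g z := f z - 1.
have Hg z : cmod (z - c) < r -> [/\ cder g z (f1 z), cder f1 z (f2 z) & cder f2 z (f3 z)].
  move=> /Hf[A B E]; split=> //; apply: cder_eq (cderB A (cder_cst 1 z)); exact: subr0.
have fz z : cmod (z - c) < r -> f z != 0 by move=> /om[].
have gz z : cmod (z - c) < r -> g z != 0 by move=> /om[_]; rewrite subr_eq0.
pose xf z := ln (cmod (f z) ^+ 2); pose xg z := ln (cmod (g z) ^+ 2).
pose sg z := rob (xf z) + rob (xg z).
pose p z : R := expR (xf z / 6); pose q z : R := expR (xg z / 6).
have p6 z : cmod (z - c) < r -> p z ^+ 6 = cmod (f z) ^+ 2.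
  move=> zr; rewrite /p -expRM_natl mulrC divfK // /xf lnK // posrE exprn_gt0 // cmod_gt0.
  exact: fz.
have q6 z : cmod (z - c) < r -> q z ^+ 6 = cmod (g z) ^+ 2.
  move=> zr; rewrite /q -expRM_natl mulrC divfK // /xg lnK // posrE exprn_gt0 // cmod_gt0.
  exact: gz.
have pp z : 0 < p z by exact: expR_gt0.
have qp z : 0 < q z by exact: expR_gt0.
have p3 z : cmod (z - c) < r -> p z ^+ 3 = cmod (f z).
  move=> zr; apply/eqP; rewrite -(eqrXn2 (n:=2)) ?cmod_ge0 ?exprn_ge0 // ?ltW // -exprM.
  exact/eqP/p6.
have q3 z : cmod (z - c) < r -> q z ^+ 3 = cmod (g z).
  move=> zr; apply/eqP; rewrite -(eqrXn2 (n:=2)) ?cmod_ge0 ?exprn_ge0 // ?ltW // -exprM.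
  exact/eqP/q6.
have eE (x : R) : expR (rob x) = (1 + expR (x / 6)) / expR (x / 6) ^+ 5.
  rewrite /rob expRD lnK ?posrE; last by have := expR_gt0 (x / 6); lra.
  by congr (_ * _); rewrite -expRM_natl -expRN; congr expR; field.
have esg z : expR (sg z) = (1 + p z) / p z ^+ 5 * ((1 + q z) / q z ^+ 5).
  by rewrite /sg expRD !eE.
(* [1 / 360 = (4 / 36) / 40]: the 4 is that of [sum4_psi], [1 / 36] comes from [rob1_der] and 40
   from [rob_ineq]. *)
have k0 : (0 : R) < 1 / 360 by lra.
have Hc : cmod (f1 c) ^+ 2 * expR (sg c) * r ^+ 2 <= 64 / (1 / 360).
  apply: (@ahl_metric R f1 f2 f3 sg c r (1 / 360)) => // [z /Hf[]//|z zr|z zr e e0].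
  - have [A B E] := Hf z zr; have [A' _ _] := Hg z zr.
    apply: contRD; (apply: contR_comp; first exact: rob_der).
      by apply: cont_lncmod A _; exact: fz.
    by apply: cont_lncmod A' _; exact: gz.
  - have e2 : 0 < e / 2 by lra.
    have [d1 d10 H1] := @sum4_psi R xf z _ rob rob1 _ 1 (harm2_hol Hf zr (fz z zr)) ltr01 (fun x _ => rob_der x) (rob1_der _) _ e2.
    have [d2 d20 H2] := @sum4_psi R xg z _ rob rob1 _ 1 (harm2_hol Hg zr (gz z zr)) ltr01 (fun x _ => rob_der x) (rob1_der _) _ e2.
    exists (Num.min d1 d2); first by rewrite lt_min d10.
    move=> s; rewrite lt_min => /andP[s0 /andP[s1 s2]].
    have A := H1 s; rewrite s0 s1 in A; have {}A := A isT.
    have B := H2 s; rewrite s0 s2 in B; have {}B := B isT.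
    have -> : sum4 sg z s = sum4 (rob \o xf) z s + sum4 (rob \o xg) z s by rewrite /sum4 /=; rewrite /sg; ring.
    have I : 1 / 360 * (cmod (f1 z) ^+ 2 * expR (sg z)) <=
       4 * (1 / 36 * (expR (xf z / 6) / (1 + expR (xf z / 6)) ^+ 2)) * cmod (f1 z / f z) ^+ 2 +
       4 * (1 / 36 * (expR (xg z / 6) / (1 + expR (xg z / 6)) ^+ 2)) * cmod (f1 z / g z) ^+ 2.
      rewrite -/(p z) -/(q z) !cmodf !expr_div_n -p6 // -q6 // esg.
      have h : 1 <= p z ^+ 3 + q z ^+ 3.
        rewrite p3 // q3 // /g; have := cmodB (f z) (f z - 1).
        have -> : f z - (f z - 1) = 1 by ring.
        by rewrite cmod1.
      have := rob_ineq (pp z) (qp z) h; rewrite -(ler_pM2l (_ : 0 < 1 / 360)) // => J.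
      have := ler_wpM2l (sqr_ge0 (cmod (f1 z))) J.
      move: (p z / _) (q z / _) ((1 + p z) / _) ((1 + q z) / _) (p z ^+ 6)^-1 (q z ^+ 6)^-1 (cmod _ ^+ 2).
      by clear; move=> a1 a2 a3 a4 a5 a6 a7; lra.
    move: A B I; rewrite !ler_norml; move: (sum4 _ _ _) (sum4 _ _ _) => x y.
    move: (_ * cmod (f1 z / f z) ^+ 2) (_ * cmod (f1 z / g z) ^+ 2) (1 / 360 * _) (sqr_ge0 s) => a b v.
    by move: (s ^+ 2) => t; nra.
have cr : cmod (c - c) < r by rewrite subrr cmod0.
have fD : f1 c = D by have [A _ _] := Hf c cr; exact: cder_uniq A DD.
rewrite esg fD in Hc.
have M0 : 0 <= M := le_trans (cmod_ge0 _) fM.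
have pq0 : 0 < p c ^+ 5 * q c ^+ 5 by rewrite mulr_gt0 ?exprn_gt0.
have P := pp c; have Q := qp c.
have five (x y : R) : 0 < x -> x ^+ 3 <= y -> x ^+ 5 <= 1 + y ^+ 2.
  move=> x0 xy; have y0 : 0 <= y by apply: le_trans xy; rewrite exprn_ge0 // ltW.
  have : x ^+ 6 <= y ^+ 2 by rewrite (exprM x 3 2) lerXn2r // nnegrE exprn_ge0 // ltW.
  have [x1|x1] := leP x 1.
    have : x ^+ 5 <= 1 by rewrite exprn_ile1 // ltW.
    by have := sqr_ge0 y; lra.
  have : x ^+ 5 <= x ^+ 6 by rewrite ler_eXn2l.
  lra.
have P5 := five _ _ P (_ : p c ^+ 3 <= M); rewrite p3 // in P5; have {}P5 := P5 fM.
have Q5 := five _ _ Q (_ : q c ^+ 3 <= M + 1); rewrite q3 // in Q5.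
have {}Q5 : q c ^+ 5 <= 1 + (M + 1) ^+ 2.
  by apply: Q5; rewrite /g (le_trans (cmodB _ _)) // cmod1 lerD2r.
(* The constant 160 is chosen for [64 * 360 <= 160^2]. *)
rewrite -ler_sqr ?nnegrE ?mulr_ge0 ?cmod_ge0 ?sqr_ge0 ?(ltW r0) //.
apply: le_trans (_ : 64 / (1 / 360) * (p c ^+ 5 * q c ^+ 5) <= _).
  rewrite -ler_pdivrMr //; apply: le_trans Hc.
  have -> : cmod D ^+ 2 * ((1 + p c) / p c ^+ 5 * ((1 + q c) / q c ^+ 5)) * r ^+ 2 =
    (cmod D * r) ^+ 2 / (p c ^+ 5 * q c ^+ 5) * ((1 + p c) * (1 + q c)).
    by field; rewrite !gt_eqF.
  rewrite ler_peMr //; first by rewrite divr_ge0 ?sqr_ge0 // ltW.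
  nra.
have PQ : p c ^+ 5 * q c ^+ 5 <= (1 + M ^+ 2) * (1 + (M + 1) ^+ 2).
  by rewrite ler_pM // exprn_ge0 // ltW.
have : (1 + M ^+ 2) * (1 + (M + 1) ^+ 2) <= (2 + M) ^+ 4.
  rewrite (exprM _ 2 2) [leRHS]expr2 ler_pM ?addr_ge0 ?sqr_ge0 //; nra.
rewrite exprMn -exprM; move: ((2 + M) ^+ (2 * 2)%N) PQ => a.
- move: pq0; move: (p c ^+ 5 * q c ^+ 5) ((1 + M ^+ 2) * (1 + (M + 1) ^+ 2)) => x y x0 h1 h2; lra.
- lra.
- lra.
Qed.
End LANDAU.

Section LANDAU2. Variable R : realType.
Implicit Types (z c h w : C R) (s t e : R) (f : C R -> C R).

(** The hypothesis is applied at the infimum of the counterexamples. At [t = 0] its premise is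
    vacuous, so it contains the base case. *)
Lemma real_induction (A : R -> Prop) :
  (forall t, 0 <= t <= 1 -> (forall s, 0 <= s < t -> A s) ->
     exists2 eta : R, 0 < eta & forall s, t <= s < t + eta -> A s) ->
  forall t, 0 <= t <= 1 -> A t.
Proof.
move=> H t tb; apply: contrapT => nA.
set B : set R := [set t | 0 <= t <= 1 /\ ~ A t].
have Bt : B t by [].
have lB : lbound B 0 by move=> x [/andP[]].
have hB : has_inf B by split; [exists t|exists 0].
have T0 : 0 <= inf B by apply: lb_le_inf => //; exists t.
have T1 : inf B <= 1.
  by apply: le_trans (ge_inf hB.2 Bt) _; case/andP: tb.
have TA s : 0 <= s < inf B -> A s.
  move=> /andP[s0 sT]; apply: contrapT => nAs.
  have Bs : B s by split => //; rewrite s0 (le_trans (ltW sT)).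
  by have := ge_inf hB.2 Bs; rewrite leNgt sT.
have Tb : 0 <= inf B <= 1 by rewrite T0.
have [eta eta0 He] := H (inf B) Tb TA.
have [x [/andP[x0 x1] nAx] xT] := inf_adherent eta0 hB.
apply: (nAx); apply: He; rewrite xT andbT.
by apply: (ge_inf hB.2); split => //; rewrite x0 x1.
Qed.

Lemma hol_sub c c' (r r' : R) f : cmod (c' - c) + r' <= r -> hol c r f -> hol c' r' f.
Proof.
move=> h [f1 [f2 [f3 H]]]; exists f1, f2, f3 => z zr; apply: H.
by have := cmodBtri c' z c; lra.
Qed.

(** As long as [|f w - f c| <= 1], [landau_center] on the disc of radius [r / 2] about [w] bounds
    the derivative by [2 K / r]; integrating along a segment of length at most [eps * r] the
    deviation is then at most [1 / 4]. By continuity it never reaches 1. *)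
Lemma landau (M del : R) : 0 <= M -> 0 < del -> exists2 eps : R, 0 < eps &
  forall c (r : R) f, 0 < r -> hol c r f ->
    (forall z, cmod (z - c) < r -> f z != 0 /\ f z != 1) -> cmod (f c) <= M ->
  forall z, cmod (z - c) <= eps * r -> cmod (f z - f c) <= del.
Proof.
move=> M0 del0; set K := 160 * (3 + M) ^+ 2.
have K0 : 1 <= K.
  have : (1 : R) <= (3 + M) ^+ 2 by rewrite expr_ge1 //; lra.
  rewrite /K; lra.
have K0' : 0 < K by lra.
set eps := Num.min (1 / 4) (Num.min 1 del / (8 * K)).
have m0 : 0 < Num.min 1 del by rewrite lt_min ltr01.
have KE : K = 160 * (3 + M) ^+ 2 by [].
clearbody K; have K8 : 0 < 8 * K by lra.
have e0 : 0 < eps by rewrite lt_min (divr_gt0 m0 K8) andbT; lra.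
have [e1 e2] : eps <= 1 / 4 /\ eps <= Num.min 1 del / (8 * K) by apply/andP; rewrite -le_min.
have [m1 md] : Num.min 1 del <= 1 /\ Num.min 1 del <= del by apply/andP; rewrite -le_min.
have eK : 8 * K * eps <= Num.min 1 del by move: e2; rewrite ler_pdivlMr // mulrC.
exists eps => // c r f r0 Hf om fM z zc.
have [f1 [f2 [f3 Hf']]] := Hf.
set h := z - c in zc *.
have zE : z = c + h by rewrite /h; ring.
have hr : cmod h <= r / 4 by nra.
have th (t : R) : 0 <= t <= 1 -> cmod ((t%:C)%C * h) <= cmod h.
  by move=> /andP[t0 t1]; rewrite cmodM cmodR (ger0_norm t0) ler_piMl ?cmod_ge0.
have inr (t : R) : 0 <= t <= 1 -> cmod (c + (t%:C)%C * h - c) <= r / 4.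
  by move=> tb; rewrite addrC addKr (le_trans (th _ tb)).
have D1 w : cmod (w - c) <= r / 4 -> cmod (f w - f c) <= 1 -> cmod (f1 w) <= 2 * K / r.
  move=> wr fw.
  have wr' : cmod (w - c) < r by lra.
  have [D _ _] := Hf' w wr'.
  have := @landau_center R f w (r / 2) (f1 w) (M + 1) _ _ _ D _.
  have -> : 160 * (2 + (M + 1)) ^+ 2 = K by rewrite KE; ring.
  move=> H; rewrite ler_pdivlMr //.
  suff : cmod (f1 w) * (r / 2) <= K by lra.
  apply: H; first by lra.
  - by apply: hol_sub Hf; lra.
  - by move=> u ur; apply: om; have := cmodBtri w u c; lra.
  - by have := cmodD (f w - f c) (f c); rewrite subrK; lra.
have seg (t : R) : 0 <= t <= 1 -> (forall s, 0 <= s <= t -> cmod (f (c + (s%:C)%C * h) - f c) <= 1) ->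
    cmod (f (c + (t%:C)%C * h) - f c) <= Num.min 1 del / 4.
  move=> tb H; have /andP[t0 t1] := tb.
  have := @mvi R f f1 c ((t%:C)%C * h) (2 * K / r) => X.
  apply: le_trans (X _ _) _.
  - move=> s /andP[s0 s1]; have sb : 0 <= s * t <= 1 by rewrite mulr_ge0 //= mulr_ile1.
    have Y := inr _ sb.
    have -> : c + (s%:C)%C * ((t%:C)%C * h) = c + ((s * t)%:C)%C * h by rewrite rmorphM /= mulrA.
    by have [] // := Hf' (c + ((s * t)%:C)%C * h); lra.
  - move=> s /andP[s0 s1]; have sb : 0 <= s * t <= 1 by rewrite mulr_ge0 //= mulr_ile1.
    have -> : c + (s%:C)%C * ((t%:C)%C * h) = c + ((s * t)%:C)%C * h by rewrite rmorphM /= mulrA.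
    by apply: D1; [exact: inr|apply: H; rewrite mulr_ge0 //= ler_piMl].
  apply: le_trans (_ : 2 * K / r * (eps * r) <= _).
    apply: ler_wpM2l; last exact: le_trans (th _ tb) zc.
    by apply: divr_ge0; lra.
  have -> : 2 * K / r * (eps * r) = 2 * K * eps by field; rewrite gt_eqF.
  lra.
have all1 : forall t, 0 <= t <= 1 -> cmod (f (c + (t%:C)%C * h) - f c) <= 1.
  apply: real_induction => t tb H; have /andP[t0 t1] := tb.
  have w0 : cmod (c + (t%:C)%C * h - c) < r by have := inr _ tb; lra.
  have [D _ _] := Hf' _ w0.
  have e8 : (0 : R) < 1 / 8 by lra.
  have [d d0 Hd] := cder_cont D e8.
  have h1 : 0 < cmod h + 1 by rewrite ltr_wpDl ?cmod_ge0.
  have dist (s : R) : `|s - t| < d / (cmod h + 1) -> cmod (f (c + (s%:C)%C * h) - f (c + (t%:C)%C * h)) < 1 / 8.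
    move=> st; apply: Hd.
    have -> : c + (s%:C)%C * h - (c + (t%:C)%C * h) = ((s - t)%:C)%C * h by rewrite rmorphB /=; ring.
    rewrite cmodM cmodR; move: st; rewrite ltr_pdivlMr //.
    have := normr_ge0 (s - t); nra.
  have eta0 : 0 < d / (cmod h + 1) by rewrite divr_gt0.
  have Pt : cmod (f (c + (t%:C)%C * h) - f c) <= 1 / 2.
    have [t00|tn0] := eqVneq t 0.
      rewrite t00 rmorph0 mul0r addr0 subrr cmod0; lra.
    have tp : 0 < t by rewrite lt_neqAle eq_sym tn0.
    set s : R := Num.max 0 (t - d / (cmod h + 1) / 2).
    have [s0 sd] : 0 <= s /\ t - d / (cmod h + 1) / 2 <= s by apply/andP; rewrite -ge_max.
    have st : s < t by rewrite gt_max tp; lra.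
    have Y : cmod (f (c + (s%:C)%C * h) - f c) <= Num.min 1 del / 4.
      apply: seg; first by rewrite s0 (le_trans (ltW st)).
      by move=> u /andP[u0 us]; apply: H; rewrite u0 (le_lt_trans us).
    have := dist s; rewrite ler0_norm; last by lra.
    move=> Z; have {}Z := Z ltac:(lra).
    have := cmodBtri (f (c + (s%:C)%C * h)) (f (c + (t%:C)%C * h)) (f c).
    rewrite cmodBC in Z; lra.
  exists (d / (cmod h + 1)) => // s /andP[s0 s1].
  have := dist s; rewrite ger0_norm; last by lra.
  move=> Z; have {}Z := Z ltac:(lra).
  by have := cmodBtri (f (c + (t%:C)%C * h)) (f (c + (s%:C)%C * h)) (f c); lra.
have Y : cmod (f (c + (1%:C)%C * h) - f c) <= Num.min 1 del / 4.
  by apply: seg => [|s sb]; [rewrite lexx ler01|exact: all1].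
by move: Y; rewrite rmorph1 mul1r -zE; lra.
Qed.
End LANDAU2.

(** * Harnack's inequality for nonvanishing functions *)

Section LANDAU3. Variable R : realType.
Implicit Types (v : C R -> R) (z b c h w : C R) (s t e : R) (f : C R -> C R).

Lemma harm2_line v z h t b : harm2 v (z + (t%:C)%C * h) b ->
  is_derive t 1 (fun t : R => v (z + (t%:C)%C * h)) (2 * complex.Re (b * h)).
Proof.
move=> [k H]; apply: rder_is_derive => e e0.
have h1 : 0 < cmod h + 1 by rewrite ltr_wpDl ?cmod_ge0.
have [d d0 Hd] := H 1 ltr01.
set K := (cmod k + 1) * (cmod h + 1) ^+ 2.
have K0 : 0 < K by rewrite mulr_gt0 ?exprn_gt0 // ltr_wpDl ?cmod_ge0.
exists (Num.min (d / (cmod h + 1)) (e / K)); first by rewrite lt_min !divr_gt0.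
move=> s; rewrite lt_min ltr_pdivlMr // ltr_pdivlMr // => /andP[s1 s2].
have h0 := cmod_ge0 h; have sn := normr_ge0 s.
have shd : cmod ((s%:C)%C * h) < d by rewrite cmodM cmodR; nra.
have := Hd _ shd.
have -> : z + (t%:C)%C * h + (s%:C)%C * h = z + ((t + s)%:C)%C * h by rewrite rmorphD /=; ring.
have -> : b * ((s%:C)%C * h) = b * h * (s%:C)%C by ring.
rewrite cReMr cmodM cmodR => A.
have B : `|complex.Re (k * ((s%:C)%C * h) ^+ 2)| <= cmod k * (`|s| * cmod h) ^+ 2.
  by apply: le_trans (Re_cmod _) _; rewrite cmodM cmodX cmodM cmodR.
have E : (cmod k + 1) * (`|s| * cmod h) ^+ 2 <= e * `|s|.
  have k0 := cmod_ge0 k.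
  apply: le_trans (_ : `|s| * K * `|s| <= _); last by rewrite ler_wpM2r // ltW.
  have -> : `|s| * K * `|s| = (cmod k + 1) * (`|s| * (cmod h + 1)) ^+ 2 by rewrite /K; ring.
  apply: ler_wpM2l; first by lra.
  by apply: lerXn2r; rewrite ?nnegrE ?mulr_ge0 //; nra.
move: A B E; rewrite mul1r mulrDl mul1r !ler_norml.
by move: (v _) (v _) ((`|s| * cmod h) ^+ 2) => v1 v2 q; lra.
Qed.

(** Ahlfors' lemma for the hyperbolic metric of the punctured unit disc: its squared density
    [1 / (|w| ln |w|^2)^2] is [exp (psi (ln |w|^2))], and the curvature condition holds with
    equality for [kap = 8]. *)
Lemma nonvanish_center f c (r : R) (D : C R) : 0 < r -> hol c r f ->
  (forall z, cmod (z - c) < r -> f z != 0 /\ cmod (f z) < 1) -> cder f c D ->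
  cmod (D / f c) * r <= 4 * - ln (cmod (f c) ^+ 2).
Proof.
move=> r0 [f1 [f2 [f3 Hf]]] om DD.
pose x z := ln (cmod (f z) ^+ 2).
have fz z : cmod (z - c) < r -> f z != 0 by move=> /om[].
have x0 z : cmod (z - c) < r -> x z < 0.
  move=> /om[a b]; rewrite /x ln_lt0 // exprn_gt0 ?cmod_gt0 //=.
  by rewrite expr_lt1 // cmod_ge0.
pose psi (x : R) := - x - 2 * ln (- x).
pose psi1 (x : R) := - 1 - 2 * x^-1.
have Dpsi (y : R) : y < 0 -> is_derive y 1 psi (psi1 y).
  move=> y0; have y1 : 0 < - y by lra.
  have X : is_derive y 1 (fun y : R => - y) (- 1) by apply: is_derive_eq.
  have Z := @is_derive1_comp R (@ln R) (fun y : R => - y) y _ _ (is_derive1_ln y1) X.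
  rewrite /psi /psi1; apply: is_derive_eq; rewrite /GRing.scale /=; field.
  by rewrite lt_eqF.
have Dpsi1 (y : R) : y < 0 -> is_derive y 1 psi1 (2 / y ^+ 2).
  move=> y0; have Z := @is_deriveV R id y _ 1 (ltr0_neq0 y0) (is_derive_id _ _).
  rewrite /psi1; apply: is_derive_eq; rewrite /GRing.scale /=; field.
  by rewrite lt_eqF.
have esg z : cmod (z - c) < r -> expR (psi (x z)) = (cmod (f z) ^+ 2 * x z ^+ 2)^-1.
  move=> zr; have xz := x0 z zr; have xz' : 0 < - x z by lra.
  rewrite /psi -opprD expRN expRD /x lnK ?posrE ?exprn_gt0 ?cmod_gt0 ?fz //; congr (_ * _)^-1.
  by rewrite expRM_natl lnK ?posrE // sqrrN.
have k0 : (0 : R) < 8 by [].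
have Hc : cmod (f1 c) ^+ 2 * expR (psi (x c)) * r ^+ 2 <= 64 / 8.
  apply: (@ahl_metric R f1 f2 f3 (fun z => psi (x z)) c r 8) => // [z /Hf[]//|z zr|z zr e e0].
    have [A B E] := Hf z zr.
    apply: (@contR_comp R psi x z (psi1 (x z))); first exact: Dpsi (x0 z zr).
    exact: cont_lncmod A (fz z zr).
  have xz := x0 z zr; have nx : 0 < - x z by lra.
  have [d1 d10 H1] := @sum4_psi R x z _ psi psi1 _ (- x z) (harm2_hol Hf zr (fz z zr)) nx
    (fun y (yb : `|y - x z| < - x z) => Dpsi y ltac:(move: yb; rewrite ltr_norml; lra)) (Dpsi1 _ xz) _ e0.
  exists d1 => // s sb; have A := H1 s sb.
  have I : 8 * (cmod (f1 z) ^+ 2 * expR (psi (x z))) = 4 * (2 / x z ^+ 2) * cmod (f1 z / f z) ^+ 2.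
    have fz' : cmod (f z) != 0 by rewrite gt_eqF // cmod_gt0 fz.
    have xz' : x z != 0 by rewrite lt_eqF.
    by rewrite esg // cmodf; field; rewrite fz' xz'.
  rewrite I; move: A; rewrite ler_norml; move: (_ * cmod (f1 z / f z) ^+ 2) (sum4 _ _ _) (s ^+ 2) => a b q; lra.
have cr : cmod (c - c) < r by rewrite subrr cmod0.
have fD : f1 c = D by have [A _ _] := Hf c cr; exact: cder_uniq A DD.
have xc := x0 c cr; have fc := fz c cr; rewrite -cmod_gt0 in fc.
rewrite -/(x c) esg // fD in Hc *.
rewrite -ler_sqr ?nnegrE ?mulr_ge0 ?cmod_ge0 ?(ltW r0) //; last by lra.
have A : cmod D ^+ 2 * (cmod (f c) ^+ 2 * x c ^+ 2)^-1 * r ^+ 2 = (cmod (D / f c) * r) ^+ 2 / x c ^+ 2.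
  by rewrite cmodf; field; rewrite lt_eqF //= gt_eqF.
have x2 : 0 < x c ^+ 2 by rewrite exprn_even_gt0 //= lt_eqF.
move: Hc; rewrite A ler_pdivrMr //.
have -> : (4 * - x c) ^+ 2 = 16 * x c ^+ 2 by ring.
by move: ((_ * r) ^+ 2) x2; clear; move=> a x2 H; lra.
Qed.

(* Harnack's inequality for the positive harmonic function [- ln |f|]. *)
Lemma nonvanish_harnack f c z (r : R) : 0 < r -> hol c r f ->
  (forall z, cmod (z - c) < r -> f z != 0 /\ cmod (f z) < 1) -> cmod (z - c) <= r / 2 ->
  - ln (cmod (f z) ^+ 2) <= expR 8 * - ln (cmod (f c) ^+ 2).
Proof.
move=> r0 Hf om zr; have [f1 [f2 [f3 Hf']]] := Hf.
set h := z - c in zr.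
have zE : z = c + h by rewrite /h; ring.
pose x z := ln (cmod (f z) ^+ 2).
have fz z' : cmod (z' - c) < r -> f z' != 0 by move=> /om[].
have x0 z' : cmod (z' - c) < r -> x z' < 0.
  move=> /om[a b]; rewrite /x ln_lt0 // exprn_gt0 ?cmod_gt0 //=.
  by rewrite expr_lt1 // cmod_ge0.
have inr (t : R) : 0 <= t <= 1 -> cmod (c + (t%:C)%C * h - c) <= r / 2.
  move=> /andP[t0 t1]; rewrite addrC addKr cmodM cmodR (ger0_norm t0).
  by apply: le_trans zr; rewrite ler_piMl ?cmod_ge0.
have inr' (t : R) : 0 <= t <= 1 -> cmod (c + (t%:C)%C * h - c) < r by move=> /inr; lra.
pose w (t : R) : C R := c + (t%:C)%C * h.
pose u (t : R) := ln (- x (w t)).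
pose u1 (t : R) := (- x (w t))^-1 * - (2 * complex.Re (f1 (w t) / f (w t) * h)).
have Du (t : R) : 0 <= t <= 1 -> is_derive t 1 u (u1 t).
  move=> tb; have xt := x0 _ (inr' t tb).
  have H2 := harm2_line (harm2_hol Hf' (inr' t tb) (fz _ (inr' t tb))).
  have nx : 0 < - x (w t) by rewrite oppr_gt0.
  have X : is_derive t 1 (fun t : R => - x (w t)) (- (2 * complex.Re (f1 (w t) / f (w t) * h))).
    by apply: is_deriveN; exact: H2.
  exact: (@is_derive1_comp R (@ln R) (fun t : R => - x (w t)) t _ _ (is_derive1_ln nx) X).
have Bu (t : R) : 0 <= t <= 1 -> u1 t <= 8.
  move=> tb; have xt := x0 _ (inr' t tb).
  have wr : cmod (w t - c) <= r / 2 by exact: inr.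
  have wr' : cmod (w t - c) < r by exact: inr'.
  have [D _ _] := Hf' _ wr'.
  have r20 : 0 < r / 2 by lra.
  have := @nonvanish_center f (w t) (r / 2) (f1 (w t)) r20 _ _ D; rewrite -/(x (w t)) => N.
  have {}N : cmod (f1 (w t) / f (w t)) * (r / 2) <= 4 * - x (w t).
    apply: N; first by apply: hol_sub Hf; lra.
    by move=> y yr; apply: om; have := cmodBtri (w t) y c; lra.
  rewrite /u1 mulrC ler_pdivrMr ?oppr_gt0 //.
  apply: le_trans (ler_norm _) _; rewrite normrN normrM ger0_norm //.
  have A := Re_cmod (f1 (w t) / f (w t) * h); rewrite cmodM in A.
  have B := cmod_ge0 (f1 (w t) / f (w t)).
  have : cmod (f1 (w t) / f (w t)) * cmod h <= cmod (f1 (w t) / f (w t)) * (r / 2) by rewrite ler_wpM2l.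
  lra.
have := mean_value_le ler01 Du Bu; rewrite /u /w rmorph1 mul1r -zE rmorph0 mul0r addr0 => M.
have xz : 0 < - x z by rewrite oppr_gt0 x0 // -/h; lra.
have xc : 0 < - x c by rewrite oppr_gt0 x0 // subrr cmod0.
rewrite -/(x z) -/(x c) -ler_ln ?posrE ?mulr_gt0 ?expR_gt0 //.
rewrite lnM ?posrE ?expR_gt0 // expRK; lra.
Qed.
End LANDAU3.

(** * The coordinate in which a parabolic germ is nearly a translation *)

Section UPLANE. Variable R : realType.
Implicit Types (z w x a b : C R) (c e : R).

Lemma inv_pow_est (nu : nat) : exists2 K : R, 0 < K & forall x, cmod x <= 1 / 2 ->
  cmod ((1 + x)^-1 ^+ nu - 1 + nu%:R * x) <= K * cmod x ^+ 2.
Proof.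
elim: nu => [|nu [K K0 IH]].
  exists 1 => // x _; rewrite expr0 subrr mul0r addr0 cmod0 mul1r; exact: sqr_ge0.
exists (2 * K + 2 + 2 * nu%:R) => [|x xs].
  by have := ler0n R nu; lra.
have x0 := cmod_ge0 x.
have x1 : 1 / 2 <= cmod (1 + x) by have := lerD_cmod 1 x; rewrite cmod1; lra.
have xn : 1 + x != 0 by rewrite -cmod_gt0; lra.
set P := (1 + x)^-1 ^+ nu; have := IH x xs; rewrite -/P => H.
have -> : (1 + x)^-1 ^+ nu.+1 - 1 + nu.+1%:R * x =
  (1 + x)^-1 * ((P - 1 + nu%:R * x) + (1 + nu%:R) * (x * x)).
  by rewrite exprSr -/P -[nu.+1%:R]natr1; field.
rewrite cmodM cmodV mulrC ler_pdivrMr; last by lra.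
apply: le_trans (cmodD _ _) _; rewrite !cmodM.
have n1 : cmod (1 + nu%:R : C R) <= 1 + nu%:R.
  by apply: le_trans (cmodD _ _) _; rewrite cmod1 cmodn.
have A : cmod (1 + nu%:R : C R) * (cmod x * cmod x) <= (1 + nu%:R) * (cmod x * cmod x).
  by rewrite ler_wpM2r ?mulr_ge0.
have n0 := ler0n R nu.
have B : (K + 1 + nu%:R) * cmod x ^+ 2 <= (2 * K + 2 + 2 * nu%:R) * cmod x ^+ 2 * cmod (1 + x).
  have -> : (2 * K + 2 + 2 * nu%:R) * cmod x ^+ 2 * cmod (1 + x) = (K + 1 + nu%:R) * cmod x ^+ 2 * (2 * cmod (1 + x)) by ring.
  rewrite ler_peMr //; last by lra.
  by rewrite mulr_ge0 ?sqr_ge0 //; lra.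
move: H A B; rewrite expr2; move: (cmod x * cmod x) => q; lra.
Qed.

Lemma upm_cone_aux (c cz cw p q s t : R) : 0 < c <= 1 / 2 -> `|q - p| <= c / 8 * cz ->
  `|t - s| <= c / 8 * cz -> c * cz <= p + `|s| -> cw <= c / 8 * cz + cz -> 0 <= cz ->
  c / 2 * cw <= q + `|t|.
Proof.
move=> /andP[c0 c1]; rewrite !ler_norml => /andP[A B] /andP[D E] H W z0.
have : `|s| <= `|t| + c / 8 * cz.
  have := ler_norm t; have := ler_norm (- t); rewrite normrN => *.
  by rewrite ler_norml; lra.
have : c / 2 * cw <= c / 2 * (c / 8 * cz + cz) by rewrite ler_pM2l //; lra.
have : 0 <= c * (1 / 2 - c) * cz by rewrite !mulr_ge0 //; lra.
have : 0 <= c * cz by rewrite mulr_ge0 // ltW.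
lra.
Qed.

Definition upl (nu : nat) a z : C R := - (nu%:R * (a * z ^+ nu))^-1.
(** Translation by 1 still increases [Re U + |Im U|], as it does [Re U]. Replacing [a] by [-a]
    changes the sign of [U], and thanks to [|Im U|] the cones for [a] and for [-a] overlap and cover
    a punctured disc. *)
Definition upm (nu : nat) a z : R := complex.Re (upl nu a z) + `|complex.Im (upl nu a z)|.

Variables (nu : nat) (a : C R).
Hypotheses (nu0 : (0 < nu)%N) (a0 : a != 0).
Local Notation U := (upl nu a).
Local Notation m := (upm nu a).

Lemma upm_le z : m z <= 2 * cmod (U z).
Proof.
rewrite /upm; have := le_trans (ler_norm _) (Re_cmod (U z)); have := Im_cmod (U z); lra.
Qed.

Lemma upm_near z w e : cmod (U z - (U w + (e%:C)%C)) <= 1 / 8 * e -> 0 <= e -> m w + 3 / 4 * e <= m z.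
Proof.
move=> H e0; rewrite /upm.
have := le_trans (Re_cmod _) H; have := le_trans (Im_cmod _) H.
rewrite !cReB !cImB !cReD !cImD /=.
case: (U z) (U w) => p s [q t] /=.
rewrite !ler_norml addr0 => /andP[A B] /andP[D E].
have : `|t| <= `|s| + 1 / 8 * e.
  have := ler_norm s; have := ler_norm (- s); rewrite normrN => *.
  by rewrite ler_norml; lra.
lra.
Qed.

Let nuC : (nu%:R : C R) != 0. Proof. by rewrite pnatr_eq0 -lt0n. Qed.
Let nuR : 0 < (nu%:R : R). Proof. by rewrite ltr0n. Qed.
Let ca : 0 < cmod a. Proof. by rewrite cmod_gt0. Qed.

Lemma upl_mod z : cmod (U z) = (nu%:R * (cmod a * cmod z ^+ nu))^-1.
Proof. by rewrite /upl cmodN cmodV !cmodM cmodn cmodX. Qed.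

Lemma upl_scale z x : z != 0 -> 1 + x != 0 -> U (z * (1 + x)) = U z * (1 + x)^-1 ^+ nu.
Proof.
move=> z0 x0; rewrite /upl exprMn exprVn; field.
by rewrite !expf_neq0 ?nuC ?a0.
Qed.

Lemma upl_small e : 0 < e -> exists2 r : R, 0 < r & forall z, 0 < cmod z < r -> e < cmod (U z).
Proof.
move=> e0; have q0 : 0 < e * nu%:R * cmod a by rewrite !mulr_gt0.
exists (Num.min 1 (e * nu%:R * cmod a)^-1); first by rewrite lt_min ltr01 invr_gt0.
move=> z /andP[z0]; rewrite lt_min => /andP[z1 z2].
have zn : cmod z ^+ nu <= cmod z.
  have A : cmod z ^+ nu.-1 <= 1 by apply: exprn_ile1; apply: ltW.
  by rewrite -(prednK nu0) exprS ler_piMr // ltW.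
have zp : 0 < cmod z ^+ nu by rewrite exprn_gt0.
rewrite upl_mod -[e]invrK ltf_pV2 ?posrE ?invr_gt0 ?mulr_gt0 //.
rewrite -[X in _ < X]mul1r ltr_pdivlMr //.
move: z2; rewrite -[X in _ < X]mul1r ltr_pdivlMr // => z2.
apply: le_lt_trans z2.
have -> : nu%:R * (cmod a * cmod z ^+ nu) * e = cmod z ^+ nu * (e * nu%:R * cmod a) by ring.
by rewrite ler_wpM2r // ltW.
Qed.

Lemma upl_large r : 0 < r -> exists2 e : R, 0 < e & forall z, e <= cmod (U z) -> z != 0 -> cmod z < r.
Proof.
move=> r0; have q0 : 0 < nu%:R * (cmod a * r ^+ nu) by rewrite !mulr_gt0 ?exprn_gt0.
exists (2 / (nu%:R * (cmod a * r ^+ nu))) => [|z]; first by rewrite divr_gt0.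
rewrite upl_mod -cmod_gt0 => H z0; rewrite ltNge; apply/negP => rz.
have zn : r ^+ nu <= cmod z ^+ nu by rewrite lerXn2r // ?nnegrE ltW.
have : (nu%:R * (cmod a * cmod z ^+ nu))^-1 <= (nu%:R * (cmod a * r ^+ nu))^-1.
  by rewrite lef_pV2 ?posrE ?mulr_gt0 ?exprn_gt0 // !ler_pM2l.
have : 0 < (nu%:R * (cmod a * r ^+ nu))^-1 by rewrite invr_gt0.
lra.
Qed.

(* If [|U z|] stays bounded then [z] stays away from 0. *)
Lemma upl_below e : 0 < e -> exists2 r : R, 0 < r & forall z, cmod (U z) <= e -> z != 0 -> r <= cmod z.
Proof.
move=> e0; have [r r0 H] := upl_small e0; exists r => // z ze; rewrite -cmod_gt0 => z0.
rewrite leNgt; apply/negP => zr; have := H z; rewrite z0 zr => /(_ isT); lra.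
Qed.

(** [U] is homogeneous of degree [-nu], so a small relative change of [z] makes a small relative
    change of [U z]; discs of radius proportional to [|z|] are the natural ones in this
    coordinate. *)
Lemma upl_disc (th : R) : 0 < th -> exists2 k : R, 0 < k <= 1 / 2 & forall z w, z != 0 -> cmod (w - z) <= k * cmod z ->
  w != 0 /\ cmod (U w - U z) <= th * cmod (U z).
Proof.
move=> th0; have [K K0 HK] := inv_pow_est nu.
set k := Num.min (1 / 2) (th / (K + nu%:R)).
have Kn : 0 < K + nu%:R by rewrite addr_gt0.
have k0 : 0 < k by rewrite lt_min (divr_gt0 th0 Kn) andbT; lra.
have [k1 k2] : k <= 1 / 2 /\ k <= th / (K + nu%:R) by apply/andP; rewrite -le_min.
exists k => [|z w z0]; first by rewrite k0.
have cz : 0 < cmod z by rewrite cmod_gt0.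
set x := (w - z) / z => wz.
have wE : w = z * (1 + x) by rewrite /x; field.
have xk : cmod x <= k by rewrite /x cmodf ler_pdivrMr.
have x2 : cmod x <= 1 / 2 by lra.
have x1 : 1 + x != 0 by rewrite -cmod_gt0; have := lerD_cmod 1 x; rewrite cmod1; lra.
split; first by rewrite wE mulf_neq0.
rewrite wE upl_scale //.
have -> : U z * (1 + x)^-1 ^+ nu - U z = U z * (((1 + x)^-1 ^+ nu - 1 + nu%:R * x) - nu%:R * x) by ring.
rewrite cmodM mulrC ler_wpM2r ?cmod_ge0 //.
apply: le_trans (cmodB _ _) _; rewrite cmodM cmodn.
have := HK x x2; have X0 := cmod_ge0 x.
have : K * cmod x ^+ 2 <= K * cmod x by rewrite ler_pM2l // expr2 ler_piMr //; lra.
have : cmod x * (K + nu%:R) <= th by move: k2; rewrite ler_pdivlMr //; nra.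
lra.
Qed.

Lemma cone_disc c : 0 < c <= 1 / 2 -> exists2 k : R, 0 < k <= 1 / 2 & forall z w, z != 0 -> c * cmod (U z) <= m z ->
  cmod (w - z) <= k * cmod z -> w != 0 /\ c / 2 * cmod (U w) <= m w.
Proof.
move=> /andP[c0 c1].
have th0 : 0 < c / 8 by lra.
have [k kb H] := upl_disc th0; exists k; first exact: kb.
move=> z w z0 zc wzk; have [w0 wz] := H z w z0 wzk; split; first exact: w0.
apply: (@upm_cone_aux c (cmod (U z)) (cmod (U w)) (complex.Re (U z)) (complex.Re (U w)) (complex.Im (U z)) (complex.Im (U w))).
- by rewrite c0.
- by rewrite -cReB; apply: le_trans (Re_cmod _) wz.
- by rewrite -cImB; apply: le_trans (Im_cmod _) wz.
- exact: zc.
- have := cmodD (U w - U z) (U z); rewrite subrK => X; apply: le_trans X _; by rewrite lerD2r.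
- exact: cmod_ge0.
Qed.

(* In the coordinate [U] a map tangent to [z + a z^(nu+1)] is close to the translation by 1. *)
Lemma upl_step (F : C R -> C R) (R1 : R) : 0 < R1 ->
  (forall z, cmod z < R1 -> cmod (F z - z - a * z ^+ nu.+1) <= 1 / 16 * (cmod a * cmod z ^+ nu.+1)) ->
  exists2 R2 : R, 0 < R2 <= R1 & forall z, 0 < cmod z < R2 -> F z != 0 /\ cmod (U (F z) - (U z + 1)) <= 1 / 8.
Proof.
move=> R10 HF; have [K K0 HK] := inv_pow_est nu.
set k := Num.min (1 / 4) (nu%:R / (64 * K)).
have K64 : 0 < 64 * K by lra.
have k0 : 0 < k by rewrite lt_min (divr_gt0 nuR K64) andbT; lra.
have [k1 k2] : k <= 1 / 4 /\ k <= nu%:R / (64 * K) by apply/andP; rewrite -le_min.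
have e0 : 0 < (nu%:R * k)^-1 by rewrite invr_gt0 mulr_gt0.
have [r r0 Hr] := upl_small e0.
exists (Num.min r R1) => [|z]; first by rewrite lt_min r0 R10 ge_min lexx orbT.
rewrite lt_min => /and3P[z0 zr zR].
have zn : z != 0 by rewrite -cmod_gt0.
set t := cmod a * cmod z ^+ nu.
have t0 : 0 < t by rewrite mulr_gt0 ?exprn_gt0.
have tk : t < k.
  have := Hr z; rewrite z0 zr => /(_ isT).
  rewrite upl_mod ltf_pV2 ?posrE ?mulr_gt0 ?exprn_gt0 // -/t.
  by rewrite ltr_pM2l.
set x := (F z - z) / z; set eta := x - a * z ^+ nu.
have eb : cmod eta <= t / 16.
  have -> : eta = (F z - z - a * z ^+ nu.+1) / z by rewrite /eta /x exprS; field.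
  rewrite cmodf ler_pdivrMr //; apply: le_trans (HF z zR) _.
  by rewrite le_eqVlt /t exprS; apply/orP; left; apply/eqP; field.
have xb : cmod x <= 17 / 16 * t.
  have -> : x = eta + a * z ^+ nu by rewrite /eta; ring.
  apply: le_trans (cmodD _ _) _; rewrite cmodM cmodX -/t; lra.
have x2 : cmod x <= 1 / 2 by lra.
have x1 : 1 + x != 0 by rewrite -cmod_gt0; have := lerD_cmod 1 x; rewrite cmod1; lra.
have FE : F z = z * (1 + x) by rewrite /x; field.
split; first by rewrite FE mulf_neq0.
rewrite FE upl_scale //.
have az : a * z ^+ nu != 0 by rewrite mulf_neq0 ?expf_neq0.
have -> : U z * (1 + x)^-1 ^+ nu - (U z + 1) =
  U z * ((1 + x)^-1 ^+ nu - 1 + nu%:R * x) + eta / (a * z ^+ nu).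
  by rewrite /upl /eta; move: (a * z ^+ nu) az => y yn; field; rewrite ?nuC ?yn ?x1.
apply: le_trans (cmodD _ _) _.
have A : cmod (eta / (a * z ^+ nu)) <= 1 / 16.
  by rewrite cmodf cmodM cmodX -/t ler_pdivrMr //; lra.
have B : cmod (U z * ((1 + x)^-1 ^+ nu - 1 + nu%:R * x)) <= 1 / 16.
  rewrite cmodM upl_mod -/t mulrC ler_pdivrMr ?mulr_gt0 ?exprn_gt0 //.
  apply: le_trans (HK x x2) _.
  apply: le_trans (_ : K * (17 / 16 * t) ^+ 2 <= _).
    by rewrite ler_pM2l //; apply: lerXn2r; rewrite ?nnegrE ?cmod_ge0 //; lra.
  have : 64 * K * t <= nu%:R.
    have : 64 * K * t <= 64 * K * k by rewrite ler_pM2l // ltW.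
    by move: k2; rewrite ler_pdivlMr // mulrC; lra.
  nra.
lra.
Qed.
End UPLANE.

Ltac generalize_moduli := repeat match goal with
  | H : context [cmod ?x] |- _ => let h := fresh "h" in set (h := cmod x) in *; clearbody h
  | |- context [cmod ?x] => let h := fresh "h" in set (h := cmod x) in *; clearbody h
  | H : context [upm ?n ?b ?x] |- _ => let h := fresh "h" in set (h := upm n b x) in *; clearbody h
  | |- context [upm ?n ?b ?x] => let h := fresh "h" in set (h := upm n b x) in *; clearbody h
  end.

Ltac glra := first [keep_comparisons 5%N; generalize_moduli; lra | keep_comparisons 12%N; generalize_moduli; lra |
  generalize_moduli; lra].

(** * Perturbed parabolic germs and the depths of a petal *)

Section LOCAL. Variable R : realType.
Local Opaque upl upm cmod.
Implicit Types (z w v b : C R) (c e : R).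

(** [F0] is the parabolic germ in a chart and the [F n] are its perturbations, on one common disc. A
    displacement with Lipschitz constant [1 / 2] gives injectivity and expansion by at most [3 / 2];
    the constant [1 / 16] of [loc_asym] is the one [upl_step] expects. *)
Record loc (R1 : R) (nu : nat) (a : C R) (F : nat -> C R -> C R) (F0 : C R -> C R) : Prop := Loc {
  loc_R1 : 0 < R1;
  loc_nu : (0 < nu)%N;
  loc_a : a != 0;
  loc_hol : forall n, hol 0 R1 (F n);
  loc_lip : forall n z w, cmod z < R1 -> cmod w < R1 ->
    cmod (F n z - F n w - (z - w)) <= 1 / 2 * cmod (z - w);
  loc_lip0 : forall z w, cmod z < R1 -> cmod w < R1 ->
    cmod (F0 z - F0 w - (z - w)) <= 1 / 2 * cmod (z - w);
  loc_cvg : forall e, 0 < e -> exists n0, forall n, (n0 <= n)%N -> forall z, cmod z < R1 ->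
    cmod (F n z - F0 z) <= e;
  loc_asym : forall z, cmod z < R1 ->
    cmod (F0 z - z - a * z ^+ nu.+1) <= 1 / 16 * (cmod a * cmod z ^+ nu.+1) }.

(** For [rho1 > 0] this is a compact part of the petals, to which uniform statements apply. With
    [rho1 = 0] it also contains 0, where [U] has the value 0 by division by 0; hence the side
    conditions [v != 0]. *)
Definition cone (nu : nat) (a : C R) (rho1 rho2 c : R) z :=
  [/\ rho1 <= cmod z, cmod z <= rho2 & c * cmod (upl nu a z) <= upm nu a z].

Variables (R1 : R) (nu : nat) (a : C R) (F : nat -> C R -> C R) (F0 : C R -> C R).
Hypothesis HL : loc R1 nu a F F0.
Local Notation U := (upl nu a).
Local Notation m := (upm nu a).

Let R10 : 0 < R1. Proof. exact: (loc_R1 HL). Qed.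
Let nu0 := loc_nu HL.
Let a0 := loc_a HL.

Lemma loc_lipn n z w : cmod z < R1 -> cmod w < R1 -> cmod (F n z - F n w) <= 3 / 2 * cmod (z - w).
Proof.
move=> zR wR; have := loc_lip HL n zR wR.
have := cmodD (F n z - F n w - (z - w)) (z - w); rewrite subrK; lra.
Qed.

Lemma loc_inj n z w : cmod z < R1 -> cmod w < R1 -> F n z = F n w -> z = w.
Proof.
move=> zR wR FE; have := loc_lip HL n zR wR; rewrite FE subrr sub0r cmodN => H.
apply/eqP; rewrite -subr_eq0; apply/eqP/cmod_eq0; have := cmod_ge0 (z - w); lra.
Qed.

Lemma iter_close (P : C R -> Prop) j : (forall v, P v -> forall i, (i <= j)%N -> cmod (iter i F0 v) < R1 / 4) ->
  forall e, 0 < e -> exists n0, forall n, (n0 <= n)%N -> forall v, P v -> forall i, (i <= j)%N ->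
    cmod (iter i (F n) v - iter i F0 v) <= e.
Proof.
move=> HP e e0; set e1 := Num.min e (R1 / 4).
have e10 : 0 < e1 by rewrite lt_min e0 divr_gt0.
have [e1e e1R] : e1 <= e /\ e1 <= R1 / 4 by apply/andP; rewrite -le_min.
have p0 : 0 < (3 : R) ^+ j by rewrite exprn_gt0.
have [n0 H] := loc_cvg HL (divr_gt0 e10 p0); exists n0 => n nn v Pv.
set d : R := e1 / 3 ^+ j in H; have d0 : 0 <= d by rewrite /d divr_ge0 // ltW.
have key i : (i <= j)%N -> 3 ^+ i * d <= e1.
  move=> ij; rewrite /d mulrCA ger_pMr // ler_pdivrMr // mul1r.
  by apply: ler_weXn2l => //; lra.
suff main i : (i <= j)%N -> cmod (iter i (F n) v - iter i F0 v) <= 3 ^+ i * d.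
  by move=> i ij; apply: le_trans (main i ij) _; apply: le_trans (key i ij) e1e.
elim: i => [_|i IH ij]; first by rewrite subrr cmod0 mulr_ge0 // divr_ge0 // ltW.
have ij' := ltnW ij; have A := IH ij'; have B := HP v Pv i ij'.
have A' := le_trans A (key i ij').
have iR : cmod (iter i F0 v) < R1 by lra.
have iR' : cmod (iter i (F n) v) < R1.
  by have := cmodD (iter i (F n) v - iter i F0 v) (iter i F0 v); rewrite subrK; lra.
rewrite !iterS; have L := loc_lipn n iR' iR; have D := H n nn _ iR.
have := cmodBtri (F n (iter i F0 v)) (F n (iter i (F n) v)) (F0 (iter i F0 v)).
have X : 1 * d <= 3 ^+ i * d.
  by apply: ler_wpM2r => //; apply: exprn_ege1; lra.
have -> : 3 ^+ i.+1 * d = 3 * (3 ^+ i * d) by rewrite exprS mulrA.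
by clear key; lra.
Qed.

(** Each step adds at least [3 / 4] to [m], so the region where [upl_step] applies is invariant, and
    the errors [1 / 8] add up linearly. *)
Lemma orbit0 (rho : R) : 0 < rho -> exists2 Rb : R, 0 < Rb & forall z, z != 0 -> Rb < m z ->
  forall k, [/\ iter k F0 z != 0, cmod (iter k F0 z) < rho,
     cmod (U (iter k F0 z) - (U z + ((k%:R : R)%:C)%C)) <= 1 / 8 * k%:R & Rb < m (iter k F0 z)].
Proof.
move=> rho0; have [R2 /andP[R20 R21] step] := upl_step nu0 a0 R10 (loc_asym HL).
have r0 : 0 < Num.min rho R2 by rewrite lt_min rho0.
have [e e0 He] := upl_large nu0 a0 r0.
have small z : z != 0 -> 2 * e < m z -> cmod z < rho /\ 0 < cmod z < R2.
  move=> z0 mz; have := upm_le nu a z => mU.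
  have : cmod z < Num.min rho R2 by apply: He => //; glra.
  by rewrite lt_min => /andP[-> ->]; rewrite cmod_gt0 z0.
exists (2 * e) => [|z z0 mz]; first by glra.
elim=> [|k [k1 k2 k3 k4]].
  split => //; first by have [] := small z z0 mz.
  by rewrite mulr0 rmorph0 addr0 subrr cmod0.
have [_ kr] := small _ k1 k4; have [s1 s2] := step _ kr.
have m1 : m (iter k F0 z) + 3 / 4 * 1 <= m (iter k.+1 F0 z).
  apply: upm_near; last by glra.
  by rewrite rmorph1 mulr1 iterS.
have m1' : 2 * e < m (F0 (iter k F0 z)) by rewrite iterS in m1; glra.
rewrite iterS; split; [exact: s1|by have [] := small (F0 (iter k F0 z)) s1 m1'| |].
  have -> : U (F0 (iter k F0 z)) - (U z + ((k.+1%:R : R)%:C)%C) =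
    (U (F0 (iter k F0 z)) - (U (iter k F0 z) + 1)) + (U (iter k F0 z) - (U z + ((k%:R : R)%:C)%C)).
    have -> : ((k.+1%:R : R)%:C)%C = ((k%:R : R)%:C)%C + 1 by rewrite -natr1 rmorphD rmorph1.
    by move: (U _) (U _) (U _) (_%:C)%C => p q r s; ring.
  by apply: le_trans (cmodD _ _) _; rewrite -[k.+1%:R]natr1; glra.
exact: m1'.
Qed.

Lemma orbit0_cone (rho c : R) : 0 < rho -> 0 < c <= 1 / 2 -> exists2 rs : R, 0 < rs &
  forall rho2, rho2 <= rs -> forall v, v != 0 -> cone nu a 0 rho2 c v -> forall k,
  [/\ iter k F0 v != 0, cmod (iter k F0 v) < rho, c * cmod (U (iter k F0 v)) <= m (iter k F0 v),
      cmod (U (iter k F0 v)) <= cmod (U v) + 9 / 8 * k%:R & 3 / 8 * k%:R <= cmod (U (iter k F0 v))].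
Proof.
move=> rho0 /andP[c0 c1]; have [Rb Rb0 H] := orbit0 rho0.
have [r r0 Hr] := upl_small nu0 a0 (divr_gt0 Rb0 c0).
exists (r / 2) => [|rho2 rr v v0 [_ vr vc] k]; first by rewrite divr_gt0.
have v0' : 0 < cmod v by rewrite cmod_gt0.
have mv : Rb < m v.
  apply: lt_le_trans vc; rewrite mulrC -ltr_pdivrMr //; apply: Hr.
  by rewrite v0' /=; glra.
have [k1 k2 k3 k4] := H v v0 mv k.
have kn := ler0n R k.
have mk := upm_near k3 kn.
have ck : cmod ((k%:R : R)%:C%C : C R) = k%:R by rewrite cmodR ger0_norm.
have uk : cmod (U (iter k F0 v)) <= cmod (U v) + 9 / 8 * k%:R.
  have := cmodD (U (iter k F0 v) - (U v + ((k%:R : R)%:C)%C)) (U v + ((k%:R : R)%:C)%C).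
  by rewrite subrK; have := cmodD (U v) (((k%:R : R)%:C)%C); rewrite ck; glra.
split; [exact: k1|exact: k2| |exact: uk|].
- have : c * cmod (U (iter k F0 v)) <= c * (cmod (U v) + 9 / 8 * k%:R) by rewrite ler_pM2l.
  have : c * k%:R <= 1 / 2 * k%:R by rewrite ler_wpM2r.
  glra.
- by have := upm_le nu a (iter k F0 v); glra.
Qed.

(** Discs around [b] inside the cone may have radius proportional to [|b|], while the map moves [b]
    by [O(|b|^(nu+1))] only. Far along the orbit the step is therefore small compared with the disc,
    which is the situation where Landau's theorem says something about [F^k b] and [F^(k+1) b]. *)
Lemma deep c : 0 < c <= 1 / 2 -> exists2 rs : R, 0 < rs &
  forall rho2 : R, 0 < rho2 <= rs -> forall rho1 eps r' : R, 0 < rho1 -> 0 < eps -> 0 < r' ->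
  exists j n0 (rhol : R), 0 < rhol /\ forall n, (n0 <= n)%N -> forall v, cone nu a rho1 rho2 c v ->
    (forall i, (i <= j)%N -> cmod (iter i (F n) v) < R1 / 2) /\
    exists2 rad : R, 0 < rad &
      [/\ forall z, cmod (z - iter j (F n) v) < rad -> cone nu a rhol rho2 (c / 2) z,
          cmod (F n (iter j (F n) v) - iter j (F n) v) <= eps * rad &
          cmod (iter j (F n) v) < r'].
Proof.
move=> cb; have /andP[c0 c1] := cb.
have R14 : 0 < R1 / 4 by rewrite divr_gt0.
have [rs rs0 H0] := orbit0_cone R14 cb.
have [k /andP[k0 k1] Hk] := cone_disc nu0 a0 cb.
exists rs => // rho2 /andP[rho20 rho2s] rho1 eps r' rho10 eps0 r'0.
(* [A |y|^2] bounds the displacement of [F0] at points [b] with [|b| <= 2 |y| <= 2]; [r1] makes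
   [A |y|] at most [eps * k / 8]. *)
set A : R := 17 / 16 * (cmod a * 2 ^+ nu.+1).
have A0 : 0 < A by rewrite !mulr_gt0 ?exprn_gt0 ?cmod_gt0 // invr_gt0.
set r1 : R := Num.min (Num.min 1 (r' / 4)) (Num.min (rho2 / 4) (eps * k / (8 * A))).
have B0 : 0 < eps * k / (8 * A) by apply: divr_gt0; apply: mulr_gt0.
have r10 : 0 < r1 by rewrite !lt_min ltr01 B0 !divr_gt0.
have [[q1 q2] [q3 q4]] : (r1 <= 1 /\ r1 <= r' / 4) /\ (r1 <= rho2 / 4 /\ r1 <= eps * k / (8 * A)).
  by split; apply/andP; rewrite -le_min ge_min lexx ?orbT.
clearbody r1.
have [E E0 HE] := upl_large nu0 a0 r10.
have [j jE] : exists j : nat, E <= 3 / 8 * j%:R.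
  exists (Num.truncn (8 / 3 * E)).+1.
  have := truncnS_gt (8 / 3 * E); glra.
have Um v : cone nu a rho1 rho2 c v -> v != 0 /\ cmod (U v) <= (nu%:R * (cmod a * rho1 ^+ nu))^-1.
  move=> [v1 v2 v3]; have v0 : 0 < cmod v by glra.
  split; first by rewrite -cmod_gt0.
  have n1 : 0 < (nu%:R : R) by rewrite ltr0n.
  have a1 : 0 < cmod a by rewrite cmod_gt0.
  rewrite upl_mod lef_pV2 ?posrE ?mulr_gt0 ?exprn_gt0 // !ler_pM2l //.
  by rewrite lerXn2r // ?nnegrE ltW.
set Umax := (nu%:R * (cmod a * rho1 ^+ nu))^-1 in Um.
have Up : 0 < Umax.
  have a1 : 0 < cmod a by rewrite cmod_gt0.
  by rewrite invr_gt0 !mulr_gt0 ?exprn_gt0 ?ltr0n.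
have Ej : 0 < Umax + 9 / 8 * j%:R by have := ler0n R j; lra.
have [rl rl0 Hl] := upl_below nu0 a0 Ej.
have close : forall v, cone nu a rho1 rho2 c v -> forall i, (i <= j)%N -> cmod (iter i F0 v) < R1 / 4.
  move=> v Kv i _; have [v0 _] := Um v Kv; case: Kv => v1 v2 v3.
  by have [] := H0 rho2 rho2s v v0 _ i; first by split => //; exact: cmod_ge0.
set eta : R := Num.min (R1 / 4) (Num.min (k * rl / 4) (eps * k * rl / 8)).
have eta0 : 0 < eta by rewrite !lt_min R14 !divr_gt0 ?mulr_gt0.
have [h1 [h2 h3]] : eta <= R1 / 4 /\ (eta <= k * rl / 4 /\ eta <= eps * k * rl / 8).
  by split; [rewrite ge_min lexx | apply/andP; rewrite -le_min ge_min lexx orbT].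
clearbody eta.
have [n1 Hn1] := iter_close close eta0.
have [n2 Hn2] := loc_cvg HL eta0.
exists j, (maxn n1 n2), (rl / 2); split; first by rewrite divr_gt0.
move=> n; rewrite geq_max => /andP[nn1 nn2] v Kv.
have C1 := close v Kv; have C2 := Hn1 n nn1 v Kv.
have [v0 Uv] := Um v Kv.
have [y0 y1 y2 y3 y4] : [/\ iter j F0 v != 0, cmod (iter j F0 v) < R1 / 4,
   c * cmod (U (iter j F0 v)) <= m (iter j F0 v),
      cmod (U (iter j F0 v)) <= cmod (U v) + 9 / 8 * j%:R & 3 / 8 * j%:R <= cmod (U (iter j F0 v))].
  by case: Kv => v1 v2 v3; apply: (H0 rho2 rho2s v v0); split => //; exact: cmod_ge0.
split.
  move=> i ij; have := C1 i ij; have := C2 i ij.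
  by have := cmodD (iter i (F n) v - iter i F0 v) (iter i F0 v); rewrite subrK; glra.
have := C2 j (leqnn j).
set b := iter j (F n) v; set y := iter j F0 v in y0 y1 y2 y3 y4 *.
clearbody b y => by_; have yr1 : cmod y < r1 by apply: HE => //; glra.
have yl : rl <= cmod y by apply: Hl => //; glra.
have bY : cmod b <= 2 * cmod y.
  by have := cmodD (b - y) y; rewrite subrK; nra.
have krad : k * cmod y / 4 <= k * cmod y by nra.
exists (k * cmod y / 4); first by rewrite divr_gt0 // mulr_gt0 //; glra.
have ky : k * rl <= k * cmod y by rewrite ler_pM2l.
have zy z : cmod (z - b) < k * cmod y / 4 -> cmod (z - y) <= k * cmod y.
  move=> zk; have T : cmod (z - y) <= cmod (z - b) + cmod (b - y) by exact: cmodBtri.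
  apply: le_trans T _; clear Hn1 Hn2 C1 C2 Hk H0 HE close Hl Um; glra.
have kyy : k * cmod y <= 1 / 2 * cmod y by rewrite ler_wpM2r ?cmod_ge0.
split.
- move=> z /zy zk; have [z0 zc] := Hk y z y0 y2 zk; split => //.
  + by have := lerB_cmod y z; rewrite cmodBC; glra.
  + by have := lerB_cmod z y; glra.
- have bR : cmod b < R1 by glra.
  have D := Hn2 n nn2 b bR; have As := loc_asym HL bR.
  have P : cmod (F0 b - b) <= A * (cmod y * cmod y).
    have -> : F0 b - b = (F0 b - b - a * b ^+ nu.+1) + a * b ^+ nu.+1 by ring.
    apply: le_trans (cmodD _ _) _; rewrite cmodM cmodX.
    have -> : A * (cmod y * cmod y) = 17 / 16 * (cmod a * (2 ^+ nu.+1 * (cmod y * cmod y))) by rewrite /A; ring.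
    apply: le_trans (_ : 17 / 16 * (cmod a * cmod b ^+ nu.+1) <= _); first by glra.
    rewrite ler_pM2l ?ler_pM2l ?cmod_gt0 //.
    apply: le_trans (_ : (2 * cmod y) ^+ nu.+1 <= _).
      by rewrite lerXn2r // ?nnegrE ?mulr_ge0 ?cmod_ge0.
    rewrite exprMn ler_pM2l ?exprn_gt0 // exprS ler_wpM2l ?cmod_ge0 //.
    have Q : cmod y ^+ nu.-1 <= 1 by apply: exprn_ile1; [exact: cmod_ge0|glra].
    by rewrite -(prednK nu0) exprS ler_piMr // cmod_ge0.
  have S : A * cmod y <= eps * k / 8.
    have : A * cmod y <= A * (eps * k / (8 * A)) by rewrite ler_pM2l //; glra.
    by have -> : A * (eps * k / (8 * A)) = eps * k / 8 by field; rewrite gt_eqF.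
  have S2 : A * (cmod y * cmod y) <= eps * k / 8 * cmod y by rewrite mulrA ler_wpM2r ?cmod_ge0.
  have S3 : eps * k * rl <= eps * k * cmod y by rewrite ler_pM2l ?mulr_gt0.
  have T : cmod (F n b - b) <= cmod (F n b - F0 b) + cmod (F0 b - b) by exact: cmodBtri.
  by apply: le_trans T _; move: P S2 S3 D h3; clear; clearbody A; glra.
- glra.
Qed.
End LOCAL.

(** * Attraction of the cones under the perturbed maps *)

Section HOLOPS. Variable R : realType.
Implicit Types (z w c : C R) (f g : C R -> C R).

Lemma hol_comp c (r : R) c' (r' : R) f g : hol c r g -> hol c' r' f ->
  (forall z, cmod (z - c) < r -> cmod (g z - c') < r') -> hol c r (fun z => f (g z)).
Proof.
move=> [g1 [g2 [g3 Hg]]] [f1 [f2 [f3 Hf]]] H.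
exists (fun z => f1 (g z) * g1 z), (fun z => (f2 (g z) * g1 z) * g1 z + f1 (g z) * g2 z).
exists (fun z => (((f3 (g z) * g1 z) * g1 z + f2 (g z) * g2 z) * g1 z + (f2 (g z) * g1 z) * g2 z)
   + ((f2 (g z) * g1 z) * g2 z + f1 (g z) * g3 z)) => z zr.
have [h1 h2 h3] := Hg z zr; have [k1 k2 k3] := Hf _ (H z zr).
have c0 := cder_comp h1 k1; have c1 := cder_comp h1 k2; have c2 := cder_comp h1 k3.
split => //; first exact: (cderM c1 h2).
exact: (cderD (cderM (cderM c2 h2) h2) (cderM c1 h3)).
Qed.

Lemma hol_affine c (r : R) (p q : C R) f : hol c r f -> hol c r (fun z => q * (f z - p)).
Proof.
move=> [f1 [f2 [f3 H]]]; exists (fun z => q * f1 z), (fun z => q * f2 z), (fun z => q * f3 z) => z /H[h1 h2 h3].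
split; [|exact: cderMc|exact: cderMc].
by apply: cderMc; apply: cder_eq (subr0 _) (cderB h1 (cder_cst p z)).
Qed.

Lemma hol_id c (r : R) : hol c r id.
Proof.
by exists (fun=> 1), (fun=> 0), (fun=> 0) => z _; split; [exact: cder_id|exact: cder_cst|exact: cder_cst].
Qed.

End HOLOPS.

Section ATTR. Variable R : realType.
Local Opaque upl upm cmod.
Implicit Types (z w v b : C R) (c e : R).

(** [j0] and [n0] are uniform over the cone. As [n0] depends on [r'], for a fixed [n] the orbits
    only have to end up in a small disc and need not converge to 0. *)
Definition attr (R1 : R) nu (a : C R) (F : nat -> C R -> C R) (rho2 c : R) :=
  forall rho1 r' : R, 0 < rho1 -> 0 < r' -> exists j0 n0, forall n, (n0 <= n)%N -> forall z,
    cone nu a rho1 rho2 c z -> (forall k, cmod (iter k (F n) z) < R1 / 2) /\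
    forall k, (j0 <= k)%N -> cmod (iter k (F n) z) < r'.

(* On the cone, [tau] stands for the composition of a Moebius map [t] with the [k]-th iterate of the
   unrestricted rational map; it omits 0 and 1 because the three points sent to 0, 1 and infinity
   are taken in the Julia set. *)
Definition omitting (R1 : R) nu (a : C R) (F : nat -> C R -> C R) (rho2 c : R) :=
  exists2 B : R, 0 < B & forall rho1 : R, 0 < rho1 -> exists n0, forall n, (n0 <= n)%N ->
   forall k, exists t tau : C R -> C R,
    [/\ forall (c0 : C R) (r : R), (forall z, cmod (z - c0) < r -> cone nu a rho1 rho2 c z) -> hol c0 r tau,
        forall z, cone nu a rho1 rho2 c z -> tau z != 0 /\ tau z != 1,
        forall z, cone nu a rho1 rho2 c z -> (forall i, (i <= k)%N -> cmod (iter i (F n) z) < R1) ->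
          tau z = t (iter k (F n) z) &
        forall w, cmod w < R1 -> cmod (t w) <= B /\
          forall w', cmod w' < R1 -> cmod (w - w') <= B * cmod (t w - t w')].

Variables (R1 : R) (nu : nat) (a : C R) (F : nat -> C R -> C R) (F0 : C R -> C R).
Hypothesis HL : loc R1 nu a F F0.
Local Notation U := (upl nu a).
Local Notation m := (upm nu a).
Let R10 : 0 < R1. Proof. exact: (loc_R1 HL). Qed.
Let nu0 := loc_nu HL.
Let a0 := loc_a HL.

Lemma loc_iter_hol n k (c : C R) (r : R) :
  (forall z, cmod (z - c) < r -> forall i, (i < k)%N -> cmod (iter i (F n) z) < R1) ->
  hol c r (iter k (F n)).
Proof.
elim: k => [|k IH] H; first exact: hol_id.
apply: (hol_comp (c' := 0) (r' := R1) (f := F n) (g := iter k (F n))) (loc_hol HL n) _.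
  by apply: IH => z zr i ik; apply: H => //; exact: ltnW.
by move=> z zr; rewrite subr0; apply: H.
Qed.

Lemma loc_F00 : F0 0 = 0.
Proof.
have r : cmod (0 : C R) < R1 by rewrite cmod0.
have := loc_asym HL r; rewrite expr0n /= !mulr0 !subr0 cmod0 expr0n /= !mulr0 => H.
by apply: cmod_eq0; apply: le_anti; rewrite H cmod_ge0.
Qed.

Lemma loc_near (e : R) : 0 < e -> exists n0, forall n, (n0 <= n)%N -> forall z, cmod z < R1 ->
  cmod (F n z) <= 3 / 2 * cmod z + e.
Proof.
move=> e0; have [n0 H] := loc_cvg HL e0; exists n0 => n nn z zR; have C1 := H n nn z zR.
have r : cmod (0 : C R) < R1 by rewrite cmod0.
have := loc_lip0 HL zR r; rewrite loc_F00 !subr0 => L.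
have := cmodD (F n z - F0 z) (F0 z); rewrite subrK => T1.
have := cmodD (F0 z - z) z; rewrite subrK => T2.
by move: C1 L T1 T2; clear; glra.
Qed.

Lemma loc_moves (r' : R) : 0 < r' -> exists n0, exists2 e : R, 0 < e & forall n, (n0 <= n)%N -> forall z,
  r' <= cmod z -> cmod z < R1 -> e <= cmod (F n z - z).
Proof.
move=> r0; have ca : 0 < cmod a by rewrite cmod_gt0.
set e : R := 7 / 16 * (cmod a * r' ^+ nu.+1).
have p0 : 0 < cmod a * r' ^+ nu.+1 by rewrite mulr_gt0 ?exprn_gt0.
have e0 : 0 < e by rewrite /e; lra.
have [n0 H] := loc_cvg HL e0; exists n0, e => // n nn z zr zR.
have C1 := H n nn z zR; have A := loc_asym HL zR.
have P : cmod a * r' ^+ nu.+1 <= cmod a * cmod z ^+ nu.+1.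
  by rewrite ler_pM2l //; apply: lerXn2r; rewrite ?nnegrE // ?ltW //; apply: lt_le_trans zr.
have := lerB_cmod (a * z ^+ nu.+1) (a * z ^+ nu.+1 - (F0 z - z)).
rewrite subKr cmodM cmodX (cmodBC (a * _)) => T1.
have := cmodBtri (F n z) (F0 z) z; rewrite (cmodBC (F0 z) (F n z)) => T2.
move: C1 A P T1 T2 p0; rewrite /e; clear.
set p : R := cmod a * r' ^+ _; set q : R := cmod a * cmod z ^+ _; clearbody p q.
by lra.
Qed.

(* Landau's theorem for [tau] on a deep disc around [b] makes all steps
   [F^(k+1) b - F^k b] small, so the orbit cannot cross a thin annulus, where steps are bounded below. *)
Lemma attr_of_omitting c : 0 < c <= 1 / 2 -> exists2 rs : R, 0 < rs & forall rho2 : R, 0 < rho2 <= rs ->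
  omitting R1 nu a F rho2 (c / 2) -> attr R1 nu a F rho2 c.
Proof.
move=> cb; have [rs rs0 HD] := deep HL cb; exists rs => // rho2 r2 [B B0 HB] rho1 r'' rho10 r''0.
set r' : R := Num.min r'' (R1 / 4).
have r'0 : 0 < r' by rewrite lt_min r''0 divr_gt0.
have [r'1 r'2] : r' <= r'' /\ r' <= R1 / 4 by apply/andP; rewrite -le_min.
have hr' : 0 < r' / 2 by rewrite divr_gt0.
clearbody r'.
have [n1 [e1 e10 H1]] := loc_moves hr'.
set e : R := Num.min (e1 / 2) (r' / 4).
have e0 : 0 < e by rewrite lt_min !divr_gt0.
have [ee1 er'] : e <= e1 / 2 /\ e <= r' / 4 by apply/andP; rewrite -le_min.
clearbody e.
have [epl' epl'0 HLan'] := landau (ltW B0) (divr_gt0 e0 B0).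
have [epl [epl0 epl1 HLan]] : exists epl : R, [/\ 0 < epl, epl < 1 & forall (c0 : C R) (r : R) f, 0 < r -> hol c0 r f ->
    (forall z, cmod (z - c0) < r -> f z != 0 /\ f z != 1) -> cmod (f c0) <= B ->
    forall z, cmod (z - c0) <= epl * r -> cmod (f z - f c0) <= e / B].
  exists (Num.min epl' (1 / 2)); split; [by rewrite lt_min epl'0; lra|by rewrite gt_min; apply/orP; right; lra|].
  move=> c0 r f r0 fh fo fB z zr; apply: (HLan' c0 r f) => //; apply: le_trans zr _.
  by rewrite ler_pM2r // ge_min lexx.
have [j [n2 [rhol [rl0 H2]]]] := HD rho2 r2 rho1 epl (r' / 2) rho10 epl0 hr'.
have [n3 H3] := HB rhol rl0.
have [n4 H4] := loc_near (divr_gt0 R10 (ltr0Sn R 3)).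
exists j, (maxn (maxn n1 n2) (maxn n3 n4)) => n; rewrite !geq_max => /andP[/andP[nn1 nn2] /andP[nn3 nn4]] v Kv.
have [D1 [rad rad0 [D2 D3 D4]]] := H2 n nn2 v Kv.
set b := iter j (F n) v in D2 D3 D4.
suff main k : cmod (iter k (F n) b) < r' / 2.
  split=> k; last first.
    by move=> jk; have := main (k - j)%N; rewrite /b -iterD subnK // => Q; apply: lt_le_trans Q _; lra.
  case: (ltnP k j) => kj.
  - by apply: D1; exact: ltnW.
  - by have := main (k - j)%N; rewrite /b -iterD subnK // => Q; apply: lt_le_trans Q _; lra.

have inR w : cmod w < r' -> cmod (F n w) < R1.
  move=> wr; have wR : cmod w < R1 by lra.
  by have := H4 n nn4 w wR; lra.
(* The iterates are only assumed smaller than [r'], not [r' / 2], so that this can be applied once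
   more at the iterate suspected of having left the disc of radius [r' / 2]. *)
have step h : (forall i, (i <= h)%N -> cmod (iter i (F n) b) < r') ->
    cmod (F n (iter h (F n) b) - iter h (F n) b) <= e.
  move=> small; have [t [tau [T1 T2 T3 T4]]] := H3 n nn3 h.
  have Kb : cone nu a rhol rho2 (c / 2) b by apply: D2; rewrite subrr cmod0.
  have epr : epl * rad < rad by rewrite gtr_pMl.
  have Kfb : cone nu a rhol rho2 (c / 2) (F n b) by apply: D2; apply: le_lt_trans D3 epr.
  have smallR i : (i <= h.+1)%N -> cmod (iter i (F n) b) < R1.
    rewrite leq_eqVlt => /orP[/eqP ->|ik]; first by rewrite iterS; apply: inR; exact: small.
    by have := small i ik; lra.
  have t1 : tau b = t (iter h (F n) b).
    by apply: T3 => // i ik; apply: smallR; exact: leqW.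
  have t2 : tau (F n b) = t (F n (iter h (F n) b)).
    rewrite -iterS iterSr; apply: T3 => // i ik; rewrite -iterSr; exact: smallR.
  have hk := smallR h (leqnSn h); have hk1 := smallR h.+1 (leqnn _).
  have [Bk _] := T4 _ hk; have [_ Lk] := T4 _ hk1.
  have Lt := HLan b rad tau rad0 (T1 b rad D2) (fun z zr => T2 z (D2 z zr)).
  rewrite t1 in Lt; have {}Lt := Lt Bk _ D3; rewrite t2 in Lt.
  have {}Lk := Lk _ hk; rewrite iterS in Lk.
  by apply: le_trans Lk _; rewrite -ler_pdivlMl // mulrC.
suff main i : (i <= k)%N -> cmod (iter i (F n) b) < r' / 2 by exact: main.
elim: k i => [|k IH] i; first by rewrite leqn0 => /eqP ->.
rewrite leq_eqVlt => /orP[/eqP -> {i}|]; last exact: IH.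
have s1 := step k (fun i ik => lt_trans (IH i ik) (ltac:(lra) : r' / 2 < r')).
have k1 := IH k (leqnn k).
have k2 : cmod (iter k.+1 (F n) b) < r'.
  rewrite iterS; have := cmodD (F n (iter k (F n) b) - iter k (F n) b) (iter k (F n) b).
  by rewrite subrK; move: s1 k1 er' r'0; clear; glra.
rewrite ltNge; apply/negP => k3.
have s2 : cmod (F n (iter k.+1 (F n) b) - iter k.+1 (F n) b) <= e.
  apply: step => i; rewrite leq_eqVlt => /orP[/eqP -> //|ik].
  by apply: lt_trans (IH i ik) _; lra.
have k4 : cmod (iter k.+1 (F n) b) < R1 by lra.
by have := H1 n nn1 _ k3 k4; move: s2 ee1 e10; clear; glra.
Qed.
End ATTR.

(** * Accumulation points and equicontinuity of the orbits *)

Section ORBITS. Variable R : realType.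
Local Opaque upl upm cmod.
Implicit Types (z w v b : C R) (c e : R).

Definition accum (u : nat -> C R) (y : C R) :=
  forall e : R, 0 < e -> forall N, exists2 k, (N <= k)%N & cmod (u k - y) < e.

Variables (R1 : R) (nu : nat) (a : C R) (F : nat -> C R -> C R) (F0 : C R -> C R).
Hypothesis HL : loc R1 nu a F F0.
Let R10 : 0 < R1. Proof. exact: (loc_R1 HL). Qed.

Lemma iter_cont n k v : (forall i, (i < k)%N -> cmod (iter i (F n) v) < R1) ->
  forall e : R, 0 < e -> exists2 del : R, 0 < del & forall z, cmod (z - v) < del ->
    forall i, (i <= k)%N -> cmod (iter i (F n) z - iter i (F n) v) < e.
Proof.
elim: k => [|k IH] H e e0; first by exists e => // z ze i; rewrite leqn0 => /eqP ->.
have g0 : 0 < R1 - cmod (iter k (F n) v) by rewrite subr_gt0 H.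
set e1 : R := Num.min (e / 2) (R1 - cmod (iter k (F n) v)).
have e10 : 0 < e1 by rewrite lt_min g0 divr_gt0.
have [h1 h2] : e1 <= e / 2 /\ e1 <= R1 - cmod (iter k (F n) v) by apply/andP; rewrite -le_min.
have [del del0 Hd] := IH (fun i ik => H i (leqW ik)) e1 e10; exists del => // z zd i.
clearbody e1; rewrite leq_eqVlt => /orP[/eqP ->|ik]; last by have := Hd z zd i ik; lra.
have := Hd z zd k (leqnn k); have vR := H k (leqnn _).
set p := iter k (F n) z; set q := iter k (F n) v => pq.
have pR : cmod p < R1.
  by have := cmodD (p - q) q; rewrite subrK; move: pq h2; rewrite -/q; clear; glra.
have := loc_lipn HL n pR vR; rewrite !iterS -/p -/q; lra.
Qed.

Lemma iter_inj n k z w : (forall i, (i < k)%N -> cmod (iter i (F n) z) < R1) ->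
  (forall i, (i < k)%N -> cmod (iter i (F n) w) < R1) -> iter k (F n) z = iter k (F n) w -> z = w.
Proof.
elim: k => [//|k IH] Hz Hw /(loc_inj HL (Hz k (leqnn _)) (Hw k (leqnn _))).
by apply: IH => i ik; [apply: Hz|apply: Hw]; exact: leqW.
Qed.

(** The disc about [b] lies in [|z| >= rhol], and [attr] brings the orbit of [b] into [|z| < rhol]
    after [j0] steps; so the orbit never returns to the disc. *)
Lemma deep_orbit c : 0 < c <= 1 / 2 -> exists2 rs : R, 0 < rs & forall rho2 : R, 0 < rho2 <= rs ->
  attr R1 nu a F rho2 (c / 2) -> forall rho1 eps : R, 0 < rho1 -> 0 < eps ->
  exists j j0 n0, forall n, (n0 <= n)%N -> forall v, cone nu a rho1 rho2 c v ->
    (forall k, cmod (iter k (F n) v) < R1 / 2) /\ exists2 rad : R, 0 < rad &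
    [/\ forall z, cmod (z - iter j (F n) v) < rad -> forall k, cmod (iter k (F n) z) < R1 / 2,
        forall k, (j0 <= k)%N -> rad <= cmod (iter k (F n) (iter j (F n) v) - iter j (F n) v) &
        cmod (F n (iter j (F n) v) - iter j (F n) v) <= eps * rad].
Proof.
have R1p := R10; move=> cb; have [rs rs0 HD] := deep HL cb; exists rs => // rho2 r2 HA rho1 eps rho10 eps0.
have [j [n0 [rhol [rl0 H1]]]] := HD rho2 r2 rho1 eps 1 rho10 eps0 ltr01.
have [j0 [n1 H2]] := HA rhol rhol rl0 rl0.
exists j, j0, (maxn n0 n1) => n; rewrite geq_max => /andP[nn0 nn1] v Kv.
have [D1 [rad rad0 [D2 D3 D4]]] := H1 n nn0 v Kv.
set b := iter j (F n) v in D2 D3 *.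
have Kb : cone nu a rhol rho2 (c / 2) b by apply: D2; rewrite subrr cmod0.
split.
  move=> k; case: (leqP k j) => kj; first exact: D1.
  by rewrite -(subnK (ltnW kj)) iterD; have [A _] := H2 n nn1 b Kb; exact: A.
exists rad => //; split=> //.
- by move=> z zr; have [] := H2 n nn1 z (D2 z zr).
- move=> k kj; rewrite leNgt; apply/negP => kr.
  have [A1 _ _] := D2 _ kr; have [_ A2] := H2 n nn1 b Kb.
  by have := A2 k kj; rewrite ltNge A1.
Qed.

(* The function [(F^k z - z_(k+m)) / (z_(k+m+1) - z_(k+m))] omits 0 and 1 on a deep disc. *)
Lemma orbit_steps c : 0 < c <= 1 / 2 -> exists2 rs : R, 0 < rs & forall rho2 : R, 0 < rho2 <= rs ->
  attr R1 nu a F rho2 (c / 2) -> forall M rho1 : R, 0 <= M -> 0 < rho1 ->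
  exists j j0 n0, forall n, (n0 <= n)%N -> forall v, cone nu a rho1 rho2 c v ->
    (forall k, cmod (iter k (F n) v) < R1 / 2) /\
    forall k m, (j <= k)%N -> (j0 <= m)%N ->
    cmod (iter k (F n) v - iter (k + m) (F n) v) <=
      M * cmod (iter (k + m).+1 (F n) v - iter (k + m) (F n) v) ->
    cmod (iter k.+1 (F n) v - iter k (F n) v) <=
      1 / 4 * cmod (iter (k + m).+1 (F n) v - iter (k + m) (F n) v).
Proof.
have R1p := R10; move=> cb; have [rs rs0 HD] := deep_orbit cb; exists rs => // rho2 r2 HA M rho1 M0 rho10.
have q0 : 0 < 1 / 4 :> R by rewrite divr_gt0.
have [epl' epl'0 HLan'] := landau M0 q0.
set epl : R := Num.min epl' (1 / 2).
have epl0 : 0 < epl by rewrite lt_min epl'0; lra.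
have [ep1 ep2] : epl <= epl' /\ epl <= 1 / 2 by apply/andP; rewrite -le_min.
have [j [j0 [n0 H]]] := HD rho2 r2 HA rho1 epl rho10 epl0.
exists j, j0, n0 => n nn v Kv; have [H1 [rad rad0 [D1 D2 D3]]] := H n nn v Kv.
split=> // k m jk jm; set p := iter (k + m) (F n) v; set q := iter (k + m).+1 (F n) v.
have iR i : cmod (iter i (F n) v) < R1 by have := H1 i; lra.
(* If the orbit is stationary at time [k + m], injectivity makes it stationary at time [k] already;
   this case is separated because of the division by [q - p]. *)
have [qp|qp] := eqVneq q p.
  move=> _; rewrite qp subrr cmod0 mulr0.
  suff -> : iter k.+1 (F n) v = iter k (F n) v by rewrite subrr cmod0.
  apply: (@iter_inj n m) => [i _|i _|]; rewrite -!iterD //.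
  by rewrite addnS addnC.
have qp0 : q - p != 0 by rewrite subr_eq0.
have cq : 0 < cmod (q - p) by rewrite cmod_gt0.
set b := iter j (F n) v in D1 D2 D3.
pose f z := (q - p)^-1 * (iter (k - j) (F n) z - p).
have bE i : iter (k - j + i) (F n) b = iter (k + i) (F n) v.
  by rewrite /b -iterD addnAC subnK.
have zR z : cmod (z - b) < rad -> forall i, cmod (iter i (F n) z) < R1.
  by move=> zr i; have := D1 z zr i; lra.
have bb : cmod (b - b) < rad by rewrite subrr cmod0.
have fh : hol b rad f.
  apply: hol_affine; apply: (loc_iter_hol HL) => z zr i _; exact: zR.
(* Equality would force [z = F^i b] by injectivity, and the orbit of [b] has left the disc for
   [i >= j0]. *)
have omit z i : cmod (z - b) < rad -> (j0 <= i)%N -> iter (k - j) (F n) z != iter (k + i) (F n) v.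
  move=> zr ij; apply/eqP => E.
  have : z = iter i (F n) b.
    apply: (@iter_inj n (k - j)) => [h _|h _|]; [exact: zR|by rewrite -iterD; exact: zR|].
    by rewrite E -bE iterD.
  by move=> zE; have := D2 i ij; rewrite leNgt -zE zr.
have fo z : cmod (z - b) < rad -> f z != 0 /\ f z != 1.
  move=> zr; split.
    by rewrite /f mulf_neq0 ?invr_neq0 // subr_eq0; exact: omit.
  apply/eqP => /(congr1 (fun x => (q - p) * x)); rewrite /f mulrA divff // mul1r mulr1.
  by move/(addIr _); apply/eqP; rewrite /q -addnS; apply: omit => //; exact: leqW.
move=> Hk.
have fb : cmod (f b) <= M.
  rewrite /f cmodM cmodV ler_pdivrMl // -[(k - j)%N]addn0 bE addn0 mulrC; exact: Hk.
have D3' : cmod (F n b - b) <= epl' * rad.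
  by apply: le_trans D3 _; rewrite ler_pM2r.
have := HLan' b rad f rad0 fh fo fb _ D3'.
rewrite /f -mulrBr opprB addrA subrK cmodM cmodV ler_pdivrMl // -iterSr iterS.
by rewrite -[(k - j)%N]addn0 bE addn0 mulrC.
Qed.

(** At two late times when the orbit is close to a point [y] that is not fixed, both steps have
    nearly the length [d = |F y - y|], and the two positions differ by at most [d / 8].
    [orbit_steps] with [M = 1] would make the earlier step at most a quarter of the later one. *)
Lemma accum_fixed c : 0 < c <= 1 / 2 -> exists2 rs : R, 0 < rs & forall rho2 : R, 0 < rho2 <= rs ->
  attr R1 nu a F rho2 (c / 2) -> forall rho1 : R, 0 < rho1 ->
  exists n0, forall n, (n0 <= n)%N -> forall v, cone nu a rho1 rho2 c v ->
    forall y, accum (fun k => iter k (F n) v) y -> F n y = y.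
Proof.
have R1p := R10; move=> cb; have [rs rs0 HD] := orbit_steps cb; exists rs => // rho2 r2 HA rho1 rho10.
have [j [j0 [n0 H]]] := HD rho2 r2 HA 1 rho1 ler01 rho10.
exists n0 => n nn v Kv y Hy; have [H1 H2] := H n nn v Kv.
apply/eqP/negPn/negP => yy; have d0 : 0 < cmod (F n y - y) by rewrite cmod_gt0 subr_eq0.
have yR : cmod y < R1.
  have [k _ ky] := Hy (R1 / 2) (divr_gt0 R10 (ltr0Sn R 1)) 0%N.
  have := H1 k; have := lerB_cmod y (y - iter k (F n) v); rewrite subKr (cmodBC y).
  by move: ky; clear; glra.
set d := cmod (F n y - y) in d0 *.
have e0 : 0 < d / 16 by rewrite divr_gt0.
have [k1 jk1 k1y] := Hy _ e0 j.
have [k2 jk2 k2y] := Hy _ e0 (k1 + j0)%N.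
have near k : cmod (iter k (F n) v - y) < d / 16 ->
   `|cmod (iter k.+1 (F n) v - iter k (F n) v) - d| <= 5 / 32 * d.
  move=> ky; set w := iter k (F n) v in ky *; rewrite iterS -/w.
  have wR : cmod w < R1 by have := H1 k; rewrite -/w; lra.
  have L := loc_lipn HL n wR yR.
  have T1 := lerB_cmod (F n w - w) (F n y - y); have T2 := lerB_cmod (F n y - y) (F n w - w).
  have E : (F n w - w) - (F n y - y) = (F n w - F n y) + (y - w) by ring.
  rewrite (cmodBC (F n y - y)) E in T2; rewrite E in T1.
  have := cmodD (F n w - F n y) (y - w); rewrite (cmodBC y) => T3.
  rewrite -/d in T1 T2; rewrite ler_norml; move: T1 T2 T3 L ky; clearbody d; clear.
  by move=> *; apply/andP; split; glra.
have := near k1 k1y; have := near k2 k2y; rewrite !ler_norml => /andP[A1 A2] /andP[B1 B2].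
have ek : k2 = (k1 + (k2 - k1))%N by rewrite subnKC // (leq_trans _ jk2) // leq_addr.
have jm : (j0 <= k2 - k1)%N by rewrite leq_subRL ?(leq_trans _ jk2) // leq_addr.
have := H2 k1 (k2 - k1)%N jk1 jm; rewrite -ek.
have T := cmodBtri y (iter k1 (F n) v) (iter k2 (F n) v).
rewrite (cmodBC y) in T.
move=> X; have {}X := X ltac:(move: T k1y k2y A1 d0; clearbody d; clear; glra).
by move: X A2 B1 d0; clearbody d; clear; glra.
Qed.

(** Landau's theorem takes the place of Cauchy's estimate: iterates bounded by [R1 / 2] on a disc
    are mapped by [1 / 2 + x / (4 * R1)] to functions that stay near [1 / 2] and so omit 0 and 1. *)
Lemma orbit_equicont c : 0 < c <= 1 / 2 -> exists2 rs : R, 0 < rs & forall rho2 : R, 0 < rho2 <= rs ->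
  attr R1 nu a F rho2 (c / 2) -> forall rho1 : R, 0 < rho1 ->
  exists n0, forall n, (n0 <= n)%N -> forall v, cone nu a rho1 rho2 c v ->
    (forall k, cmod (iter k (F n) v) < R1 / 2) /\
    forall e : R, 0 < e -> exists2 del : R, 0 < del & forall z, cmod (z - v) < del ->
      forall k, cmod (iter k (F n) z - iter k (F n) v) < e.
Proof.
have R1p := R10; move=> cb; have [rs rs0 HD] := deep_orbit cb; exists rs => // rho2 r2 HA rho1 rho10.
have [j [j0 [n0 H]]] := HD rho2 r2 HA rho1 1 rho10 ltr01.
exists n0 => n nn v Kv; have [H1 [rad rad0 [D1 _ _]]] := H n nn v Kv; split=> // e e0.
have iR i : cmod (iter i (F n) v) < R1 by have := H1 i; lra.
set b := iter j (F n) v in D1.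
have e1 : 0 < e / (9 * R1) by rewrite divr_gt0 // mulr_gt0.
have [epl epl0 HLan] := landau ler01 e1.
have e2 : 0 < Num.min e (Num.min rad (epl * rad)) by rewrite !lt_min e0 rad0 mulr_gt0.
have [del del0 Hd] := iter_cont (fun i (_ : (i < j)%N) => iR i) e2.
exists del => // z zd k; case: (leqP k j) => kj.
  by apply: lt_le_trans (Hd z zd k kj) _; rewrite ge_min lexx.
have := Hd z zd j (leqnn j); rewrite !lt_min -/b => /andP[_ /andP[z1 z2]].
rewrite -(subnK (ltnW kj)) !iterD -/b; set w := iter j (F n) z in z1 z2 *.
set i := (k - j)%N.
have h0 : 4 * R1 != 0 by rewrite gt_eqF // mulr_gt0.
have cR : cmod ((((4 * R1)^-1 : R)%:C)%C : C R) = (4 * R1)^-1.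
  by rewrite cmodR ger0_norm // invr_ge0 mulr_ge0 // ltW.
pose f x : C R := (((4 * R1)^-1 : R)%:C)%C * (iter i (F n) x - (((- 2 * R1) : R)%:C)%C).
have fh : hol b rad f.
  by apply: hol_affine; apply: (loc_iter_hol HL) => x xr h _; have := D1 x xr h; lra.
have fE x : f x - 1 / 2 = (((4 * R1)^-1 : R)%:C)%C * iter i (F n) x.
  have e3 : (1 / 2 : C R) = (((4 * R1)^-1 * (2 * R1) : R)%:C)%C.
    have -> : (4 * R1)^-1 * (2 * R1) = 1 / 2 :> R by field; rewrite gt_eqF.
    by rewrite fmorph_div rmorph1 rmorphMn.
  have e4 : (((- 2 * R1) : R)%:C)%C = - ((2 * R1 : R)%:C)%C :> C R by rewrite mulNr rmorphN.
  rewrite e3 /f e4; move: ((4 * R1)^-1) (2 * R1) => s t; case: (iter i _ x) => p q.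
  by apply/eqP; rewrite eq_complex /=; apply/andP; split; apply/eqP; ring.
have fS x : cmod (x - b) < rad -> cmod (f x - 1 / 2) < 1 / 4.
  move=> xr; rewrite fE cmodM cR ltr_pdivrMl ?mulr_gt0 //.
  by have := D1 x xr i; lra.
have c2 : cmod (1 / 2 : C R) = 1 / 2.
  have -> : (1 / 2 : C R) = ((1 / 2 : R)%:C)%C by rewrite fmorph_div rmorph1 rmorphMn.
  by rewrite cmodR ger0_norm //; lra.
have fo x : cmod (x - b) < rad -> f x != 0 /\ f x != 1.
  move=> xr; have := fS x xr => S; split; apply/eqP => E; move: S; rewrite E.
    by rewrite sub0r cmodN c2; lra.
  have -> : 1 - 1 / 2 = 1 / 2 :> C R by field.
  by rewrite c2; lra.
have fb : cmod (f b) <= 1.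
  have bb : cmod (b - b) < rad by rewrite subrr cmod0.
  have := cmodD (f b - 1 / 2) (1 / 2); rewrite subrK c2; have := fS b bb; lra.
have := HLan b rad f rad0 fh fo fb w (ltW z2).
have -> : f w - f b = (((4 * R1)^-1 : R)%:C)%C * (iter i (F n) w - iter i (F n) b).
  by rewrite /f -mulrBr; congr (_ * _); ring.
rewrite cmodM cR ler_pdivrMl ?mulr_gt0 // => X; apply: le_lt_trans X _.
have -> : 4 * R1 * (e / (9 * R1)) = 4 / 9 * e by field; rewrite gt_eqF.
by rewrite gtr_pMl //; lra.
Qed.
End ORBITS.

(** * Powers of a multiplier after one turn *)

Section TURN. Variable R : realType.
Local Opaque cmod.
Implicit Types (x t : R).

Lemma pow_near1 (r t : R) N : `|r - 1| <= t -> N%:R * t <= 1 / 2 -> `|r ^+ N - 1| <= 2 * (N%:R * t).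
Proof.
move=> rt; have t0 : 0 <= t := le_trans (normr_ge0 _) rt.
elim: N => [|N IH] Nt; first by rewrite expr0 subrr normr0 mul0r mulr0.
have E : N.+1%:R * t = N%:R * t + t by rewrite -natr1 mulrDl mul1r.
have Np : 0 <= N%:R * t by rewrite mulr_ge0.
rewrite E in Nt *; have {}IH := IH ltac:(lra).
have -> : r ^+ N.+1 - 1 = (r - 1) * (r ^+ N - 1) + (r ^+ N - 1) + (r - 1) by rewrite exprS; ring.
have P : `|r - 1| * `|r ^+ N - 1| <= t * 1.
  by apply: ler_pM => //; apply: le_trans IH _; lra.
have := ler_normD ((r - 1) * (r ^+ N - 1) + (r ^+ N - 1)) (r - 1).
have := ler_normD ((r - 1) * (r ^+ N - 1)) (r ^+ N - 1); rewrite normrM.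
lra.
Qed.

Lemma atan_ub x : 0 <= x -> atan x <= x.
Proof.
move=> x0; have := @mean_value_le R atan (fun x => (1 + x ^+ 2)^-1) 1 x x0 (fun t _ => is_derive1_atan t).
rewrite atan0 subr0 mul1r; apply => t _; rewrite invf_le1 ?lerDl ?sqr_ge0 //.
by rewrite ltr_pwDl // sqr_ge0.
Qed.

Lemma sin_ub x : 0 <= x -> sin x <= x.
Proof.
move=> x0; have := @mean_value_le R sin cos 1 x x0 (fun t _ => is_derive_sin t).
by rewrite sin0 subr0 mul1r; apply => t _; exact: cos_le1.
Qed.

Lemma sin_lb x : 0 <= x -> - x <= sin x.
Proof.
move=> x0; have D t : is_derive t 1 (fun t : R => - sin t) (- cos t) by apply: is_deriveN.
have := @mean_value_le R (fun t => - sin t) (fun t => - cos t) 1 x x0 (fun t _ => D t).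
rewrite sin0 mul1r oppr0 subr0 => H; rewrite lerNl; apply: H => t _.
by rewrite lerNl; exact: cos_geN1.
Qed.

Lemma cos_lb x : 0 <= x -> 1 - x <= cos x.
Proof.
move=> x0; have D t : is_derive t 1 (fun t : R => - cos t) (sin t).
  by rewrite -[sin t]opprK; apply: is_deriveN.
have := @mean_value_le R (fun t => - cos t) sin 1 x x0 (fun t _ => D t).
rewrite cos0 mul1r opprK => H; have := H (fun t _ => sin_le1 t); lra.
Qed.

Lemma de_moivre (r t : R) N : (Complex (r * cos t) (r * sin t) : C R) ^+ N =
  Complex (r ^+ N * cos (N%:R * t)) (r ^+ N * sin (N%:R * t)).
Proof.
elim: N => [|N IH]; first by rewrite !expr0 mul0r cos0 sin0 mulr0 mulr1.
rewrite exprS IH -natr1 mulrDl mul1r cosD sinD exprS.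
by apply/eqP; rewrite eq_complex /=; apply/andP; split; apply/eqP; ring.
Qed.

Lemma cmod_polar (r t : R) : 0 <= r -> cmod (Complex (r * cos t) (r * sin t) : C R) = r.
Proof.
move=> r0; apply/eqP; rewrite -(eqrXn2 (ltn0Sn 1)) ?cmod_ge0 // cmodE /=.
by rewrite !exprMn -mulrDr cos2Dsin2 mulr1.
Qed.

(** Let [lam] have modulus [r] and argument [th], and let [d = |1 - lam|]. The hypothesis gives
    [|r^2 - 1| <= K d^2], while [th] lies between [d / 5] and [2 d]. After [N] steps, with [N] of
    order [1 / d], the argument exceeds [2 pi] by at most [th] and the modulus has changed by [O(d)]
    only. *)
Let one_turn_up (M : R) : 0 <= M -> exists2 M2 : R, 0 <= M2 & forall j0 : nat, exists2 eps : R, 0 < eps &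
  forall lam : C R, lam != 1 -> cmod (1 - lam) < eps -> `|complex.Re (1 - lam)| <= M * cmod (1 - lam) ^+ 2 ->
  0 <= complex.Im lam ->
  exists2 N : nat, (j0 <= N)%N & 1 / 2 <= cmod (lam ^+ N) <= 2 /\ cmod (1 - lam ^+ N) <= M2 * cmod (1 - lam).
Proof.
move=> M0; set K : R := 2 * M + 1; exists (8 + 82 * K) => [|j0]; first by rewrite /K; lra.
have K1 : 1 <= K by rewrite /K; lra.
have J0 : 0 < 2 / j0.+1%:R :> R by rewrite divr_gt0.
have K0 : 0 < (200 * K)^-1 by rewrite invr_gt0; lra.
exists (Num.min (2 / j0.+1%:R) (200 * K)^-1) => [|lam l1]; first by rewrite lt_min J0.
rewrite lt_min => /andP[d1 d2] Hre Him.
have d0 : 0 < cmod (1 - lam) by rewrite cmod_gt0 subr_eq0 eq_sym.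
have dK : cmod (1 - lam) * K < 1 / 200.
  have : cmod (1 - lam) * K < (200 * K)^-1 * K by rewrite ltr_pM2r //; lra.
  by have -> : (200 * K)^-1 * K = 1 / 200 by field; rewrite gt_eqF //; lra.
have Ed := cmodE (1 - lam).
set d := cmod (1 - lam) in d0 d1 d2 dK Hre Ed *.
case: lam l1 d d0 d1 d2 dK Hre Him Ed => p q /= l1 d d0 d1 d2 dK Hre q0 Ed.
rewrite sub0r sqrrN in Ed.
have dd : d < 1 / 200.
  by have : d * 1 <= d * K by [rewrite ler_pM2l]; lra.
have Md : M * d ^+ 2 <= 1 / 40 * d.
  have -> : M * d ^+ 2 = (d * M) * d by ring.
  rewrite ler_pM2r //; have : d * (2 * M) <= d * K by rewrite ler_pM2l // /K; lra.
  lra.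
have [p1 p2] : 1 - p <= 1 / 40 * d /\ p - 1 <= 1 / 40 * d.
  by move: Hre; rewrite ler_norml => /andP[]; lra.
have sq (s t : R) : 0 <= s -> 0 <= t -> s ^+ 2 <= t ^+ 2 -> s <= t by move=> s0 t0; rewrite ler_sqr ?nnegrE.
have qd : q <= d.
  by apply: sq => //; [exact: ltW|rewrite Ed lerDr; exact: sqr_ge0].
have dq : 1 / 2 * d <= q.
  apply: sq => //; first by lra.
  have : 0 <= (1 / 2 * d - (1 - p)) * (1 / 2 * d + (1 - p)) by apply: mulr_ge0; lra.
  have -> : (1 / 2 * d - (1 - p)) * (1 / 2 * d + (1 - p)) = 1 / 4 * d ^+ 2 - (1 - p) ^+ 2 by field.
  have -> : (1 / 2 * d) ^+ 2 = 1 / 4 * d ^+ 2 by field.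
  have := sqr_ge0 d; move: Ed; set D : R := d ^+ 2; set P : R := (1 - p) ^+ 2; set Q : R := q ^+ 2.
  by clearbody D P Q; lra.
have pp : 0 < p by lra.
set x := q / p.
have xd : x <= 2 * d by rewrite ler_pdivrMr //; have : 2 * d * (1/2) <= 2 * d * p by [rewrite ler_pM2l; lra]; lra.
have dx : 2 / 5 * d <= x by rewrite ler_pdivlMr //; have : 2 / 5 * d * p <= 2 / 5 * d * (5 / 4) by [rewrite ler_pM2l; lra]; lra.
have x0 : 0 < x by lra.
set S := Num.sqrt (1 + x ^+ 2).
have S2 : S ^+ 2 = 1 + x ^+ 2 by rewrite sqr_sqrtr // addr_ge0 // sqr_ge0.
have S0 : 0 < S by rewrite sqrtr_gt0 ltr_pwDl // sqr_ge0.
have S1 : S <= 2.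
  apply: sq; [exact: ltW|by []|rewrite S2].
  have : x ^+ 2 <= 1 ^+ 2 by rewrite ler_sqr ?nnegrE; lra.
  by rewrite expr1n; lra.
set th := atan x.
have cth : cos th = S^-1 by exact: cos_atan.
have sth : sin th = x / S.
  have : tan th = x by exact: atanK.
  rewrite /tan cth => <-; by field; rewrite gt_eqF.
have thx : th <= x by apply: atan_ub; exact: ltW.
have th0 : 0 <= th by rewrite /th -(atan0 R); apply: le_atan; exact: ltW.
have thd : 1 / 5 * d <= th.
  apply: le_trans (sin_ub th0); rewrite sth ler_pdivlMr //.
  have : 1 / 5 * d * S <= 1 / 5 * d * 2 by rewrite ler_pM2l //; lra.
  by lra.
have thp : 0 < th by lra.
set r := p * S; have r0 : 0 < r by rewrite mulr_gt0.
have lE : (Complex p q : C R) = Complex (r * cos th) (r * sin th).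
  rewrite cth sth /r /x; congr Complex; by field; rewrite !gt_eqF.
have tp : 0 <= 2 * pi / th by rewrite divr_ge0 // mulr_ge0 // pi_ge0.
have [N1 N2] : 2 * pi / th < (Num.truncn (2 * pi / th)).+1%:R /\
    (Num.truncn (2 * pi / th)).+1%:R <= 2 * pi / th + 1.
  by rewrite truncnS_gt -natr1 lerD2r truncn_le.
set N := (Num.truncn (2 * pi / th)).+1 in N1 N2.
have n1 : 2 * pi < N%:R * th by rewrite -ltr_pdivrMr.
have n2 : N%:R * th <= 2 * pi + th.
  have -> : 2 * pi + th = (2 * pi / th + 1) * th by field; rewrite gt_eqF.
  by rewrite ler_pM2r.
clearbody N.
set ph := N%:R * th - 2 * pi.
have [ph0 ph1] : 0 <= ph /\ ph <= 2 * d by rewrite /ph; clear - n1 n2 thx xd; lra.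
have Eph : N%:R * th = ph + pi *+ 2 by rewrite /ph -mulr_natl; ring.
have [cph sph] : cos (N%:R * th) = cos ph /\ sin (N%:R * th) = sin ph.
  by rewrite Eph cosD2pi sinD2pi.
have pi4 : 2 * pi < 8 :> R by have := pihalf_lt2 R; lra.
(* From [N d / 5 <= N th <= 2 pi + th < 8 + 2 d]. The term [82 K] of the bound is [2 * 41 * K]. *)
have Nd : N%:R * d <= 41.
  have : N%:R * (1 / 5 * d) <= N%:R * th by rewrite ler_wpM2l.
  clear - n2 pi4 thx xd dd; lra.
have r1 : `|r ^+ 2 - 1| <= K * d ^+ 2.
  have -> : r ^+ 2 - 1 = 2 * (p - 1) + d ^+ 2.
    rewrite /r exprMn S2 /x Ed; by field; rewrite gt_eqF.
  apply: le_trans (ler_normD _ _) _; rewrite normrM (ger0_norm (sqr_ge0 d)) /K distrC.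
  by have -> : `|2 : R| = 2 by [rewrite ger0_norm]; clear - Hre; lra.
have Nt : N%:R * (K * d ^+ 2) <= 41 * (d * K).
  have -> : N%:R * (K * d ^+ 2) = N%:R * d * (d * K) by ring.
  by rewrite ler_wpM2r // mulr_ge0 //; clear - d0 K1; lra.
have Nh : N%:R * (K * d ^+ 2) <= 1 / 2 by clear - Nt dK; lra.
have := pow_near1 (N := N) r1 Nh => rN.
have rp : 0 < r ^+ N by rewrite exprn_gt0.
have rN1 : `|r ^+ N - 1| <= `|(r ^+ 2) ^+ N - 1|.
  have -> : (r ^+ 2) ^+ N - 1 = (r ^+ N - 1) * (r ^+ N + 1) by rewrite -exprM mulnC exprM; ring.
  rewrite normrM ler_peMr // (ger0_norm (_ : 0 <= r ^+ N + 1)); clear - rp; lra.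
have rN2 : `|r ^+ N - 1| <= 82 * (d * K) by lra.
have rN3 : `|r ^+ N - 1| <= 1 / 2 by clear - rN2 dK; lra.
exists N.
  rewrite -(ler_nat R); apply: le_trans (ltW N1).
  have : j0%:R * th <= 2 * pi.
    have : d * j0.+1%:R < 2 by rewrite -ltr_pdivlMr.
    have : j0%:R * th <= j0.+1%:R * (2 * d) by apply: ler_pM => //; [rewrite ler_nat|clear - thx xd; lra].
    by have := pi_ge2 R; lra.
  by rewrite ler_pdivlMr.
rewrite lE de_moivre (cmod_polar _ (ltW rp)); split.
  by move: rN3; rewrite ler_norml => /andP[]; lra.
rewrite cph sph; set u : C R := Complex (cos ph) (sin ph).
have -> : (Complex (r ^+ N * cos ph) (r ^+ N * sin ph) : C R) = ((r ^+ N)%:C)%C * u.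
  by apply/eqP; rewrite eq_complex /=; apply/andP; split; apply/eqP; ring.
have -> : 1 - ((r ^+ N)%:C)%C * u = (1 - ((r ^+ N)%:C)%C) + ((r ^+ N)%:C)%C * (1 - u) by ring.
apply: le_trans (cmodD _ _) _; rewrite cmodM cmodR (ger0_norm (ltW rp)).
have -> : cmod (1 - ((r ^+ N)%:C)%C) = `|r ^+ N - 1|.
  by rewrite -[1 - _]opprB cmodN -(rmorph1 (real_complex R)) -rmorphB cmodR.
have u1 : cmod (1 - u) <= 4 * d.
  apply: le_trans (cmod_ReIm _) _; rewrite /u /= sub0r normrN.
  have -> : `|1 - cos ph| = 1 - cos ph by rewrite ger0_norm // subr_ge0 cos_le1.
  have := cos_lb ph0; have := sin_ub ph0; have := sin_lb ph0.
  move=> s1 s2 c1; have : `|sin ph| <= ph by rewrite ler_norml s1 s2.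
  lra.
have : r ^+ N * cmod (1 - u) <= 2 * (4 * d).
  by apply: ler_pM => //; [exact: ltW|exact: cmod_ge0|move: rN3; rewrite ler_norml => /andP[]; clear -R; lra].
lra.
Qed.

(* [N] is the number of steps of one turn around the fixed point. *)
Lemma one_turn (M : R) : 0 <= M -> exists2 M2 : R, 0 <= M2 & forall j0 : nat, exists2 eps : R, 0 < eps &
  forall lam : C R, lam != 1 -> cmod (1 - lam) < eps -> `|complex.Re (1 - lam)^-1| <= M ->
  exists2 N : nat, (j0 <= N)%N & 1 / 2 <= cmod (lam ^+ N) <= 2 /\ cmod (1 - lam ^+ N) <= M2 * cmod (1 - lam).
Proof.
move=> M0; have [M2 M20 H] := one_turn_up M0; exists M2 => // j0.
have [eps eps0 He] := H j0; exists eps => // lam l1 le HM.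
have cj z : cmod (conjc z : C R) = cmod z.
  apply/eqP; rewrite -(eqrXn2 (ltn0Sn 1)) ?cmod_ge0 // !cmodE.
  by case: z => s t /=; rewrite sqrrN.
have d0 : 0 < cmod (1 - lam) by rewrite cmod_gt0 subr_eq0 eq_sym.
(* [Re (1 / w) = Re w / |w|^2] for [w = 1 - lam]. The case [Im lam < 0] follows by conjugation. *)
have Hre : `|complex.Re (1 - lam)| <= M * cmod (1 - lam) ^+ 2.
  rewrite mulrC -ler_pdivrMl ?exprn_gt0 //; apply: le_trans HM.
  rewrite -(ger0_norm (_ : 0 <= (cmod (1 - lam) ^+ 2)^-1)) ?invr_ge0 ?exprn_ge0 ?cmod_ge0 // -normrM.
  rewrite cmodE; case: (1 - lam) => s t /=.
  by rewrite mulrC.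
case: (lerP 0 (complex.Im lam)) => [|Him]; first exact: He.
have e1 : 1 - conjc lam = conjc (1 - lam) :> C R by rewrite rmorphB rmorph1.
have [||||N jN] := He (conjc lam).
- by rewrite -(inj_eq (can_inj (@conjcK R))) conjcK rmorph1.
- by rewrite e1 cj.
- by rewrite e1 cj; move: Hre; case: (1 - lam).
- by move: Him; case: (lam) => s t /=; lra.
rewrite -rmorphXn cj => -[N1 N2]; exists N => //; split=> //.
move: N2; rewrite e1 cj.
have -> : 1 - conjc (lam ^+ N) = conjc (1 - lam ^+ N) :> C R by rewrite rmorphB rmorph1.
by rewrite cj.
Qed.
End TURN.

(** * Orbits of the cones do not accumulate at the given fixed point *)

Section NOACC. Variable R : realType.
Local Opaque upl upm cmod.
Implicit Types (z w v b : C R) (c e : R).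

Lemma cder_iter (f : C R -> C R) z l : f z = z -> cder f z l -> forall k, cder (iter k f) z (l ^+ k).
Proof.
move=> fz fl; have itz k : iter k f z = z by elim: k => //= k ->.
elim=> [|k IH]; first exact: cder_id.
by rewrite exprS; apply: (cder_comp (f := f) (g := iter k f)) IH _; rewrite itz.
Qed.

Lemma cone_sub nu (a : C R) (rho1 rho2 c c' : R) z : c' <= c -> cone nu a rho1 rho2 c z -> cone nu a rho1 rho2 c' z.
Proof.
move=> cc [h1 h2 h3]; split=> //; apply: le_trans h3; by apply: ler_wpM2r; [exact: cmod_ge0|].
Qed.

Variables (R1 : R) (nu : nat) (a : C R) (F : nat -> C R -> C R) (F0 : C R -> C R).
Hypothesis HL : loc R1 nu a F F0.

(** Near the fixed point [x], write [w = z - x] and [q = |1 - l| |w|]. One turn brings [z] to [z1]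
    with [|z - z1| = O(q)], and the steps at [z] and at [z1] are comparable with [q]. So
    [orbit_steps] applies with a fixed [M] and bounds the step at [z] by [33/64 q], although it is
    at least [31/32 q]. *)
Lemma no_accum c : 0 < c <= 1 / 2 -> exists2 rs : R, 0 < rs & forall rho2 : R, 0 < rho2 <= rs ->
  attr R1 nu a F rho2 (c / 2) -> forall M rho1 : R, 0 <= M -> 0 < rho1 ->
  exists n0, exists2 eps : R, 0 < eps & forall n, (n0 <= n)%N -> forall v, cone nu a rho1 rho2 c v ->
    forall z l, F n z = z -> cder (F n) z l -> l != 1 -> cmod (1 - l) < eps ->
    `|complex.Re (1 - l)^-1| <= M -> ~ accum (fun k => iter k (F n) v) z.
Proof.
have R10 := loc_R1 HL; move=> cb; have [rs rs0 HD] := orbit_steps HL cb; exists rs => // rho2 r2 HA M rho1 M0 rho10.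
have [M2 M20 HM] := one_turn M0.
have M40 : 0 <= 4 * (M2 + 1) by lra.
have [j [j0 [n0 H]]] := HD rho2 r2 HA _ rho1 M40 rho10.
have [j1 [n1 H1]] := HA rho1 rho1 rho10 rho10.
have [eps eps0 He] := HM j0.
exists (maxn n0 n1), eps => // n; rewrite geq_max => /andP[nn0 nn1] v Kv x l Fx Fl l1 le lM acc.
have [N jN [/andP[N1 N2] N3]] := He l l1 le lM.
have [vR step] := H n nn0 v Kv.
have vR1 i : cmod (iter i (F n) v) < R1 by have := vR i; lra.
have xR : cmod x < R1.
  have h : 0 < R1 / 2 by lra.
  have [k _ kx] := acc _ h 0%N; have := vR k; have := lerB_cmod x (x - iter k (F n) v).
  by rewrite subKr (cmodBC x); move: kx; clear; glra.
have itx k : iter k (F n) x = x by elim: k => //= k ->.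
(* By injectivity an orbit through [x] starts at [x] and is constant, whereas [attr] brings [v]
   below its own modulus. *)
have zx k : iter k (F n) v != x.
  apply/eqP => E; have vx : v = x.
    by apply: (iter_inj HL (n := n) (k := k)) => [i _|i _|]; rewrite ?itx ?E.
  have Kv' : cone nu a rho1 rho2 (c / 2) v by apply: cone_sub Kv; lra.
  have [_ A] := H1 n nn1 v Kv'; have := A j1 (leqnn _).
  by rewrite vx itx; case: Kv; rewrite vx leNgt => /negP.
have d0 : 0 < cmod (1 - l) by rewrite cmod_gt0 subr_eq0 eq_sym.
have e0 : 0 < cmod (1 - l) / 32 by rewrite divr_gt0.
have D k := cder_iter Fx Fl k.
have [dl1 p1 E1] := D N _ e0; have [dl2 p2 E2] := D N.+1 _ e0; have [dl3 p3 E3] := Fl _ e0.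
have p0 : 0 < Num.min dl1 (Num.min dl2 dl3) by rewrite !lt_min p1 p2.
have [k jk] := acc _ p0 j; rewrite !lt_min => /andP[k1 /andP[k2 k3]].
set z := iter k (F n) v in k1 k2 k3.
have {}E1 := E1 _ k1; have {}E2 := E2 _ k2; have {}E3 := E3 _ k3.
rewrite !(addrC x) subrK !itx ?Fx in E1 E2 E3.
have EN i : iter i (F n) z = iter (k + i) (F n) v by rewrite /z -iterD addnC.
rewrite !EN addnS in E1 E2.
have S := step k N jk jN; rewrite !iterS -/z in S.
rewrite !iterS in E2.
set z1 := iter (k + N) (F n) v in S E1 E2.
set w := z - x in k1 k2 k3 E1 E2 E3.
have w0 : 0 < cmod w by rewrite cmod_gt0 subr_eq0 zx.
have A1 : cmod (z - z1) <= (M2 + 1 / 32) * (cmod (1 - l) * cmod w).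
  have -> : z - z1 = (1 - l ^+ N) * w - (z1 - x - l ^+ N * w) by rewrite /w; ring.
  apply: le_trans (cmodB _ _) _; rewrite cmodM.
  have : cmod (1 - l ^+ N) * cmod w <= M2 * cmod (1 - l) * cmod w by rewrite ler_wpM2r ?cmod_ge0.
  by move: E1; clear; lra.
have eE : F n z1 - z1 = l ^+ N * (l - 1) * w + ((F n z1 - x - l ^+ N.+1 * w) - (z1 - x - l ^+ N * w)).
  by rewrite exprS; ring.
set err := (F n z1 - x - l ^+ N.+1 * w) - (z1 - x - l ^+ N * w) in eE.
have err1 : cmod err <= 1 / 16 * (cmod (1 - l) * cmod w).
  by apply: le_trans (cmodB _ _) _; move: E1 E2; clear; lra.
have main : cmod (l ^+ N * (l - 1) * w) = cmod (l ^+ N) * (cmod (1 - l) * cmod w).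
  by rewrite !cmodM (cmodBC l) mulrA.
have q0 : 0 < cmod (1 - l) * cmod w by rewrite mulr_gt0.
have A2 : 7 / 16 * (cmod (1 - l) * cmod w) <= cmod (F n z1 - z1).
  have := lerB_cmod (l ^+ N * (l - 1) * w) (- err); rewrite opprK -eE cmodN main.
  have : 1 / 2 * (cmod (1 - l) * cmod w) <= cmod (l ^+ N) * (cmod (1 - l) * cmod w) by rewrite ler_pM2r.
  by move: err1; clear; lra.
have A3 : cmod (F n z1 - z1) <= (2 + 1 / 16) * (cmod (1 - l) * cmod w).
  have := cmodD (l ^+ N * (l - 1) * w) err; rewrite -eE main.
  have : cmod (l ^+ N) * (cmod (1 - l) * cmod w) <= 2 * (cmod (1 - l) * cmod w) by rewrite ler_pM2r.
  by move: err1; clear; lra.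
have A4 : 31 / 32 * (cmod (1 - l) * cmod w) <= cmod (F n z - z).
  have e4 : F n z - z = (l - 1) * w + (F n z - x - l * w) by rewrite /w; ring.
  have := lerB_cmod ((l - 1) * w) (- (F n z - x - l * w)); rewrite opprK -e4 cmodN cmodM (cmodBC l).
  by move: E3; clear; lra.
move: S; set q := cmod (1 - l) * cmod w in q0 A1 A2 A3 A4 *.
have A5 : cmod (z - z1) <= 4 * (M2 + 1) * cmod (F n z1 - z1).
  have : 4 * (M2 + 1) * (7 / 16 * q) <= 4 * (M2 + 1) * cmod (F n z1 - z1) by rewrite ler_wpM2l.
  have : 0 <= M2 * q by rewrite mulr_ge0 // ltW.
  by move: A1 q0; clearbody q; clear; glra.
by move/(_ A5); move: A3 A4 q0; clearbody q; clear; glra.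
Qed.
End NOACC.

(** * Points moved inwards lie in the attracting cone *)

Section HALF. Variable R : realType.
Local Opaque cmod.

(** [U v] is a positive multiple of minus the conjugate of [p = a v^nu]. If [|Im p| >= 5/8 |p|],
    then [- Re p + |Im p|] is at least [(5/8 - 1/8) |p|]; otherwise [|Re p| > |p| / 2], and the
    hypothesis leaves only the sign for which [- Re p] alone suffices. *)
Lemma upm_half nu (a v : C R) : (0 < nu)%N -> a != 0 -> v != 0 ->
  complex.Re (a * v ^+ nu) <= 1 / 8 * cmod (a * v ^+ nu) -> 1 / 2 * cmod (upl nu a v) <= upm nu a v.
Proof.
move=> n0 a0 v0; rewrite /upm /upl; set p := a * v ^+ nu.
have p0 : p != 0 by rewrite mulf_neq0 // expf_neq0.
clearbody p; have h0 : 0 < cmod p by rewrite cmod_gt0.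
have k0 : 0 < (nu%:R * cmod p ^+ 2)^-1 by rewrite invr_gt0 mulr_gt0 ?ltr0n ?exprn_gt0.
have E : - (nu%:R * p)^-1 = - (conjc p * (((nu%:R * cmod p ^+ 2)^-1 : R)%:C)%C) :> C R.
  congr (- _); have n1 : (nu%:R : C R) != 0 by rewrite pnatr_eq0 -lt0n.
  have e1 : p * conjc p = ((cmod p ^+ 2)%:C)%C.
    by rewrite cmodE; case: p {p0 h0 k0} => s t; apply/eqP; rewrite eq_complex /=; apply/andP; split; apply/eqP; ring.
  have c0 : conjc p != 0 by rewrite fmorph_eq0.
  have e2 (s : R) : ((((nu%:R * s)^-1 : R))%:C)%C = (nu%:R * (s%:C)%C)^-1 :> C R.
    by rewrite (fmorphV (real_complex R)) (rmorphM (real_complex R)) (rmorph_nat (real_complex R)).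
  by rewrite e2 -e1; field; rewrite n1 c0 p0.
move: E k0; set k : R := (nu%:R * _)^-1 => E k0; clearbody k.
rewrite E cmodN cmodM (cmodR k) (ger0_norm (ltW k0)) cReN cImN normrN.
have -> : cmod (conjc p) = cmod p.
  apply/eqP; rewrite -(eqrXn2 (ltn0Sn 1)) ?cmod_ge0 // !cmodE.
  by case: p {p0 h0 k0 E} => s t /=; rewrite sqrrN.
rewrite cReMr cImM /= mulr0 add0r normrM (ger0_norm (ltW k0)).
have := cmodE p; have := cmod_ge0 p.
set h : R := cmod p; clearbody h.
case: p {p0 h0 E} => x y /= hp He xh; rewrite normrN mulrA.
rewrite -mulNr -mulrDl ler_pM2r //.
have [y0|y0] := lerP (5 / 8 * h) `|y|; first by lra.
have y2 : y ^+ 2 <= 25 / 64 * h ^+ 2.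
  rewrite -real_normK ?num_real //; have -> : 25 / 64 * h ^+ 2 = (5 / 8 * h) ^+ 2 by field.
  by rewrite lerXn2r ?nnegrE //; lra.
have xx : 39 / 64 * h ^+ 2 <= x ^+ 2 by lra.
case: (lerP 0 x) => x0.
  have : x ^+ 2 <= (1 / 8 * h) ^+ 2 by rewrite lerXn2r ?nnegrE //; lra.
  have -> : (1 / 8 * h) ^+ 2 = 1 / 64 * h ^+ 2 by field.
  move=> xl; have h2 : h ^+ 2 <= 0 by lra.
  have : h = 0 by apply/eqP; rewrite -sqrf_eq0 eq_le h2 sqr_ge0.
  by have := normr_ge0 y; lra.
suff : 1 / 2 * h <= - x by have := normr_ge0 y; lra.
rewrite -(ler_sqr (x := 1 / 2 * h)) ?nnegrE; [|lra|lra].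
by rewrite sqrrN exprMn; have := sqr_ge0 h; lra.
Qed.

End HALF.

Section EXIT. Variable R : realType.
Local Opaque upl upm cmod.
Implicit Types (z w v b : C R) (c e : R).

Lemma cpow_near1 (x : C R) (t : R) N : cmod x <= t -> N%:R * t <= 1 / 2 -> cmod ((1 + x) ^+ N - 1) <= 2 * (N%:R * t).
Proof.
move=> rt; have t0 : 0 <= t := le_trans (cmod_ge0 _) rt.
elim: N => [|N IH] Nt; first by rewrite expr0 subrr cmod0 mul0r mulr0.
have E : N.+1%:R * t = N%:R * t + t by rewrite -natr1 mulrDl mul1r.
have Np : 0 <= N%:R * t by rewrite mulr_ge0.
rewrite E in Nt *; have {}IH := IH ltac:(lra).
have -> : (1 + x) ^+ N.+1 - 1 = (x * ((1 + x) ^+ N - 1) + ((1 + x) ^+ N - 1)) + x by rewrite exprS; ring.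
set y := (1 + x) ^+ N - 1 in IH *.
have P : cmod x * cmod y <= t * 1.
  by apply: ler_pM => //; [exact: cmod_ge0|exact: cmod_ge0|]; apply: le_trans IH _; lra.
have := cmodD (x * y + y) x; have := cmodD (x * y) y; rewrite cmodM.
by move: P IH rt; clearbody y; clear -R; lra.
Qed.

Variables (R1 : R) (nu : nat) (a : C R) (F : nat -> C R -> C R) (F0 : C R -> C R).
Hypothesis HL : loc R1 nu a F F0.

(** [F n v] is [v (1 + p)] with [p = a v^nu], up to [|v p| / 8]: half of this error comes from
    [F n - F0], half from [loc_asym]. Then [|1 + p| <= 1 + |p| / 8], and squaring gives
    [Re p <= |p| / 8]. *)
Lemma exit_cone (r1 : R) : 0 < r1 -> exists n0, forall n, (n0 <= n)%N -> forall v,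
  r1 <= cmod v -> cmod v < R1 -> cmod (F n v) <= cmod v -> 1 / 2 * cmod (upl nu a v) <= upm nu a v.
Proof.
move=> r10; have ca : 0 < cmod a by rewrite cmod_gt0 (loc_a HL).
have e0 : 0 < 1 / 16 * (cmod a * r1 ^+ nu.+1) by rewrite mulr_gt0 // mulr_gt0 // exprn_gt0.
have [n0 H] := loc_cvg HL e0; exists n0 => n nn v rv vR Fv.
have vp : 0 < cmod v by lra.
have v0 : v != 0 by rewrite -cmod_gt0.
apply: upm_half => //; [exact: loc_nu HL|exact: loc_a HL|].
set p := a * v ^+ nu.
have C1 := H n nn v vR; have A := loc_asym HL vR.
have pE : cmod a * cmod v ^+ nu.+1 = cmod p * cmod v by rewrite /p cmodM cmodX exprSr mulrA.
have P : cmod a * r1 ^+ nu.+1 <= cmod p * cmod v.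
  by rewrite -pE ler_pM2l // lerXn2r ?nnegrE // ltW.
have B : cmod (v * (1 + p)) <= cmod v * (1 + 1 / 8 * cmod p).
  have -> : v * (1 + p) = F n v - (F n v - F0 v) - (F0 v - v - a * v ^+ nu.+1) by rewrite /p exprSr; ring.
  have := cmodB (F n v - (F n v - F0 v)) (F0 v - v - a * v ^+ nu.+1).
  have := cmodB (F n v) (F n v - F0 v); rewrite pE in A.
  have -> : cmod v * (1 + 1 / 8 * cmod p) = cmod v + 1 / 8 * (cmod p * cmod v) by ring.
  by move: (cmod p * _) C1 A P Fv => q; lra.
rewrite cmodM ler_pM2l // in B.
have : cmod (1 + p) ^+ 2 <= (1 + 1 / 8 * cmod p) ^+ 2.
  by rewrite lerXn2r ?nnegrE ?cmod_ge0 //; have := cmod_ge0 p; lra.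
rewrite cmodE; have := cmodE p; case: (p) => x y /=; rewrite add0r.
set h := cmod _ => E1; have -> : (1 + x) ^+ 2 + y ^+ 2 = 1 + 2 * x + (x ^+ 2 + y ^+ 2) by ring.
rewrite -E1; have -> : (1 + 1 / 8 * h) ^+ 2 = 1 + 1 / 4 * h + 1 / 64 * h ^+ 2 by field.
by have := sqr_ge0 h; lra.
Qed.

Lemma loc_restrict (r : R) : 0 < r <= R1 -> loc r nu a F F0.
Proof.
move=> /andP[r0 rR]; have L z : cmod z < r -> cmod z < R1 by move=> zr; apply: lt_le_trans zr rR.
split=> //.
- exact: loc_nu HL.
- exact: loc_a HL.
- by move=> n; apply: hol_sub (loc_hol HL n); rewrite subrr cmod0 add0r.
- by move=> n z w /L zR /L wR; exact: (loc_lip HL).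
- by move=> z w /L zR /L wR; exact: (loc_lip0 HL).
- by move=> e e0; have [n0 H] := loc_cvg HL e0; exists n0 => n nn z /L; exact: H.
- by move=> z /L; exact: (loc_asym HL).
Qed.
End EXIT.

(** * Attraction of the opposite cones under the inverse *)

Section ATTRINV. Variable R : realType.
Local Opaque upl upm cmod.
Implicit Types (z w v b l : C R) (c e : R).
Variables (S : R) (nu : nat) (a : C R) (F G : nat -> C R -> C R) (F0 G0 : C R -> C R).
Hypothesis HF : loc S nu a F F0.
Hypothesis HG : loc S nu (- a) G G0.
Hypothesis FG : forall n w, cmod w < S -> cmod (G n w) < S -> F n (G n w) = w.

(* A backward orbit leaving the disc of radius [r'] does so through the attracting cone of [F], and
   would then be sent back close to 0 too quickly. *)
Lemma attr_inverse c c' rho2 : 0 < c <= 1 / 2 -> 0 < c' <= 1 / 2 -> 0 < rho2 -> attr S nu a F rho2 c ->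
  exists2 rs : R, 0 < rs & forall rho2' : R, 0 < rho2' <= rs -> attr S nu (- a) G rho2' c'.
Proof.
have S0 := loc_R1 HF; have nu0 := loc_nu HG; have a0 := loc_a HG.
move=> /andP[c0 c1] cb' r20 HA.
have S8 : 0 < S / 8 by rewrite divr_gt0.
have [rs rs0 H0] := orbit0_cone HG S8 cb'.
exists rs => // rho2' /andP[r2'0 r2's] rho1 r'' rho10 r''0.
set r' : R := Num.min r'' (Num.min (rho2 / 2) (S / 8)).
have r'0 : 0 < r' by rewrite !lt_min r''0 S8 divr_gt0.
have [q1 [q2 q3]] : r' <= r'' /\ (r' <= rho2 / 2 /\ r' <= S / 8).
  by split; [rewrite ge_min lexx | apply/andP; rewrite -le_min ge_min lexx orbT].
clearbody r'.
have hr' : 0 < r' / 2 by rewrite divr_gt0.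
have [E E0 HE] := upl_large nu0 a0 hr'.
have [j jE] : exists j : nat, E <= 3 / 8 * j%:R.
  by exists (Num.truncn (8 / 3 * E)).+1; have := truncnS_gt (8 / 3 * E); lra.
have n1 : 0 < (nu%:R : R) by rewrite ltr0n.
have ca : 0 < cmod (- a) by rewrite cmod_gt0.
set Umax : R := (nu%:R * (cmod (- a) * rho1 ^+ nu))^-1.
have Up : 0 < Umax by rewrite invr_gt0 !mulr_gt0 ?exprn_gt0.
have Um v : cone nu (- a) rho1 rho2' c' v -> v != 0 /\ cmod (upl nu (- a) v) <= Umax.
  move=> [v1 v2 v3]; have v0 : 0 < cmod v by apply: lt_le_trans v1.
  split; first by rewrite -cmod_gt0.
  rewrite upl_mod lef_pV2 ?posrE ?mulr_gt0 ?exprn_gt0 // !ler_pM2l //.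
  by rewrite lerXn2r // ?nnegrE ltW.
have Ej : 0 < Umax + 9 / 8 * j%:R by have := ler0n R j; lra.
have [r3 r30 H3] := upl_below nu0 a0 Ej.
have HO l : cone nu (- a) rho1 rho2' c' l -> forall k, [/\ cmod (iter k G0 l) < S / 8,
    (j <= k)%N -> cmod (iter k G0 l) < r' / 2 & k = j -> r3 <= cmod (iter k G0 l)].
  move=> Kl k; have [v0 vU] := Um l Kl; case: Kl => v1 v2 v3.
  have K0 : cone nu (- a) 0 rho2' c' l by split => //; exact: cmod_ge0.
  have [k1 k2 _ k4 k5] := H0 rho2' r2's l v0 K0 k; split => //.
  - move=> jk; apply: HE => //; apply: le_trans jE _; apply: le_trans k5.
    by rewrite ler_pM2l // ler_nat.
  - by move=> kj; apply: H3 => //; apply: le_trans k4 _; rewrite kj lerD2r.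
have r32 : 0 < r3 / 2 by rewrite divr_gt0.
have [j1 [m1 M1]] := HA r' (r3 / 2) r'0 r32.
have [m2 M2] := exit_cone HF r'0.
have e0 : 0 < Num.min (r3 / 4) (r' / 4) by rewrite lt_min !divr_gt0.
have cl : forall l, cone nu (- a) rho1 rho2' c' l -> forall i, (i <= j + j1)%N -> cmod (iter i G0 l) < S / 4.
  by move=> l Kl i _; have [h _ _] := HO l Kl i; lra.
have [m3 M3] := iter_close HG cl e0.
have [m4 M4] := loc_near HG hr'.
exists j, (maxn (maxn m1 m2) (maxn m3 m4)) => n; rewrite !geq_max => /andP[/andP[nn1 nn2] /andP[nn3 nn4]] l Kl.
have C1 := M3 n nn3 l Kl.
have T i : (i <= j + j1)%N -> cmod (iter i (G n) l) < S / 2 /\ ((j <= i)%N -> cmod (iter i (G n) l) < r').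
  move=> ij; have := C1 i ij; rewrite le_min => /andP[_ h].
  have [h1 h2 _] := HO l Kl i; have := cmodD (iter i (G n) l - iter i G0 l) (iter i G0 l).
  rewrite subrK => t; split; first by lra.
  by move=> /h2; lra.
have zj : r3 / 2 < cmod (iter j (G n) l).
  have := C1 j (leq_addr _ _); rewrite le_min => /andP[h _]; have [_ _ /(_ erefl) h1] := HO l Kl j.
  by have := lerB_cmod (iter j G0 l) (iter j G0 l - iter j (G n) l); rewrite subKr cmodBC; lra.
have main k : (j <= k)%N -> cmod (iter k (G n) l) < r'.
  have [N] := ubnP k; elim: N k => // N IH k kN jk.
  case: (leqP k (j + j1)) => [kj|kj]; first by have [_] := T k kj; exact.
  rewrite ltNge; apply/negP => kr.
  case: k kN jk kj kr => // k kN jk kj kr.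
  have jk' : (j <= k)%N by rewrite (leq_trans _ (_ : j + j1 <= k)%N) // leq_addr.
  have k1 := IH k kN jk'.
  have k2 : cmod (iter k.+1 (G n) l) <= 2 * r'.
    have kS : cmod (iter k (G n) l) < S by lra.
    by rewrite iterS; have := M4 n nn4 _ kS; lra.
  have inS i : (j <= i <= k.+1)%N -> cmod (iter i (G n) l) < S.
    case/andP => ji; rewrite leq_eqVlt => /orP[/eqP ->|ik]; first by lra.
    by have := IH i (leq_trans ik kN) ji; lra.
  have back i : (i <= k.+1 - j)%N -> iter i (F n) (iter k.+1 (G n) l) = iter (k.+1 - i) (G n) l.
    elim: i => [_|i IHi ij]; first by rewrite subn0.
    rewrite iterS IHi; last exact: ltnW.
    have ik : (i <= k)%N by rewrite -ltnS; apply: leq_trans ij (leq_subr _ _).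
    have e1 : (k.+1 - i = (k - i).+1)%N by rewrite subSn.
    rewrite e1 iterS subSS; apply: FG; rewrite -?iterS; apply: inS.
      by move: ij; clear; lia.
    by move: ij; clear; lia.
  have Kz : cone nu a r' rho2 c (iter k.+1 (G n) l).
    split=> //; first by lra.
    have Fz : cmod (F n (iter k.+1 (G n) l)) <= cmod (iter k.+1 (G n) l).
      have -> : F n (iter k.+1 (G n) l) = iter k (G n) l.
        have := back 1%N; rewrite subn1 /= => -> //; by rewrite subn_gt0 ltnS.
      by lra.
    have X := M2 n nn2 _ kr ltac:(lra) Fz; apply: le_trans X; rewrite ler_wpM2r ?cmod_ge0 //.
  (* Applying [F] to this point [k + 1 - j] times, which is at least [j1] times, leads back to the
     [j]-th backward iterate. Its modulus exceeds [r3 / 2] by [zj], while attraction from the cone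
     makes it smaller. *)
  have [_ A] := M1 n nn1 _ Kz.
  have := A (k.+1 - j)%N; rewrite back // subKn ?leqW // => A'.
  have {}A' := A' ltac:(rewrite leq_subRL ?leqW //; exact: ltnW).
  by lra.
split=> k; last by move=> /main; lra.
case: (leqP k (j + j1)) => [/T[] //|kj].
by have := main k (leq_trans (leq_addr _ _) (ltnW kj)); lra.
Qed.
End ATTRINV.

(** * Local inverses *)

Section INVERSE. Variable R : realType.
Local Opaque upl upm cmod.
Implicit Types (z w v b : C R) (c e : R).

Section ONE. Variables (R1 : R) (f : C R -> C R).
Hypothesis R10 : 0 < R1.
Hypothesis f4 : forall z w, cmod z < R1 -> cmod w < R1 -> cmod (f z - f w - (z - w)) <= 1 / 4 * cmod (z - w).

(** A chosen preimage in the disc, with default 0 where there is none. It is unique by [lip4_inj],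
    and exists for [|w| < R1 / 16] when [|f 0| <= R1 / 64], by [linv_surj]. *)
Definition linv (w : C R) : C R := xget (0 : C R) [set z : C R | cmod z < R1 /\ f z = w].

Lemma lip4_expand z w : cmod z < R1 -> cmod w < R1 -> 3 / 4 * cmod (z - w) <= cmod (f z - f w).
Proof.
move=> zR wR; have := f4 zR wR.
by have := lerB_cmod (z - w) (f z - f w); rewrite (cmodBC (z - w) (f z - f w)); lra_all.
Qed.

Lemma lip4_inj z w : cmod z < R1 -> cmod w < R1 -> f z = f w -> z = w.
Proof.
move=> zR wR E; have := lip4_expand zR wR; rewrite E subrr cmod0 => H.
by apply/eqP; rewrite -subr_eq0; apply/eqP/cmod_eq0; have := cmod_ge0 (z - w); lra_all.
Qed.

Lemma linvK z : cmod z < R1 -> linv (f z) = z.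
Proof.
move=> zR; rewrite /linv; case: xgetP => [x _ [xR E]|]; first exact: lip4_inj E.
by move=> /(_ z) H; exfalso; apply: H; split.
Qed.

(* A minimum of [|f z - w|] on a closed disc is a zero, since moving [z] by [w - f z] would decrease it. *)
Lemma linv_surj w : cmod (f 0) <= R1 / 64 -> cmod w < R1 / 16 -> cmod (linv w) < R1 /\ f (linv w) = w.
Proof.
have R1p := R10; move=> f0 wR; suff [z zR E] : exists2 z, cmod z < R1 & f z = w.
  by rewrite /linv; case: xgetP => [x _ [xR E']//|] /(_ z) H; exfalso; apply: H; split.
have r0 : 0 <= R1 / 2 by lra_all.
have z0R : cmod (0 : C R) < R1 by rewrite cmod0.
have [z|z zr zmax] := @max_disc R (fun z => - cmod (f z - w)) 0 (R1 / 2) r0.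
  rewrite subr0 => zr e e0; exists (e / 2) => [|x xe]; first by lra_all.
  rewrite subr0 => xr; have xR : cmod x < R1 by lra_all.
  have zR : cmod z < R1 by lra_all.
  have := f4 xR zR; have := cmodD (f x - f z - (x - z)) (x - z); rewrite subrK => T1 T2.
  have := lerB_cmod (f x - w) (f z - w); have := lerB_cmod (f z - w) (f x - w).
  have e1 : f x - w - (f z - w) = f x - f z by ring.
  rewrite (cmodBC (f z - w)) e1 => T3 T4; rewrite opprK addrC ltr_norml.
  by apply/andP; split; lra_all.
rewrite subr0 in zr; have zR : cmod z < R1 by lra_all.
exists z => //; apply/eqP; rewrite -subr_eq0; apply/negPn; rewrite -cmod_gt0; apply/negP => P.
have Z := zmax 0; rewrite subrr cmod0 in Z; have {}Z := Z r0.
have F1 := cmodB (f 0) w; have F2 := lip4_expand zR z0R; rewrite subr0 in F2.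
have F3 : cmod (f z - f 0) <= cmod (f z - w) + cmod (f 0 - w) by rewrite (cmodBC (f 0)); exact: cmodBtri.
set h := w - f z; have ch : cmod h = cmod (f z - w) by rewrite cmodBC.
have zh : cmod (z + h) <= R1 / 2 by have := cmodD z h; rewrite ch; lra_all.
have zhR : cmod (z + h) < R1 by lra_all.
have := zmax (z + h); rewrite subr0 => /(_ zh); rewrite lerN2.
have := f4 zhR zR.
have -> : f (z + h) - f z - (z + h - z) = f (z + h) - w by rewrite /h; ring.
by rewrite [z + h]addrC addrK ch; lra_all.
Qed.

Lemma linv_lip u v : cmod (linv u) < R1 -> cmod (linv v) < R1 -> f (linv u) = u -> f (linv v) = v ->
  cmod (linv u - linv v) <= 4 / 3 * cmod (u - v).
Proof. by move=> uR vR uE vE; have := lip4_expand uR vR; rewrite uE vE; lra_all. Qed.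

Lemma cder_lip4 z d : cmod z < R1 -> cder f z d -> 1 / 2 <= cmod d.
Proof.
have R1p := R10; move=> zR fd; have q0 : 0 < 1 / 4 :> R by lra_all.
have [del del0 Hd] := fd _ q0.
set s : R := Num.min (del / 2) ((R1 - cmod z) / 2).
have s0 : 0 < s by rewrite lt_min; apply/andP; split; lra_all.
have [s1 s2] : s <= del / 2 /\ s <= (R1 - cmod z) / 2 by apply/andP; rewrite -le_min.
clearbody s; set h : C R := (s%:C)%C; have ch : cmod h = s by rewrite cmodR gtr0_norm.
have hd : cmod h < del by rewrite ch; lra_all.
have zhR : cmod (z + h) < R1 by have := cmodD z h; rewrite ch; lra_all.
have := Hd h hd; have := lip4_expand zhR zR; rewrite [z + h]addrC addrK ch.
rewrite [h + z]addrC; have := lerB_cmod (f (z + h) - f z) (f (z + h) - f z - d * h); rewrite subKr cmodM ch.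
move=> A B D; rewrite -(ler_pM2r s0); lra_all.
Qed.

Lemma cder_linv (w d : C R) (r : R) : 0 < r ->
  (forall u, cmod (u - w) < r -> cmod (linv u) < R1 /\ f (linv u) = u) ->
  cder f (linv w) d -> cder linv w d^-1.
Proof.
move=> r0 Hr fd; have ww : cmod (w - w) < r by rewrite subrr cmod0.
have [wR wE] := Hr w ww; have dp := cder_lip4 wR fd.
have d0 : d != 0 by rewrite -cmod_gt0; lra_all.
move=> e e0; have e3 : 0 < e * 3 / 8 by lra_all.
have [del del0 Hd] := fd _ e3; exists (Num.min r (del / 2)) => [|k].
  by rewrite lt_min r0; lra_all.
rewrite lt_min => /andP[kr kd].
have kw : cmod (w + k - w) < r by rewrite addrC addKr.
have [kR kE] := Hr _ kw; have L := linv_lip kR wR kE wE.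
rewrite [w + k]addrC addrK [k + w]addrC in L.
have hd : cmod (linv (w + k) - linv w) < del by lra_all.
have eh : linv w + (linv (w + k) - linv w) = linv (w + k) by ring.
have := Hd _ hd; rewrite eh kE wE.
set h := linv (w + k) - linv w in L hd *.
have -> : w + k - w - d * h = k - d * h by ring.
have -> : h - d^-1 * k = - d^-1 * (k - d * h) by field.
rewrite cmodM cmodN cmodV => X.
rewrite ler_pdivrMl; last by lra_all.
have : e * cmod k * (1 / 2) <= e * cmod k * cmod d by rewrite ler_wpM2l // mulr_ge0 ?cmod_ge0 // ltW.
have : e * 3 / 8 * cmod h <= e * 3 / 8 * (4 / 3 * cmod k) by rewrite ler_pM2l.
by lra_all.
Qed.

Lemma hol_linv (r : R) : hol 0 R1 f -> (forall w, cmod w < r -> cmod (linv w) < R1 /\ f (linv w) = w) -> hol 0 r linv.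
Proof.
move=> [f1 [f2 [f3 H]]] Hr.
pose g1 w := (f1 (linv w))^-1; pose g2 w := - (f2 (linv w) * g1 w) * (g1 w * g1 w).
exists g1, g2, (fun w => - ((f3 (linv w) * g1 w) * g1 w + f2 (linv w) * g2 w) * (g1 w * g1 w) +
  - (f2 (linv w) * g1 w) * (g2 w * g1 w + g1 w * g2 w)) => w; rewrite subr0 => wr.
have [wR wE] := Hr w wr.
have wR' : cmod (linv w - 0) < R1 by rewrite subr0.
have [d1 d2 d3] := H _ wR'.
have f1p := cder_lip4 wR d1.
have f10 : f1 (linv w) != 0 by rewrite -cmod_gt0; lra_all.
have rw : 0 < r - cmod w by rewrite subr_gt0.
have G1 : cder linv w (g1 w).
  apply: (cder_linv rw) => // u uw; apply: Hr.
  by have := cmodD (u - w) w; rewrite subrK; lra_all.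
have G2 : cder g1 w (g2 w).
  apply: cder_eq (cder_inv (cder_comp G1 d2) f10).
  by rewrite /g2 /g1; field.
split=> //; apply: cderM; last exact: cderM.
by apply: cderN; apply: cderM (cder_comp G1 d3) G2.
Qed.
End ONE.

Variables (R1 : R) (nu : nat) (a : C R) (F : nat -> C R -> C R) (F0 : C R -> C R).
Hypothesis HL : loc R1 nu a F F0.
Hypothesis F4 : forall n z w, cmod z < R1 -> cmod w < R1 -> cmod (F n z - F n w - (z - w)) <= 1 / 4 * cmod (z - w).
Hypothesis F04 : forall z w, cmod z < R1 -> cmod w < R1 -> cmod (F0 z - F0 w - (z - w)) <= 1 / 4 * cmod (z - w).
Hypothesis Fn0 : forall n, cmod (F n 0) <= R1 / 64.
Hypothesis Fasym : forall z, cmod z < R1 ->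
    cmod (F0 z - z - a * z ^+ nu.+1) <= 1 / 64 * (cmod a * cmod z ^+ nu.+1).

(** With [w = F0 z = z (1 + s)], the error of the inverse is [a z^(nu+1) ((1 + s)^(nu+1) - 1) - E],
    where [E] is the error of [F0]. Both terms are at most [1/64] of the leading one, which leaves
    less than [1/16]; this is why [F0] is controlled with [1/64]. Likewise the Lipschitz constant
    [1/4] becomes [1/3] for the inverse. *)
Lemma loc_inverse : exists2 S : R, 0 < S <= R1 / 16 & loc S nu (- a) (fun n => linv R1 (F n)) (linv R1 F0) /\
  forall n w, cmod w < S -> cmod (linv R1 (F n) w) < R1 /\ F n (linv R1 (F n) w) = w.
Proof.
have R10 := loc_R1 HL; have nu0 := loc_nu HL.
have ca : 0 < cmod a by rewrite cmod_gt0 (loc_a HL).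
have F00 : cmod (F0 0) <= R1 / 64 by rewrite (loc_F00 HL) cmod0; lra_all.
(* This bound on [S] yields [(nu + 1) |s| <= 1/128], hence [|(1 + s)^(nu+1) - 1| <= 1/64]. *)
set K : R := (192 * (nu.+1%:R * cmod a))^-1.
have K0 : 0 < K by rewrite invr_gt0 !mulr_gt0 // ltr0n.
set S : R := Num.min (R1 / 16) (Num.min (1 / 2) K).
have S0 : 0 < S by rewrite !lt_min K0 !divr_gt0.
have [s1 [s2 s3]] : S <= R1 / 16 /\ (S <= 1 / 2 /\ S <= K).
  by split; [rewrite ge_min lexx | apply/andP; rewrite -le_min ge_min lexx orbT].
clearbody S; have in16 w : cmod w < S -> cmod w < R1 / 16 by lra_all.
have Gs n w (wS : cmod w < S) := linv_surj R10 (F4 n) (Fn0 n) (in16 w wS).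
have G0s w (wS : cmod w < S) := linv_surj R10 F04 F00 (in16 w wS).
exists S; first by rewrite S0.
split; last exact: Gs.
have lipG f : (forall z w, cmod z < R1 -> cmod w < R1 -> cmod (f z - f w - (z - w)) <= 1 / 4 * cmod (z - w)) ->
    (forall w, cmod w < S -> cmod (linv R1 f w) < R1 /\ f (linv R1 f w) = w) ->
    forall z w, cmod z < S -> cmod w < S -> cmod (linv R1 f z - linv R1 f w - (z - w)) <= 1 / 2 * cmod (z - w).
  move=> f4 fs z w zS wS; have [zR zE] := fs z zS; have [wR wE] := fs w wS.
  have L := linv_lip f4 zR wR zE wE; have := f4 _ _ zR wR; rewrite zE wE (cmodBC (z - w)).
  by have := cmod_ge0 (z - w); lra_all.
split=> //.
- by rewrite oppr_eq0 (loc_a HL).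
- by move=> n; apply: (hol_linv R10 (F4 n) (loc_hol HL n)) => w; exact: Gs.
- by move=> n; apply: lipG; [exact: F4|exact: Gs].
- by apply: lipG.
- move=> e e0; have e3 : 0 < 3 / 4 * e by lra_all.
  have [n0 H] := loc_cvg HL e3; exists n0 => n nn w wS.
  have [zR zE] := Gs n w wS; have [xR xE] := G0s w wS.
  have := lip4_expand F04 zR xR; have := H n nn _ zR; rewrite xE zE (cmodBC w).
  set x := linv R1 F0 w; set z := linv R1 (F n) w; set d := F0 z - w; move: e0; clear -R.
  by generalize_moduli; lra_all.
move=> w wS; have [zR zE] := G0s w wS; set z := linv R1 F0 w in zR zE *.
have [z0|z0] := eqVneq z 0.
  have -> : w = 0 by rewrite -zE z0 (loc_F00 HL).
  by rewrite z0 !expr0n /= mulr0 !subr0 cmod0 expr0n /= !mulr0.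
have cz : 0 < cmod z by rewrite cmod_gt0.
have r0R : cmod (0 : C R) < R1 by rewrite cmod0.
have zw : cmod z <= 4 / 3 * cmod w.
  by have := lip4_expand F04 zR r0R; rewrite zE (loc_F00 HL) !subr0; lra_all.
have zS : cmod z < 4 / 3 * S by lra_all.
have As := Fasym zR; rewrite zE in As.
set E := w - z - a * z ^+ nu.+1 in As.
set s := w / z - 1.
have wE : w = z * (1 + s) by rewrite /s; field.
have sE : s = a * z ^+ nu + E / z by rewrite /s /E exprS; field.
have sB : cmod s <= 65 / 64 * (cmod a * cmod z ^+ nu).
  rewrite sE; apply: le_trans (cmodD _ _) _; rewrite !cmodM cmodX cmodV.
  have : cmod E / cmod z <= 1 / 64 * (cmod a * cmod z ^+ nu).
    rewrite ler_pdivrMr //.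
    by have -> : 1 / 64 * (cmod a * cmod z ^+ nu) * cmod z = 1 / 64 * (cmod a * cmod z ^+ nu.+1) by rewrite exprSr; ring.
  lra_all.
have zn : cmod z ^+ nu <= cmod z.
  rewrite -(prednK nu0) exprS ger_pMr //; apply: exprn_ile1; [exact: cmod_ge0|lra_all].
have sK : nu.+1%:R * cmod s <= 1 / 128.
  have n0 : 0 < nu.+1%:R :> R by rewrite ltr0n.
  have A1 : nu.+1%:R * cmod s <= nu.+1%:R * (65 / 64 * (cmod a * cmod z)).
    rewrite (ler_pM2l n0); apply: le_trans sB _.
    have q : cmod a * cmod z ^+ nu <= cmod a * cmod z by rewrite (ler_pM2l ca).
    by lra_all.
  have A2 : nu.+1%:R * cmod a * cmod z <= nu.+1%:R * cmod a * (4 / 3 * K).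
    rewrite ler_pM2l ?mulr_gt0 //; lra_all.
  have A3 : nu.+1%:R * cmod a * (4 / 3 * K) = 1 / 144 by rewrite /K; field; rewrite !gt_eqF.
  have A4 : nu.+1%:R * (65 / 64 * (cmod a * cmod z)) = 65 / 64 * (nu.+1%:R * cmod a * cmod z) by ring.
  by lra_all.
have PW := cpow_near1 (lexx (cmod s)) (N := nu.+1) (ltac:(lra_all)).
have {}PW : cmod ((1 + s) ^+ nu.+1 - 1) <= 1 / 64 by lra_all.
have -> : z - w - - a * w ^+ nu.+1 = a * z ^+ nu.+1 * ((1 + s) ^+ nu.+1 - 1) - E.
  by rewrite /E wE exprMn; ring.
apply: le_trans (cmodB _ _) _; rewrite !cmodM cmodX cmodN.
have w1 : cmod w ^+ nu.+1 = cmod z ^+ nu.+1 * cmod ((1 + s) ^+ nu.+1) by rewrite wE cmodM exprMn cmodX.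
have s63 : 63 / 64 <= cmod ((1 + s) ^+ nu.+1).
  have := lerB_cmod 1 (1 - (1 + s) ^+ nu.+1); rewrite subKr cmod1 cmodBC; lra_all.
have q0 : 0 < cmod a * cmod z ^+ nu.+1 by rewrite mulr_gt0 // exprn_gt0.
rewrite w1 mulrA; set q := cmod a * _ in q0 As *.
have : q * cmod ((1 + s) ^+ nu.+1 - 1) <= q * (1 / 64) by rewrite ler_pM2l.
have : q * (63 / 64) <= q * cmod ((1 + s) ^+ nu.+1) by rewrite ler_pM2l.
by lra_all.
Qed.
End INVERSE.

(** * Stability along a ray issued from the fixed point *)

Section TRICHOTOMY. Variable R : realType.
Local Opaque cmod.
Implicit Types (z w v y : C R) (e : R) (f g : C R -> C R).

(** What is used of a map with fixed point [x]; it holds alike for [F n] and for its inverse. By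
    [side_near] an orbit leaving the disc of radius [r] lands at modulus at most [2 r]. The points
    [v] of [side_cone] are crossing points of orbits of the map or of its inverse. *)
Record side (S r : R) (x : C R) f : Prop := Side {
  side_near : forall z, cmod z < S -> cmod (f z) <= 3 / 2 * cmod z + r / 2;
  side_cont : forall k v, (forall i, (i < k)%N -> cmod (iter i f v) < S) ->
    forall e, 0 < e -> exists2 del : R, 0 < del & forall z, cmod (z - v) < del ->
      forall i, (i <= k)%N -> cmod (iter i f z - iter i f v) < e;
  side_inj : forall k z w, (forall i, (i < k)%N -> cmod (iter i f z) < S) ->
    (forall i, (i < k)%N -> cmod (iter i f w) < S) -> iter k f z = iter k f w -> z = w;
  side_hol : forall k (c : C R) (rho : R),
    (forall z, cmod (z - c) < rho -> forall i, (i < k)%N -> cmod (iter i f z) < S) -> hol c rho (iter k f);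
  side_fix : f x = x;
  side_cone : forall v, r <= cmod v -> cmod v <= 2 * r -> cmod (f v) <= cmod v ->
    [/\ forall k, cmod (iter k f v) < S / 2,
        forall e, 0 < e -> exists2 del : R, 0 < del & forall z, cmod (z - v) < del ->
          forall k, cmod (iter k f z - iter k f v) < e &
        forall y, accum (fun k => iter k f v) y -> f y = y /\ y != x] }.

Variables (S r : R) (x h : C R).
Hypotheses (r0 : 0 < r) (rS : 4 * r <= S) (xr : cmod x < r).

Definition ray (t : R) : C R := x + (t%:C)%C * h.

Lemma ray0 : ray 0 = x. Proof. by rewrite /ray rmorph0 mul0r addr0. Qed.

Lemma ray_dist s t : cmod (ray s - ray t) = `|s - t| * cmod h.
Proof.
have -> : ray s - ray t = ((s - t)%:C)%C * h by rewrite /ray rmorphB; ring.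
by rewrite cmodM cmodR.
Qed.

Lemma bounded_prefix f N y : side S r x f ->
  (forall k, (k <= N)%N -> cmod (iter k f y) < r) ->
  exists2 del : R, 0 < del & forall z, cmod (z - y) < del -> forall k, (k <= N)%N -> cmod (iter k f z) < r.
Proof.
move=> Hf; have r1 := r0; have rS1 := rS.
elim: N => [|N IH] H.
  have y0 := H 0%N (leqnn _); exists (r - cmod y) => [|z zy k]; first by rewrite subr_gt0.
  rewrite leqn0 => /eqP -> /=; have := cmodD (z - y) y; rewrite subrK; lra.
have [del del0 Hd] := IH (fun k kN => H k (leqW kN)).
have e0 : 0 < r - cmod (iter N.+1 f y) by rewrite subr_gt0 H.
have yS i : (i < N.+1)%N -> cmod (iter i f y) < S by move=> iN; have := H i (ltnW iN); lra.
have [d1 d10 Hd1] := side_cont Hf yS e0.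
exists (Num.min del d1) => [|z]; first by rewrite lt_min del0.
rewrite lt_min => /andP[zd zd1] k; rewrite leq_eqVlt => /orP[/eqP ->|]; last exact: Hd.
have := Hd1 z zd1 _ (leqnn _); have := cmodD (iter N.+1 f z - iter N.+1 f y) (iter N.+1 f y).
by rewrite subrK; lra.
Qed.

Section STEP. Variables f g : C R -> C R.
Hypotheses (Hf : side S r x f) (Hg : side S r x g).
Hypothesis FG : forall w, cmod w < S -> cmod (g w) < S -> f (g w) = w.
Hypothesis GF : forall w, cmod w < S -> cmod (f w) < S -> g (f w) = w.
Hypothesis Hray : forall t : R, 0 < t <= 1 -> cmod (ray t) < S -> f (ray t) <> ray t.

Definition stab y := exists2 del : R, 0 < del &
  forall z, cmod (z - y) < del -> forall k, cmod (iter k f z) < r /\ cmod (iter k g z) < r.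

Let iterx k : iter k f x = x.
Proof. by elim: k => //= k ->; exact: side_fix Hf. Qed.

Let limit_orbit t : 0 <= t <= 1 -> (forall s, 0 <= s < t -> stab (ray s)) -> forall k, cmod (iter k f (ray t)) <= r.
Proof.
have r1 := r0; have rS1 := rS; have xr1 := xr.
move=> /andP[t0 t1] Hs; elim/ltn_ind=> k IH.
have [->|tn] := eqVneq t 0; first by rewrite ray0 iterx ltW.
have tp : 0 < t by rewrite lt_neqAle eq_sym tn.
have yS i : (i < k)%N -> cmod (iter i f (ray t)) < S by move=> /IH; lra.
apply/ler_addgt0Pr => e e0; have [del del0 Hd] := side_cont Hf yS e0.
set q : R := Num.min t (del / (2 * (cmod h + 1))).
have h1 : 0 < cmod h + 1 by have := cmod_ge0 h; lra.
have q0 : 0 < q by rewrite lt_min tp divr_gt0 // mulr_gt0.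
have [q1 q2] : q <= t /\ q <= del / (2 * (cmod h + 1)) by apply/andP; rewrite -le_min.
clearbody q; have sb : 0 <= t - q < t by apply/andP; split; lra.
have [d d0 Hdd] := Hs _ sb.
have ss : cmod (ray (t - q) - ray (t - q)) < d by rewrite subrr cmod0.
have [A _] := Hdd _ ss k.
have dist : cmod (ray (t - q) - ray t) < del.
  rewrite ray_dist addrAC subrr sub0r normrN gtr0_norm //.
  have : q * (2 * (cmod h + 1)) <= del by rewrite -ler_pdivlMr // mulr_gt0.
  by have := mulr_ge0 (ltW q0) (cmod_ge0 h); lra.
have := Hd _ dist k (leqnn _); have := lerB_cmod (iter k f (ray t)) (iter k f (ray t) - iter k f (ray (t - q))).
by rewrite subKr cmodBC; lra.
Qed.

(* Arbitrarily late exits near [y] give a point whose [g]-orbit accumulates at [y]. *)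
Let late_exits t : 0 <= t <= 1 -> (forall s, 0 <= s < t -> stab (ray s)) ->
  ~ (forall (N : nat) (del : R), 0 < del -> exists z k, [/\ cmod (z - ray t) < del, (N < k)%N, r <= cmod (iter k f z) &
       forall i, (i < k)%N -> cmod (iter i f z) < r]).
Proof.
have r1 := r0; have rS1 := rS; have xr1 := xr.
move=> tb Hs H; have yb := limit_orbit tb Hs; set y := ray t in yb *.
have n0 m : 0 < m.+1%:R^-1 :> R by rewrite invr_gt0 ltr0n.
have /choice[zk zkP] : forall m : nat, exists p : C R * nat, [/\ cmod (p.1 - y) < m.+1%:R^-1, (m < p.2)%N,
    r <= cmod (iter p.2 f p.1) & forall i, (i < p.2)%N -> cmod (iter i f p.1) < r].
  by move=> m; have [z [k zP]] := H m _ (n0 m); exists (z, k).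
pose z m := (zk m).1; pose k m := (zk m).2; pose v m := iter (k m) f (z m).
have vP m : [/\ r <= cmod (v m), cmod (v m) <= 2 * r, cmod (g (v m)) < r & iter (k m) g (v m) = z m].
  have [_ h2 h3 h4] := zkP m; rewrite -/(z m) -/(k m) -/(v m) in h2 h3 h4.
  have v2 : cmod (v m) <= 2 * r.
    rewrite /v; case: (k m) h2 h4 => // i _ h4; rewrite iterS.
    have lt := h4 i (leqnn _); have iS : cmod (iter i f (z m)) < S by lra.
    by have := side_near Hf iS; lra.
  have back i : (i <= k m)%N -> iter i g (v m) = iter (k m - i) f (z m).
    elim: i => [|i IHi] ik; first by rewrite subn0.
    rewrite iterS IHi 1?ltnW // (_ : (k m - i = (k m - i.+1).+1)%N); last by lia.
    rewrite iterS; apply: GF.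
      by have := h4 (k m - i.+1)%N ltac:(lia); lra.
    rewrite -iterS (_ : ((k m - i.+1).+1 = k m - i)%N); last by lia.
    case: i ik {IHi} => [|i] ik; first by rewrite subn0; lra.
    by have := h4 (k m - i.+1)%N ltac:(lia); lra.
  split => //; last by rewrite back ?leqnn // subnn.
  have := back 1%N; rewrite iterS /= => ->; last by lia.
  by apply: h4; lia.
have vB m : cmod (v m) <= 2 * r by have [] := vP m.
have [s [si [l vl]]] := bwC vB.
have l2 : cmod l <= 2 * r.
  by have := cmod_le_lim (c := 0) vl (r := 2 * r); rewrite subr0; apply => m /=; rewrite subr0.
have lr : r <= cmod l.
  rewrite leNgt; apply/negP => lr; have e0 : 0 < r - cmod l by rewrite subr_gt0.
  have [m0 Hm] := vl _ e0; have := Hm m0 (leqnn _); rewrite /=.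
  by have [+ _ _ _] := vP (s m0); have := cmodD (v (s m0) - l) l; rewrite subrK; lra.
have lS : cmod l < S by lra.
have lg : cmod (g l) <= cmod l.
  apply: le_trans lr; apply/ler_addgt0Pr => e e0.
  have l1S i : (i < 1)%N -> cmod (iter i g l) < S by rewrite ltnS leqn0 => /eqP ->.
  have [del del0 Hd] := side_cont Hg l1S e0; have [m0 Hm] := vl _ del0.
  have /= := Hd _ (Hm m0 (leqnn _)) 1%N (leqnn _).
  have [_ _ + _] := vP (s m0); have := lerB_cmod (g l) (g l - g (v (s m0))).
  by rewrite subKr (cmodBC (g l)); lra.
have [_ Eq Ac] := side_cone Hg lr l2 lg.
(* [g^(k m)] carries the exit point [v m] back to [z m], which tends to [y]. By equicontinuity at
   the limit [l] of exit points, the same iterates carry [l] close to [y]; then [side_cone] applies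
   to [y]. *)
have [gy yx] : g y = y /\ y != x.
  apply: Ac => e e0 N; have e2 : 0 < e / 2 by lra.
  have [del del0 Hd] := Eq _ e2; have [m0 Hm] := vl _ del0; have [m1 Hm1] := inv_nat_small e2.
  set m := maxn N (maxn m0 m1); have mN : (N <= m)%N by exact: leq_maxl.
  have mm0 : (m0 <= m)%N by rewrite /m !leq_max leqnn orbT.
  have mm1 : (m1 <= m)%N by rewrite /m !leq_max leqnn !orbT.
  clearbody m; have sm := incr_geid si m; exists (k (s m)).
    by have [_ h2 _ _] := zkP (s m); exact: leq_trans mN (leq_trans sm (ltnW h2)).
  have := Hd _ (Hm m mm0) (k (s m)); rewrite /=; have [_ _ _ ->] := vP (s m).
  have [h1 _ _ _] := zkP (s m); rewrite -/(z _) -/y in h1.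
  have h3 := Hm1 (s m) (leq_trans mm1 sm).
  move=> h4; apply: le_lt_trans (cmodBtri (z (s m)) (iter (k (s m)) g l) y) _.
  by rewrite (splitr e); apply: ltrD; [rewrite cmodBC|exact: lt_trans h1 h3].
have yS : cmod y < S by have := yb 0%N; rewrite /=; lra.
have tp : 0 < t <= 1.
  case/andP: tb => t0 ->; rewrite andbT lt_neqAle t0 andbT; apply/eqP => t0'.
  by move: yx; rewrite /y -t0' ray0 eqxx.
by apply: (Hray tp yS); rewrite -/y -{1}gy FG // gy.
Qed.

(** If [|f^k y| >= r], then by [limit_orbit] it equals [r], the next iterate is not larger, and
    [side_cone] shows that the orbit accumulates at a fixed point [y'] other than [x]. The functions
    [f^i - y'] do not vanish near the ray up to [y] and are independent of [i] at [x]; Harnack's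
    inequality keeps them away from 0 at [y]. *)
Let early_exits t : 0 <= t <= 1 -> (forall s, 0 <= s < t -> stab (ray s)) -> forall k, cmod (iter k f (ray t)) < r.
Proof.
have r1 := r0; have rS1 := rS; have xr1 := xr.
move=> tb Hs k; have yb := limit_orbit tb Hs; set y := ray t in yb *.
rewrite ltNge; apply/negP => kr; set v := iter k f y in kr.
have yS i : cmod (iter i f y) < S by have := yb i; lra.
have vr := yb k; rewrite -/v in vr.
have fv : cmod (f v) <= cmod v by have := yb k.+1; rewrite iterS -/v; lra.
have [vS Eq Ac] := side_cone Hf kr ltac:(lra) fv.
have [s [si [y' vy]]] := bwC (fun i => ltW (vS i)).
have acc : accum (fun i => iter i f v) y'.
  move=> e e0 N; have [m0 Hm] := vy _ e0; exists (s (maxn N m0)); last exact: Hm (leq_maxr _ _).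
  by apply: leq_trans (leq_maxl N m0) (incr_geid si _).
have [fy' y'x] := Ac _ acc.
have y'S : cmod y' <= S / 2.
  by have := cmod_le_lim (c := 0) vy (r := S / 2); rewrite subr0; apply => m /=; rewrite subr0 ltW.
have itery' i : iter i f y' = y' by elim: i => //= i ->.
have tn : t != 0.
  by apply/eqP => t0; move: kr; rewrite /v /y t0 ray0 iterx; lra.
have yray u : 0 <= u <= 1 -> ray u != y'.
  move=> /andP[u0 u1]; have [->|un] := eqVneq u 0; first by rewrite ray0 eq_sym.
  apply/eqP => E; apply: (Hray (t := u)); rewrite ?E //; last by lra.
  by rewrite lt_neqAle eq_sym un u0.
have disc u : 0 <= u <= t -> exists2 rho : R, 0 < rho & forall z, cmod (z - ray u) < rho -> z != y' /\ forall i, cmod (iter i f z) < S.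
  move=> /andP[u0 ut]; have ub : 0 <= u <= 1 by case/andP: tb => _ t1; rewrite u0; lra.
  suff [d d0 Hd] : exists2 d : R, 0 < d & forall z, cmod (z - ray u) < d -> forall i, cmod (iter i f z) < S.
    have g0 : 0 < cmod (y' - ray u) by rewrite cmod_gt0 subr_eq0 eq_sym yray.
    exists (Num.min d (cmod (y' - ray u))) => [|z]; first by rewrite lt_min d0.
    rewrite lt_min => /andP[zd zy]; split; last exact: Hd.
    by apply/eqP => E; move: zy; rewrite E ltxx.
  case: (ltrP u t) => utl.
    have [|d d0 Hd] := Hs u; first by rewrite u0.
    by exists d => // z zd i; have [] := Hd z zd i; lra.
  have -> : u = t by lra.
  have S4 : 0 < S / 4 by lra.
  have [d1 d10 Hd1] := Eq _ S4.
  have m0 : 0 < Num.min d1 (S / 4) by rewrite lt_min d10.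
  have [d d0 Hd] := side_cont Hf (fun i (_ : (i < k)%N) => yS i) m0.
  exists d => // z zd i; case: (leqP i k) => ik.
    have := Hd z zd i ik; rewrite lt_min => /andP[_ A].
    by have := yb i; have := cmodD (iter i f z - iter i f y) (iter i f y); rewrite subrK; lra.
  have := Hd z zd k (leqnn _); rewrite lt_min => /andP[A _].
  have := Hd1 _ A (i - k)%N; rewrite -iterD subnK 1?ltnW //.
  by have := vS (i - k)%N; have := cmodD (iter i f z - iter (i - k) f v) (iter (i - k) f v); rewrite subrK; lra.
have S2 : 0 < (2 * S)^-1 by rewrite invr_gt0; lra.
(* The factor brings the modulus below 1, as [nonvanish_harnack] requires: the iterates are below
   [S] and [|y'| <= S / 2]. *)
pose X i z : C R := (((2 * S)^-1 : R)%:C)%C * (iter i f z - y').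
have cX i z : cmod (X i z) = (2 * S)^-1 * cmod (iter i f z - y') by rewrite /X cmodM cmodR gtr0_norm.
have harnack u (rho : R) : 0 < rho -> (forall z, cmod (z - u) < rho -> z != y' /\ forall i, cmod (iter i f z) < S) ->
    forall i z, cmod (z - u) <= rho / 2 -> - ln (cmod (X i z) ^+ 2) <= expR 8 * - ln (cmod (X i u) ^+ 2).
  move=> p0 Hd i z zu; apply: (nonvanish_harnack p0) zu.
    by apply: hol_affine; apply: (side_hol Hf) => w wu j _; have [] := Hd w wu.
  move=> w wu; have [wy wS] := Hd w wu; split.
    rewrite /X mulf_neq0 //; first by rewrite -cmod_gt0 cmodR gtr0_norm.
    rewrite subr_eq0; apply/eqP => E; move/eqP: wy; apply.
    by apply: (side_inj Hf (k := i)) => [j _|j _|]; rewrite ?itery' //; lra.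
  rewrite cX ltr_pdivrMl; last by lra.
  by have := wS i; have := cmodB (iter i f w) y'; lra.
have h1 : 0 < cmod h + 1 by have := cmod_ge0 h; lra.
have dist_lt p q (rho : R) : 0 < rho -> `|p - q| <= rho / (2 * (cmod h + 1)) -> cmod (ray p - ray q) <= rho / 2.
  move=> p0 pq; rewrite ray_dist.
  have : `|p - q| * (cmod h + 1) <= rho / (2 * (cmod h + 1)) * (cmod h + 1) by rewrite ler_pM2r.
  have -> : rho / (2 * (cmod h + 1)) * (cmod h + 1) = rho / 2 by field; rewrite gt_eqF.
  by have := normr_ge0 (p - q); lra.
(* [K] may depend on the point of the ray but not on [i]. The premise [u <= t] is there because
   [real_induction] runs over [[0, 1]] while the discs exist only up to [t]. *)
have chain : t <= t -> exists K : R, forall i, - ln (cmod (X i (ray t)) ^+ 2) <= K.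
  apply: (@real_induction R (fun u => u <= t -> exists K : R, forall i, - ln (cmod (X i (ray u)) ^+ 2) <= K)) => // u /andP[u0 u1] IH.
  case: (ltrP t u) => tu; first by exists 1 => // s' /andP[h2 _] h3; lra.
  have [|rho rho0 Hd] := disc u; first by rewrite u0.
  have dd : 0 < rho / (2 * (cmod h + 1)) by rewrite divr_gt0 // mulr_gt0.
  have [K HK] : exists K : R, forall i, - ln (cmod (X i (ray u)) ^+ 2) <= K.
    have [->|un] := eqVneq u 0.
      by exists (- ln (cmod (X 0%N x) ^+ 2)) => i; rewrite ray0 /X iterx.
    have up : 0 < u by rewrite lt_neqAle eq_sym un.
    set q : R := Num.min u (rho / (2 * (cmod h + 1)) / 2).
    have q0 : 0 < q by rewrite lt_min up divr_gt0.
    have [q1 q2] : q <= u /\ q <= rho / (2 * (cmod h + 1)) / 2 by apply/andP; rewrite -le_min.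
    clearbody q; have qb : 0 <= u - q < u by apply/andP; split; lra.
    have [K HK] := IH _ qb ltac:(lra).
    have r2 : 0 < rho / 2 by lra.
    have dq : cmod (ray u - ray (u - q)) <= rho / 2 / 2.
      apply: dist_lt => //; rewrite subKr gtr0_norm //.
      by apply: le_trans q2 _; rewrite mulrAC.
    exists (expR 8 * K) => i.
    apply: le_trans (harnack (ray (u - q)) (rho / 2) r2 _ i (ray u) dq) _; last by rewrite ler_pM2l ?expR_gt0.
    move=> z zq; apply: Hd; have := cmodBtri (ray (u - q)) z (ray u); rewrite (cmodBC (ray (u - q))); lra.
  exists (rho / (2 * (cmod h + 1))) => // s' /andP[s1 s2] _; exists (expR 8 * K) => i.
  apply: le_trans (harnack (ray u) rho rho0 Hd i (ray s') _) _; last by rewrite ler_pM2l ?expR_gt0.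
  by apply: dist_lt => //; rewrite ger0_norm; lra.
have [K HK] := chain (lexx t).
have e0 : 0 < expR (- K - 1) by exact: expR_gt0.
set E : R := expR (- K - 1) in e0; set e1 : R := Num.min 1 E.
have e10 : 0 < e1 * (2 * S) by rewrite mulr_gt0 ?lt_min ?ltr01 //; lra.
have [j _ jy] := acc _ e10 0%N.
have Xj : cmod (X (j + k)%N y) < e1 by rewrite cX iterD -/v ltr_pdivrMl ?[_ * e1]mulrC //; lra.
have [e11 e1E] : e1 <= 1 /\ e1 <= E by apply/andP; rewrite -le_min.
have Xp : 0 < cmod (X (j + k)%N y).
  rewrite cX mulr_gt0 // cmod_gt0 subr_eq0; apply/eqP => E'.
  have yy : ray t != y' by apply: yray.
  move/eqP: yy; apply; apply: (side_inj Hf (k := (j + k)%N)) => [i _|i _|]; rewrite ?itery' //; lra.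
have := HK (j + k)%N; rewrite -/y.
have : ln (cmod (X (j + k)%N y) ^+ 2) <= ln E.
  rewrite ler_ln ?posrE ?exprn_gt0 //.
  have : cmod (X (j + k)%N y) * cmod (X (j + k)%N y) <= 1 * E by apply: ler_pM; lra.
  by rewrite mul1r.
by rewrite /E expRK; lra.
Qed.

(** The orbit of [ray t] stays strictly inside the disc, so over any bounded time nearby orbits do
    too, by [bounded_prefix]. If stability failed, exits would thus occur arbitrarily late at points
    arbitrarily close. *)
Lemma stab_half t : 0 <= t <= 1 -> (forall s, 0 <= s < t -> stab (ray s)) ->
  exists2 del : R, 0 < del & forall z, cmod (z - ray t) < del -> forall k, cmod (iter k f z) < r.
Proof.
move=> tb Hs; have lt := early_exits tb Hs; apply: contrapT => Hn; apply: (late_exits tb Hs) => N del del0.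
have [d d0 Hd] := bounded_prefix Hf (fun k (_ : (k <= N)%N) => lt k).
have m0 : 0 < Num.min d del by rewrite lt_min d0.
have [z [zd [k kr]]] : exists z, cmod (z - ray t) < Num.min d del /\ exists k, r <= cmod (iter k f z).
  apply: contrapT => H; apply: Hn; exists (Num.min d del) => // z zd k.
  by rewrite ltNge; apply/negP => kr; apply: H; exists z; split => //; exists k.
have ex : exists k, r <= cmod (iter k f z) by exists k.
have P := ex_minnP ex; case: P => i ir imin.
move: zd; rewrite lt_min => /andP[zd zdel]; exists z, i; split=> //.
  by rewrite ltnNge; apply/negP => iN; have := Hd z zd i iN; rewrite ltNge ir.
by move=> l li; rewrite ltNge; apply/negP => lr; have := imin l lr; rewrite leqNgt li.
Qed.
End STEP.

(** Stability propagates along the whole ray by [real_induction], but at its end the iterate of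
    order 0 is already at modulus at least [r]. *)
Lemma two_sided_contra f g : side S r x f -> side S r x g ->
  (forall w, cmod w < S -> cmod (g w) < S -> f (g w) = w) ->
  (forall w, cmod w < S -> cmod (f w) < S -> g (f w) = w) ->
  (forall t : R, 0 < t <= 1 -> cmod (ray t) < S -> f (ray t) <> ray t) ->
  r <= cmod (ray 1) -> False.
Proof.
have r1 := r0; have rS1 := rS.
move=> Hf Hg FG GF Hray far.
have Hray' (t : R) : 0 < t <= 1 -> cmod (ray t) < S -> g (ray t) <> ray t.
  move=> tb tS E; apply: (Hray t tb tS); by rewrite -{1}E FG // E.
suff A (t : R) : 0 <= t <= 1 -> stab f g (ray t).
  have [|del del0 H] := A 1; first by rewrite ler01 lexx.
  have c1 : cmod (ray 1 - ray 1) < del by rewrite subrr cmod0.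
  by have [] := H _ c1 0%N; rewrite /=; lra.
move: t; apply: (@real_induction R (fun t => stab f g (ray t))) => t tb Hs.
have Hs' s : 0 <= s < t -> stab g f (ray s).
  by move=> /Hs[d d0 Hd]; exists d => // z zd k; have [] := Hd z zd k.
have [d1 d10 H1] := stab_half Hf Hg FG GF Hray tb Hs.
have [d2 d20 H2] := stab_half Hg Hf GF FG Hray' tb Hs'.
set d : R := Num.min d1 d2; have d0 : 0 < d by rewrite lt_min d10.
have [dd1 dd2] : d <= d1 /\ d <= d2 by apply/andP; rewrite -le_min.
clearbody d.
have h1 : 0 < cmod h + 1 by have := cmod_ge0 h; lra.
exists (d / 2 / (cmod h + 1)) => [|s /andP[ts st]]; first by rewrite !divr_gt0.
have sd : cmod (ray s - ray t) < d / 2.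
  rewrite ray_dist ger0_norm ?subr_ge0 //.
  have : (s - t) * (cmod h + 1) < d / 2 / (cmod h + 1) * (cmod h + 1) by rewrite ltr_pM2r //; lra.
  by rewrite mulfVK ?gt_eqF //; lra.
exists (d / 2) => [|z zs k]; first by lra.
have zt : cmod (z - ray t) < d by have := cmodBtri (ray s) z (ray t); lra.
by split; [apply: H1|apply: H2]; apply: lt_le_trans zt _.
Qed.
End TRICHOTOMY.

(** * The contradiction in a chart *)

Section LOCALTHM. Variable R : realType.
Local Opaque upl upm cmod.
Implicit Types (z w v b x l : C R) (c e : R).

Lemma attr_sub (S : R) nu (a : C R) F (rho rho' c : R) : rho' <= rho -> attr S nu a F rho c -> attr S nu a F rho' c.
Proof.
move=> rr H rho1 r' r10 r'0; have [j0 [n0 A]] := H rho1 r' r10 r'0.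
exists j0, n0 => n nn z [z1 z2 z3]; apply: A => //; split => //; exact: le_trans z2 rr.
Qed.

Lemma omitting_sub (R1 S : R) nu (a : C R) F (rho rho' c : R) : S <= R1 -> rho' <= rho ->
  omitting R1 nu a F rho c -> omitting S nu a F rho' c.
Proof.
move=> SR rr [B B0 H]; exists B => // rho1 r10; have [n0 A] := H rho1 r10.
have sub z : cone nu a rho1 rho' c z -> cone nu a rho1 rho c z.
  by move=> [z1 z2 z3]; split => //; exact: le_trans z2 rr.
exists n0 => n nn k; have [t [tau [T1 T2 T3 T4]]] := A n nn k; exists t, tau; split.
- by move=> c0 r Hc; apply: T1 => z /Hc; exact: sub.
- by move=> z /sub; exact: T2.
- by move=> z /sub Kz Hz; apply: T3 => // i ik; apply: lt_le_trans (Hz i ik) SR.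
- move=> w wS; have [h1 h2] := T4 w (lt_le_trans wS SR); split => // w' w'S.
  exact: h2 (lt_le_trans w'S SR).
Qed.

Lemma mk_side (S : R) nu (a : C R) F F0 : loc S nu a F F0 -> exists2 rs : R, 0 < rs & forall rho : R, 0 < rho <= rs ->
  attr S nu a F rho (1 / 2 / 2) -> forall M r : R, 0 <= M -> 0 < r -> 2 * r <= rho -> 2 * r < S ->
  exists n0, exists2 eps : R, 0 < eps & forall n, (n0 <= n)%N -> forall x l, F n x = x -> cder (F n) x l ->
    l != 1 -> cmod (1 - l) < eps -> `|complex.Re (1 - l)^-1| <= M -> side S r x (F n).
Proof.
move=> HL; have cb : 0 < (1 / 2 : R) <= 1 / 2 by rewrite lexx divr_gt0.
have [rs1 rs10 H1] := accum_fixed HL cb; have [rs2 rs20 H2] := orbit_equicont HL cb.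
have [rs3 rs30 H3] := no_accum HL cb.
exists (Num.min rs1 (Num.min rs2 rs3)) => [|rho]; first by rewrite !lt_min rs10 rs20.
rewrite !le_min => /andP[r0 /and3P[le1 le2 le3]] HA M r M0 rp rr rS.
have {}H1 := H1 rho ltac:(by rewrite r0) HA r rp; have {}H2 := H2 rho ltac:(by rewrite r0) HA r rp.
have {}H3 := H3 rho ltac:(by rewrite r0) HA M r M0 rp.
have [n1 {}H1] := H1; have [n2 {}H2] := H2; have [n3 [eps eps0 {}H3]] := H3.
have [n4 H4] := exit_cone HL rp.
have hr : 0 < r / 2 by rewrite divr_gt0.
have [n5 H5] := loc_near HL hr.
exists (maxn n1 (maxn (maxn n2 n3) (maxn n4 n5))), eps => // n; rewrite !geq_max.
move=> /and3P[nn1 /andP[nn2 nn3] /andP[nn4 nn5]] x l Fx Fl l1 le lM; split=> //.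
- exact: H5.
- by move=> k v; exact: (iter_cont HL).
- by move=> k z w; exact: (iter_inj HL).
- by move=> k c0 rh; exact: (loc_iter_hol HL).
move=> v rv v2 Fv; have vS : cmod v < S by apply: le_lt_trans v2 rS.
have Kv : cone nu a r rho (1 / 2) v.
  by split => //; [exact: le_trans v2 rr|exact: (H4 n nn4 v rv vS Fv)].
have [A1 A2] := H2 n nn2 v Kv; split=> //.
move=> y Hy; split; first exact: (H1 n nn1 v Kv y Hy).
by apply/eqP => E; apply: (H3 n nn3 v Kv x l) => //; rewrite -E.
Qed.

Lemma seq_bound (s : seq (C R)) (phi : C R -> R) : exists2 u : R, 0 < u & forall p, p \in s -> `|phi p| < u.
Proof.
elim: s => [|q s [u u0 IH]]; first by exists 1.
exists (u + `|phi q| + 1) => [|p]; first by have := normr_ge0 (phi q); lra.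
rewrite in_cons => /orP[/eqP ->|/IH]; first lra.
by have := normr_ge0 (phi q); lra_all.
Qed.

Variables (R1 : R) (nu : nat) (a : C R) (F : nat -> C R -> C R) (F0 : C R -> C R).
Hypothesis HL : loc R1 nu a F F0.
Hypothesis F4 : forall n z w, cmod z < R1 -> cmod w < R1 -> cmod (F n z - F n w - (z - w)) <= 1 / 4 * cmod (z - w).
Hypothesis F04 : forall z w, cmod z < R1 -> cmod w < R1 -> cmod (F0 z - F0 w - (z - w)) <= 1 / 4 * cmod (z - w).
Hypothesis Fn0 : forall n, cmod (F n 0) <= R1 / 64.
Hypothesis Fasym : forall z, cmod z < R1 ->
    cmod (F0 z - z - a * z ^+ nu.+1) <= 1 / 64 * (cmod a * cmod z ^+ nu.+1).
Variables (rhoO : R) (M : R) (x l : nat -> C R).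
Hypothesis rhoO0 : 0 < rhoO.
Hypothesis Hom : omitting R1 nu a F rhoO (1 / 2 / 2 / 2).
Hypothesis Hfin : forall n, exists s : seq (C R), forall z, cmod z < R1 -> F n z = z -> z \in s.
Hypothesis x0 : cvgC x 0.
Hypothesis Fx : forall n, F n (x n) = x n.
Hypothesis Fl : forall n, cder (F n) (x n) (l n).
Hypothesis l1 : forall n, l n != 1.
Hypothesis lcvg : cvgC l 1.
Hypothesis lM : forall n, `|complex.Re (1 - l n)^-1| <= M.

Lemma local_theorem : False.
Proof.
have M0 : 0 <= M := le_trans (normr_ge0 _) (lM 0%N).
have R10 := loc_R1 HL.
have [S /andP[S0 SR] [HG GP]] := loc_inverse HL F4 F04 Fn0 Fasym.
have SR1 : S <= R1 by lra_all.
have HF : loc S nu a F F0 by apply: loc_restrict HL _ _; rewrite S0.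
set G := fun n : nat => linv R1 (F n) in HG.
(* Apertures are halved whenever a disc is fitted into a cone: the orbit lemmas work at [1/2] and
   need [attr] at [1/4], which needs [omitting] at [1/8]. *)
have q4 : 0 < 1 / 2 / 2 :> R by rewrite !divr_gt0.
have cb : 0 < (1 / 2 / 2 : R) <= 1 / 2 by rewrite q4; lra_all.
have [rsA rsA0 HA] := attr_of_omitting HF cb.
set rhoF : R := Num.min rsA rhoO.
have rF0 : 0 < rhoF by rewrite lt_min rsA0.
have [f1 f2] : rhoF <= rsA /\ rhoF <= rhoO by apply/andP; rewrite -le_min.
clearbody rhoF.
have aF : attr S nu a F rhoF (1 / 2 / 2) by apply: HA; [rewrite rF0|exact: omitting_sub SR1 f2 Hom].
have FG n w : cmod w < S -> cmod (G n w) < S -> F n (G n w) = w by move=> wS _; have [] := GP n w wS.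
have GF n w : cmod w < S -> cmod (F n w) < S -> G n (F n w) = w.
  by move=> wS _; apply: (linvK (F4 n)); apply: lt_le_trans wS SR1.
have [rsG rsG0 HAG] := attr_inverse HF HG FG cb cb rF0 aF.
have [rs1 rs10 S1] := mk_side HF; have [rs2 rs20 S2] := mk_side HG.
set rho : R := Num.min (Num.min rhoF rsG) (Num.min rs1 rs2).
have rho0 : 0 < rho by rewrite !lt_min rF0 rsG0 rs10.
have : rho <= rho by []. rewrite {2}/rho !le_min => /andP[/andP[g1 g2] /andP[g3 g4]].
clearbody rho.
set r : R := Num.min (rho / 2) (S / 4).
have r0 : 0 < r by rewrite lt_min !divr_gt0.
have [r1 r2] : r <= rho / 2 /\ r <= S / 4 by apply/andP; rewrite -le_min.
clearbody r.
have aF' : attr S nu a F rho (1 / 2 / 2) := attr_sub g1 aF.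
have aG' : attr S nu (- a) G rho (1 / 2 / 2) by apply: HAG; rewrite rho0.
have rr : 2 * r <= rho by lra_all.
have rS : 2 * r < S by lra_all.
have rhb1 : 0 < rho <= rs1 by rewrite rho0.
have rhb2 : 0 < rho <= rs2 by rewrite rho0.
(* The inverse has multiplier [1 / l] at the fixed point, and
   [1 / (1 - 1 / l) = 1 - 1 / (1 - l)]. *)
have M1 : 0 <= M + 1 by lra_all.
have [n1 [e1 e10 K1]] := S1 rho rhb1 aF' M r M0 r0 rr rS.
have [n2 [e2 e20 K2]] := S2 rho rhb2 aG' (M + 1) r M1 r0 rr rS.
set e : R := Num.min (1 / 2) (Num.min e1 (e2 / 2)).
have e0 : 0 < e by rewrite !lt_min e10 !divr_gt0.
have : e <= e by []. rewrite {2}/e !le_min => /and3P[h1 h2 h3]; clearbody e.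
have [n3 L3] := lcvg e0; have [n4 X4] := x0 r0.
pose n := maxn (maxn n1 n2) (maxn n3 n4).
have : (n <= n)%N by []. rewrite {1}/n !geq_max => /andP[/andP[nn1 nn2] /andP[nn3 nn4]].
have lne := L3 n nn3; rewrite cmodBC in lne.
have xr : cmod (x n) < r by have := X4 n nn4; rewrite subr0.
have le1 : cmod (1 - l n) < e1 by lra_all.
have sF := K1 n nn1 (x n) (l n) (Fx n) (Fl n) (l1 n) le1 (lM n).
have xS : cmod (x n) < S by lra_all.
have Gx : G n (x n) = x n by rewrite -{1}(Fx n); apply: GF; rewrite ?Fx.
have cl : 1 / 2 < cmod (l n).
  by have := lerB_cmod 1 (1 - l n); rewrite subKr cmod1; lra_all.
have ln0 : l n != 0 by rewrite -cmod_gt0; lra_all.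
have Gl : cder (G n) (x n) (l n)^-1.
  have d0 : 0 < S - cmod (x n) by rewrite subr_gt0.
  apply: (cder_linv R10 (F4 n) d0).
    move=> u ux; apply: GP; have := cmodD (u - x n) (x n); rewrite subrK; lra_all.
  by rewrite -/(G n) Gx.
have linv1 : (l n)^-1 != 1 by rewrite invr_eq1.
have l1' : 1 - l n != 0 by rewrite subr_eq0 eq_sym.
have lmi : cmod (1 - (l n)^-1) < e2.
  have -> : 1 - (l n)^-1 = - (1 - l n) / l n by field.
  rewrite cmodM cmodN cmodV ltr_pdivrMr; last by lra_all.
  have : e2 * (1 / 2) <= e2 * cmod (l n) by rewrite ler_pM2l //; lra_all.
  lra_all.
have lMi : `|complex.Re (1 - (l n)^-1)^-1| <= M + 1.
  have -> : (1 - (l n)^-1)^-1 = 1 - (1 - l n)^-1.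
    have h4 : l n - 1 != 0 by rewrite subr_eq0.
    by field; rewrite ln0 h4 l1'.
  rewrite cReB /=; have := lM n; have := ler_normB 1 (complex.Re (1 - l n)^-1); rewrite normr1; lra_all.
have sG := K2 n nn2 (x n) (l n)^-1 Gx Gl linv1 lmi lMi.
have [s Hs] := Hfin n.
have [u u0 Hu] := seq_bound s (fun p => complex.Im (p - x n) / complex.Re (p - x n)).
(* The slope [u] of the ray is larger than that of [p - x n] for every fixed point [p] in the disc,
   so the ray meets none of them; [Re h = 2 r] takes its end out of the disc of radius [r]. *)
pose h : C R := Complex (2 * r) (2 * r * u).
have rS4 : 4 * r <= S by lra_all.
apply: (two_sided_contra (x := x n) (h := h) r0 rS4 xr sF sG (FG n) (GF n)).
- move=> t /andP[t0 t1] tS E; have tR : cmod (ray (x n) h t) < R1 by lra_all.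
  have := Hu _ (Hs _ tR E).
  have -> : ray (x n) h t - x n = Complex (t * (2 * r)) (t * (2 * r) * u).
    rewrite /ray addrC addKr; apply/eqP; rewrite eq_complex /=; apply/andP; split; apply/eqP; ring.
  have -> : complex.Im (Complex (t * (2 * r)) (t * (2 * r) * u)) / complex.Re (Complex (t * (2 * r)) (t * (2 * r) * u)) = u.
    by rewrite /= mulrAC divff ?mul1r // gt_eqF // !mulr_gt0.
  by rewrite gtr0_norm // ltxx.
- have -> : ray (x n) h 1 = h + x n by rewrite /ray rmorph1 mul1r addrC.
  have := lerB_cmod h (- x n); rewrite opprK cmodN.
  have := Re_cmod h; rewrite /h /= gtr0_norm; lra_all.
Qed.
End LOCALTHM.

(** * Rational maps in homogeneous coordinates *)

Section HOMOG. Variable R : realType.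
Implicit Types (u v w : C R * C R) (z : C R) (p q : sphere R).

Definition hpt u : sphere R := if u.2 == 0 then None else Some (u.1 / u.2).
Definition nz u := (u.1 != 0) || (u.2 != 0).
Definition hscale (k : C R) u : C R * C R := (k * u.1, k * u.2).

Lemma hpt_hcoord p : hpt (hcoord p) = p.
Proof. by case: p => [a|]; rewrite /hpt /= ?eqxx // oner_eq0 divr1. Qed.

Lemma hcoord_nz p : nz (hcoord p).
Proof. by case: p => [a|]; rewrite /nz /= oner_eq0 ?orbT. Qed.

Lemma hptP u : nz u -> exists2 k, k != 0 & u = hscale k (hcoord (hpt u)).
Proof.
case: u => x y; rewrite /nz /hpt /hscale /=; have [->|y0 _] := eqVneq y 0.
  by rewrite orbF => x0; exists x; rewrite //= mulr1 mulr0.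
by exists y; rewrite //= mulr1 mulrCA divff // mulr1.
Qed.

Lemma hnorm_scale (k : C R) u : hnorm (hscale k u) = cmod k * hnorm u.
Proof.
rewrite /hnorm /= !cmodM !exprMn -mulrDr sqrtrM ?sqr_ge0 //.
by rewrite sqrtr_sqr ger0_norm // cmod_ge0.
Qed.

Lemma hnorm_gt0 u : (0 < hnorm u) = nz u.
Proof.
rewrite /hnorm sqrtr_gt0 /nz; apply/idP/idP => [H|/orP[h|h]].
- rewrite -!cmod_gt0 !lt_neqAle !cmod_ge0 !andbT -negb_and; apply/negP => /andP[/eqP h1 /eqP h2].
  by rewrite -h1 -h2 expr0n addr0 ltxx in H.
- by rewrite ltr_pwDl ?exprn_gt0 ?sqr_ge0 // cmod_gt0.
- by rewrite ltr_wpDl ?exprn_gt0 ?sqr_ge0 // cmod_gt0.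
Qed.

Lemma chordal_hpt u v : nz u -> nz v -> chordal (hpt u) (hpt v) = 2 * cmod (wedge u v) / (hnorm u * hnorm v).
Proof.
move=> nu nv; have [k k0 Eu] := hptP nu; have [l l0 Ev] := hptP nv.
rewrite {2 3}Eu {2 3}Ev !hnorm_scale /chordal.
have -> : wedge (hscale k (hcoord (hpt u))) (hscale l (hcoord (hpt v))) = k * l * wedge (hcoord (hpt u)) (hcoord (hpt v)).
  by rewrite /wedge /hscale /=; ring.
have h1 : hnorm (hcoord (hpt u)) != 0 by rewrite gt_eqF // hnorm_gt0 hcoord_nz.
have h2 : hnorm (hcoord (hpt v)) != 0 by rewrite gt_eqF // hnorm_gt0 hcoord_nz.
have k1 : cmod k != 0 by rewrite gt_eqF // cmod_gt0.
have l1 : cmod l != 0 by rewrite gt_eqF // cmod_gt0.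
by rewrite !cmodM; field; rewrite h1 h2 k1 l1.
Qed.

Lemma hpt_eq u v : nz u -> nz v -> (hpt u = hpt v) <-> wedge u v = 0.
Proof.
move=> nu nv; split=> [E|w0].
  have [k k0 Eu] := hptP nu; have [l l0 Ev] := hptP nv.
  by rewrite Eu Ev E /wedge /hscale /=; ring.
by apply: chordal_positivity; rewrite chordal_hpt // w0 cmod0 mulr0 mul0r.
Qed.

Lemma hpt_scale (k : C R) u : k != 0 -> hpt (hscale k u) = hpt u.
Proof.
move=> k0; rewrite /hpt /hscale /= mulf_eq0 (negPf k0) /=; case: eqP => // /eqP u0.
by congr Some; field; rewrite k0 u0.
Qed.

Lemma chordal_le2 p q : chordal p q <= 2.
Proof.
rewrite -(hpt_hcoord p) -(hpt_hcoord q) chordal_hpt ?hcoord_nz //.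
set u := hcoord p; set v := hcoord q.
have u0 : 0 < hnorm u by rewrite hnorm_gt0 hcoord_nz.
have v0 : 0 < hnorm v by rewrite hnorm_gt0 hcoord_nz.
rewrite ler_pdivrMr ?mulr_gt0 // ler_pM2l //.
have uv0 : 0 <= hnorm u * hnorm v by rewrite mulr_ge0 // ltW.
rewrite -(ler_sqr (x := cmod _)) ?nnegrE ?cmod_ge0 // exprMn.
rewrite /hnorm !sqr_sqrtr ?addr_ge0 ?sqr_ge0 //.
have := cmodB (u.1 * v.2) (u.2 * v.1); rewrite !cmodM -/(wedge u v).
have := cmod_ge0 (wedge u v); have := cmod_ge0 u.1; have := cmod_ge0 u.2; have := cmod_ge0 v.1; have := cmod_ge0 v.2.
move: (cmod _) (cmod _) (cmod _) (cmod _) (cmod _) => d c b a w d0 c0 b0 a0 w0 h.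
apply: le_trans (_ : (c * w + b * a) ^+ 2 <= _).
  by rewrite lerXn2r ?nnegrE // ?addr_ge0 ?mulr_ge0.
rewrite -subr_ge0.
have -> : (c ^+ 2 + b ^+ 2) * (a ^+ 2 + w ^+ 2) - (c * w + b * a) ^+ 2 = (c * a - b * w) ^+ 2 by ring.
exact: sqr_ge0.
Qed.

(** Over any commutative ring, because the same formula is iterated on pairs of numbers and on pairs
    of polynomials, and evaluation commutes with it by [hm_rmorph]. *)
Definition hm (A : comNzRingType) (d : nat) (P Q : nat -> A) (u : A * A) : A * A :=
  (\sum_(i < d.+1) P i * (u.1 ^+ i * u.2 ^+ (d - i)), \sum_(i < d.+1) Q i * (u.1 ^+ i * u.2 ^+ (d - i))).

Lemma hm_rmorph (A B : comNzRingType) (phi : {rmorphism A -> B}) d P Q (u : A * A) :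
  let h := hm d P Q u in
  (phi h.1, phi h.2) = hm d (phi \o P) (phi \o Q) (phi u.1, phi u.2).
Proof. by rewrite /hm /= !rmorph_sum; congr pair; apply: eq_bigr => i _; rewrite !rmorphM !rmorphXn. Qed.

Lemma hm_scale d P Q (k : C R) u : hm d P Q (hscale k u) = hscale (k ^+ d) (hm d P Q u).
Proof.
rewrite /hm /hscale /= !big_distrr /=; congr pair; apply: eq_bigr => i _; rewrite !exprMn [RHS]mulrCA; congr (_ * _);
  by rewrite mulrACA -exprD subnKC // -ltnS.
Qed.

Section REVAL. Variables (f : ratmap R) (c : C R).
Hypothesis c0 : c != 0.
Let d := rdeg f.
Let P i := c * (rnum f)`_i.
Let Q i := c * (rden f)`_i.

Let horner_hm (p : {poly C R}) (z : C R) : (size p <= d.+1)%N ->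
  \sum_(i < d.+1) c * p`_i * (z ^+ i * 1 ^+ (d - i)) = c * p.[z].
Proof.
move=> sp; rewrite (horner_coef_wide _ sp) big_distrr /=; apply: eq_bigr => i _.
by rewrite expr1n mulr1 mulrA.
Qed.

Let sizes : (size (rnum f) <= d.+1)%N /\ (size (rden f) <= d.+1)%N.
Proof.
rewrite /d /rdeg; split; apply: leq_trans (leqSpred _); [exact: leq_maxl|exact: leq_maxr].
Qed.

Let hm_inf : hm d P Q (1, 0) = (P d, Q d).
Proof.
have S (p : nat -> C R) : \sum_(i < d.+1) p i * (1 ^+ i * 0 ^+ (d - i)) = p d.
  rewrite (bigD1 ord_max) //= subnn expr0 expr1n !mulr1 big1 ?addr0 // => i ni.
  have : (i < d)%N by rewrite ltn_neqAle -ltnS ltn_ord andbT.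
  by rewrite -subn_gt0 => /lt0n_neq0 h; rewrite expr0n (negPf h) !mulr0.
by rewrite /hm !S.
Qed.

Let lead_nz : nz (P d, Q d).
Proof.
have cop : coprimep (rnum f) (rden f) by case: f.
have [s1 s2] := sizes.
rewrite /nz /P /Q /= !mulf_eq0 (negPf c0) /=.
case: (leqP (size (rden f)) (size (rnum f))) => h.
  have n0 : rnum f != 0.
    apply/eqP => n0; rewrite n0 size_poly0 leqn0 size_poly_eq0 in h.
    by move: cop; rewrite n0 (eqP h) coprimep_def gcdp0 size_poly0.
  apply/orP; left; have -> : d = (size (rnum f)).-1 by rewrite /d /rdeg (maxn_idPl h).
  by rewrite -lead_coefE lead_coef_eq0.
have n0 : rden f != 0 by rewrite -size_poly_eq0 -lt0n; apply: leq_ltn_trans h.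
apply/orP; right; have -> : d = (size (rden f)).-1 by rewrite /d /rdeg (maxn_idPr (ltnW h)).
by rewrite -lead_coefE lead_coef_eq0.
Qed.

(** Coprimality excludes a common zero of the two forms at a finite point, and the choice of the
    degree as [rdeg f] one at infinity. *)
Lemma reval_hm u : nz u -> nz (hm d P Q u) /\ reval f (hpt u) = hpt (hm d P Q u).
Proof.
have cop : coprimep (rnum f) (rden f) by case: f.
have [s1 s2] := sizes.
suff main p : nz (hm d P Q (hcoord p)) /\ reval f p = hpt (hm d P Q (hcoord p)).
  move=> nu; have [k k0 Eu] := hptP nu; have kd : k ^+ d != 0 by rewrite expf_neq0.
  have -> : hm d P Q u = hscale (k ^+ d) (hm d P Q (hcoord (hpt u))) by rewrite -hm_scale -Eu.
  rewrite hpt_scale //; have [h1 h2] := main (hpt u); split=> //.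
  by move: h1; rewrite /nz /hscale /= !mulf_eq0 (negPf kd).
case: p => [z|].
  have E : hm d P Q (hcoord (Some z)) = (c * (rnum f).[z], c * (rden f).[z]).
    by rewrite /hm /P /Q /= !horner_hm.
  rewrite E; split.
    rewrite /nz /= !mulf_eq0 (negPf c0) /= -negb_and; apply/negP => /andP[/eqP a1 a2].
    by have := coprimep_root cop; move=> /(_ z); rewrite /root a1 eqxx => /(_ isT); rewrite a2.
  rewrite /reval /hpt /= mulf_eq0 (negPf c0) /=; case: eqP => // /eqP q0.
  by congr Some; field; rewrite c0 q0.
rewrite /= hm_inf; split; first exact: lead_nz.
rewrite /reval /hpt /= -/d /P /Q mulf_eq0 (negPf c0) /=; case: eqP => // /eqP q0.
by congr Some; field; rewrite c0 q0.
Qed.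

Lemma riter_hm k u : nz u -> nz (iter k (hm d P Q) u) /\ riter f k (hpt u) = hpt (iter k (hm d P Q) u).
Proof.
move=> nu; elim: k => [|k [n1 E]] //=; have [h1 h2] := reval_hm n1.
by split=> //; rewrite -h2 -E.
Qed.
End REVAL.
End HOMOG.

(** * Charts of the sphere and the chordal metric *)

Section CHARTS. Variable R : realType.
Local Opaque cmod.
Implicit Types (u v w : C R * C R) (z : C R) (p q : sphere R).

(* Homogeneous coordinates centred at a point: [unl p (z, 1)] represents the point of coordinate [z] in
   the chart at [p], which is [z - a] for [p = a] finite and [1 / z] for [p] infinite. *)
Definition unl (A : comNzRingType) (o : option A) (u : A * A) : A * A :=
  if o is Some a then (u.1 + a * u.2, u.2) else (u.2, u.1).
Definition lin (A : comNzRingType) (o : option A) (u : A * A) : A * A :=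
  if o is Some a then (u.1 - a * u.2, u.2) else (u.2, u.1).

Lemma unlK (A : comNzRingType) (o : option A) (u : A * A) : lin o (unl o u) = u.
Proof. by case: o u => [a|] [s t] //=; rewrite /lin /= addrK. Qed.
Lemma linK (A : comNzRingType) (o : option A) (u : A * A) : unl o (lin o u) = u.
Proof. by case: o u => [a|] [s t] //=; rewrite /unl /= subrK. Qed.

Lemma unl_rmorph (A B : comNzRingType) (phi : {rmorphism A -> B}) (o : option A) (u : A * A) :
  (phi (unl o u).1, phi (unl o u).2) = unl (omap phi o) (phi u.1, phi u.2).
Proof. by case: o => [a|] //=; rewrite /unl /= rmorphD rmorphM. Qed.
Lemma lin_rmorph (A B : comNzRingType) (phi : {rmorphism A -> B}) (o : option A) (u : A * A) :
  (phi (lin o u).1, phi (lin o u).2) = lin (omap phi o) (phi u.1, phi u.2).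
Proof. by case: o => [a|] //=; rewrite /lin /= rmorphB rmorphM. Qed.

Lemma unl_wedge p u v : cmod (wedge (unl p u) (unl p v)) = cmod (wedge u v).
Proof.
case: p => [a|]; rewrite /wedge /unl /=.
  by congr cmod; ring.
by rewrite -cmodN; congr cmod; ring.
Qed.

Lemma lin_nz p u : nz (lin p u) = nz u.
Proof.
rewrite /nz; case: p => [a|] /=; last by rewrite orbC.
have [->|//] := eqVneq u.2 0; last by rewrite !orbT.
by rewrite mulr0 subr0.
Qed.
Lemma unl_nz p u : nz (unl p u) = nz u.
Proof. by rewrite -(lin_nz p) unlK. Qed.
Lemma nz1 z : nz (z, 1).
Proof. by rewrite /nz /= oner_eq0 orbT. Qed.
Lemma unl_nz1 p z : nz (unl p (z, 1)).
Proof. by rewrite unl_nz nz1. Qed.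

Lemma lin_scale p (k : C R) u : lin p (hscale k u) = hscale k (lin p u).
Proof. by case: p => [a|]; rewrite /lin /hscale //=; congr pair; ring. Qed.
Lemma unl_scale p (k : C R) u : unl p (hscale k u) = hscale k (unl p u).
Proof. by case: p => [a|]; rewrite /unl /hscale //=; congr pair; ring. Qed.

(** Parametrization of the sphere without one point, centred at [p]; [crd p] is its inverse, with
    value 0 at the missing point by division by 0. *)
Definition cst p z : sphere R := hpt (unl p (z, 1)).
Definition crd p q : C R := (lin p (hcoord q)).1 / (lin p (hcoord q)).2.

Lemma crd_hpt p u : nz u -> crd p (hpt u) = (lin p u).1 / (lin p u).2.
Proof.
move=> nu; have [k k0 Eu] := hptP nu; rewrite {2 3}Eu lin_scale /hscale /= /crd.
have [->|h] := eqVneq (lin p (hcoord (hpt u))).2 0; first by rewrite mulr0 invr0 !mulr0.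
by field; rewrite h k0.
Qed.

Lemma cst_crd p u : nz u -> (lin p u).2 != 0 -> cst p (crd p (hpt u)) = hpt u.
Proof.
move=> nu h; rewrite crd_hpt // /cst.
have -> : ((lin p u).1 / (lin p u).2, 1) = hscale (lin p u).2^-1 (lin p u).
  by rewrite /hscale mulrC mulVf.
by rewrite unl_scale linK hpt_scale ?invr_neq0.
Qed.

Lemma crd_cst p z : crd p (cst p z) = z.
Proof. by rewrite /cst crd_hpt ?unl_nz1 // unlK /= divr1. Qed.

Lemma cst0 p : cst p 0 = p.
Proof. by case: p => [a|]; rewrite /cst /hpt /unl /= ?oner_eq0 ?eqxx // add0r mulr1 divr1. Qed.

Lemma crdpp p : crd p p = 0.
Proof. by rewrite -{2}(cst0 p) crd_cst. Qed.

Lemma hnorm_ge u : cmod u.1 <= hnorm u /\ cmod u.2 <= hnorm u.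
Proof.
have h0 : 0 <= hnorm u by exact: sqrtr_ge0.
have E : hnorm u ^+ 2 = cmod u.1 ^+ 2 + cmod u.2 ^+ 2 by rewrite sqr_sqrtr // addr_ge0 ?sqr_ge0.
split; rewrite -(ler_sqr (x := cmod _)) ?nnegrE ?cmod_ge0 // E; [rewrite lerDl|rewrite lerDr]; exact: sqr_ge0.
Qed.

Lemma hnorm_le u : hnorm u <= cmod u.1 + cmod u.2.
Proof.
have a0 := cmod_ge0 u.1; have b0 := cmod_ge0 u.2.
rewrite -(ler_sqr (x := hnorm _)) ?nnegrE ?addr_ge0 ?sqrtr_ge0 //.
rewrite /hnorm sqr_sqrtr ?addr_ge0 ?sqr_ge0 // sqrrD -addrA lerD2l lerDr.
by rewrite mulrn_wge0 // mulr_ge0.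
Qed.

Lemma unl_norm1 p z : 1 <= hnorm (unl p (z, 1)).
Proof.
by have [h1 h2] := hnorm_ge (unl p (z, 1)); case: p h1 h2 => [a|] /=; rewrite cmod1.
Qed.

Definition pabs p : R := if p is Some a then 1 + cmod (a : C R) else 1.
Lemma pabs_ge1 p : 1 <= pabs p.
Proof. by case: p => [a|] /=; rewrite ?lerDl ?cmod_ge0. Qed.

Lemma unl_norm_le p s t : hnorm (unl p (s, t)) <= pabs p * (cmod s + cmod t).
Proof.
apply: le_trans (hnorm_le _) _; case: p => [a|] /=; last by rewrite mul1r addrC.
have := cmodD s (a * t); rewrite cmodM; have := mulr_ge0 (cmod_ge0 a) (cmod_ge0 s); have := cmod_ge0 t; have := cmod_ge0 s.
by lra.
Qed.

Lemma chordal_cst p z (w : C R) : chordal (cst p z) (cst p w) = 2 * cmod (z - w) / (hnorm (unl p (z, 1)) * hnorm (unl p (w, 1))).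
Proof.
rewrite /cst chordal_hpt ?unl_nz1 // unl_wedge /wedge /=; congr (_ * cmod _ / _); ring.
Qed.

Lemma chordal_cst_le p z (w : C R) : chordal (cst p z) (cst p w) <= 2 * cmod (z - w).
Proof.
have h1 := unl_norm1 p z; have h2 := unl_norm1 p w.
have h3 : 0 < hnorm (unl p (z, 1)) * hnorm (unl p (w, 1)) by apply: mulr_gt0; lra.
rewrite chordal_cst ler_pdivrMr // ler_peMr ?mulr_ge0 ?cmod_ge0 //; rewrite -[1]mulr1; apply: ler_pM => //.
Qed.

Lemma chart_ball p z (e : R) : 0 < e -> exists2 del : R, 0 < del & forall q, chordal q (cst p z) < del ->
  exists2 w, q = cst p w & cmod (w - z) < e.
Proof.
move=> e0; set K := hnorm (unl p (z, 1)); have K1 : 1 <= K := unl_norm1 p z.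
set B := pabs p; have B1 : 1 <= B := pabs_ge1 p.
have z1 : 0 < 1 + cmod z by have := cmod_ge0 z; lra.
have KB : 0 < K * B by rewrite mulr_gt0; lra.
exists (Num.min (K * B)^-1 (e / (K * B * (1 + cmod z)))) => [|q].
  by rewrite lt_min invr_gt0 KB divr_gt0 // mulr_gt0.
rewrite lt_min => /andP[q1 q2]; set u := hcoord q; have nu : nz u := hcoord_nz q.
have qE : q = hpt u by rewrite /u hpt_hcoord.
set s := (lin p u).1; set t := (lin p u).2.
have uE : u = unl p (s, t) by rewrite -(linK p u) /s /t; case: (lin p u).
have hu : 0 < hnorm u by rewrite hnorm_gt0.
set del := chordal q (cst p z) in q1 q2.
have dE : del * (hnorm u * K) = 2 * cmod (s - t * z).
  rewrite /del qE /cst chordal_hpt ?unl_nz1 // {1 2}uE unl_wedge -uE -/K /wedge /= mulr1.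
  by field; rewrite !gt_eqF //; lra.
have del0 : 0 <= del.
  have : 0 <= del * (hnorm u * K) by rewrite dE mulr_ge0 // cmod_ge0.
  by rewrite pmulr_lge0 // mulr_gt0 //; lra.
have nu' : hnorm u <= B * (cmod (s - t * z) + cmod t * (1 + cmod z)).
  rewrite uE; apply: le_trans (unl_norm_le _ _ _) _; rewrite -/B ler_pM2l; last by lra.
  have := cmodD (s - t * z) (t * z); rewrite subrK cmodM; lra.
set D := cmod (s - t * z) in dE nu'.
have D0 : 0 <= D := cmod_ge0 _.
have dK : del * (K * B) < 1 by rewrite -ltr_pdivlMr // div1r.
have X : 2 * D <= del * (K * B) * (D + cmod t * (1 + cmod z)).
  rewrite -dE; have : del * K * hnorm u <= del * K * (B * (D + cmod t * (1 + cmod z))) by rewrite ler_wpM2l // mulr_ge0 //; lra.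
  by move: (D + _) (hnorm u) => x y; lra.
have Y : del * (K * B) * D <= D by rewrite ler_piMl // ltW.
have Z : D <= del * (K * B) * (1 + cmod z) * cmod t by lra.
have t0 : t != 0.
  apply/eqP => t0; move: Z; rewrite /D t0 mul0r subr0 cmod0 mulr0 => s0.
  move: nu; rewrite -(lin_nz p) /nz -/s -/t t0 eqxx orbF -cmod_gt0; lra.
exists (crd p q); first by rewrite qE cst_crd.
rewrite qE crd_hpt // -/s -/t.
have ct : 0 < cmod t by rewrite cmod_gt0.
have -> : s / t - z = (s - t * z) / t by field.
rewrite cmodM cmodV -/D ltr_pdivrMr //; apply: le_lt_trans Z _; rewrite ltr_pM2r //.
by rewrite -mulrA -ltr_pdivlMr // mulr_gt0.
Qed.
End CHARTS.

(** * Limits and derivatives in the topology of [C R] *)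

Section BRIDGE. Variable R : realType.
Implicit Types (z : C R).

(** In the partial order of [C R] a positive element is a positive real, which turns the tolerances
    of the filters into real ones. *)
Lemma C_gt0 (e : C R) : 0 < e -> 0 < complex.Re e /\ e = ((complex.Re e)%:C)%C.
Proof. by case: e => a b; rewrite ltcE /= => /andP[/eqP -> ->]. Qed.

Lemma cvgC_cvg (u : nat -> C R) l : cvgC u l -> u n @[n --> \oo] --> l.
Proof.
move=> H; apply/cvgrPdist_lt => e /C_gt0[e0 ->]; have [n0 Hn] := H _ e0.
exists n0 => // n /= nn; rewrite normE ltcR cmodBC; exact: Hn.
Qed.

Lemma cvg_cvgC (u : nat -> C R) l : u n @[n --> \oo] --> l -> cvgC u l.
Proof.
move=> /cvgrPdist_lt H e e0; have e0' : 0 < (e%:C)%C :> C R by rewrite ltcR.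
have [n0 _ Hn] := H _ e0'; exists n0 => n nn; have := Hn n nn.
by rewrite normE ltcR cmodBC.
Qed.

Lemma cder_derive1 (f : C R -> C R) z d : cder f z d -> derive1 f z = d.
Proof.
move=> H; rewrite /derive1; apply: cvg_lim => //.
apply/cvgrPdist_le => e /C_gt0[e0 ->]; have [del del0 Hd] := H _ e0.
rewrite near_withinE; apply/nbhs_ballP; exists ((del%:C)%C) => /=; first by rewrite ltcR.
move=> h; rewrite /ball /= sub0r normrN normE ltcR => hd h0.
have n0 : 0 < cmod h by rewrite cmod_gt0.
rewrite normE lecR; have := Hd _ hd.
have -> : d - h^-1 *: (f (h + z) - f z) = - (h^-1 * (f (z + h) - f z - d * h)).
  by rewrite /GRing.scale /= [h + z]addrC; field.
by move=> X; rewrite cmodN cmodM cmodV ler_pdivrMl // [_ * complex.Re e]mulrC; exact: X.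
Qed.
End BRIDGE.

(** * Derivatives and multipliers on the sphere *)

Section SDER. Variable R : realType.
Local Opaque cmod.
Implicit Types (z : C R) (p q : sphere R) (g : sphere R -> sphere R).

Lemma cder_poly (P : {poly C R}) z : cder (fun x => P.[x]) z (P^`()).[z].
Proof.
elim/poly_ind: P => [|P c IH].
  rewrite deriv0 horner0; apply: (cder_ext (f := fun=> 0) (r := 1)) => //; last exact: cder_cst.
  by move=> w _; rewrite horner0.
apply: (cder_ext (f := fun x => P.[x] * x + c) (r := 1)) => //.
  by move=> w _; rewrite hornerMXaddC.
rewrite derivD derivC addr0 derivM derivX mulr1 hornerD hornerM hornerX.
by apply: cder_eq (addr0 _) (cderD (cder_eq _ (cderM IH (cder_id z))) (cder_cst c z)); rewrite mulr1.
Qed.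

(** Quotients of the form [N / D^(k+1)] with fixed [D] are stable under differentiation; three uses
    give [hol_ratio]. *)
Lemma cder_ratio (N D : {poly C R}) z k : D.[z] != 0 ->
  cder (fun x => N.[x] / D.[x] ^+ k.+1) z ((N^`() * D - (k.+1%:R *: (N * D^`()))).[z] / D.[z] ^+ k.+2).
Proof.
move=> D0; have dk j : cder (fun x => D.[x] ^+ j.+1) z (j.+1%:R * D.[z] ^+ j * (D^`()).[z]).
  elim: j => [|j IH].
    by apply: (cder_ext (f := fun x => D.[x]) (r := 1)) => //; rewrite expr0 !mul1r; exact: cder_poly.
  apply: (cder_ext (f := fun x => D.[x] ^+ j.+1 * D.[x]) (r := 1)) => // [w _|]; first by rewrite -exprSr.
  apply: cder_eq (cderM IH (cder_poly D z)); rewrite -[in RHS]natr1 [in RHS]exprS [in LHS]exprS; ring.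
have Dk : D.[z] ^+ k.+1 != 0 by rewrite expf_neq0.
apply: cder_eq (cderM (cder_poly N z) (cder_inv (dk k) Dk)).
rewrite hornerD hornerN hornerZ !hornerM !exprS.
have e : D.[z] ^+ k != 0 by rewrite expf_neq0.
by move: (D.[z] ^+ k) e => E e; field; rewrite e D0.
Qed.

Lemma hol_ratio (N D : {poly C R}) (c : C R) (r : R) : (forall z, cmod (z - c) < r -> D.[z] != 0) ->
  hol c r (fun z => N.[z] / D.[z]).
Proof.
move=> H; pose nx (k : nat) (N : {poly C R}) := N^`() * D - k.+1%:R *: (N * D^`()).
exists (fun x => (nx 0%N N).[x] / D.[x] ^+ 2), (fun x => (nx 1%N (nx 0%N N)).[x] / D.[x] ^+ 3).
exists (fun x => (nx 2%N (nx 1%N (nx 0%N N))).[x] / D.[x] ^+ 4) => z zr; split; last 2 first.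
- exact: (cder_ratio _ _ (H z zr)).
- exact: (cder_ratio _ _ (H z zr)).
by have := cder_ratio N 0%N (H z zr); apply: cder_ext (ltr01 (R := R)) _ => w _; rewrite expr1.
Qed.

Lemma poly_punctured (P : {poly C R}) : (forall t : C R, t != 0 -> P.[t] = 0) -> P.[0] = 0.
Proof.
move=> H; apply/eqP/negPn/negP => P0; have c0 : 0 < cmod P.[0] by rewrite cmod_gt0.
have [del del0 Hd] := cder_cont (cder_poly P 0) c0.
set t : C R := ((del / 2)%:C)%C.
have ct : cmod t = del / 2 by rewrite cmodR gtr0_norm // divr_gt0.
have t0 : t != 0 by rewrite -cmod_gt0 ct divr_gt0.
have := Hd t; rewrite subr0 ct (H t t0) sub0r cmodN ltxx => X; apply: notF; apply: X; lra.
Qed.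

(* [k] is the derivative of [g] at [p], in the charts at [p] and at [g p]. *)
Definition sder g p (k : C R) := cder (fun z => crd (g p) (g (cst p z))) 0 k /\
  exists2 r : R, 0 < r & forall z, cmod z < r -> g (cst p z) = cst (g p) (crd (g p) (g (cst p z))).

Lemma sder_comp g1 g2 p k1 k2 : sder g1 p k1 -> sder g2 (g1 p) k2 -> sder (g2 \o g1) p (k2 * k1).
Proof.
move=> [d1 [r1 r10 H1]] [d2 [r2 r20 H2]].
have h0 : crd (g1 p) (g1 (cst p 0)) = 0 by rewrite cst0 crdpp.
have [del del0 Hd] := cder_cont d1 r20.
have m0 : 0 < Num.min r1 del by rewrite lt_min r10.
split.
  apply: (cder_ext m0 (f := fun z => crd (g2 (g1 p)) (g2 (cst (g1 p) (crd (g1 p) (g1 (cst p z))))))).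
    by move=> w; rewrite subr0 lt_min => /andP[wr _]; rewrite -H1.
  by apply: (cder_comp (f := fun w => crd (g2 (g1 p)) (g2 (cst (g1 p) w)))) d1 _; rewrite h0.
exists (Num.min r1 del) => // z; rewrite lt_min => /andP[z1 z2] /=.
have := Hd z; rewrite subr0 h0 subr0 => /(_ z2) z3.
by rewrite H1 //; exact: H2.
Qed.

Lemma sder_uniq g p k1 k2 : sder g p k1 -> sder g p k2 -> k1 = k2.
Proof. by move=> [d1 _] [d2 _]; exact: cder_uniq d1 d2. Qed.

Lemma sder_id p : sder id p 1.
Proof.
split; first by apply: (cder_ext (r := 1) (f := id)) (cder_id 0) => // w _; rewrite crd_cst.
by exists 1 => // z _; rewrite crd_cst.
Qed.

Lemma sder_iter g p k n : g p = p -> sder g p k -> sder (iter n g) p (k ^+ n).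
Proof.
move=> gp H; have ip j : iter j g p = p by elim: j => //= j ->.
elim: n => [|n IH]; first exact: sder_id.
by rewrite exprS; apply: (sder_comp (g1 := iter n g) (g2 := g)) IH _; rewrite ip.
Qed.

Lemma crd_some a q : q != None -> crd (Some a : sphere R) q = odflt 0 q - a.
Proof. by case: q => // b _; rewrite /crd /lin /= mulr1 divr1. Qed.

Lemma crd_inf q : crd (None : sphere R) q = odflt 0 (sphere_inv q).
Proof.
case: q => [b|]; rewrite /crd /lin /=; last by rewrite mul0r.
by rewrite mul1r; case: eqP => // ->; rewrite invr0.
Qed.

Lemma cst_some a z : cst (Some a : sphere R) z = Some (z + a).
Proof. by rewrite /cst /hpt /unl /= oner_eq0 mulr1 divr1. Qed.

Lemma cst_inf z : cst (None : sphere R) z = sphere_inv (Some z).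
Proof. by rewrite /cst /hpt /unl /= div1r. Qed.

Lemma sder_mult g p k : g p = p -> sder g p k -> multiplier g p = k.
Proof.
move=> gp [d [r r0 H]]; rewrite gp in d H.
case: p gp d H => [a|] gp d H; rewrite /multiplier; apply: cder_derive1; last first.
  by apply: cder_ext (ltr01 (R := R)) _ d => w _; rewrite crd_inf cst_inf.
have sh : cder (fun z : C R => z - a) a 1 by apply: cder_eq (subr0 _) (cderB (cder_id a) (cder_cst a a)).
have d' : cder (fun z => crd (Some a) (g (cst (Some a) z))) (a - a) k by rewrite subrr.
apply: (cder_ext r0 (f := fun z => crd (Some a) (g (cst (Some a) (z - a))) + a)).
  move=> w wr; rewrite cst_some subrK; have := H _ wr; rewrite cst_some subrK => E.
  have ne : g (Some w) != None by rewrite E cst_some.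
  by rewrite (crd_some a ne) subrK.
apply: cder_eq (addr0 _) (cderD _ (cder_cst a a)).
by apply: cder_eq (mulr1 _) (cder_comp sh d').
Qed.

(* The derivative at a fixed point near [p], computed in the chart at [p]. *)
Lemma cder_of_sder g p t k : g (cst p t) = cst p t -> sder g (cst p t) k ->
  cder (fun z => crd p (g (cst p z))) t k.
Proof.
move=> gx [d [r r0 H]]; rewrite gx in d H.
have sh : cder (fun z : C R => z - t) t 1 by apply: cder_eq (subr0 _) (cderB (cder_id t) (cder_cst t t)).
case: p gx d H => [a|] gx d H.
  rewrite cst_some in gx d H.
  have d' : cder (fun z => crd (Some (t + a)) (g (cst (Some (t + a)) z))) (t - t) k by rewrite subrr.
  apply: (cder_ext r0 (f := fun z => crd (Some (t + a)) (g (cst (Some (t + a)) (z - t))) + t)).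
    move=> w wr; have := H _ wr; rewrite !cst_some.
    have -> : w - t + (t + a) = w + a by ring.
    move=> E; have ne : g (Some (w + a)) != None by rewrite E.
    by rewrite (crd_some (t + a) ne) (crd_some a ne); ring.
  apply: cder_eq (addr0 _) (cderD _ (cder_cst t t)).
  by apply: cder_eq (mulr1 _) (cder_comp sh d').
have [t0|t0] := eqVneq t 0.
  have pE : cst None t = None :> sphere R by rewrite t0 cst0.
  rewrite pE in gx d; rewrite t0; exact: d.
have ce : cst None t = Some t^-1 :> sphere R by rewrite cst_inf /= (negPf t0).
rewrite ce in gx d H.
(* with [w = 1/t], the local map is [z |-> 1 / (w + h (1/z - w))] *)
have iv : cder (fun z : C R => z^-1 - t^-1) t (- (t ^+ 2)^-1).
  by apply: cder_eq (subr0 _) (cderB (cderV t0) (cder_cst t^-1 t)).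
have d' : cder (fun z => crd (Some t^-1) (g (cst (Some t^-1) z))) (t^-1 - t^-1) k by rewrite subrr.
have c1 := cderD (cder_comp iv d') (cder_cst t^-1 t).
have h0 : crd (Some t^-1) (g (cst (Some t^-1) (t^-1 - t^-1))) = 0 :> C R.
  by rewrite subrr cst0 gx crdpp.
have v0 : crd (Some t^-1) (g (cst (Some t^-1) (t^-1 - t^-1))) + t^-1 != 0 :> C R.
  by rewrite h0 add0r invr_neq0.
have c2 := cder_inv c1 v0.
have ct : 0 < cmod t by rewrite cmod_gt0.
have [del del0 Hd] := cder_cont iv r0.
have m0 : 0 < Num.min (cmod t) del by rewrite lt_min ct.
apply: (cder_ext m0) (cder_eq _ c2); last by rewrite h0 add0r; field.
move=> w; rewrite lt_min => /andP[wt wd].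
have w0 : w != 0 by apply/eqP => w0; move: wt; rewrite w0 sub0r cmodN ltxx.
have := Hd w wd; rewrite subrr subr0 => /H.
have -> : cst (Some t^-1) (w^-1 - t^-1) = cst None w :> sphere R.
  by rewrite cst_some subrK cst_inf /= (negPf w0).
move=> E; have ne : g (cst None w) != None by rewrite E cst_some.
rewrite (crd_some t^-1 ne) subrK crd_inf.
by case: (g (cst None w)) => [b|] /=; [case: eqP => // ->|]; rewrite invr0.
Qed.
End SDER.

(** * Iterates as quotients of polynomials, and preimages *)

Section RATIONAL. Variable R : realType.
Local Opaque cmod.
Implicit Types (z : C R) (p q : sphere R).
Variables (f : ratmap R) (c : C R).
Hypothesis c0 : c != 0.
Let d := rdeg f.
Let P i := c * (rnum f)`_i.
Let Q i := c * (rden f)`_i.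
Let H := hm d P Q.

(** The two homogeneous components are never divided by a common factor, so their coefficients are
    polynomial in those of [f] and pass to the limit. *)
Definition rpoly k (o : option {poly C R}) (x : {poly C R} * {poly C R}) : {poly C R} * {poly C R} :=
  iter k (hm d (fun i => (P i)%:P) (fun i => (Q i)%:P)) (unl o x).

Lemma rpolyE k p (x : {poly C R} * {poly C R}) z :
  ((rpoly k (omap polyC p) x).1.[z], (rpoly k (omap polyC p) x).2.[z]) = iter k H (unl p (x.1.[z], x.2.[z])).
Proof.
elim: k => [|k IH].
  rewrite /rpoly /= -!horner_evalE (unl_rmorph (horner_eval z)); congr unl.
  by case: p => //= a; rewrite horner_evalE hornerC.
rewrite /rpoly !iterS -/(rpoly k _ _) -IH -!horner_evalE (hm_rmorph (horner_eval z)) /H !horner_evalE.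
by congr hm; apply/funext => i /=; rewrite horner_evalE hornerC.
Qed.

(** Numerator and denominator of the [k]-th iterate read from the chart at [p] to the chart at
    [q]. *)
Definition nden k p q : {poly C R} * {poly C R} := lin (omap polyC q) (rpoly k (omap polyC p) ('X, 1)).

Lemma ndenE k p q z : ((nden k p q).1.[z], (nden k p q).2.[z]) = lin q (iter k H (unl p (z, 1))).
Proof.
have := rpolyE k p ('X, 1) z; rewrite /= hornerX hornerC => <-.
rewrite /nden -!horner_evalE (lin_rmorph (horner_eval z)); congr lin.
by case: q => //= a; rewrite horner_evalE hornerC.
Qed.

Lemma riter_cst k p z : nz (iter k H (unl p (z, 1))) /\ riter f k (cst p z) = hpt (iter k H (unl p (z, 1))).
Proof. exact: riter_hm c0 k _ (unl_nz1 p z). Qed.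

Lemma riter_crd k p q z : crd q (riter f k (cst p z)) = (nden k p q).1.[z] / (nden k p q).2.[z].
Proof.
have [n1 ->] := riter_cst k p z; rewrite crd_hpt //; have := ndenE k p q z; by case: (lin _ _) => s t /= [-> ->].
Qed.

Lemma riter_eq_cst k p q z : (nden k p q).2.[z] != 0 ->
  riter f k (cst p z) = cst q ((nden k p q).1.[z] / (nden k p q).2.[z]).
Proof.
move=> h; rewrite -riter_crd; have [n1 E] := riter_cst k p z; rewrite E cst_crd //.
by have := ndenE k p q z; case: (lin _ _) => s t /= [_ <-].
Qed.

Lemma nden_at0 k p q : riter f k p = q -> (nden k p q).1.[0] = 0 /\ (nden k p q).2.[0] != 0.
Proof.
move=> E; have [n1 E1] := riter_cst k p 0; rewrite cst0 E in E1.
have := ndenE k p q 0; set u := iter k H _ in n1 E1 * => En.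
have w0 : wedge u (unl q (0, 1)) = 0 by apply/(hpt_eq n1 (unl_nz1 q 0)); rewrite -E1 -/(cst q 0) cst0.
have : (lin q u).1 = 0.
  have : cmod (wedge u (unl q (0, 1))) = 0 by rewrite w0 cmod0.
  by rewrite -{1}(linK q u) unl_wedge /wedge /= mulr1 mulr0 subr0 => /cmod_eq0.
rewrite -En /= => h; split=> //.
by have := lin_nz q u; rewrite n1 -En /nz /= h eqxx.
Qed.

Lemma nden_root k p q z : (nden k p q).1.[z] = 0 -> riter f k (cst p z) = q.
Proof.
move=> h; rewrite (@riter_eq_cst k p q) ?h ?mul0r ?cst0 //.
have [n1 _] := riter_cst k p z.
by have := lin_nz q (iter k H (unl p (z, 1))); rewrite n1 -ndenE /nz /= h eqxx.
Qed.

Lemma sder_riter k p : exists l, sder (riter f k) p l /\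
  l = (nden k p (riter f k p)).1^`().[0] / (nden k p (riter f k p)).2.[0].
Proof.
set q := riter f k p; have [N0 D0] := nden_at0 (erefl q : riter f k p = q).
exists ((nden k p q).1^`().[0] / (nden k p q).2.[0]); split=> //.
have D' := cder_ratio (nden k p q).1 0%N D0.
split.
  apply: (cder_ext (ltr01 (R := R))) (cder_eq _ D') => [w _|]; first by rewrite expr1 riter_crd.
  rewrite hornerD hornerN hornerZ !hornerM N0; by field.
have c1 : 0 < cmod (nden k p q).2.[0] by rewrite cmod_gt0.
have [del del0 Hd] := cder_cont (cder_poly (nden k p q).2 0) c1.
exists del => // z zd; rewrite riter_crd; apply: riter_eq_cst; apply/eqP => E.
by have := Hd z; rewrite subr0 E sub0r cmodN ltxx => /(_ zd).
Qed.

(** The numerator of [nden 1 p q] in the complementary coordinate [t = 1 / z], which is 0 at the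
    point missed by the chart. *)
Let Psi p q : {poly C R} := (lin (omap polyC q) (rpoly 1 (omap polyC p) (1, 'X))).1.

Let PsiE p q t : (Psi p q).[t] = (lin q (H (unl p (1, t)))).1.
Proof.
have L := lin_rmorph (horner_eval t) (omap polyC q) (rpoly 1 (omap polyC p) (1, 'X)).
have qE : omap (horner_eval t) (omap polyC q) = q by case: (q) => //= a; rewrite horner_evalE hornerC.
have E1 := rpolyE 1 p (1, 'X) t.
have xE : ((1 : {poly C R}, 'X : {poly C R}).1.[t], (1 : {poly C R}, 'X : {poly C R}).2.[t]) = (1, t).
  by rewrite /= hornerC hornerX.
rewrite qE in L; have L' : (Psi p q).[t] = (lin q ((rpoly 1 (omap polyC p) (1, 'X)).1.[t],
  (rpoly 1 (omap polyC p) (1, 'X)).2.[t])).1 := congr1 fst L.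
by rewrite L' E1 xE.
Qed.

(* The point missed by the chart at [p]. *)
Let miss p := hpt (unl p (1, 0)).

(** The numerator is a form of degree [d]. If it is [k z^e] in the chart with [e < d], it is
    divisible by the second coordinate, hence vanishes at the missed point as well. *)
Let monomial_miss p q (k : C R) e : (e < d)%N -> (forall z, (nden 1 p q).1.[z] = k * z ^+ e) -> reval f (miss p) = q.
Proof.
move=> ed Hh.
have n1 : nz (unl p (1, 0)) by rewrite unl_nz /nz /= oner_eq0.
have P0 : (Psi p q).[0] = 0.
  have := @poly_punctured R (Psi p q - k *: 'X^(d - e)).
  rewrite !hornerE /= expr0n subn_eq0 leqNgt ed /= mulr0 oppr0 addr0; apply => t t0.
  rewrite !hornerE PsiE.
  have -> : unl p (1, t) = hscale t (unl p (t^-1, 1)) by rewrite -unl_scale /hscale /= divff // mulr1.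
  rewrite /H hm_scale lin_scale -/H.
  have N : (nden 1 p q).1.[t^-1] = (lin q (H (unl p (t^-1, 1)))).1 := congr1 fst (ndenE 1 p q t^-1).
  have -> : (hscale (t ^+ d) (lin q (H (unl p (t^-1, 1))))).1 = t ^+ (d - e) * t ^+ e * (k * (t ^+ e)^-1).
    by rewrite -exprD subnK 1?ltnW // -exprVn -Hh N.
  have te : t ^+ e != 0 by rewrite expf_neq0.
  by move: (t ^+ e) te (t ^+ (d - e)) => X X0 Y; field.
have [n2 E] := reval_hm f c0 n1; rewrite -/d -/P -/Q -/H in n2 E.
rewrite /miss E; have h := lin_nz q (H (unl p (1, 0))); rewrite n2 /nz -PsiE P0 eqxx /= in h.
by rewrite -(cst_crd (p := q) n2 h) crd_hpt // -PsiE P0 mul0r cst0.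
Qed.

Let miss_neq p : miss p <> p.
Proof.
have n1 : nz (unl p (1, 0)) by rewrite unl_nz /nz /= oner_eq0.
rewrite -{2}(cst0 p) => /(hpt_eq n1 (unl_nz1 p 0)) w0.
have : cmod (wedge (unl p (1, 0)) (unl p (0, 1))) = 0 by rewrite w0 cmod0.
by rewrite unl_wedge /wedge /= mulr1 mulr0 subr0 cmod1 => /eqP; rewrite oner_eq0.
Qed.

Lemma reval_surj q : (0 < d)%N -> exists y, reval f y = q.
Proof.
move=> d0; set h := (nden 1 q q).1.
have [s1|s1] := eqVneq (size h) 1%N; last first.
  have /closed_rootP[z /rootP hz] := s1; by exists (cst q z); exact: (nden_root (k := 1) hz).
have /size_poly1P[k k0 hk] : size h == 1%N by rewrite s1.
exists (miss q); apply: (@monomial_miss q q k 0) => // z; by rewrite -/h hk hornerC expr0 mulr1.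
Qed.

(** As the derivative is not 0, [p] is a simple zero of the numerator. The cofactor [k] has another
    zero, or is constant; in that case, the degree being at least 2, the missed point is a
    preimage. *)
Lemma other_preimage p l : (1 < d)%N -> l != 0 -> sder (reval f) p l -> exists2 y, y <> p & reval f y = reval f p.
Proof.
move=> d1 l0 Hl; set q := reval f p.
have [l' [Hl' lE]] := sder_riter 1 p.
have ll : l' = l := sder_uniq Hl' Hl.
have [N0 D0] := nden_at0 (erefl (riter f 1 p)); rewrite -ll lE {l ll Hl l' Hl' lE} in l0.
rewrite -/(reval f p) -/q in N0 D0 l0; change (riter f 1 p) with q in *.
set h := (nden 1 p q).1 in N0 l0.
have /factor_theorem[k hk] : root h 0 by apply/rootP.
rewrite subr0 in hk.
have k0 : k.[0] != 0.
  apply: contraNneq l0 => k0; apply/eqP.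
  by rewrite hk derivM derivX mulr1 hornerD hornerM k0 hornerX mulr0 addr0 mul0r.
have [s1|s1] := eqVneq (size k) 1%N.
  exists (miss p); first exact: miss_neq.
  have /size_poly1P[b b0 kb] : size k == 1%N by rewrite s1.
  apply: (@monomial_miss p q b 1) => // z; by rewrite -/h hk kb hornerM hornerC hornerX expr1.
have /closed_rootP[z /rootP kz] := s1.
have hz : h.[z] = 0 by rewrite hk hornerM kz mul0r.
exists (cst p z); last exact: (nden_root (k := 1) hz).
by move=> E; move: k0; rewrite -{1}(crdpp p) -{2}E crd_cst kz eqxx.
Qed.
End RATIONAL.

(** * Convergence of polynomials *)

Section PCVG. Variable R : realType.
Local Opaque cmod.
Implicit Types (z l : C R) (u v : nat -> C R).

Lemma cvgC_cst z : cvgC (fun=> z) z.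
Proof. by move=> e e0; exists 0%N => n _; rewrite subrr cmod0. Qed.

Lemma cvgCD u v k l : cvgC u k -> cvgC v l -> cvgC (fun n => u n + v n) (k + l).
Proof.
move=> hu hv e e0; have e2 : 0 < e / 2 by rewrite divr_gt0.
have [n0 H0] := hu _ e2; have [n1 H1] := hv _ e2; exists (maxn n0 n1) => n.
rewrite geq_max => /andP[/H0 a0 /H1 a1]; have -> : u n + v n - (k + l) = (u n - k) + (v n - l) by ring.
by apply: le_lt_trans (cmodD _ _) _; rewrite (splitr e); exact: ltrD.
Qed.

Lemma cvgCM u v k l : cvgC u k -> cvgC v l -> cvgC (fun n => u n * v n) (k * l).
Proof.
move=> hu hv e e0; have K0 : 0 < cmod k + 1 by have := cmod_ge0 k; lra.
have L0 : 0 < cmod l + 1 by have := cmod_ge0 l; lra.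
have e1 : 0 < e / 2 / (cmod k + 1) by rewrite !divr_gt0.
have e2 : 0 < Num.min 1 (e / 2 / (cmod l + 1)) by rewrite lt_min ltr01 !divr_gt0.
have [n0 H0] := hu _ e2; have [n1 H1] := hv _ e1; exists (maxn n0 n1) => n.
rewrite geq_max => /andP[/H0 + /H1 a1]; rewrite lt_min => /andP[a0 a2].
have -> : u n * v n - k * l = u n * (v n - l) + l * (u n - k) by ring.
apply: le_lt_trans (cmodD _ _) _; rewrite !cmodM (splitr e).
have un : cmod (u n) <= cmod k + 1 by have := cmodD (u n - k) k; rewrite subrK; lra.
apply: ltr_leD.
  apply: le_lt_trans (_ : (cmod k + 1) * cmod (v n - l) < _); first by rewrite ler_wpM2r // cmod_ge0.
  by rewrite mulrC -ltr_pdivlMr.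
apply: le_trans (_ : (cmod l + 1) * cmod (u n - k) <= _); first by rewrite ler_wpM2r ?cmod_ge0 // lerDl.
by rewrite mulrC -ler_pdivlMr // ltW.
Qed.

Lemma cvgC_sum K (u : nat -> nat -> C R) (l : nat -> C R) : (forall i, (i < K)%N -> cvgC (fun n => u n i) (l i)) ->
  cvgC (fun n => \sum_(i < K) u n i) (\sum_(i < K) l i).
Proof.
elim: K => [|K IH] H.
  by rewrite big_ord0; move=> e e0; exists 0%N => n _; rewrite big_ord0 subrr cmod0.
have h := cvgCD (IH (fun i iK => H i (leqW iK))) (H K (leqnn _)).
rewrite big_ord_recr /=; move=> e e0; have [n0 Hn] := h e e0; exists n0 => n nn.
by rewrite big_ord_recr /=; exact: Hn.
Qed.

(** The common bound on the sizes makes convergence of the coefficients uniform convergence on the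
    unit disc. *)
Definition pcvg (A : nat -> {poly C R}) (A0 : {poly C R}) := (exists K, (size A0 <= K)%N /\ forall n, (size (A n) <= K)%N) /\
  forall i, cvgC (fun n => (A n)`_i) A0`_i.

Lemma pcvg_cst A0 : pcvg (fun=> A0) A0.
Proof. by split; [exists (size A0)|move=> i; exact: cvgC_cst]. Qed.

Lemma pcvgC u l : cvgC u l -> pcvg (fun n => (u n)%:P) l%:P.
Proof.
move=> h; split; first by exists 1%N; split=> [|n]; exact: size_polyC_leq1.
move=> i; rewrite coefC; case: eqP => [->|i0].
  by move=> e e0; have [n0 Hn] := h e e0; exists n0 => n nn; rewrite coefC eqxx; exact: Hn.
by move=> e e0; exists 0%N => n _; rewrite coefC; case: eqP => // _; rewrite subrr cmod0.
Qed.

Lemma pcvgD A B A0 B0 : pcvg A A0 -> pcvg B B0 -> pcvg (fun n => A n + B n) (A0 + B0).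
Proof.
move=> [[K [k0 Kn]] ha] [[L [l0 Ln]] hb]; split.
  exists (maxn K L); split=> [|n]; apply: leq_trans (size_polyD _ _) _; rewrite geq_max !leq_max.
    by rewrite k0 l0 orbT.
  by rewrite Kn Ln orbT.
move=> i; rewrite coefD => e e0; have [n0 Hn] := cvgCD (ha i) (hb i) e0; exists n0 => n nn.
by rewrite coefD; exact: Hn.
Qed.

Lemma pcvgM A B A0 B0 : pcvg A A0 -> pcvg B B0 -> pcvg (fun n => A n * B n) (A0 * B0).
Proof.
move=> [[K [k0 Kn]] ha] [[L [l0 Ln]] hb]; split.
  exists (K + L)%N; split=> [|n]; apply: leq_trans (size_polyMleq _ _) _; apply: leq_trans (leq_pred _) _; exact: leq_add.
move=> i; rewrite coefM => e e0.
have [n0 Hn] := cvgC_sum (K := i.+1) (u := fun n j => (A n)`_j * (B n)`_(i - j))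
  (l := fun j => A0`_j * B0`_(i - j)) (fun j _ => cvgCM (ha j) (hb _)) e0.
by exists n0 => n nn; rewrite coefM; exact: Hn.
Qed.

Lemma pcvgX A A0 k : pcvg A A0 -> pcvg (fun n => A n ^+ k) (A0 ^+ k).
Proof. by move=> h; elim: k => [|k IH]; [exact: pcvg_cst|]; rewrite exprS (_ : (fun n => _) = (fun n => A n * A n ^+ k)); [exact: pcvgM|apply/funext => n; rewrite exprS]. Qed.

Lemma pcvg_sum K (A : nat -> nat -> {poly C R}) (A0 : nat -> {poly C R}) :
  (forall i, (i < K)%N -> pcvg (fun n => A n i) (A0 i)) -> pcvg (fun n => \sum_(i < K) A n i) (\sum_(i < K) A0 i).
Proof.
elim: K => [|K IH] H.
  rewrite big_ord0 (_ : (fun n => _) = (fun=> 0)); first exact: pcvg_cst.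
  by apply/funext => n; rewrite big_ord0.
rewrite big_ord_recr (_ : (fun n => _) = (fun n => \sum_(i < K) A n i + A n K)).
  exact: pcvgD (IH (fun i iK => H i (leqW iK))) (H K (leqnn _)).
by apply/funext => n; rewrite big_ord_recr.
Qed.

Lemma pcvg_deriv A A0 : pcvg A A0 -> pcvg (fun n => (A n)^`()) A0^`().
Proof.
move=> [[K [k0 Kn]] ha]; split.
  exists K; split=> [|n]; rewrite ?size_poly; apply: leq_trans (size_poly _ _) _; apply: leq_trans (leq_pred _) _ => //.
move=> i; rewrite coef_deriv -mulr_natl => e e0.
have [n0 Hn] := cvgCM (cvgC_cst i.+1%:R) (ha i.+1) e0.
by exists n0 => n nn; rewrite coef_deriv -(mulr_natl (A n)`_i.+1); exact: Hn.
Qed.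

Lemma pcvg_unif A A0 : pcvg A A0 -> forall e : R, 0 < e -> exists n0, forall n, (n0 <= n)%N ->
  forall z, cmod z <= 1 -> cmod ((A n).[z] - A0.[z]) <= e.
Proof.
move=> [[K [k0 Kn]] ha].
suff H : forall e : R, 0 < e -> exists n0, forall n, (n0 <= n)%N -> \sum_(i < K) cmod ((A n)`_i - A0`_i) <= e.
  move=> e /H[n0 Hn]; exists n0 => n nn z z1; apply: le_trans (Hn n nn).
  rewrite (horner_coef_wide _ k0) (horner_coef_wide _ (Kn n)) -sumrB.
  elim: K {k0 Kn H Hn} => [|K IH]; first by rewrite !big_ord0 cmod0.
  rewrite !big_ord_recr /=; apply: le_trans (cmodD _ _) _; apply: lerD => //.
  rewrite -mulrBl cmodM cmodX ler_piMr ?cmod_ge0 //; apply: exprn_ile1 => //; exact: cmod_ge0.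
elim: K {k0 Kn} => [|K IH] e e0; first by exists 0%N => n _; rewrite big_ord0 ltW.
have e2 : 0 < e / 2 by rewrite divr_gt0.
have [n0 H0] := IH _ e2; have [n1 H1] := ha K _ e2.
exists (maxn n0 n1) => n; rewrite geq_max => /andP[nn0 nn1]; rewrite big_ord_recr /= (splitr e).
by apply: lerD; [exact: H0|apply: ltW; exact: H1].
Qed.

Lemma pcvg_near A A0 : pcvg A A0 -> forall e : R, 0 < e -> exists2 r : R, 0 < r & exists n0, forall n, (n0 <= n)%N ->
  forall z, cmod z < r -> cmod ((A n).[z] - A0.[0]) <= e.
Proof.
move=> h e e0; have e2 : 0 < e / 2 by rewrite divr_gt0.
have [n0 Hn] := pcvg_unif h e2; have [del del0 Hd] := cder_cont (cder_poly A0 0) e2.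
exists (Num.min 1 del); first by rewrite lt_min ltr01.
exists n0 => n nn z; rewrite lt_min => /andP[z1 zd].
apply: le_trans (cmodBtri A0.[z] _ _) _; rewrite (splitr e); apply: lerD; first exact: Hn n nn z (ltW z1).
by apply: ltW; apply: Hd; rewrite subr0.
Qed.

Lemma pcvg_neq0 A A0 : pcvg A A0 -> A0 != 0 -> exists n0, forall n, (n0 <= n)%N -> A n != 0.
Proof.
move=> [_ h] A00; set i := (size A0).-1.
have c0 : 0 < cmod A0`_i by rewrite cmod_gt0 -lead_coefE lead_coef_eq0.
have [n0 Hn] := h i _ c0; exists n0 => n nn; apply/eqP => E; have := Hn n nn.
by rewrite E coef0 sub0r cmodN ltxx.
Qed.

Lemma rpoly_cvg (f : nat -> ratmap R) (f0 : ratmap R) (c : nat -> C R) k o x :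
  (forall n, rdeg (f n) = rdeg f0) ->
  (forall i, cvgC (fun n => c n * (rnum (f n))`_i) (rnum f0)`_i) ->
  (forall i, cvgC (fun n => c n * (rden (f n))`_i) (rden f0)`_i) ->
  pcvg (fun n => (rpoly (f n) (c n) k o x).1) (rpoly f0 1 k o x).1 /\
  pcvg (fun n => (rpoly (f n) (c n) k o x).2) (rpoly f0 1 k o x).2.
Proof.
move=> dn hP hQ; elim: k => [|k [IH1 IH2]]; first by split; exact: pcvg_cst.
have step (P : nat -> nat -> C R) (P0 : nat -> C R) : (forall i, cvgC (fun n => P n i) (P0 i)) ->
    pcvg (fun n => \sum_(i < (rdeg f0).+1) (P n i)%:P * ((rpoly (f n) (c n) k o x).1 ^+ i * (rpoly (f n) (c n) k o x).2 ^+ (rdeg f0 - i)))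
     (\sum_(i < (rdeg f0).+1) (P0 i)%:P * ((rpoly f0 1 k o x).1 ^+ i * (rpoly f0 1 k o x).2 ^+ (rdeg f0 - i))).
  move=> h.
  apply: (@pcvg_sum _ (fun n i => (P n i)%:P * ((rpoly (f n) (c n) k o x).1 ^+ i * (rpoly (f n) (c n) k o x).2 ^+ (rdeg f0 - i)))
     (fun i => (P0 i)%:P * ((rpoly f0 1 k o x).1 ^+ i * (rpoly f0 1 k o x).2 ^+ (rdeg f0 - i)))) => i _.
  by apply: pcvgM; [exact: pcvgC|apply: pcvgM; exact: pcvgX].
have rw n : rpoly (f n) (c n) k.+1 o x = hm (rdeg f0) (fun i => (c n * (rnum (f n))`_i)%:P) (fun i => (c n * (rden (f n))`_i)%:P) (rpoly (f n) (c n) k o x).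
  by rewrite /rpoly iterS dn.
have r0 : rpoly f0 1 k.+1 o x = hm (rdeg f0) (fun i => (1 * (rnum f0)`_i)%:P) (fun i => (1 * (rden f0)`_i)%:P) (rpoly f0 1 k o x) by [].
split.
  have -> : (fun n => (rpoly (f n) (c n) k.+1 o x).1) = (fun n => (hm (rdeg f0) (fun i => (c n * (rnum (f n))`_i)%:P)
      (fun i => (c n * (rden (f n))`_i)%:P) (rpoly (f n) (c n) k o x)).1) by apply/funext => n; rewrite rw.
  by rewrite r0; apply: (step (fun n i => c n * (rnum (f n))`_i) (fun i => 1 * (rnum f0)`_i)) => i; rewrite mul1r.
have -> : (fun n => (rpoly (f n) (c n) k.+1 o x).2) = (fun n => (hm (rdeg f0) (fun i => (c n * (rnum (f n))`_i)%:P)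
    (fun i => (c n * (rden (f n))`_i)%:P) (rpoly (f n) (c n) k o x)).2) by apply/funext => n; rewrite rw.
by rewrite r0; apply: (step (fun n i => c n * (rden (f n))`_i) (fun i => 1 * (rden f0)`_i)) => i; rewrite mul1r.
Qed.

Lemma nden_cvg (f : nat -> ratmap R) (f0 : ratmap R) (c : nat -> C R) k p q :
  (forall n, rdeg (f n) = rdeg f0) ->
  (forall i, cvgC (fun n => c n * (rnum (f n))`_i) (rnum f0)`_i) ->
  (forall i, cvgC (fun n => c n * (rden (f n))`_i) (rden f0)`_i) ->
  pcvg (fun n => (nden (f n) (c n) k p q).1) (nden f0 1 k p q).1 /\
  pcvg (fun n => (nden (f n) (c n) k p q).2) (nden f0 1 k p q).2.
Proof.
move=> dn hP hQ; have [h1 h2] := rpoly_cvg k (omap polyC p) ('X, 1) dn hP hQ.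
rewrite /nden; case: q => [a|] /=; split=> //.
have h3 := pcvgM (pcvg_cst (- a%:P)) h2; have := pcvgD h1 h3; rewrite mulNr.
by rewrite (_ : (fun n => _) = (fun n => (rpoly (f n) (c n) k (omap polyC p) ('X, 1)).1 - a%:P * (rpoly (f n) (c n) k (omap polyC p) ('X, 1)).2)) //;
   apply/funext => n; rewrite mulNr.
Qed.
End PCVG.

(** * From convergent quotients of polynomials to perturbed parabolic germs *)

Section LOCPOLY. Variable R : realType.
Local Opaque cmod.
Implicit Types (z w : C R).

(* The displacement [N / D - z] is [E / D] with [E = N - z D] and [E, E'] small. *)
Lemma ratio_lip4 (N D : {poly C R}) (r d B k : R) : 0 < d -> 0 <= B -> 0 <= k -> k * (2 * d + B) <= d ^+ 2 / 16 ->
  (forall z, cmod z < r -> [/\ d / 2 <= cmod D.[z], cmod D.[z] <= 2 * d, cmod D^`().[z] <= B,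
     cmod (N - 'X * D).[z] <= k & cmod (N - 'X * D)^`().[z] <= k]) ->
  forall z w, cmod z < r -> cmod w < r -> cmod (N.[z] / D.[z] - N.[w] / D.[w] - (z - w)) <= 1 / 4 * cmod (z - w).
Proof.
move=> d0 B0 k0 kd H z w zr wr; set E := N - 'X * D.
have D0 x : cmod x < r -> D.[x] != 0.
  by move=> /H[h _ _ _ _]; rewrite -cmod_gt0; apply: lt_le_trans h; rewrite divr_gt0.
have EE x : cmod x < r -> N.[x] / D.[x] = E.[x] / D.[x] + x.
  by move=> /D0 h; rewrite /E hornerD hornerN hornerM hornerX; field.
have seg (t : R) : 0 <= t <= 1 -> cmod (w + (t%:C)%C * (z - w)) < r.
  move=> /andP[t0 t1]; have -> : w + (t%:C)%C * (z - w) = ((1 - t)%:C)%C * w + (t%:C)%C * z by rewrite rmorphB rmorph1; ring.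
  apply: le_lt_trans (cmodD _ _) _; rewrite !cmodM !cmodR !ger0_norm ?subr_ge0 //.
  have [->|tn] := eqVneq t 0; first by rewrite subr0 mul1r mul0r addr0.
  have tp : 0 < t by rewrite lt_neqAle eq_sym tn.
  have : t * cmod z < t * r by rewrite ltr_pM2l.
  have : (1 - t) * cmod w <= (1 - t) * r by rewrite ler_wpM2l ?subr_ge0 // ltW.
  lra.
have M := @mvi R (fun x => E.[x] / D.[x]) (fun x => (E^`() * D - (1%:R *: (E * D^`()))).[x] / D.[x] ^+ 2) w (z - w) (1 / 4).
rewrite (EE z zr) (EE w wr).
have -> : E.[z] / D.[z] + z - (E.[w] / D.[w] + w) - (z - w) = E.[z] / D.[z] - E.[w] / D.[w] by ring.
have wz : w + (z - w) = z by ring.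
rewrite wz in M; apply: M => t /seg xr; set x := w + _ in xr *.
  by have := cder_ratio E 0%N (D0 x xr); apply: cder_ext (ltr01 (R := R)) _ => y _; rewrite expr1.
have [h1 h2 h3 h4 h5] := H x xr; rewrite scale1r hornerD hornerN !hornerM cmodM cmodV cmodX.
have dp : 0 < cmod D.[x] ^+ 2 by rewrite exprn_gt0 // cmod_gt0 D0.
rewrite ler_pdivrMr //; apply: le_trans (cmodB _ _) _; rewrite !cmodM.
have a1 : cmod E^`().[x] * cmod D.[x] <= k * (2 * d) by apply: ler_pM => //; exact: cmod_ge0.
have a2 : cmod E.[x] * cmod D^`().[x] <= k * B by apply: ler_pM => //; exact: cmod_ge0.
have a3 : (d / 2) ^+ 2 <= cmod D.[x] ^+ 2 by rewrite lerXn2r ?nnegrE ?cmod_ge0 // divr_ge0 // ltW.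
have a4 : (d / 2) ^+ 2 = 4 * (d ^+ 2 / 16) by field.
move: kd a1 a2 a3; rewrite a4 mulrDr; move: (d ^+ 2 / 16) (cmod D.[x] ^+ 2) (cmod _ * cmod _) (cmod _ * cmod _) => A X Y Z.
lra.
Qed.

Variables (N D : nat -> {poly C R}) (N0 D0 W : {poly C R}) (nu : nat).
Hypotheses (hN : pcvg N N0) (hD : pcvg D D0) (D00 : D0.[0] != 0).
Hypothesis nu0 : (0 < nu)%N.
Hypothesis hW : N0 - 'X * D0 = W * 'X ^+ nu.+1.
Hypothesis W0 : W.[0] != 0.

Let E0_0 : (N0 - 'X * D0).[0] = 0.
Proof. by rewrite hW hornerM hornerXn expr0n mulr0. Qed.
Let E0'_0 : (N0 - 'X * D0)^`().[0] = 0.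
Proof. by rewrite hW derivM derivXn /= hornerD !hornerM hornerMn !hornerXn !expr0n /= (gtn_eqF nu0) mul0rn !mulr0 addr0. Qed.

(** [N0 - 'X * D0] vanishes to order at least 2 at 0, so this polynomial and its derivative are
    small near 0, and [ratio_lip4] applies to the limit and to the perturbations. [R1] and [n0] come
    before [s], since the subsequence of bad indices is extracted later. *)
Lemma loc_of_polys (R' : R) : 0 < R' -> exists2 R1 : R, 0 < R1 <= R' & exists n0, forall s : nat -> nat,
  (forall k, (n0 + k <= s k)%N) ->
  let F k z := (N (s k)).[z] / (D (s k)).[z] in let F0 z := N0.[z] / D0.[z] in let a := W.[0] / D0.[0] in
  [/\ loc R1 nu a F F0,
   forall k z, cmod z < R1 -> (D (s k)).[z] != 0,
   forall n z w, cmod z < R1 -> cmod w < R1 -> cmod (F n z - F n w - (z - w)) <= 1 / 4 * cmod (z - w),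
   (forall z w, cmod z < R1 -> cmod w < R1 -> cmod (F0 z - F0 w - (z - w)) <= 1 / 4 * cmod (z - w)) /\
   (forall n, cmod (F n 0) <= R1 / 64) &
   forall z, cmod z < R1 -> cmod (F0 z - z - a * z ^+ nu.+1) <= 1 / 64 * (cmod a * cmod z ^+ nu.+1)].
Proof.
move=> R'0; set d := cmod D0.[0]; have d0 : 0 < d by rewrite cmod_gt0.
set B := cmod D0^`().[0] + 1; have B0 : 0 < B by have := cmod_ge0 D0^`().[0]; rewrite /B; lra_all.
set k := d ^+ 2 / 16 / (2 * d + B).
have dB : 0 < 2 * d + B by lra_all.
have k0 : 0 < k by rewrite !divr_gt0 // exprn_gt0.
have kd : k * (2 * d + B) <= d ^+ 2 / 16 by rewrite /k divfK // gt_eqF.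
set a := W.[0] / D0.[0]; have a0 : a != 0 by rewrite mulf_neq0 // invr_neq0.
have ca : 0 < cmod a by rewrite cmod_gt0.
have hE : pcvg (fun n => N n - 'X * D n) (N0 - 'X * D0).
  have := pcvgD hN (pcvgM (pcvg_cst (- 'X)) hD); rewrite mulNr.
  by rewrite (_ : (fun n => N n + _) = (fun n => N n - 'X * D n)) //; apply/funext => n; rewrite mulNr.
have d2 : 0 < d / 2 by rewrite divr_gt0.
have [r1 r10 [n1 H1]] := pcvg_near hD d2.
have [r2 r20 [n2 H2]] := pcvg_near (pcvg_deriv hD) (ltr01 (R := R)).
have [r3 r30 [n3 H3]] := pcvg_near hE k0.
have [r4 r40 [n4 H4]] := pcvg_near (pcvg_deriv hE) k0.
have [t1 t10 [j1 T1]] := pcvg_near (pcvg_cst D0) d2.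
have [t2 t20 [j2 T2]] := pcvg_near (pcvg_cst D0^`()) (ltr01 (R := R)).
have [t3 t30 [j3 T3]] := pcvg_near (pcvg_cst (N0 - 'X * D0)) k0.
have [t4 t40 [j4 T4]] := pcvg_near (pcvg_cst (N0 - 'X * D0)^`()) k0.
have ca64 : 0 < 1 / 64 * cmod a by rewrite mulr_gt0.
have Wc := cder_ratio W 0%N D00.
have [r5 r50 H5] := cder_cont Wc ca64.
have [r6 r60 [j6 H6]] := pcvg_near (pcvg_cst N0) (ltr01 (R := R)).
have N00 : N0.[0] = 0 by have := E0_0; rewrite hornerD hornerN hornerM hornerX mul0r subr0.
set R1 : R := Num.min (Num.min (Num.min R' 1) (Num.min r1 r2)) (Num.min (Num.min (Num.min r3 r4) (Num.min r5 r6))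
  (Num.min (Num.min t1 t2) (Num.min t3 t4))).
have R10 : 0 < R1 by rewrite !lt_min R'0 ltr01 r10 r20 r30 r40 r50 r60 t10 t20 t30 t40.
have := lexx R1; rewrite {2}/R1 !le_min.
move=> /andP[/andP[/andP[q0 q1] /andP[q2 q3]] /andP[/andP[/andP[q4 q5] /andP[q6 q7]] /andP[/andP[q8 q9] /andP[q10 q11]]]].
clearbody R1; exists R1; first by rewrite R10.
have lt z (r : R) : R1 <= r -> cmod z < R1 -> cmod z < r by move=> rr zr; apply: lt_le_trans zr rr.
have R64 : 0 < R1 / 64 * (d / 2) by rewrite mulr_gt0 // divr_gt0.
(* The bound on [F n 0] is relative to [R1], so it is obtained by increasing the index after [R1]
   has been fixed. *)
have [r7 r70 [n5 H7]] := pcvg_near hN R64.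
have bD (P : {poly C R}) z : cmod (P.[z] - D0.[0]) <= d / 2 -> d / 2 <= cmod P.[z] /\ cmod P.[z] <= 2 * d.
  move=> h; have := lerB_cmod D0.[0] (D0.[0] - P.[z]); have := cmodD (P.[z] - D0.[0]) D0.[0].
  by rewrite subKr subrK (cmodBC D0.[0]) -/d; lra_all.
have bD' (x : C R) : cmod (x - D0^`().[0]) <= 1 -> cmod x <= B.
  by move=> h; have := cmodD (x - D0^`().[0]) D0^`().[0]; rewrite subrK /B; lra_all.
have unif (e : R) : 0 < e -> exists n0, forall n, (n0 <= n)%N -> forall z, cmod z < R1 -> cmod ((N n).[z] / (D n).[z] - N0.[z] / D0.[z]) <= e.
  move=> e0; have e1 : 0 < e * (d ^+ 2 / 4) / (2 * d + 1) by rewrite !divr_gt0 ?mulr_gt0 ?divr_gt0 ?exprn_gt0 //; lra_all.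
  have [m1 K1] := pcvg_unif hN e1; have [m2 K2] := pcvg_unif hD e1.
  exists (maxn n1 (maxn m1 m2)) => n; rewrite !geq_max => /and3P[nn1 mm1 mm2] z zR.
  have z1 : cmod z <= 1 by apply: ltW; exact: lt zR.
  have [p1 p2] := bD _ _ (H1 n nn1 z (lt z r1 q2 zR)).
  have [p3 p4] := bD _ _ (T1 _ (leqnn _) z (lt z t1 q8 zR)).
  have p5 : cmod N0.[z] <= 1 by have := H6 _ (leqnn _) z (lt z r6 q7 zR); rewrite N00 subr0.
  have Dn0 : (D n).[z] != 0 by rewrite -cmod_gt0; lra_all.
  have D0z : D0.[z] != 0 by rewrite -cmod_gt0; lra_all.
  have -> : (N n).[z] / (D n).[z] - N0.[z] / D0.[z] =
     (((N n).[z] - N0.[z]) * D0.[z] - N0.[z] * ((D n).[z] - D0.[z])) / ((D n).[z] * D0.[z]) by field; rewrite Dn0 D0z.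
  rewrite cmodM cmodV cmodM ler_pdivrMr ?mulr_gt0 ?cmod_gt0 //.
  apply: le_trans (cmodB _ _) _; rewrite !cmodM.
  set e' := e * (d ^+ 2 / 4) / (2 * d + 1) in e1 K1 K2.
  have a1 : cmod ((N n).[z] - N0.[z]) * cmod D0.[z] <= e' * (2 * d) by apply: ler_pM; rewrite ?cmod_ge0 //; exact: K1.
  have a2 : cmod N0.[z] * cmod ((D n).[z] - D0.[z]) <= 1 * e' by apply: ler_pM; rewrite ?cmod_ge0 //; exact: K2.
  have a3 : d / 2 * (d / 2) <= cmod (D n).[z] * cmod D0.[z] by apply: ler_pM; rewrite // ltW.
  have a4 : e * (d / 2 * (d / 2)) <= e * (cmod (D n).[z] * cmod D0.[z]) by rewrite ler_pM2l.
  have a5 : e' * (2 * d) + 1 * e' = e * (d / 2 * (d / 2)) by rewrite /e'; field; rewrite gt_eqF //; lra_all.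
  by lra_all.
exists (maxn (maxn n1 n2) (maxn (maxn n3 n4) n5)) => s Hs F F0.
have sk j : [/\ (n1 <= s j)%N, (n2 <= s j)%N, (n3 <= s j)%N, (n4 <= s j)%N & (n5 <= s j)%N].
  have := leq_trans (leq_addr j _) (Hs j); rewrite !geq_max.
  by move=> /andP[/andP[-> ->] /andP[/andP[-> ->] ->]].
have lipn j z w : cmod z < R1 -> cmod w < R1 -> cmod (F j z - F j w - (z - w)) <= 1 / 4 * cmod (z - w).
  have [s1 s2 s3 s4 _] := sk j.
  apply: (ratio_lip4 d0 (ltW B0) (ltW k0) kd) => x xR.
  have [p1 p2] := bD _ _ (H1 _ s1 x (lt x r1 q2 xR)); split=> //.
  - by apply: bD'; exact: H2 _ s2 x (lt x r2 q3 xR).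
  - by have := H3 _ s3 x (lt x r3 q4 xR); rewrite E0_0 subr0.
  - by have := H4 _ s4 x (lt x r4 q5 xR); rewrite E0'_0 subr0.
have lip0 z w : cmod z < R1 -> cmod w < R1 -> cmod (F0 z - F0 w - (z - w)) <= 1 / 4 * cmod (z - w).
  apply: (ratio_lip4 d0 (ltW B0) (ltW k0) kd) => x xR.
  have [p1 p2] := bD _ _ (T1 _ (leqnn _) x (lt x t1 q8 xR)); split=> //.
  - by apply: bD'; exact: T2 _ (leqnn _) x (lt x t2 q9 xR).
  - by have := T3 _ (leqnn _) x (lt x t3 q10 xR); rewrite E0_0 subr0.
  - by have := T4 _ (leqnn _) x (lt x t4 q11 xR); rewrite E0'_0 subr0.
have Dz j z : cmod z < R1 -> (D (s j)).[z] != 0.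
  have [s1 _ _ _ _] := sk j; move=> zR; rewrite -cmod_gt0.
  by have [p1 p2] := bD _ _ (H1 _ s1 z (lt z r1 q2 zR)); lra_all.
have asym z : cmod z < R1 -> cmod (F0 z - z - a * z ^+ nu.+1) <= 1 / 64 * (cmod a * cmod z ^+ nu.+1).
  move=> zR; have [p1 p2] := bD _ _ (T1 _ (leqnn _) z (lt z t1 q8 zR)).
  have D0z : D0.[z] != 0 by rewrite -cmod_gt0; lra_all.
  have EZ : N0.[z] - z * D0.[z] = W.[z] * z ^+ nu.+1.
    by have := congr1 (fun p : {poly C R} => p.[z]) hW; rewrite hornerD hornerN !hornerM hornerX hornerXn.
  have NE : N0.[z] = z * D0.[z] + W.[z] * z ^+ nu.+1 by rewrite -EZ; ring.
  have -> : F0 z - z - a * z ^+ nu.+1 = (W.[z] / D0.[z] - a) * z ^+ nu.+1 by rewrite /F0 NE; field.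
  rewrite cmodM cmodX [X in _ <= X]mulrA ler_wpM2r ?exprn_ge0 ?cmod_ge0 //.
  by apply: ltW; have := H5 z; rewrite subr0 !expr1; apply; exact: lt zR.
split => //; first split => //.
- by move=> j; apply: hol_ratio => z; rewrite subr0; exact: Dz.
- by move=> j z w zR wR; have := lipn j z w zR wR; have := cmod_ge0 (z - w); lra_all.
- by move=> z w zR wR; have := lip0 z w zR wR; have := cmod_ge0 (z - w); lra_all.
- move=> e e0; have [n0 Hn] := unif e e0; exists n0 => n nn; apply: Hn.
  by apply: leq_trans nn _; apply: leq_trans (Hs n); exact: leq_addl.
- by move=> z zR; have := asym z zR; have := mulr_ge0 (cmod_ge0 a) (exprn_ge0 nu.+1 (cmod_ge0 z)); lra_all.
split=> // j; have [s1 _ _ _ s5] := sk j; rewrite /F cmodM cmodV.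
have o0 : cmod (0 : C R) < R1 by rewrite cmod0.
have [p1 p2] := bD _ _ (H1 _ s1 0 (lt 0 r1 q2 o0)).
rewrite ler_pdivrMr; last by lra_all.
have o7 : cmod (0 : C R) < r7 by rewrite cmod0.
have := H7 _ s5 0 o7; rewrite N00 subr0 => h; apply: le_trans h _.
by rewrite ler_wpM2l // divr_ge0 // ltW.
Qed.

(** The derivative of [N / D] minus 1 is that of [E / D] with [E = N - 'X * D], and [E] and its
    derivative are small near 0, uniformly in [n]. *)
Lemma mult_of_polys e : 0 < e -> exists2 r : R, 0 < r & exists n0, forall n, (n0 <= n)%N -> forall z l, cmod z < r ->
  cder (fun z => (N n).[z] / (D n).[z]) z l -> cmod (l - 1) <= e.
Proof.
move=> e0; set d := cmod D0.[0]; have d0 : 0 < d by rewrite cmod_gt0.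
set B := cmod D0^`().[0] + 1; have B0 : 0 < B by have := cmod_ge0 D0^`().[0]; rewrite /B; lra_all.
set k := e * (d ^+ 2 / 4) / (2 * d + B).
have dB : 0 < 2 * d + B by lra_all.
have k0 : 0 < k by rewrite divr_gt0 ?mulr_gt0 ?divr_gt0 ?exprn_gt0.
have hE : pcvg (fun n => N n - 'X * D n) (N0 - 'X * D0).
  have := pcvgD hN (pcvgM (pcvg_cst (- 'X)) hD); rewrite mulNr.
  by rewrite (_ : (fun n => N n + _) = (fun n => N n - 'X * D n)) //; apply/funext => n; rewrite mulNr.
have d2 : 0 < d / 2 by rewrite divr_gt0.
have [r1 r10 [n1 H1]] := pcvg_near hD d2.
have [r2 r20 [n2 H2]] := pcvg_near (pcvg_deriv hD) (ltr01 (R := R)).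
have [r3 r30 [n3 H3]] := pcvg_near hE k0.
have [r4 r40 [n4 H4]] := pcvg_near (pcvg_deriv hE) k0.
exists (Num.min (Num.min r1 r2) (Num.min r3 r4)); first by rewrite !lt_min r10 r20 r30 r40.
exists (maxn (maxn n1 n2) (maxn n3 n4)) => n; rewrite !geq_max => /andP[/andP[m1 m2] /andP[m3 m4]] z l.
rewrite !lt_min => /andP[/andP[z1 z2] /andP[z3 z4]] Hl.
have a1 := H1 n m1 z z1; have a2 := H2 n m2 z z2; have a3 := H3 n m3 z z3; have a4 := H4 n m4 z z4.
rewrite E0_0 subr0 in a3; rewrite E0'_0 subr0 in a4.
have b1 : d / 2 <= cmod (D n).[z].
  by have := lerB_cmod D0.[0] (D0.[0] - (D n).[z]); rewrite subKr (cmodBC D0.[0]) -/d; lra_all.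
have b2 : cmod (D n).[z] <= 2 * d.
  by have := cmodD ((D n).[z] - D0.[0]) D0.[0]; rewrite subrK -/d; lra_all.
have b3 : cmod (D n)^`().[z] <= B.
  by have := cmodD ((D n)^`().[z] - D0^`().[0]) D0^`().[0]; rewrite subrK /B; lra_all.
have Dz : (D n).[z] != 0 by rewrite -cmod_gt0; lra_all.
set E := N n - 'X * D n in a3 a4.
have [del del0 Hdel] := cder_cont (cder_poly (D n) z) (ltac:(rewrite cmod_gt0; exact: Dz) : 0 < cmod (D n).[z]).
have c1 : cder (fun x => (N n).[x] / (D n).[x]) z ((E^`() * D n - (1%:R *: (E * (D n)^`()))).[z] / (D n).[z] ^+ 2 + 1).
  apply: (cder_ext del0 (f := fun x => E.[x] / (D n).[x] ^+ 1 + x)) (cderD (cder_ratio E 0%N Dz) (cder_id z)).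
  move=> w /Hdel h; have Dw : (D n).[w] != 0 by apply/eqP => E'; move: h; rewrite E' sub0r cmodN ltxx.
  by rewrite expr1 /E hornerD hornerN hornerM hornerX; field.
rewrite (cder_uniq Hl c1) addrK scale1r hornerD hornerN !hornerM cmodM cmodV cmodX.
have dp : 0 < cmod (D n).[z] ^+ 2 by rewrite exprn_gt0 // cmod_gt0.
rewrite ler_pdivrMr //; apply: le_trans (cmodB _ _) _; rewrite !cmodM.
have c2 : cmod E^`().[z] * cmod (D n).[z] <= k * (2 * d) by apply: ler_pM => //; exact: cmod_ge0.
have c3 : cmod E.[z] * cmod (D n)^`().[z] <= k * B by apply: ler_pM => //; exact: cmod_ge0.
have c4 : e * (d / 2) ^+ 2 <= e * cmod (D n).[z] ^+ 2.
  by rewrite ler_pM2l // lerXn2r ?nnegrE ?cmod_ge0 // divr_ge0 // ltW.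
have c5 : k * (2 * d) + k * B = e * (d / 2) ^+ 2 by rewrite /k; field; rewrite gt_eqF.
lra_all.
Qed.
End LOCPOLY.

(** * Topology of the sphere, Fatou and Julia sets *)

Section SPHERETOP. Variable R : realType.
Local Opaque cmod.
Implicit Types (z w : C R) (p q x : sphere R) (f : ratmap R).

Lemma nbhs_sphere x (U : set (sphere R)) : nbhs x U <-> exists2 e : R, 0 < e & forall y, chordal x y < e -> U y.
Proof.
split=> [/nbhs_ballP[e e0 He]|[e e0 He]]; first by exists e => // y xy; exact: He.
by apply/nbhs_ballP; exists e => // y xy; exact: He.
Qed.

Lemma chordal_ge0 p q : 0 <= chordal p q.
Proof. by rewrite divr_ge0 ?mulr_ge0 ?cmod_ge0 ?sqrtr_ge0. Qed.

Lemma chordal_gt0 p q : p <> q -> 0 < chordal p q.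
Proof.
by move=> pq; rewrite lt_neqAle chordal_ge0 andbT; apply/eqP => E; apply: pq; apply: chordal_positivity.
Qed.

Lemma open_chordal_ball x (e : R) : open [set y | chordal x y < e].
Proof.
rewrite openE => y /= xy; apply/nbhs_sphere; exists (e - chordal x y); first by rewrite subr_gt0.
by move=> q yq; apply: le_lt_trans (chordal_triangle y x q) _; rewrite -ltrBrDl.
Qed.

Lemma uniform_sphere (K : set (sphere R)) (u : nat -> sphere R -> sphere R) (g : sphere R -> sphere R) :
  {uniform K, u @ \oo --> g} <-> forall e : R, 0 < e -> exists n0, forall n, (n0 <= n)%N -> forall x, K x -> chordal (g x) (u n x) < e.
Proof.
split=> [H e e0|H P].
  have nb : nbhs (g : {uniform` K -> sphere R}) [set h | forall y, K y -> chordal (g y) (h y) < e].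
    apply/uniform_nbhs; exists [set xy | ball xy.1 e xy.2]; split; last by move=> h.
    by rewrite -entourage_ballE; exists e.
  by have [n0 _ Hn] := H _ nb; exists n0 => n nn x Kx; exact: Hn n nn x Kx.
move/uniform_nbhs => [E [entE EP]]; move: entE; rewrite -entourage_ballE => -[e e0 Ee].
have [n0 Hn] := H e e0; exists n0 => // n nn; apply: EP => y Ky; apply: Ee; exact: Hn n nn y Ky.
Qed.

(** A square rather than a disc: as the image of a product of two segments it is visibly compact. *)
Definition chart_square p (e : R) : set (sphere R) :=
  (fun x : R * R => cst p (Complex x.1 x.2)) @` (`[- e, e]%classic `*` `[- e, e]%classic).

Lemma chart_square_compact p e : compact (chart_square p e).
Proof.
apply: continuous_compact; last by apply: compact_setX; exact: segment_compact.
apply: continuous_subspaceT => -[a b] /= U /nbhs_sphere[d d0 Hd].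
have d4 : 0 < d / 4 by rewrite divr_gt0.
apply/nbhs_ballP; exists (d / 4) => //= -[a' b'] [/= ha hb]; apply: Hd.
apply: le_lt_trans (chordal_cst_le p (Complex a b) (Complex a' b')) _.
apply: le_lt_trans (_ : 2 * (`|a - a'| + `|b - b'|) < _).
  by rewrite ler_pM2l //; apply: le_trans (cmod_ReIm _) _.
move: ha hb; rewrite /ball /= => ha hb; lra.
Qed.

Lemma chart_square_mem p (e : R) z : cmod z <= e -> chart_square p e (cst p z).
Proof.
move=> ze; exists (complex.Re z, complex.Im z) => /=; last by case: z ze.
have h1 := le_trans (Re_cmod z) ze; have h2 := le_trans (Im_cmod z) ze.
by split; rewrite /= in_itv /= -ler_norml.
Qed.

Lemma chart_square_elim p (e : R) q : chart_square p e q -> exists2 z, q = cst p z & cmod z <= 2 * e.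
Proof.
move=> [[a b] [/=]]; rewrite !in_itv /= -!ler_norml => ha hb <-; exists (Complex a b) => //.
by apply: le_trans (cmod_ReIm _) _; rewrite /=; lra.
Qed.

Lemma subseq_build (Q : nat -> nat -> Prop) : (forall n N, exists2 m, (N <= m)%N & Q n m) ->
  exists2 s : nat -> nat, {homo s : m n / (m < n)%N} & forall n, Q n (s n).
Proof.
move=> H; have /choice[g Hg] : forall nN : nat * nat, exists m, (nN.2 <= m)%N /\ Q nN.1 m.
  by move=> [n N]; have [m m1 m2] := H n N; exists m.
pose s := fix s n := if n is n'.+1 then g (n, (s n').+1) else g (0%N, 0%N).
have s1 n : (s n < s n.+1)%N by have [] := Hg (n.+1, (s n).+1).
exists s; last by case=> [|n]; [have [] := Hg (0%N, 0%N)|have [] := Hg (n.+1, (s n).+1)].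
by move=> m n; elim: n => // n IH; rewrite ltnS leq_eqVlt => /orP[/eqP ->|/IH h] //; exact: ltn_trans h (s1 n).
Qed.

(** For the orders of a sequence of iterates: on a subsequence they are constant, or tend to
    infinity in one residue class modulo the period [l]. *)
Lemma subseq_dichotomy (k : nat -> nat) l : (0 < l)%N -> exists2 s : nat -> nat, {homo s : m n / (m < n)%N} &
  (exists v, forall n, k (s n) = v) \/ (exists2 j, (j < l)%N & forall n, exists2 q, (n <= q)%N & k (s n) = (q * l + j)%N).
Proof.
move=> l0; case: (pselect (exists v, forall N, exists2 n, (N <= n)%N & k n = v)) => [[v Hv]|H].
  have [s s1 s2] := subseq_build (Q := fun _ m => k m = v) (fun _ N => Hv N).
  by exists s => //; left; exists v.
have big B : exists N, forall n, (N <= n)%N -> (B <= k n)%N.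
  elim: B => [|B [N HN]]; first by exists 0%N.
  have [M HM] : exists M, forall n, (M <= n)%N -> k n <> B.
    apply: contrapT => h; apply: H; exists B => M; apply: contrapT => h'; apply: h; exists M => n Mn E.
    by apply: h'; exists n.
  exists (maxn N M) => n; rewrite geq_max => /andP[/HN h1 /HM h2].
  by rewrite ltn_neqAle h1 andbT eq_sym; apply/eqP.
have [j jl Hj] : exists2 j, (j < l)%N & forall N, exists2 n, (N <= n)%N & (k n %% l)%N = j.
  apply: contrapT => h.
  have bnd m : (m <= l)%N -> exists N, forall n, (N <= n)%N -> (m <= k n %% l)%N.
    elim: m => [_|m IH ml]; first by exists 0%N.
    have [N HN] := IH (ltnW ml).
    have [M HM] : exists M, forall n, (M <= n)%N -> (k n %% l)%N <> m.
      apply: contrapT => h'; apply: h; exists m => // M; apply: contrapT => h''; apply: h'; exists M => n Mn E.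
      by apply: h''; exists n.
    exists (maxn N M) => n; rewrite geq_max => /andP[/HN h1 /HM h2].
    by rewrite ltn_neqAle h1 andbT eq_sym; apply/eqP.
  have [N /(_ N (leqnn _))] := bnd l (leqnn _).
  by rewrite leqNgt ltn_pmod.
have [s s1 s2] := @subseq_build (fun n m => (n * l + l <= k m)%N /\ (k m %% l)%N = j) (fun n N =>
  let: ex_intro M HM := big (n * l + l)%N in let: ex_intro2 m m1 m2 := Hj (maxn N M) in
  ex_intro2 _ _ m (leq_trans (leq_maxl N M) m1) (conj (HM m (leq_trans (leq_maxr N M) m1)) m2)).
exists s => //; right; exists j => // n; have [h1 h2] := s2 n; exists (k (s n) %/ l)%N.
  by rewrite leq_divRL //; apply: leq_trans h1; exact: leq_addr.
by rewrite -{1}h2 -divn_eq.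
Qed.

Lemma sder_cont (g : sphere R -> sphere R) p l : sder g p l -> forall e : R, 0 < e -> exists2 del : R, 0 < del &
  forall q, chordal q p < del -> chordal (g q) (g p) < e.
Proof.
move=> [d [r r0 H]] e e0; have e2 : 0 < e / 2 by rewrite divr_gt0.
have [d1 d10 Hd] := cder_cont d e2; have m0 : 0 < Num.min r d1 by rewrite lt_min r0.
have [del del0 Hq] := chart_ball p 0 m0; exists del => // q; rewrite -{1}(cst0 p) => /Hq[w -> ].
rewrite subr0 lt_min => /andP[wr wd]; rewrite H //.
have := Hd w; rewrite subr0 cst0 crdpp subr0 => /(_ wd); set t := crd _ _ => te.
have := chordal_cst_le (g p) t 0; rewrite subr0 cst0; lra.
Qed.

Lemma riter_cont f k p : forall e : R, 0 < e -> exists2 del : R, 0 < del &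
  forall q, chordal q p < del -> chordal (riter f k q) (riter f k p) < e.
Proof. by have [l [Hl _]] := sder_riter f (oner_neq0 (C R)) k p; exact: sder_cont Hl. Qed.

Lemma fatou_sub f (U : set (sphere R)) : open U -> normal_on U (range (riter f)) -> U `<=` fatou f.
Proof. by move=> oU nU z Uz; exists U. Qed.

Lemma fatou_nbhs f (z : sphere R) : fatou f z -> exists2 e : R, 0 < e & forall y, chordal z y < e -> fatou f y.
Proof.
move=> [U [oU Uz nU]]; move: (oU); rewrite openE => /(_ z Uz) /nbhs_sphere[e e0 He].
by exists e => // y /He; exact: fatou_sub.
Qed.

(* Local uniform convergence of the iterates to a periodic orbit. *)
Lemma fatou_of_cvg f p l (z : sphere R) (d : R) : (0 < l)%N -> riter f l p = p -> 0 < d ->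
  (forall e : R, 0 < e -> exists k0, forall k, (k0 <= k)%N -> forall y, chordal z y < d -> chordal (riter f (k * l) y) p < e) ->
  fatou f z.
Proof.
move=> l0 lp d0 H; exists [set y | chordal z y < d]; split; [exact: open_chordal_ball|by rewrite /= chordalxx|].
move=> h hr; have /choice[k hk] : forall n, exists k, riter f k = h n.
  by move=> n; have [k _ <-] := hr n; exists k.
have [s s1 s2] := subseq_dichotomy k l0; exists s; split=> //; case: s2 => [[v Hv]|[j jl Hj]].
  exists (riter f v) => K _ _; apply/uniform_sphere => e e0; exists 0%N => n _ x _.
  by rewrite /= -hk Hv chordalxx.
exists (fun=> riter f j p) => K KU _; apply/uniform_sphere => e e0.
have [del del0 Hdel] := riter_cont f j p e0; have [k0 Hk] := H _ del0.
exists k0 => n nn x /KU Ux; have [q nq E] := Hj n.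
rewrite /= -hk E addnC /riter iterD chordal_sym; apply: Hdel; apply: Hk => //; exact: leq_trans nn nq.
Qed.

(* A normal family cannot send points tending to a fixed point to a fixed different point. *)
Lemma julia_of_repel f p l x (w : nat -> sphere R) : riter f l p = p -> x <> p ->
  (forall e : R, 0 < e -> exists k0, forall k, (k0 <= k)%N -> chordal (w k) p < e) ->
  (forall k, riter f (k * l) (w k) = x) -> julia f p.
Proof.
move=> lp xp wp wx [U [oU Up nU]]; move: (oU); rewrite openE => /(_ p Up) /nbhs_sphere[e e0 He].
have [s [s1 [g Hg]]] := nU (fun k => riter f (k * l)) (fun k => ex_intro2 _ _ (k * l)%N I erefl).
have e4 : 0 < e / 8 by rewrite divr_gt0.
have sqU : chart_square p (e / 8) `<=` U.
  move=> q /chart_square_elim[z -> zz]; apply: He; rewrite -{1}(cst0 p).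
  by apply: le_lt_trans (chordal_cst_le p 0 z) _; rewrite sub0r cmodN; lra.
have /uniform_sphere Hu := Hg _ sqU (@chart_square_compact p (e / 8)).
have c0 : 0 < chordal x p / 3 by rewrite divr_gt0 // chordal_gt0.
have [n0 Hn] := Hu _ c0.
have lkp k : riter f (k * l) p = p.
  by elim: k => // k IH; rewrite mulSn /riter iterD -/(riter f _ p) IH.
have [del del0 Hdel] := riter_cont f (s n0 * l) p c0; rewrite lkp in Hdel.
have [d1 d10 Hd1] := chart_ball p 0 e4; rewrite cst0 in Hd1.
have m0 : 0 < Num.min del d1 by rewrite lt_min del0.
have [k0 Hk] := wp _ m0.
set n := maxn n0 k0; have sn : (k0 <= s n)%N.
  by apply: leq_trans (leq_maxr n0 k0) (incr_geid _ _) => a b; exact: s1.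
have := Hk _ sn; rewrite lt_min => /andP[w1 w2].
have sq : chart_square p (e / 8) (w (s n)).
  by have [z -> zz] := Hd1 _ w2; apply: chart_square_mem; rewrite subr0 in zz; exact: ltW.
(* At [w (s n)] the iterate of index [s n] has the value [x], and by continuity the one of index
   [s n0] is close to [p]. Both are close to the limit [g], and three distances below a third of
   [chordal x p] cannot add up to it. *)
have a1 := Hn n (leq_maxl _ _) _ sq; have a2 := Hn n0 (leqnn _) _ sq; have a3 := Hdel _ w1.
rewrite /= in a1 a2; rewrite wx in a1.
have := chordal_triangle (g (w (s n))) x p; have := chordal_triangle (riter f (s n0 * l) (w (s n))) (g (w (s n))) p.
rewrite (chordal_sym x (g _)); lra.
Qed.
End SPHERETOP.

(** * Openness of rational maps and backward invariance of the Julia set *)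

Section OPENMAP. Variable R : realType.
Local Opaque cmod.
Implicit Types (z w : C R) (p q : sphere R) (f : ratmap R).

Lemma poly_factor0 (P : {poly C R}) : P != 0 -> exists m W, P = W * 'X^m /\ W.[0] != 0.
Proof.
move=> P0; have [m [W]] := multiplicity_XsubC P 0; rewrite P0 /= subr0 => W0 ->.
by exists m, W; split => //; move: W0; rewrite /root.
Qed.

Lemma poly_nonzero_near (P : {poly C R}) (e : R) : P != 0 -> 0 < e -> exists2 h, cmod h < e & P.[h] != 0.
Proof.
move=> /poly_factor0[m [W [-> W0]]] e0; have c0 : 0 < cmod W.[0] by rewrite cmod_gt0.
have [del del0 Hd] := cder_cont (cder_poly W 0) c0.
set s : R := Num.min (e / 2) (del / 2); have s0 : 0 < s by rewrite lt_min !divr_gt0.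
have [s1 s2] : s <= e / 2 /\ s <= del / 2 by apply/andP; rewrite -le_min.
have cs : cmod ((s%:C)%C : C R) = s by rewrite cmodR gtr0_norm.
exists ((s%:C)%C); first by rewrite cs; lra.
rewrite hornerM hornerXn mulf_neq0 //; last by rewrite expf_neq0 // -cmod_gt0 cs.
by apply/eqP => E; have := Hd ((s%:C)%C); rewrite subr0 cs E sub0r cmodN ltxx => X; apply: notF; apply: X; lra.
Qed.

(** Every root [z] satisfies [|z| >= e], so [|h - z| <= |z| (1 + |h| / e)]; multiply over the roots.
    Read backwards, a polynomial much smaller at 0 than at [h] has a root in [|z| < e], which
    replaces Rouche's theorem. *)
Lemma no_small_root (P : {poly C R}) (e : R) h K : 0 < e -> (size P <= K)%N -> (forall z, cmod z < e -> P.[z] != 0) ->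
  cmod P.[h] <= cmod P.[0] * (1 + cmod h / e) ^+ K.
Proof.
move=> e0 sK H; have [r Pr] := closed_field_poly_normal P.
have P0 : P != 0 by apply/eqP => E; have := H 0; rewrite E horner0 cmod0 eqxx => /(_ e0).
have rK : (size r <= K)%N.
  apply: leq_trans sK; rewrite Pr size_scale ?lead_coef_eq0 // size_prod_XsubC; exact: leqnSn.
have rr z : z \in r -> e <= cmod z.
  move=> zr; rewrite leNgt; apply/negP => /H /eqP; apply; apply/eqP; change (root P z).
  by rewrite Pr rootZ ?lead_coef_eq0 // root_prod_XsubC.
have x1 : 1 <= 1 + cmod h / e by rewrite lerDl divr_ge0 ?cmod_ge0 // ltW.
apply: le_trans (_ : _ <= cmod P.[0] * (1 + cmod h / e) ^+ size r) _; last first.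
  by rewrite ler_wpM2l ?cmod_ge0 //; exact: ler_weXn2l.
rewrite Pr !hornerZ !cmodM -mulrA ler_wpM2l ?cmod_ge0 //.
elim: r rr {Pr rK} => [|z r IH] rr; first by rewrite !big_nil !hornerC expr0 mulr1.
rewrite !big_cons !hornerM !hornerXsubC !cmodM sub0r cmodN /= exprS.
have IH' := IH (fun x xr => rr x (mem_behead (s := z :: r) xr)).
have ze : e <= cmod z by apply: rr; rewrite inE eqxx.
have hz : cmod (h - z) <= cmod z * (1 + cmod h / e).
  have := cmodB h z; have : cmod h / e * e <= cmod h / e * cmod z by rewrite ler_wpM2l ?divr_ge0 ?cmod_ge0 // ltW.
  by rewrite divfK ?gt_eqF //; lra.
rewrite mulrACA; apply: ler_pM => //; exact: cmod_ge0.
Qed.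

(** Otherwise the map would be constant on the chart, whose complement is one point, and two further
    values could not both be attained. *)
Lemma nden_neq0 f p : (0 < rdeg f)%N -> (nden f 1 1 p (reval f p)).1 != 0.
Proof.
move=> d0; apply/eqP => E; have o := oner_neq0 (C R).
have const z : reval f (cst p z) = reval f p.
  by apply: (nden_root (k := 1) o); rewrite E horner0.
have offc q : reval f q <> reval f p -> (lin p (hcoord q)).2 = 0.
  move=> qp; apply/eqP/negPn/negP => h; apply: qp.
  by rewrite -(hpt_hcoord q) -(cst_crd (hcoord_nz q) h) const.
have inj q1 q2 : (lin p (hcoord q1)).2 = 0 -> (lin p (hcoord q2)).2 = 0 -> q1 = q2.
  move=> h1 h2; rewrite -(hpt_hcoord q1) -(hpt_hcoord q2); apply/hpt_eq; [exact: hcoord_nz|exact: hcoord_nz|].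
  apply: cmod_eq0; rewrite -(linK p (hcoord q1)) -(linK p (hcoord q2)) unl_wedge /wedge h1 h2 mulr0 mul0r subr0; exact: cmod0.
have [x1 [x2 [n1 n2 n12]]] : exists x1 x2 : sphere R, [/\ x1 <> reval f p, x2 <> reval f p & x1 <> x2].
  exists (cst (reval f p) 1), (cst (reval f p) (1 + 1)); split=> E'.
  - by have := crd_cst (reval f p) 1; rewrite E' crdpp => /esym/eqP; rewrite oner_eq0.
  - by have := crd_cst (reval f p) (1 + 1); rewrite E' crdpp => /esym/eqP; rewrite -(natrD _ 1 1) pnatr_eq0.
  - have := crd_cst (reval f p) 1; rewrite E' crd_cst => /eqP.
    by rewrite -subr_eq0 addrK oner_eq0.
have [y1 e1] := reval_surj o x1 d0; have [y2 e2] := reval_surj o x2 d0.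
apply: n12; rewrite -e1 -e2; congr reval; apply: inj; apply: offc; by rewrite ?e1 ?e2.
Qed.

(** For small [t] the polynomial [N - t D] is small at 0, where [N] vanishes, but not at [h], where
    [N] does not; [no_small_root] gives a solution of [N = t D] near 0. The constant [B] measures
    how small [t] has to be. *)
Lemma open_reval f p (e : R) : (0 < rdeg f)%N -> 0 < e -> exists2 del : R, 0 < del &
  forall q, chordal q (reval f p) < del -> exists2 w, cmod w < e & reval f (cst p w) = q.
Proof.
move=> d0 e0; have o := oner_neq0 (C R); set q0 := reval f p.
set N := (nden f 1 1 p q0).1; set D := (nden f 1 1 p q0).2.
have [h he Nh] := poly_nonzero_near (nden_neq0 p d0) e0; rewrite -/q0 -/N in Nh.
have [N0 D0] := nden_at0 (k := 1) (p := p) o (erefl : riter f 1 p = q0); rewrite -/N -/D in N0 D0.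
have [K KN KD] : exists2 K, (size N <= K)%N & (size D <= K)%N.
  by exists (maxn (size N) (size D)); [exact: leq_maxl|exact: leq_maxr].
set B := cmod D.[h] + cmod D.[0] * 2 ^+ K + 1.
have B0 : 0 < B.
  by rewrite /B; have := cmod_ge0 D.[h]; have := mulr_ge0 (cmod_ge0 D.[0]) (exprn_ge0 K (ler0n R 2)); lra.
have ch : 0 < cmod N.[h] / B by rewrite divr_gt0 // cmod_gt0.
have [del del0 Hd] := chart_ball q0 0 ch; rewrite cst0 in Hd; exists del => // q /Hd[t qE]; rewrite subr0 => tB.
suff [w we wr] : exists2 w, cmod w < e & N.[w] = t * D.[w].
  exists w => //; have Dw : D.[w] != 0.
    apply/eqP => Dw; have [n1 _] := riter_cst f o 1 p w; have := lin_nz q0 (iter 1 (hm (rdeg f)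
      (fun i => 1 * (rnum f)`_i) (fun i => 1 * (rden f)`_i)) (unl p (w, 1))).
    by rewrite n1 -(ndenE f 1 1 p q0 w) /nz /= -/N -/D wr Dw mulr0 eqxx.
  have := riter_eq_cst o (k := 1) (p := p) (q := q0) (z := w) Dw; rewrite -/N -/D wr mulfK // -qE; exact.
apply: contrapT => H.
have Hn z : cmod z < e -> (N - t *: D).[z] != 0.
  move=> ze; rewrite hornerD hornerN hornerZ subr_eq0; apply/eqP => E; apply: H; by exists z.
have sK : (size (N - t *: D)%R <= K)%N.
  apply: leq_trans (size_polyD _ _) _; rewrite size_polyN geq_max KN /=.
  by apply: leq_trans (size_scale_leq _ _) KD.
have := no_small_root h e0 sK Hn; rewrite !hornerD !hornerN !hornerZ N0 sub0r cmodN cmodM => X.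
have x2 : (1 + cmod h / e) ^+ K <= 2 ^+ K.
  have : cmod h / e < 1 by rewrite ltr_pdivrMr // mul1r.
  have : 0 <= cmod h / e by rewrite divr_ge0 ?cmod_ge0 // ltW.
  by move=> *; apply: lerXn2r; rewrite ?nnegrE //; lra.
have t0 := cmod_ge0 t.
have X2 : cmod t * cmod D.[0] * (1 + cmod h / e) ^+ K <= cmod t * (cmod D.[0] * 2 ^+ K).
  by rewrite -mulrA ler_wpM2l // ler_wpM2l ?cmod_ge0.
have Y := lerB_cmod N.[h] (t * D.[h]); rewrite cmodM in Y.
have Z : cmod t * B < cmod N.[h] by rewrite -ltr_pdivlMr.
have ZB : cmod t * B = cmod t * cmod D.[h] + cmod t * (cmod D.[0] * 2 ^+ K) + cmod t by rewrite /B; ring.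
lra.
Qed.

(** By openness the points near [f p] lift to a compact square about [p], through a choice function
    [pre]. An iterate of order [k] at a point is the one of order [k + 1] at its lift, and normality
    near [p] is transferred. *)
Lemma fatou_forward f p : (0 < rdeg f)%N -> fatou f p -> fatou f (reval f p).
Proof.
move=> d0 [U [oU Up nU]]; move: (oU); rewrite openE => /(_ p Up) /nbhs_sphere[e e0 He].
have e8 : 0 < e / 8 by rewrite divr_gt0.
have sqU : chart_square p (e / 8) `<=` U.
  move=> q /chart_square_elim[z -> zz]; apply: He; rewrite -{1}(cst0 p).
  by apply: le_lt_trans (chordal_cst_le p 0 z) _; rewrite sub0r cmodN; lra.
have [del del0 Hd] := open_reval p d0 e8.
exists [set q | chordal (reval f p) q < del]; split; [exact: open_chordal_ball|by rewrite /= chordalxx|].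
move=> h hr; have /choice[k hk] : forall n, exists k, riter f k = h n.
  by move=> n; have [k _ <-] := hr n; exists k.
have /choice[pre Hpre] : forall v : sphere R, exists u : sphere R,
    chordal v (reval f p) < del -> chart_square p (e / 8) u /\ reval f u = v.
  move=> v; case: (pselect (chordal v (reval f p) < del)) => [/Hd[w we wv]|nv]; last by exists v.
  by exists (cst p w) => _; split => //; apply: chart_square_mem; exact: ltW.
have [s [s1 [g Hg]]] := nU (fun n => riter f (k n).+1) (fun n => ex_intro2 _ _ (k n).+1 I erefl).
have /uniform_sphere Hu := Hg _ sqU (@chart_square_compact R p (e / 8)).
exists s; split=> //; exists (fun v => g (pre v)) => K KV _; apply/uniform_sphere => e' e'0.
have [n0 Hn] := Hu e' e'0; exists n0 => n nn v /KV; rewrite /= chordal_sym => /Hpre[p1 p2].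
rewrite -hk.
have X : chordal (g (pre v)) (riter f (k (s n)).+1 (pre v)) < e' := Hn n nn _ p1.
by rewrite /riter iterSr p2 in X.
Qed.

Lemma julia_backward f k p : (0 < rdeg f)%N -> julia f (riter f k p) -> julia f p.
Proof.
move=> d0; elim: k => // k IH H; apply: IH => fp; apply: H; exact: fatou_forward d0 fp.
Qed.
End OPENMAP.

(** * Petals in the Fatou set, and their distance to the Julia sets *)

Section PETAL. Variable R : realType.
Local Opaque upl upm cmod.
Implicit Types (z w v : C R) (p q : sphere R).
Variables (f0 : ratmap R) (l : nat) (zeta : sphere R).
Variables (R1 : R) (nu : nat) (a : C R) (F : nat -> C R -> C R) (F0 : C R -> C R).
Hypothesis HL : loc R1 nu a F F0.
Hypothesis l0 : (0 < l)%N.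
Hypothesis conj0 : forall z, cmod z < R1 -> riter f0 l (cst zeta z) = cst zeta (F0 z).

Let fix0 : riter f0 l zeta = zeta.
Proof.
have := conj0 (z := 0); rewrite cmod0 (loc_F00 HL) cst0; apply; exact: loc_R1 HL.
Qed.

Lemma conj_iter k z : (forall i, (i < k)%N -> cmod (iter i F0 z) < R1) ->
  riter f0 (k * l) (cst zeta z) = cst zeta (iter k F0 z).
Proof.
elim: k => [//|k IH] H; rewrite mulSn /riter iterD -/(riter f0 _ (cst zeta z)) IH; last by move=> i ik; apply: H; exact: leqW.
by rewrite -/(riter f0 _ _) conj0 ?iterS //; exact: H.
Qed.

Lemma chordal_cst0 z : chordal (cst zeta z) zeta <= 2 * cmod z.
Proof. by have := chordal_cst_le zeta z 0; rewrite subr0 cst0. Qed.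

Lemma cone_fatou c : 0 < c <= 1 / 2 -> exists2 rs : R, 0 < rs & forall z, z != 0 -> cmod z <= rs ->
  c * cmod (upl nu a z) <= upm nu a z -> fatou f0 (cst zeta z).
Proof.
move=> cb; have /andP[c0 c1] := cb; have R10 := loc_R1 HL.
have [k /andP[k0 k1] Hk] := cone_disc (loc_nu HL) (loc_a HL) cb.
have cb2 : 0 < c / 2 <= 1 / 2 by apply/andP; split; lra_all.
have [rs rs0 H0] := orbit0_cone HL R10 cb2.
exists (rs / 2) => [|z z0 zr zc]; first by rewrite divr_gt0.
have cz : 0 < cmod z by rewrite cmod_gt0.
have kz : 0 < k * cmod z by rewrite mulr_gt0.
have [d d0 Hd] := chart_ball zeta z kz.
apply: (fatou_of_cvg l0 fix0 d0) => e e0.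
have e2 : 0 < e / 2 by rewrite divr_gt0.
have [E E0 HE] := upl_large (loc_nu HL) (loc_a HL) e2.
exists (Num.truncn (8 / 3 * E)).+1 => j nj q; rewrite chordal_sym => /Hd[w -> wz].
have [w0 wc] := Hk z w z0 zc (ltW wz).
have wr : cmod w <= rs.
  have := lerB_cmod w z; have : k * cmod z <= 1 / 2 * cmod z by rewrite ler_pM2r.
  by lra_all.
have Kw : cone nu a 0 rs (c / 2) w by split => //; exact: cmod_ge0.
have Kj := H0 rs (lexx _) w w0 Kw.
rewrite conj_iter; last by move=> i _; have [] := Kj i.
apply: le_lt_trans (chordal_cst0 _) _.
have [j1 _ _ _ j5] := Kj j.
have : cmod (iter j F0 w) < e / 2.
  apply: HE => //; apply: le_trans j5.
  have : (Num.truncn (8 / 3 * E)).+1%:R <= j%:R :> R by rewrite ler_nat.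
  by have := truncnS_gt (8 / 3 * E); lra_all.
lra_all.
Qed.

Lemma zeta_julia (S : R) (G : nat -> C R -> C R) (G0 : C R -> C R) : loc S nu (- a) G G0 -> S <= R1 ->
  (forall w, cmod w < S -> F0 (G0 w) = w) -> julia f0 zeta.
Proof.
move=> HG SR FG; have nu0 := loc_nu HL; have a0 := loc_a HL; have S0 := loc_R1 HG.
have cb : 0 < (1 / 2 : R) <= 1 / 2 by rewrite lexx divr_gt0.
have [rs rs0 H0] := orbit0_cone HG S0 cb.
(* [b^nu = 1 / a] makes [a z^nu] a positive real: [z] lies on a repelling direction, in the middle
   of a cone for [-a]. *)
set b : C R := nu.-root a^-1; have bE : b ^+ nu = a^-1 by rewrite rootCK.
have b0 : b != 0 by apply/eqP => b0; move: bE; rewrite b0 expr0n (gtn_eqF nu0) => /esym/eqP; rewrite invr_eq0 (negPf a0).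
have cb0 : 0 < cmod b by rewrite cmod_gt0.
set t : R := rs / cmod b; have t0 : 0 < t by rewrite divr_gt0.
pose z : C R := ((t%:C)%C) * b.
have cz : cmod z = rs by rewrite /z cmodM cmodR gtr0_norm // /t divfK // gt_eqF.
have z0 : z != 0 by rewrite -cmod_gt0 cz.
have Kz : cone nu (- a) 0 rs (1 / 2) z.
  split; rewrite ?cz //; first exact: ltW.
  apply: (upm_half nu0); rewrite ?oppr_eq0 //.
  have -> : - a * z ^+ nu = ((- t ^+ nu)%:C)%C.
    by rewrite /z exprMn bE (rmorphN (real_complex R)) (rmorphXn (real_complex R)); field.
  rewrite cmodR /=; have := normr_ge0 (- t ^+ nu); have : 0 <= t ^+ nu by rewrite exprn_ge0 // ltW.
  lra_all.
have K k := H0 rs (lexx _) z z0 Kz k.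
apply: (julia_of_repel (x := cst zeta z) (w := fun k => cst zeta (iter k G0 z)) fix0).
- by move=> E; have := crd_cst zeta z; rewrite E crdpp => /esym/eqP; rewrite (negPf z0).
- move=> e e0; have e2 : 0 < e / 2 by rewrite divr_gt0.
  have [E E0 HE] := upl_large nu0 (loc_a HG) e2.
  exists (Num.truncn (8 / 3 * E)).+1 => k nk; apply: le_lt_trans (chordal_cst0 _) _.
  have [k1 _ _ _ k5] := K k.
  have : cmod (iter k G0 z) < e / 2.
    apply: HE => //; apply: le_trans k5.
    have : (Num.truncn (8 / 3 * E)).+1%:R <= k%:R :> R by rewrite ler_nat.
    by have := truncnS_gt (8 / 3 * E); lra_all.
  lra_all.
move=> k; have back i : (i <= k)%N -> iter i F0 (iter k G0 z) = iter (k - i) G0 z.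
  elim: i => [|i IH] ik; first by rewrite subn0.
  rewrite iterS IH 1?ltnW // -(subnSK ik).
  by rewrite iterS FG //; have [] := K (k - i.+1)%N.
rewrite conj_iter; first by rewrite back // subnn.
move=> i ik; rewrite back 1?ltnW //; have [_ h _ _ _] := K (k - i)%N; exact: lt_le_trans h SR.
Qed.

(** Compactness: cone points approaching the Julia set have a limit in a wider cone, hence in the
    Fatou set, which is open. *)
Lemma cone_dist c : 0 < c <= 1 / 2 -> exists2 rs : R, 0 < rs & forall rho1 rho2 : R, 0 < rho1 -> rho2 <= rs ->
  exists2 e : R, 0 < e & forall z, cone nu a rho1 rho2 c z -> forall q, julia f0 q -> e <= chordal (cst zeta z) q.
Proof.
move=> cb; have /andP[c0 c1] := cb.
have [k /andP[k0 k1] Hk] := cone_disc (loc_nu HL) (loc_a HL) cb.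
have cb2 : 0 < c / 2 <= 1 / 2 by apply/andP; split; lra_all.
have [rs rs0 Hrs] := cone_fatou cb2; exists rs => // rho1 rho2 r10 r2.
apply: contrapT => Hn.
have /choice[zq Hzq] : forall m : nat, exists zq : C R * sphere R,
    [/\ cone nu a rho1 rho2 c zq.1, julia f0 zq.2 & chordal (cst zeta zq.1) zq.2 < m.+1%:R^-1].
  move=> m; apply: contrapT => h; apply: Hn; exists m.+1%:R^-1; first by rewrite invr_gt0 ltr0n.
  by move=> z Kz q Jq; rewrite leNgt; apply/negP => zq; apply: h; exists (z, q).
have zB m : cmod (zq m).1 <= rho2 by have [[]] := Hzq m.
have [s [s1 [z sz]]] := bwC zB.
have kr : 0 < k * rho1 by rewrite mulr_gt0.
have [m0 Hm0] := sz _ kr.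
have [[h1 h2 h3] _ _] := Hzq (s m0).
have y0 : (zq (s m0)).1 != 0 by rewrite -cmod_gt0; exact: lt_le_trans r10 h1.
have zz : cmod (z - (zq (s m0)).1) <= k * cmod (zq (s m0)).1.
  rewrite cmodBC; apply: le_trans (ltW (Hm0 m0 (leqnn _))) _; by rewrite ler_pM2l.
have [z0 zc] := Hk _ z y0 h3 zz.
have zr : cmod z <= rs.
  apply: le_trans r2; have := cmod_le_lim (c := 0) sz (r := rho2).
  by rewrite subr0; apply => m /=; rewrite subr0.
have [e e0 He] := fatou_nbhs (Hrs z z0 zr zc).
have e3 : 0 < e / 4 by rewrite divr_gt0.
have [m1 Hm1] := sz _ e3; have [m2 Hm2] := inv_nat_small e3.
set m := maxn m1 m2; have a1 := Hm1 m (leq_maxl _ _).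
have a2 := Hm2 (s m) (leq_trans (leq_maxr m1 m2) (incr_geid s1 m)).
have [_ Jq zq'] := Hzq (s m); apply: Jq; apply: He.
have := chordal_triangle (cst zeta (zq (s m)).1) (cst zeta z) (zq (s m)).2.
have := chordal_cst_le zeta z (zq (s m)).1; rewrite cmodBC; rewrite /= in a1; move: a1 a2 zq'.
move: (s m).+1%:R^-1 (chordal _ _) (chordal _ _) (chordal _ _) (cmod _) => x1 x2 x3 x4 x5; lra_all.
Qed.

Lemma cone_avoid c (g : nat -> ratmap R) : 0 < c <= 1 / 2 -> hausdorff_cvg (fun n => julia (g n)) (julia f0) ->
  exists2 rs : R, 0 < rs & forall rho1 rho2 : R, 0 < rho1 -> rho2 <= rs ->
  exists n0, forall n, (n0 <= n)%N -> forall z, cone nu a rho1 rho2 c z -> ~ julia (g n) (cst zeta z).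
Proof.
move=> cb HJ; have [rs rs0 H] := cone_dist cb; exists rs => // rho1 rho2 r1 r2.
have [e e0 He] := H rho1 rho2 r1 r2; have [n0 _ Hn] := HJ e e0.
exists n0 => n nn z Kz Jz; have [/(_ _ Jz)[y Jy zy] _] := Hn n nn.
by have := He z Kz y Jy; rewrite leNgt => /negP; apply.
Qed.
End PETAL.

(** * Cross ratios and chordal distances *)

Section CROSSRATIO. Variable R : realType.
Local Opaque cmod.
Implicit Types (z w : C R) (u v : C R * C R) (p q a b c : sphere R).

(** The Moebius map sending [a], [c], [b] to 0, 1, infinity, on homogeneous coordinates; at [b]
    itself the division by 0 gives 0. *)
Definition cratio a b c u : C R :=
  wedge u (hcoord a) * wedge (hcoord c) (hcoord b) / (wedge u (hcoord b) * wedge (hcoord c) (hcoord a)).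

Lemma cratio_hpt a b c u : nz u -> cratio a b c u = cratio a b c (hcoord (hpt u)).
Proof.
move=> nu; have [k k0 Eu] := hptP nu; rewrite {1}Eu /cratio; set v := hcoord (hpt u).
have E x : wedge (hscale k v) x = k * wedge v x by rewrite /wedge /hscale /=; ring.
by rewrite !E -![k * wedge _ _ * _]mulrA -(mulf_div k) divff // mul1r.
Qed.

Lemma wedge_neq0 p q : p <> q -> wedge (hcoord p) (hcoord q) != 0.
Proof.
move=> pq; apply/eqP => E; apply: pq; rewrite -(hpt_hcoord p) -(hpt_hcoord q).
by apply/hpt_eq => //; exact: hcoord_nz.
Qed.

Let hn p : 0 < hnorm (hcoord p). Proof. by rewrite hnorm_gt0 hcoord_nz. Qed.

Lemma cratio_mod a b c p : p <> b -> c <> a ->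
  cmod (cratio a b c (hcoord p)) = chordal p a * chordal c b / (chordal p b * chordal c a).
Proof.
move=> pb ca; rewrite /cratio /chordal !cmodM cmodV cmodM.
have w1 : cmod (wedge (hcoord p) (hcoord b)) != 0 by rewrite gt_eqF // cmod_gt0 wedge_neq0.
have w2 : cmod (wedge (hcoord c) (hcoord a)) != 0 by rewrite gt_eqF // cmod_gt0 wedge_neq0.
move: (hn p) (hn a) (hn b) (hn c).
move: (hnorm (hcoord p)) (hnorm (hcoord a)) (hnorm (hcoord b)) (hnorm (hcoord c)) => h1 h2 h3 h4 i1 i2 i3 i4.
by field; rewrite w1 w2 !gt_eqF.
Qed.

Lemma cratio_diff a b c p q : p <> b -> q <> b -> c <> a ->
  cmod (cratio a b c (hcoord p) - cratio a b c (hcoord q)) =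
  chordal p q * chordal a b * chordal c b / (chordal p b * chordal q b * chordal c a).
Proof.
move=> pb qb ca; rewrite /cratio.
have w1 := wedge_neq0 pb; have w2 := wedge_neq0 qb; have w3 := wedge_neq0 ca.
have -> : wedge (hcoord p) (hcoord a) * wedge (hcoord c) (hcoord b) / (wedge (hcoord p) (hcoord b) * wedge (hcoord c) (hcoord a))
   - wedge (hcoord q) (hcoord a) * wedge (hcoord c) (hcoord b) / (wedge (hcoord q) (hcoord b) * wedge (hcoord c) (hcoord a)) =
   wedge (hcoord p) (hcoord q) * wedge (hcoord a) (hcoord b) * wedge (hcoord c) (hcoord b) /
   (wedge (hcoord p) (hcoord b) * wedge (hcoord q) (hcoord b) * wedge (hcoord c) (hcoord a)).
  (* The Pluecker relation between the wedge products of four vectors of the plane. *)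
  have pl : wedge (hcoord p) (hcoord a) * wedge (hcoord q) (hcoord b) - wedge (hcoord q) (hcoord a) * wedge (hcoord p) (hcoord b)
     = wedge (hcoord p) (hcoord q) * wedge (hcoord a) (hcoord b) by rewrite /wedge; ring.
  by rewrite -pl; field; rewrite w1 w2 w3.
rewrite !cmodM cmodV !cmodM /chordal.
have W1 : cmod (wedge (hcoord p) (hcoord b)) != 0 by rewrite gt_eqF // cmod_gt0.
have W2 : cmod (wedge (hcoord q) (hcoord b)) != 0 by rewrite gt_eqF // cmod_gt0.
have W3 : cmod (wedge (hcoord c) (hcoord a)) != 0 by rewrite gt_eqF // cmod_gt0.
move: (hn p) (hn q) (hn a) (hn b) (hn c).
move: (hnorm (hcoord p)) (hnorm (hcoord q)) (hnorm (hcoord a)) (hnorm (hcoord b)) (hnorm (hcoord c)) => h1 h2 h3 h4 h5 i1 i2 i3 i4 i5.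
by field; rewrite W1 W2 W3 !gt_eqF.
Qed.

Lemma cratio_neq a b c p : p <> a -> p <> b -> p <> c -> a <> b -> c <> b -> c <> a ->
  cratio a b c (hcoord p) != 0 /\ cratio a b c (hcoord p) != 1.
Proof.
move=> pa pb pc ab cb ca; have w1 := wedge_neq0 pa; have w2 := wedge_neq0 pb; have w3 := wedge_neq0 pc.
have w4 := wedge_neq0 ab; have w5 := wedge_neq0 cb; have w6 := wedge_neq0 ca; split.
  by rewrite /cratio !mulf_neq0 // invr_neq0 // mulf_neq0.
have one : cratio a b c (hcoord c) = 1 by rewrite /cratio [X in X / _]mulrC divff // mulf_neq0.
rewrite -one -subr_eq0 -cmod_gt0 cratio_diff //.
by do ![exact: chordal_gt0 | apply: divr_gt0 | apply: mulr_gt0].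
Qed.
End CROSSRATIO.

(** * Omitted values supplied by the Julia sets *)

Section OMITTING. Variable R : realType.
Local Opaque upl upm cmod.
Implicit Types (z w : C R) (p q a b c : sphere R).

Lemma chordal_pos_neq p q (e : R) : 0 < e -> e <= chordal p q -> p <> q.
Proof. by move=> e0 + E; rewrite E chordalxx leNgt e0. Qed.

Lemma cratio_mod_le a b c p (e : R) : 0 < e -> e <= chordal p b -> e <= chordal c a ->
  cmod (cratio a b c (hcoord p)) <= 4 / e ^+ 2.
Proof.
move=> e0 pb ca; rewrite cratio_mod; [|exact: chordal_pos_neq pb|exact: chordal_pos_neq ca].
have P0 : 0 < chordal p b by lra.
have K0 : 0 < chordal c a by lra.
have h1 := chordal_le2 p a; have h2 := chordal_le2 c b; have h3 := chordal_ge0 p a; have h4 := chordal_ge0 c b.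
move: (chordal p a) (chordal c b) (chordal p b) (chordal c a) h1 h2 h3 h4 P0 K0 pb ca => x y u v h1 h2 h3 h4 P0 K0 pb ca.
rewrite ler_pdivrMr ?mulr_gt0 // mulrAC ler_pdivlMr ?exprn_gt0 // expr2.
have : x * y <= 2 * 2 by apply: ler_pM.
have : e * e <= u * v by apply: ler_pM => //; exact: ltW.
have : 0 <= x * y by apply: mulr_ge0.
have : 0 <= e * e by rewrite -expr2 sqr_ge0.
move: (x * y) (e * e) (u * v) => X E U E0 X0 EU X4.
have : X * E <= 4 * E by rewrite ler_wpM2r //; lra.
lra.
Qed.

Lemma cratio_diff_ge a b c p q (e : R) : 0 < e -> e <= chordal p b -> e <= chordal q b -> e <= chordal a b ->
  e <= chordal c b -> e <= chordal c a ->
  chordal p q <= 8 / e ^+ 2 * cmod (cratio a b c (hcoord p) - cratio a b c (hcoord q)).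
Proof.
move=> e0 pb qb ab cb ca.
rewrite cratio_diff; [|exact: chordal_pos_neq pb|exact: chordal_pos_neq qb|exact: chordal_pos_neq ca].
have l1 := chordal_le2 p b; have l2 := chordal_le2 q b; have l3 := chordal_le2 c a; have X0 := chordal_ge0 p q.
move: (chordal p q) (chordal a b) (chordal c b) (chordal p b) (chordal q b) (chordal c a) X0 pb qb ab cb ca l1 l2 l3.
move=> X A B P Q K X0 P1 Q1 A1 B1 K1 P2 Q2 K2.
have PQ : P * Q * K <= 8.
  have -> : 8 = 2 * 2 * 2 :> R by ring.
  by apply: ler_pM => //; [apply: mulr_ge0; lra|lra|apply: ler_pM => //; lra].
have P0 : 0 < P * Q * K by rewrite !mulr_gt0 //; lra.
have AB : e ^+ 2 <= A * B by rewrite expr2; apply: ler_pM => //; lra.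
have e2 : 0 < e ^+ 2 by rewrite exprn_gt0.
rewrite -[X * A * B]mulrA; move: (P * Q * K) (A * B) (e ^+ 2) PQ P0 AB e2 => T U V PQ P0 AB e2.
have -> : 8 / V * (X * U / T) = 8 * (X * U) / (V * T) by field; rewrite !gt_eqF.
rewrite ler_pdivlMr ?mulr_gt0 //.
have h1 : X * T * V <= X * V * 8 by rewrite mulrAC ler_wpM2l // mulr_ge0 // ltW.
have h2 : X * V <= X * U by rewrite ler_wpM2l.
lra.
Qed.

Lemma chart_dist p (r : R) : 0 < r -> exists2 K : R, 0 < K & forall z w, cmod z < r -> cmod w < r ->
  cmod (z - w) <= K * chordal (cst p z) (cst p w).
Proof.
move=> r0; set K := pabs p * (r + 1); have p1 := pabs_ge1 p.
have K0 : 0 < K by rewrite mulr_gt0 //; lra.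
have hK z : cmod z < r -> hnorm (unl p (z, 1)) <= K.
  move=> zr; apply: le_trans (unl_norm_le _ _ _) _; rewrite ler_wpM2l ?cmod1 //; lra.
exists (K * K) => [|z w zr wr]; first by rewrite mulr_gt0.
have h1 := unl_norm1 p z; have h2 := unl_norm1 p w; have k1 := hK z zr; have k2 := hK w wr.
rewrite chordal_cst mulrA ler_pdivlMr; last by apply: mulr_gt0; lra.
have d0 := cmod_ge0 (z - w).
have : hnorm (unl p (z, 1)) * hnorm (unl p (w, 1)) <= K * K by apply: ler_pM => //; lra.
have KK : 0 < K * K by rewrite mulr_gt0.
move: (hnorm _ * hnorm _) (K * K) (cmod _) d0 KK => u v d d0 KK uv.
have : d * u <= d * v by rewrite ler_wpM2l.
have : 0 <= d * v by rewrite mulr_ge0 // ltW.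
lra.
Qed.

(* The cross ratio with three points of [julia (g n)], taken near [zeta], [y] and [y'], sends
   the iterates of [g n] on the cones to functions omitting 0, 1 and infinity. *)
Lemma omitting_of_julia (f0 : ratmap R) l zeta y y' R1 nu (al : C R) (F : nat -> C R -> C R) F0 (g : nat -> ratmap R) (k0 : R) :
  loc R1 nu al F F0 -> (0 < l)%N ->
  (forall z, cmod z < R1 -> riter f0 l (cst zeta z) = cst zeta (F0 z)) ->
  (forall n z, cmod z < R1 -> riter (g n) l (cst zeta z) = cst zeta (F n z)) ->
  (forall n, (0 < rdeg (g n))%N) ->
  hausdorff_cvg (fun n => julia (g n)) (julia f0) ->
  julia f0 zeta -> julia f0 y -> julia f0 y' ->
  8 * R1 <= chordal zeta y -> 8 * R1 <= chordal zeta y' -> 8 * R1 <= chordal y y' ->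
  0 < k0 <= 1 / 2 -> exists2 rs : R, 0 < rs & omitting R1 nu al F rs k0.
Proof.
move=> HL l0 conj0 conjn dg HJ Jz Jy Jy' d1 d2 d3 kb; have R10 := loc_R1 HL.
have [rs rs0 Hav] := cone_avoid HL l0 conj0 kb HJ; exists rs => //.
have [K K0 HK] := chart_dist zeta R10.
pose B := 4 / R1 ^+ 2 + K * (8 / R1 ^+ 2).
have e2 : 0 < R1 ^+ 2 by rewrite exprn_gt0.
have b1 : 0 < 4 / R1 ^+ 2 by rewrite divr_gt0.
have b2 : 0 < K * (8 / R1 ^+ 2) by rewrite mulr_gt0 // divr_gt0.
exists B => [|rho1 r1]; first by rewrite addr_gt0.
have [n0 Hn0] := Hav rho1 rs r1 (lexx _); have [n1 _ Hn1] := HJ R1 R10.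
exists (maxn n0 n1) => n; rewrite geq_max => /andP[nn0 nn1] k.
have [_ near] := Hn1 n nn1; have avoid := Hn0 n nn0.
have [a Ja za] := near _ Jz; have [b Jb yb] := near _ Jy; have [c Jc yc] := near _ Jy'.
rewrite /mdist /= in za yb yc.
(* [a], [b], [c] are within [R1] of [zeta], [y], [y'], and points of coordinate below [R1] are
   within [2 R1] of [zeta]; separation by [8 R1] leaves at least [R1] in all these bounds. *)
have ab : R1 <= chordal a b.
  have := chordal_triangle a zeta y; have := chordal_triangle b a y; rewrite (chordal_sym zeta a); lra.
have ca : R1 <= chordal c a.
  have := chordal_triangle a zeta y'; have := chordal_triangle c a y'; rewrite (chordal_sym zeta a) (chordal_sym c a); lra.
have cb : R1 <= chordal c b.
  have := chordal_triangle b y y'; have := chordal_triangle c b y'; rewrite (chordal_sym y b) (chordal_sym c b); lra.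
have pb w : cmod w < R1 -> R1 <= chordal (cst zeta w) b.
  move=> wr; have := chordal_cst0 zeta w; have := chordal_triangle (cst zeta w) zeta y.
  have := chordal_triangle b (cst zeta w) y; rewrite (chordal_sym zeta (cst zeta w)); lra.
have Nab := chordal_pos_neq R10 ab; have Nca := chordal_pos_neq R10 ca; have Ncb := chordal_pos_neq R10 cb.
have o := oner_neq0 (C R).
set H := hm (rdeg (g n)) (fun i => 1 * (rnum (g n))`_i) (fun i => 1 * (rden (g n))`_i).
have Hu z : nz (iter (k * l) H (unl zeta (z, 1))) /\ riter (g n) (k * l) (cst zeta z) = hpt (iter (k * l) H (unl zeta (z, 1))).
  exact: (@riter_cst R (g n) 1 o (k * l)%N zeta z).
(* An iterate of a cone point in the Julia set would put the cone point itself there, by backward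
   invariance. *)
have out q z : julia (g n) q -> cone nu al rho1 rs k0 z -> hpt (iter (k * l) H (unl zeta (z, 1))) <> q.
  move=> Jq Kz; have [_ <-] := Hu z => E; apply: (avoid z Kz); apply: (julia_backward (k := (k * l)%N) (dg n)).
  by rewrite E.
exists (fun x => cratio a b c (unl zeta (x, 1))), (fun z => cratio a b c (iter (k * l) H (unl zeta (z, 1)))).
have tE w : cratio a b c (unl zeta (w, 1)) = cratio a b c (hcoord (cst zeta w)) by rewrite cratio_hpt ?unl_nz1.
split.
- move=> c0 r Hc; set P := rpoly (g n) 1 (k * l) (omap polyC zeta) ('X, 1).
  have PE z : (P.1.[z], P.2.[z]) = iter (k * l) H (unl zeta (z, 1)).
    by rewrite /P rpolyE hornerX hornerC.
  clearbody P.
  set N := ((hcoord a).2 *: P.1 - (hcoord a).1 *: P.2) * (wedge (hcoord c) (hcoord b))%:P.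
  set D := ((hcoord b).2 *: P.1 - (hcoord b).1 *: P.2) * (wedge (hcoord c) (hcoord a))%:P.
  have DE z : D.[z] = wedge (iter (k * l) H (unl zeta (z, 1))) (hcoord b) * wedge (hcoord c) (hcoord a).
    rewrite -PE /D hornerM hornerC hornerD hornerN !hornerZ /wedge; congr (_ * _).
    by rewrite mulrC [X in _ - X]mulrC.
  have NE z : N.[z] = wedge (iter (k * l) H (unl zeta (z, 1))) (hcoord a) * wedge (hcoord c) (hcoord b).
    rewrite -PE /N hornerM hornerC hornerD hornerN !hornerZ /wedge; congr (_ * _).
    by rewrite mulrC [X in _ - X]mulrC.
  have -> : (fun z => cratio a b c (iter (k * l) H (unl zeta (z, 1)))) = (fun z => N.[z] / D.[z]).
    by apply/funext => z; rewrite NE DE.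
  apply: hol_ratio => z /Hc Kz; rewrite DE mulf_neq0 ?wedge_neq0 //; apply/eqP => w0.
  have [nzu _] := Hu z; apply: (out b z Jb Kz); rewrite -[RHS]hpt_hcoord.
  by apply/hpt_eq => //; exact: hcoord_nz.
- move=> z Kz; have [nzu _] := Hu z; rewrite (cratio_hpt a b c nzu); apply: cratio_neq => //; exact: out.
- move=> z Kz Hz; have [nzu hu] := Hu z; rewrite (cratio_hpt a b c nzu) tE; congr (cratio a b c (hcoord _)).
  by rewrite -hu (conj_iter (conjn n)) // => i ik; apply: Hz; exact: ltnW.
move=> w wr; rewrite tE; split.
  apply: le_trans (cratio_mod_le R10 (pb w wr) ca) _; rewrite /B; lra.
move=> w' wr'; rewrite tE; apply: le_trans (HK w w' wr wr') _.
have h := cratio_diff_ge R10 (pb w wr) (pb w' wr') ab cb ca.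
apply: le_trans (ler_wpM2l (ltW K0) h) _; have := cmod_ge0 (cratio a b c (hcoord (cst zeta w)) - cratio a b c (hcoord (cst zeta w'))).
move: (cmod _) => X X0; rewrite (mulrA K); apply: ler_wpM2r => //; rewrite /B; lra.
Qed.
End OMITTING.

(** * Auxiliary preimages and the multiplicity of a parabolic point *)

Section PARABOLIC. Variable R : realType.
Local Opaque upl upm cmod.
Implicit Types (z w : C R) (p q : sphere R) (f : ratmap R).

Lemma riterD f m n p : riter f (m + n) p = riter f m (riter f n p).
Proof. exact: iterD. Qed.

Lemma riter_mul_fix f n k p : riter f n p = p -> riter f (k * n) p = p.
Proof. by move=> h; elim: k => [//|k IH]; rewrite mulSn riterD IH. Qed.

(** By the chain rule the derivative along the cycle is nowhere 0, so the predecessor [p'] of [p] is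
    not its only preimage. A preimage [y] off the cycle and a preimage [y'] of [y] complete [p] to
    three distinct points of the backward orbit; moreover neither is fixed by the [l]-th iterate. *)
Lemma extra_points f l p : (1 < rdeg f)%N -> (0 < l)%N -> riter f l p = p -> sder (riter f l) p 1 ->
  exists y y', [/\ y <> p /\ y' <> p, y <> y', riter f 1 y = p, riter f 2 y' = p & riter f l y <> y /\ riter f l y' <> y'].
Proof.
case: l => // l d1 _ lp ld; set p' := riter f l p.
have fp' : reval f p' = p by [].
have [k1 [H1 _]] := sder_riter f (oner_neq0 (C R)) l p.
have [k2 [H2 _]] := sder_riter f (oner_neq0 (C R)) 1 p'.
have k2n : k2 != 0.
  apply/eqP => k20; have := sder_uniq (sder_comp H1 H2) ld; rewrite k20 mul0r => /esym/eqP.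
  by rewrite (negPf (oner_neq0 _)).
have [y yp' fy] := other_preimage (oner_neq0 (C R)) d1 k2n H2; rewrite fp' in fy.
(* A point of the forward orbit of [p] that is mapped to [p] is the predecessor of [p] on its cycle,
   which is [p']. *)
have off k : riter f k p <> y.
  move=> ky; apply: yp'; have kp : riter f k.+1 p = p by rewrite -[RHS]fy -ky.
  rewrite -ky /p' -{1}(riter_mul_fix l kp) -{2}(riter_mul_fix k lp) -!riterD.
  congr riter; lia.
have [y' fy'] := reval_surj (oner_neq0 (C R)) y (ltnW d1).
exists y, y'; split=> //.
- by split=> E; [apply: (off 0%N)|apply: (off 1%N)]; rewrite -E.
- by move=> E; apply: (off 0%N); rewrite /= -{1}fy -[in RHS]fy' E.
- by rewrite -[RHS]fy -[in RHS]fy'.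
have ly : riter f l.+1 y = p' by rewrite /riter iterSr fy.
split; first by rewrite ly => /esym.
move=> E; apply: yp'; rewrite -ly -{1}fy' -{1}E /riter -!iterS iterSr fy'.
by [].
Qed.

Lemma off_chart p q q' : (lin p (hcoord q)).2 = 0 -> (lin p (hcoord q')).2 = 0 -> q = q'.
Proof.
have o : (1 : C R) == 0 = false by rewrite oner_eq0.
case: p => [a|]; case: q => [b|]; case: q' => [b'|] //=;
  try by [move=> /eqP; rewrite o | move=> _ /eqP; rewrite o].
by move=> -> ->.
Qed.

Lemma nden_nz f (c : C R) k p q z : c != 0 -> nz ((nden f c k p q).1.[z], (nden f c k p q).2.[z]).
Proof. by move=> c0; rewrite ndenE lin_nz; have [] := riter_cst f c0 k p z. Qed.

(** If the displacement vanished identically, every point of the chart would be fixed. Two points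
    that are not fixed are given because one of them may be the point missed by the chart. *)
Lemma disp_neq0 f l p y y' : y <> y' -> riter f l y <> y -> riter f l y' <> y' ->
  (nden f 1 l p p).1 - 'X * (nden f 1 l p p).2 != 0.
Proof.
move=> yy ly ly'; apply/eqP => E; have o := oner_neq0 (C R).
have fix1 q : (lin p (hcoord q)).2 != 0 -> riter f l q = q.
  move=> h; have Eq : cst p (crd p q) = q by have := cst_crd (hcoord_nz q) h; rewrite hpt_hcoord.
  rewrite -Eq; set z := crd p q.
  have Ez : (nden f 1 l p p).1.[z] = z * (nden f 1 l p p).2.[z].
    by apply/eqP; rewrite -subr_eq0; apply/eqP; have := congr1 (horner^~ z) E; rewrite hornerD hornerN hornerM hornerX horner0.
  have Dz : (nden f 1 l p p).2.[z] != 0.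
    by apply/eqP => D0; have := nden_nz f l p p z o; rewrite Ez D0 mulr0 /nz eqxx.
  by rewrite (riter_eq_cst o Dz) Ez mulfK.
have h1 : (lin p (hcoord y)).2 = 0 by apply/eqP/negPn/negP => /fix1.
have h2 : (lin p (hcoord y')).2 = 0 by apply/eqP/negPn/negP => /fix1.
exact: yy (off_chart h1 h2).
Qed.

(** The displacement has a zero at 0 because [p] is fixed, and a multiple one because the multiplier
    is 1. *)
Lemma disp_factor f l p : riter f l p = p -> sder (riter f l) p 1 ->
  (nden f 1 l p p).1 - 'X * (nden f 1 l p p).2 != 0 ->
  exists nu W, [/\ (0 < nu)%N, (nden f 1 l p p).1 - 'X * (nden f 1 l p p).2 = W * 'X ^+ nu.+1 & W.[0] != 0].
Proof.
move=> lp ld /poly_factor0[m [W [E W0]]]; have o := oner_neq0 (C R).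
have [N0 D0] := nden_at0 o lp; have [k [Hk kE]] := sder_riter f o l p; rewrite lp (sder_uniq Hk ld) in kE.
have N1 : (nden f 1 l p p).1^`().[0] = (nden f 1 l p p).2.[0] by move: kE; move: (_.[0]) (_.2.[0]) D0 => x y y0 E1; rewrite -(divfK y0 x) -E1 mul1r.
case: m E => [|[|m]] E; last by exists m.+1, W.
- have := congr1 (horner^~ 0) E; rewrite hornerD hornerN hornerM hornerX N0 mul0r subr0 expr0 mulr1 => /esym/eqP.
  by rewrite (negPf W0).
have := congr1 (fun P : {poly C R} => P^`().[0]) E.
rewrite expr1 derivB !derivM !derivX mul1r mulr1 hornerD hornerN !hornerD !hornerM !hornerX mul0r mulr0 add0r addr0 N1 subrr => /esym/eqP.
by rewrite (negPf W0).
Qed.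

(* If the multiplier of the [l]-th iterate is 1 then the multiplier of the first return map is
   a root of unity of order dividing [l / p]. *)
Lemma parabolic_of_mult1 f l p : (0 < l)%N -> riter f l p = p -> sder (riter f l) p 1 -> parabolic f p.
Proof.
move=> l0 lp ld.
have ex : exists m, (0 < m)%N && `[< riter f m p = p >] by exists l; rewrite l0; apply/asboolP.
case: (ex_minnP ex) => m /andP[m0 /asboolP mp] mmin.
have dv : (m %| l)%N.
  rewrite /dvdn; apply/negPn/negP; rewrite -lt0n => r0.
  have : riter f (l %% m) p = p.
    by rewrite -{2}lp {2}(divn_eq l m) addnC riterD riter_mul_fix.
  by move/asboolP => h; have := mmin (l %% m)%N; rewrite r0 h => /(_ isT); rewrite leqNgt ltn_pmod.
have kE : (l = l %/ m * m)%N by rewrite divnK.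
have [k [Hk _]] := sder_riter f (oner_neq0 (C R)) m p.
exists m.
  by split=> // j /andP[j0 jm] jp; have := mmin j; rewrite j0 (asboolT jp) leqNgt jm => /(_ isT).
exists (l %/ m)%N; first by rewrite divn_gt0 // dvdn_leq.
rewrite (sder_mult mp Hk); apply: sder_uniq (sder_iter (l %/ m)%N mp Hk) _.
have -> : iter (l %/ m)%N (riter f m) = riter f l => //.
apply/funext => q; rewrite {2}kE; elim: (l %/ m)%N q => [//|j IH] q.
by rewrite iterS IH mulSn riterD.
Qed.
End PARABOLIC.

Lemma sum4_leq (a b c d k s : nat) : (a + b + c + d + k <= s)%N ->
  [/\ (a <= s)%N, (b <= s)%N, (c <= s)%N, (d + k <= s)%N & (k <= s)%N].
Proof. by move=> h; split; lia. Qed.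

(** * Multipliers at fixed points tending to a parabolic point *)

Section MAIN. Variable R : realType.
Local Opaque upl upm cmod.
Implicit Types (w x : C R) (p q y : sphere R).

Variables (f0 : ratmap R) (f : nat -> ratmap R) (c : nat -> C R) (l : nat) (zeta : sphere R).
Hypothesis d1 : (1 < rdeg f0)%N.
Hypothesis hdeg : forall n, rdeg (f n) = rdeg f0.
Hypothesis c0 : forall n, c n != 0.
Hypothesis hnum : forall i, cvgC (fun n => c n * (rnum (f n))`_i) (rnum f0)`_i.
Hypothesis hden : forall i, cvgC (fun n => c n * (rden (f n))`_i) (rden f0)`_i.
Hypothesis l0 : (0 < l)%N.
Hypothesis lz : riter f0 l zeta = zeta.
Hypothesis lm : sder (riter f0 l) zeta 1.
Variable z : nat -> sphere R.
Hypothesis zfix : forall n, riter (f n) l (z n) = z n.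
Hypothesis zcvg : z n @[n --> \oo] --> zeta.

Let N n := (nden (f n) (c n) l zeta zeta).1.
Let D n := (nden (f n) (c n) l zeta zeta).2.
Let N0 := (nden f0 1 l zeta zeta).1.
Let D0 := (nden f0 1 l zeta zeta).2.
Let x n := crd zeta (z n).
Let lam n := multiplier (riter (f n) l) (z n).

Let hN : pcvg N N0. Proof. by have [] := nden_cvg l zeta zeta hdeg hnum hden. Qed.
Let hD : pcvg D D0. Proof. by have [] := nden_cvg l zeta zeta hdeg hnum hden. Qed.
Let D00 : D0.[0] != 0. Proof. by have [] := nden_at0 (oner_neq0 (C R)) lz. Qed.

Lemma near_chart (e : R) : 0 < e -> exists n0, forall n, (n0 <= n)%N -> z n = cst zeta (x n) /\ cmod (x n) < e.
Proof.
move=> e0; have [del del0 Hd] := chart_ball zeta 0 e0; rewrite cst0 in Hd.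
have nb : nbhs zeta [set q | chordal zeta q < del] by apply/nbhs_sphere; exists del.
have [n0 _ Hn] := zcvg nb; exists n0 => n nn; have := Hn n nn.
by rewrite /= chordal_sym /x => /Hd[w ->]; rewrite crd_cst subr0.
Qed.

Lemma lam_sder n : sder (riter (f n) l) (z n) (lam n).
Proof.
have [k [Hk _]] := sder_riter (f n) (c0 n) l (z n).
by rewrite /lam (sder_mult (zfix n) Hk).
Qed.

Lemma lam_cder n : z n = cst zeta (x n) -> cder (fun w => (N n).[w] / (D n).[w]) (x n) (lam n).
Proof.
move=> zx; have h : riter (f n) l (cst zeta (x n)) = cst zeta (x n) by rewrite -zx zfix.
have hs : sder (riter (f n) l) (cst zeta (x n)) (lam n) by rewrite -zx; exact: lam_sder.
have := cder_of_sder h hs; congr cder; apply/funext => w; exact: riter_crd.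
Qed.

Section FACTOR.
Variables (nu : nat) (W : {poly C R}).
Hypothesis nu0 : (0 < nu)%N.
Hypothesis hW : N0 - 'X * D0 = W * 'X ^+ nu.+1.
Hypothesis W0 : W.[0] != 0.

Lemma lam_cvg : cvgC lam 1.
Proof.
move=> e e0; have e2 : 0 < e / 2 by rewrite divr_gt0.
have [r r0 [n0 H]] := mult_of_polys hN hD D00 nu0 hW e2.
have [n1 H1] := near_chart r0; exists (maxn n0 n1) => n; rewrite geq_max => /andP[nn0 nn1].
have [zx xr] := H1 n nn1; have := H n nn0 (x n) (lam n) xr (lam_cder zx); lra_all.
Qed.

Lemma lam_horocyclic y y' (M : R) : hausdorff_cvg (fun n => julia (f n)) (julia f0) ->
  y <> zeta -> y' <> zeta -> y <> y' -> riter f0 1 y = zeta -> riter f0 2 y' = zeta ->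
  (exists n0, forall n, (n0 <= n)%N -> lam n != 1) ->
  exists n0, forall n, (n0 <= n)%N -> M < `|complex.Re (1 - lam n)^-1|.
Proof.
move=> HJ yz y'z yy fy fy' [n1 Hn1]; apply: contrapT => Hc.
have Hinf m : exists n, (m <= n)%N /\ `|complex.Re (1 - lam n)^-1| <= M.
  apply: contrapT => h; apply: Hc; exists m => n mn; rewrite ltNge; apply/negP => nM.
  by apply: h; exists n.
have E0 : N0 - 'X * D0 != 0.
  by rewrite hW mulf_neq0 ?expf_neq0 ?polyX_eq0 //; apply: contraNneq W0 => ->; rewrite horner0.
have hE : pcvg (fun n => N n + (- 'X) * D n) (N0 - 'X * D0).
  by rewrite -mulNr; exact: pcvgD hN (pcvgM (pcvg_cst _) hD).
have [n2 Hn2] := pcvg_neq0 hE E0; have [n3 Hn3] := near_chart (ltr01 (R := R)).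
have d00 : 0 < cmod D0.[0] by rewrite cmod_gt0.
have [del del0 Hdel] := cder_cont (cder_poly D0 0) d00.
have p1 : 0 < chordal zeta y by apply: chordal_gt0 => E; exact: yz (esym E).
have p2 : 0 < chordal zeta y' by apply: chordal_gt0 => E; exact: y'z (esym E).
have p3 := chordal_gt0 yy.
(* Within [del] the denominator [D0] does not vanish; the eighths are the separations that
   [omitting_of_julia] asks for. *)
pose R' := Num.min del (Num.min (chordal zeta y / 8) (Num.min (chordal zeta y' / 8) (chordal y y' / 8))).
have R'0 : 0 < R' by rewrite !lt_min del0 /=; apply/and3P; split; lra_all.
have [R1 /andP[R10 R1R'] [n4 H]] := loc_of_polys hN hD D00 nu0 hW W0 R'0.
move: R1R'; rewrite !le_min => /and4P[q0 q1 q2 q3].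
pose m := (n1 + n2 + n3 + n4)%N.
(* [s] need not be increasing: [m + k <= s k] is enough to pass limits to the subsequence. *)
have /choice[s Hs] : forall k, exists n, (m + k <= n)%N /\ `|complex.Re (1 - lam n)^-1| <= M by move=> k; exact: Hinf.
have sm k : [/\ (n1 <= s k)%N, (n2 <= s k)%N, (n3 <= s k)%N, (n4 + k <= s k)%N & (k <= s k)%N].
  by have [h _] := Hs k; exact: sum4_leq h.
have sub u (v : C R) : cvgC u v -> cvgC (fun k => u (s k)) v.
  by move=> h e e0; have [k0 Hk] := h e e0; exists k0 => k kk; apply: Hk; have [_ _ _ _] := sm k; exact: leq_trans.
have [HL HD F4 [F04 Fn0] Fasym] := H s (fun k => let: And5 _ _ _ h _ := sm k in h).
have conjn k w : cmod w < R1 -> riter (f (s k)) l (cst zeta w) = cst zeta ((N (s k)).[w] / (D (s k)).[w]).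
  by move=> /(HD k) h; exact: (riter_eq_cst (c0 (s k)) (k := l) (p := zeta) (q := zeta) (z := w) h).
have conj0 w : cmod w < R1 -> riter f0 l (cst zeta w) = cst zeta (N0.[w] / D0.[w]).
  move=> wR; apply: (riter_eq_cst (oner_neq0 (C R)) (k := l) (p := zeta) (q := zeta)); apply/eqP => Dw.
  have := Hdel w; rewrite subr0 -/D0 Dw sub0r cmodN ltxx => h.
  by have /h : cmod w < del by exact: lt_le_trans wR q0.
have Jz : julia f0 zeta.
  have [S /andP[S0 SR] [HG _]] := loc_inverse HL F4 F04 Fn0 Fasym.
  apply: (zeta_julia HL conj0 HG); first by apply: le_trans SR _; lra_all.
  move=> w wS; have := linv_surj R10 F04 (w := w); rewrite (loc_F00 HL) cmod0 => h.
  by have [] := h ltac:(lra_all) (lt_le_trans wS SR).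
have d0 := ltnW d1.
have Jy : julia f0 y by apply: (julia_backward (k := 1) d0); rewrite fy.
have Jy' : julia f0 y' by apply: (julia_backward (k := 2) d0); rewrite fy'.
have HJs : hausdorff_cvg (fun k => julia (f (s k))) (julia f0).
  move=> e e0; have [k0 _ Hk] := HJ e e0; exists k0 => // k /= kk; apply: Hk => /=.
  by have [_ _ _ _] := sm k; exact: leq_trans.
have kb : 0 < (1 / 2 / 2 / 2 : R) <= 1 / 2 by apply/andP; split; lra_all.
have dn k : (0 < rdeg (f (s k)))%N by rewrite hdeg.
have [rs rs0 Hom] := omitting_of_julia HL l0 conj0 conjn dn HJs Jz Jy Jy' ltac:(lra_all) ltac:(lra_all) ltac:(lra_all) kb.
have zx k : z (s k) = cst zeta (x (s k)) by have [_ _ h _ _] := sm k; have [] := Hn3 _ h.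
apply: (local_theorem HL F4 F04 Fn0 Fasym rs0 Hom (x := x \o s) (l := lam \o s) (M := M)) => /=.
(* Fixed points in the chart are roots of [N - 'X * D], which is not 0 for large indices because its
   limit is not; the list consists of its roots. *)
- move=> k; have [_ k2 _ _ _] := sm k; have Ek := Hn2 _ k2.
  have [r Er] := closed_field_poly_normal (N (s k) + (- 'X) * D (s k)); exists r => w wR Fw.
  have Dw := HD k w wR; rewrite -root_prod_XsubC; apply/rootP.
  have lc : lead_coef (N (s k) + (- 'X) * D (s k)) != 0 by rewrite lead_coef_eq0.
  apply: (mulfI lc); rewrite mulr0 -hornerZ -Er hornerD hornerM hornerN hornerX.
  by rewrite -[X in - X * _]Fw mulNr divfK // subrr.
- by apply: sub => e e0; have [k0 Hk] := near_chart e0; exists k0 => k kk; rewrite subr0; have [] := Hk k kk.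
- move=> k; have Dx := zfix (s k); rewrite zx in Dx; rewrite -[RHS](crd_cst zeta) -[in RHS]Dx.
  by rewrite (riter_crd (f (s k)) (c0 (s k))).
- by move=> k; exact: lam_cder.
- by move=> k; have [h _ _ _ _] := sm k; exact: Hn1.
- exact: sub lam_cvg.
by move=> k; have [_] := Hs k.
Qed.
End FACTOR.
End MAIN.

Theorem theorem1p2 (R : realType) (d : nat) (f0 : ratmap R)
    (f : nat -> ratmap R) :
  (2 <= d)%N -> rdeg f0 = d ->
  (exists zeta, parabolic f0 zeta) ->
  generic_perturbation f f0 ->
  hausdorff_cvg (fun n => julia (f n)) (julia f0) ->
  horocyclic_cvg f f0.
Proof.
move=> d2 dE _ [Hf Hgen] HJ; rewrite -dE in d2; split=> // zeta Hz; split=> // l [l0 lz lm1 lmin] z zfix zcvg.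
have [_ /(_ l)[]] := Hgen zeta Hz; first by split.
move=> U [nU _ [n1 _ HU]].
have [hdeg [c [c0 hc]]] := Hf.
have hnum i : cvgC (fun n => c n * (rnum (f n))`_i) (rnum f0)`_i by have [h _] := hc i; exact: cvg_cvgC.
have hden i : cvgC (fun n => c n * (rden (f n))`_i) (rden f0)`_i by have [_ h] := hc i; exact: cvg_cvgC.
have lm : sder (riter f0 l) zeta 1.
  by have [k [Hk _]] := sder_riter f0 (oner_neq0 (C R)) l zeta; rewrite -lm1 (sder_mult lz Hk).
have [y [y' [[yz y'z] yy fy fy' [ly ly']]]] := extra_points d2 l0 lz lm.
have [nu [W [nu0 hW W0]]] := disp_factor lz lm (disp_neq0 zeta yy ly ly').
split; first by apply: cvgC_cvg; exact: (lam_cvg hdeg c0 hnum hden lz zfix zcvg nu0 hW).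
apply/cvgryPge => M.
have [n2 _ Hn2] := zcvg U nU.
have [|n3 Hn3] := lam_horocyclic d2 hdeg c0 hnum hden l0 lz zfix zcvg nu0 hW W0 M HJ yz y'z yy fy fy'.
  (* Genericity enters here: a fixed point of the [l]-th iterate with multiplier 1 is parabolic, and
     for large [n] there is none in [U]. *)
  exists (maxn n1 n2) => n; rewrite geq_max => /andP[nn1 nn2]; apply/eqP => E.
  apply: (HU n nn1 (z n) (Hn2 n nn2) (zfix n)); apply: parabolic_of_mult1 l0 (zfix n) _.
  by have := lam_sder c0 zfix n; rewrite E.
by exists n3 => // n /= /Hn3/ltW.
Qed.
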